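(* Let $\mathfrak{g}$ be a complex simple Lie algebra and let $\mathfrak{q}$ be a maximal parabolic subalgebra of quasi-Heisenberg type of one of the types $B_n(i)$ ($3\le i\le n$), $C_n(i)$ ($2\le i\le n-1$), $D_n(i)$ ($3\le i\le n-3$), $E_6(3)$, $E_6(5)$, $E_7(2)$, $E_7(6)$, $E_8(1)$, $F_4(4)$. Let $V(\mu+\epsilon)$ be a special constituent of $\mathfrak{l}\otimes\mathfrak{z}(\mathfrak{n})$ of type 1a or type 2. (1) If $V(\mu+\epsilon)$ is of type 1a, then the $\Omega_2|_{V(\mu+\epsilon)^*}$ system is conformally invariant on the line bundle $\mathcal{L}_{s_2}$ (that is, $\mathcal{L}(s_2\lambda_\mathfrak{q})$), where $s_2=\frac{|\Delta_{\mu+\epsilon}(\mathfrak{g}(1))|}{2}-1$. (2) If $V(\mu+\epsilon)$ is of type 2, then the $\Omega_2|_{V(\mu+\epsilon)^*}$ system is conformally invariant on the line bundle $\mathcal{L}_{-1}$ (that is, $\mathcal{L}(-\lambda_\mathfrak{q})$).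
   Context: Parabolic. $G$ is a complex, simple, connected, simply connected Lie group with Lie algebra $\mathfrak{g}$, $\mathfrak{b}=\mathfrak{h}\oplus\mathfrak{u}$ a Borel subalgebra with Cartan subalgebra $\mathfrak{h}$; $\Delta,\Delta^+,\Pi$ are the roots, positive roots, simple roots; $\kappa$ is the Killing form. ''$\mathfrak{q}$ is of type $\mathcal{T}(i)$'' means $\mathfrak{g}$ has type $\mathcal{T}$ and $\mathfrak{q}$ is the standard maximal parabolic determined by $\alpha_\mathfrak{q}=\alpha_i$ (Bourbaki numbering): $\mathfrak{q}=\mathfrak{l}\oplus\mathfrak{n}$, $\mathfrak{l}=\mathfrak{h}$ plus root spaces for roots in $\mathrm{span}(\Pi\setminus\{\alpha_\mathfrak{q}\})$, $\mathfrak{n}$ the remaining positive root spaces. Quasi-Heisenberg type: $[\mathfrak{n},[\mathfrak{n},\mathfrak{n}]]=0$, $\dim[\mathfrak{n},\mathfrak{n}]>1$. Grading by the coefficient of $\alpha_\mathfrak{q}$: $\mathfrak{g}=\bigoplus_{j=-2}^2\mathfrak{g}(j)$, $\mathfrak{l}=\mathfrak{g}(0)$, $\mathfrak{z}(\mathfrak{n})=\mathfrak{g}(2)$ (center of $\mathfrak{n}$), $\mathfrak{z}(\bar{\mathfrak{n}})=\mathfrak{g}(-2)$, $\bar{\mathfrak{n}}=\mathfrak{g}(-1)\oplus\mathfrak{g}(-2)$. $Q=N_G(\mathfrak{q})=LN$; $L$ acts by $\mathrm{Ad}$. $\Delta(W)$ is the set of roots whose root spaces lie in $W$, and $\Delta_\nu(W)=\{\alpha\in\Delta(W):\nu-\alpha\in\Delta\}$.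 $\mu$ is the highest weight of the irreducible $L$-module $\mathfrak{g}(1)$; $\gamma$ (the highest root) is that of $\mathfrak{z}(\mathfrak{n})$. Special constituents. An irreducible $L$-constituent $V(\nu)$ (highest weight $\nu$) of $\mathfrak{l}\otimes\mathfrak{z}(\mathfrak{n})$ is special if $\nu\neq\gamma$ and $\nu=\mu+\epsilon$ for some $\epsilon\in\Delta(\mathfrak{g}(1))$. It is of type 1a if $\mu+\epsilon\notin\Delta$, $\epsilon\ne\mu$ and both $\mu,\epsilon$ are long roots; of type 2 if $\epsilon=\mu$ (and $2\mu\notin\Delta$). If $\mathfrak{g}$ is simply laced all roots are regarded as long. Bundle. $\mathfrak{g}_0$ is a real form of $\mathfrak{g}$ in which $\mathfrak{q}$ has a real form, $G_0\subset G$ its analytic subgroup, $Q_0=N_{G_0}(\mathfrak{q})=L_0N_0$, $\bar N_0$ the unipotent subgroup opposite to $N_0$. $\lambda_\mathfrak{q}$ is the fundamental weight of $\alpha_\mathfrak{q}$, $\chi_\mathfrak{q}$ the character of $L$ with differential $\lambda_\mathfrak{q}$, $\chi^s=|\chi_\mathfrak{q}|^s$ on $L_0$ extended trivially to $N_0$; $\mathcal{L}_s=\mathcal{L}(s\lambda_\mathfrak{q})$ is the resulting line bundle restricted to $\bar N_0\subset G_0/Q_0$, with sections $C^\infty(\bar N_0,\mathbb{C}_{\chi^s})$. With $Y=Y_{\bar{\mathfrak{n}}}+Y_\mathfrak{q}$ along $\mathfrak{g}=\bar{\mathfrak{n}}\oplus\mathfrak{q}$ and $(R(X)f)(\bar n)=\frac{d}{dt}f(\bar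 n\exp(tX))|_{t=0}$ (extended to $\mathcal{U}(\bar{\mathfrak{n}})$), $\mathfrak{g}$ acts by $(\pi_s(Y)f)(\bar n)=s\lambda_\mathfrak{q}((\mathrm{Ad}(\bar n^{-1})Y)_\mathfrak{q})f(\bar n)-(R((\mathrm{Ad}(\bar n^{-1})Y)_{\bar{\mathfrak{n}}})f)(\bar n)$. Conformal invariance. A list $D_1,\dots,D_m$ of differential operators on $\mathcal{L}_s$ is conformally invariant if it is linearly independent at each point of $\bar N_0$ and for each $X\in\mathfrak{g}$ there is a matrix $C(X)$ of smooth functions on $\bar N_0$ with $[\pi_s(X),D_i]=\sum_jC_{ji}(X)D_j$ for all $i$. Two lists are equivalent if related by an invertible matrix of smooth functions, $D_i'=\sum_jA_{ji}D_j$. $\Omega_2$ systems. $\omega=\sum_jX_j^*\otimes X_j\in\mathfrak{z}(\bar{\mathfrak{n}})\otimes\mathfrak{z}(\mathfrak{n})$ with $\{X_j\}$ a basis of $\mathfrak{z}(\mathfrak{n})$ and $\{X_j^*\}$ its $\kappa$-dual basis of $\mathfrak{z}(\bar{\mathfrak{n}})$; $\tau_2:\mathfrak{g}(1)\to\mathfrak{l}\otimes\mathfrak{z}(\mathfrak{n})$, $\tau_2(X)=\frac12(\mathrm{ad}(X)^2\otimes\mathrm{Id})\omega$. Via $\kappa$, $(\mathfrak{l}\otimes\mathfrak{z}(\mathfrak{n}))^*\cong\mathfrak{l}\otimes\mathfrak{z}(\bar{\mathfrak{n}})$; $V(\mu+\epsilon)^*$ is the constituent corresponding to the dual of $V(\mu+\epsilon)$.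 $\tilde\tau_2(Y^* )(X)=Y^*(\tau_2(X))$ is a quadratic polynomial on $\mathfrak{g}(1)$, i.e. an element of $\mathrm{Sym}^2(\mathfrak{g}(-1))$ via $\kappa$, and $\Omega_2(Y^* )=R(\sigma(\tilde\tau_2(Y^* )))$ with $\sigma:\mathrm{Sym}^2(\mathfrak{g}(-1))\to\mathcal{U}(\bar{\mathfrak{n}})$ symmetrization. The $\Omega_2|_{V(\mu+\epsilon)^*}$ system is any list equivalent to $\Omega_2(Y_1^* ),\dots,\Omega_2(Y_n^* )$ for a basis $\{Y_i^*\}$ of $V(\mu+\epsilon)^*$ (for the special constituents of type 1a or 2, $\tilde\tau_2|_{V(\mu+\epsilon)^*}\neq0$). *)

(* Defs.v *)
From HB Require Import structures.
From mathcomp Require Import all_boot all_order all_algebra.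
From mathcomp Require Import finmap complex.
From mathcomp Require Import all_classical all_reals all_analysis.

Set Implicit Arguments.
Unset Strict Implicit.
Unset Printing Implicit Defensive.

Import Order.TTheory GRing.Theory Num.Theory.
Import numFieldNormedType.Exports.
Import passmx.

Local Open Scope classical_set_scope.
Local Open Scope ring_scope.

Record lie_algebra (K : fieldType) := LieAlgebra {
  lie_sort :> vectType K;
  lie_br : lie_sort -> lie_sort -> lie_sort;
  lie_br_linl : forall (c : K) (x y z : lie_sort),
    lie_br (c *: x + y) z = c *: lie_br x z + lie_br y z;
  lie_br_alt : forall x : lie_sort, lie_br x x = 0;
  lie_br_jacobi : forall x y z : lie_sort,
    lie_br x (lie_br y z) + lie_br y (lie_br z x) + lie_br z (lie_br x y) = 0
}.

Section LieAlgebra.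
Variables (K : fieldType) (g : lie_algebra K).
Implicit Types (x y : g) (U V : {vspace g}).

Definition ad x : 'End(g) := linfun (lie_br x).

Definition killing x y : K :=
  \tr (mxof (vbasis {:g}) (vbasis {:g}) (ad x \o ad y)%VF).

Definition brv U V : {vspace g} :=
  <<[seq lie_br x y | x <- vbasis U, y <- vbasis V]>>%VS.

Definition simple_lie : Prop :=
  brv {:g} {:g} <> 0%VS /\
  (forall I : {vspace g}, (brv {:g} I <= I)%VS -> I = 0%VS \/ I = fullv).

Definition subalgebra U : Prop := (brv U U <= U)%VS.

Definition solvable_subalgebra U : Prop :=
  subalgebra U /\ exists k, iter k (fun V => brv V V) U = 0%VS.

Definition nilpotent_subalgebra U : Prop :=
  subalgebra U /\ exists k, iter k (fun V => brv U V) U = 0%VS.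

Definition cartan_subalgebra U : Prop :=
  nilpotent_subalgebra U /\
  (forall x, (forall y, y \in U -> lie_br x y \in U) -> x \in U).

Definition borel_subalgebra U : Prop :=
  solvable_subalgebra U /\
  (forall V, solvable_subalgebra V -> (U <= V)%VS -> V = U).

(* i-th vector of the Killing-dual basis, in W, of the basis [vbasis U] of U
   (for subspaces U, W that are in perfect duality under the Killing form). *)
Definition kdual U (W : {vspace g}) (i : 'I_(\dim U)) : g :=
  xget 0 [set x | x \in W /\
    forall j : 'I_(\dim U), killing x (vbasis U)`_j = (i == j)%:R].

(* g (x) g is modelled by square matrices: the (i, j) entry of a tensor is its
   coefficient on e_i (x) e_j, where e is the basis [vbasis {:g}]. *)
Definition tensor := 'M[K]_(\dim {:g}, \dim {:g}).

Definition tens x y : tensor :=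
  (rVof (vbasis {:g}) x)^T *m rVof (vbasis {:g}) y.

Definition tensv U V : {vspace tensor} :=
  <<[seq tens x y | x <- vbasis U, y <- vbasis V]>>%VS.

Definition tens_map (f k : 'End(g)) (T : tensor) : tensor :=
  (mxof (vbasis {:g}) (vbasis {:g}) f)^T *m T
    *m mxof (vbasis {:g}) (vbasis {:g}) k.

Definition tens_act x (T : tensor) : tensor :=
  tens_map (ad x) \1%VF T + tens_map \1%VF (ad x) T.

(* The bilinear form with (a (x) b, c (x) d) |-> killing a c * killing b d. *)
Definition tens_killing (T S : tensor) : K :=
  \sum_i \sum_j \sum_k \sum_l T i j * S k l *
    killing (vbasis {:g})`_i (vbasis {:g})`_k *
    killing (vbasis {:g})`_j (vbasis {:g})`_l.

End LieAlgebra.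

Section Roots.
Variables (C : numClosedFieldType) (g : lie_algebra C) (h : {vspace g}).

Definition hdual := 'Hom(subvs_of h, C^o).

(* Value of the functional a at H; only meaningful for H in h. *)
Definition wt (a : hdual) (H : g) : C := a (vsproj h H).

Definition root_space (a : hdual) : {vspace g} :=
  (\bigcap_(H <- vbasis h) lker (ad H - wt a H *: \1%VF))%VS.

Definition roots : set hdual := [set a | a <> 0 /\ root_space a <> 0%VS].

Definition root_sum (A : set hdual) : {vspace g} :=
  \big[addv/0%VS]_(a \in A) root_space a.

Definition roots_in (W : {vspace g}) : set hdual :=
  [set a | roots a /\ (root_space a <= W)%VS].

Definition roots_in_compl (nu : hdual) (W : {vspace g}) : set hdual :=
  [set a | roots_in W a /\ roots (nu - a)].

(* The element of h that represents a under the Killing form. *)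
Definition hvec (a : hdual) : g :=
  xget 0 [set t | t \in h /\ forall H, H \in h -> killing t H = wt a H].

Definition hform (a c : hdual) : C := killing (hvec a) (hvec c).

Definition cartan_int (a c : hdual) : C := hform a c *+ 2 / hform c c.

Definition long_root (a : hdual) : Prop :=
  roots a /\ forall c, roots c -> hform c c <= hform a a.

Variable b : {vspace g}.

Definition pos_roots : set hdual := roots_in b.

Definition simple_roots : set hdual :=
  [set a | pos_roots a /\
    ~ exists a1 a2, [/\ pos_roots a1, pos_roots a2 & a = a1 + a2]].

Variables (n : nat) (al : 'I_n -> hdual) (q : 'I_n).

Definition fund_weight : hdual :=
  xget 0 [set w | forall i : 'I_n, cartan_int w (al i) = (i == q)%:R].

Definition levi_roots : set hdual :=
  [set a | roots a /\ a \in <<[seq al i | i <- enum 'I_n & i != q]>>%VS].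

Definition levi : {vspace g} := (h + root_sum levi_roots)%VS.

Definition nilrad : {vspace g} := root_sum (pos_roots `\` levi_roots).

Definition parab : {vspace g} := (levi + nilrad)%VS.

(* Roots with coefficient j on al q, and the graded pieces g(j), j <> 0. *)
Definition graded_roots (j : int) : set hdual :=
  [set a | roots a /\
    exists c : 'I_n -> int, a = \sum_i al i *~ c i /\ c q = j].

Definition gr (j : int) : {vspace g} := root_sum (graded_roots j).

Definition nilrad_opp : {vspace g} := (gr (- 1) + gr (- 2%:Z))%VS.

Definition quasi_heisenberg : Prop :=
  brv nilrad (brv nilrad nilrad) = 0%VS /\ (1 < \dim (brv nilrad nilrad))%N.

(* The differential of chi_q on q = l (+) n: the functional extending
   fund_weight by zero on the root spaces. *)
Definition fund_char (Y : g) : C :=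
  wt fund_weight (daddv_pi h (root_sum roots) Y).

(* [act : g -> E -> E] is the action on a g-module E.  The Levi subgroup L of
   the connected group G is connected, so that the L-submodules of E are its
   l-submodules. *)
Section Modules.
Variables (E : vectType C) (act : g -> E -> E).

Definition levi_stable (W : {vspace E}) : Prop :=
  forall x w, x \in levi -> w \in W -> act x w \in W.

Definition levi_irreducible (W : {vspace E}) : Prop :=
  [/\ levi_stable W, W <> 0%VS &
      forall U : {vspace E}, levi_stable U -> (U <= W)%VS -> U = 0%VS \/ U = W].

Definition highest_weight (W : {vspace E}) (nu : hdual) : Prop :=
  exists v : E, [/\ v \in W, v <> 0,
    (forall H, H \in h -> act H v = wt nu H *: v) &
    (forall a x, (levi_roots `&` pos_roots) a -> x \in root_space a ->
       act x v = 0)].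

End Modules.

(* V is a special constituent of l (x) z(n), with highest weight mu + eps. *)
Definition special_constituent (mu gamma eps : hdual)
    (V : {vspace tensor g}) : Prop :=
  [/\ (V <= tensv levi (gr 2))%VS,
      levi_irreducible (@tens_act C g) V,
      highest_weight (@tens_act C g) V (mu + eps),
      mu + eps <> gamma & roots_in (gr 1) eps].

Definition type_1a (mu eps : hdual) : Prop :=
  [/\ ~ roots (mu + eps), eps <> mu, long_root mu & long_root eps].

Definition type_2 (mu eps : hdual) : Prop := eps = mu /\ ~ roots (mu + mu).

(* Vd is the constituent of l (x) z(nbar), identified with the dual of
   l (x) z(n), that corresponds to the dual of V: it is put in perfect duality
   with V by the Killing form. *)
Definition dual_constituent (V Vd : {vspace tensor g}) : Prop :=
  [/\ (Vd <= tensv levi (gr (- 2%:Z)))%VS,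
      levi_stable (@tens_act C g) Vd,
      (forall T, T \in V ->
         (forall S, S \in Vd -> tens_killing S T = 0) -> T = 0) &
      (forall S, S \in Vd ->
         (forall T, T \in V -> tens_killing S T = 0) -> S = 0)].

Definition omega : tensor g :=
  \sum_(i < \dim (gr 2)) tens (kdual (gr (- 2%:Z)) i) (vbasis (gr 2))`_i.

Definition tau2 (X : g) : tensor g :=
  2^-1 *: tens_map (ad X \o ad X)%VF \1%VF omega.

Definition ttau2 (S : tensor g) (X : g) : C := tens_killing S (tau2 X).

(* Coefficients of the quadratic polynomial ttau2 S in the basis of g(1), so
   that ttau2 S corresponds to \sum_(i, j) (ttau2_coef S i j) E*_i E*_j in
   Sym^2 g(-1), with E*_i = kdual (gr (- 1)) i. *)
Definition ttau2_coef (S : tensor g) (i j : 'I_(\dim (gr 1))) : C :=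
  let E := vbasis (gr 1) in
  2^-1 * (ttau2 S (E`_i + E`_j) - ttau2 S E`_i - ttau2 S E`_j).

End Roots.

Inductive dynkin_type := TypeB | TypeC | TypeD | TypeE | TypeF.

Definition dynkin_edge (T : dynkin_type) (n i j : nat) : bool :=
  match T with
  | TypeB | TypeC | TypeF => (i.+1 == j)
  | TypeD => (i.+1 == j) && (j < n)%N || (i.+2 == j) && (j == n)
  | TypeE => (i, j) \in [:: (1, 3); (2, 4); (3, 4); (4, 5); (5, 6); (6, 7);
                            (7, 8)]%N
  end.

(* Entry 2 (a_i, a_j) / (a_j, a_j) of the Cartan matrix, simple roots being
   numbered 1, ..., n as in Bourbaki; it is -2 at the pair (i, j) = (long,
   short) of the double edge. *)
Definition bourbaki_entry (T : dynkin_type) (n i j : nat) : int :=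
  if i == j then 2
  else if match T with
          | TypeB => (i.+1 == j) && (j == n)
          | TypeC => (j.+1 == i) && (i == n)
          | TypeF => (i == 2%N) && (j == 3%N)
          | _ => false
          end then - 2%:Z
  else if dynkin_edge T n i j || dynkin_edge T n j i then - 1
  else 0.

Definition bourbaki_simple_roots (C : numClosedFieldType) (g : lie_algebra C)
    (h b : {vspace g}) (T : dynkin_type) (n : nat) (al : 'I_n -> hdual h) :=
  [/\ injective al, range al = simple_roots b &
      forall i j : 'I_n,
        cartan_int (al i) (al j) = (bourbaki_entry T n i.+1 j.+1)%:~R].

(* The parabolics T_n(i), i being the Bourbaki label of the simple root. *)
Definition listed_type (T : dynkin_type) (n i : nat) : bool :=
  match T with
  | TypeB => (3 <= i <= n)%N
  | TypeC => (2 <= i)%N && (i < n)%N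
  | TypeD => (3 <= i)%N && (i + 3 <= n)%N
  | TypeE => (n, i) \in [:: (6, 3); (6, 5); (7, 2); (7, 6); (8, 1)]%N
  | TypeF => (n == 4%N) && (i == 4%N)
  end.

Section RealForms.
Variables (R : realType) (g : lie_algebra R[i]).

Definition real_form_of (U0 : set g) (U : {vspace g}) : Prop :=
  [/\ U0 `<=` [set x | x \in U], U0 0,
      (forall (c : R) x y, U0 x -> U0 y -> U0 (c%:C%C *: x + y)) &
      forall u, u \in U ->
        exists! p : g * g, [/\ U0 p.1, U0 p.2 & u = p.1 + 'i%C *: p.2]].

Definition lie_real_form (g0 : set g) : Prop :=
  real_form_of g0 {:g} /\ (forall x y, g0 x -> g0 y -> g0 (lie_br x y)).

Definition has_real_form (g0 : set g) (U : {vspace g}) : Prop :=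
  real_form_of (g0 `&` [set x | x \in U]) U.

End RealForms.

Section Smooth.
Variables (R : realType) (d : nat).
Local Notation M := 'rV[R]_d.

Fixpoint Ck (k : nat) (f : M -> R) : Prop :=
  continuous f /\
  if k is k'.+1 then
    forall v, (forall x, derivable f x v) /\ Ck k' (fun x => 'D_v f x)
  else True.

Definition smooth (f : M -> R[i]) : Prop :=
  forall k, Ck k (fun x => complex.Re (f x)) /\ Ck k (fun x => complex.Im (f x)).

Definition cderive (f : M -> R[i]) (x v : M) : R[i] :=
  ('D_v (fun y => complex.Re (f y)) x +i* 'D_v (fun y => complex.Im (f y)) x)%C.

Definition cderive1 (f : R -> R[i]) (t : R) : R[i] :=
  (derive1 (fun u => complex.Re (f u)) t +i*
   derive1 (fun u => complex.Im (f u)) t)%C.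

Definition operator := (M -> R[i]) -> M -> R[i].

Inductive diff_op : operator -> Prop :=
| diff_op_mul a : smooth a -> diff_op (fun f x => a x * f x)
| diff_op_der v : diff_op (fun f x => cderive f x v)
| diff_op_add D1 D2 : diff_op D1 -> diff_op D2 ->
    diff_op (fun f x => D1 f x + D2 f x)
| diff_op_comp D1 D2 : diff_op D1 -> diff_op D2 -> diff_op (fun f => D1 (D2 f))
| diff_op_ext D1 D2 : (forall f, smooth f -> D1 f =1 D2 f) ->
    diff_op D1 -> diff_op D2.

Variable m : nat.

Definition indep_at (D : 'I_m -> operator) (x : M) : Prop :=
  forall c : 'I_m -> R[i],
    (forall f, smooth f -> \sum_i c i * D i f x = 0) -> forall i, c i = 0.

Definition equivalent_lists (D D' : 'I_m -> operator) : Prop :=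
  exists A : M -> 'M[R[i]]_m,
    [/\ forall i j, smooth (fun x => A x i j),
        forall x, A x \in unitmx &
        forall i f x, smooth f -> D' i f x = \sum_j A x j i * D j f x].

End Smooth.

(* nbar is a 2-step nilpotent complex Lie algebra with a basis e consisting of
   vectors of the real form g0, hence a real basis of Lie(Nbar_0).  The group
   Nbar_0, being connected, simply connected and nilpotent, is identified with
   R^d by z |-> exp (\sum_i z_i e_i). *)
Section LineBundle.
Variables (R : realType) (g : lie_algebra R[i]) (d : nat) (e : d.-tuple g).
Local Notation M := 'rV[R]_d.

Definition log_vec (z : M) : g := \sum_i (z 0 i)%:C%C *: tnth e i.

Definition log_coord (x : g) : M := \row_i complex.Re (coord e i x).

(* exp x * exp y = exp (bch x y) when brackets of length 3 vanish. *)
Definition bch (x y : g) : g := x + y + 2^-1 *: lie_br x y.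

(* Right derivative along X in the real Lie algebra of Nbar_0. *)
Definition right_der0 (X : g) : operator R d := fun f z =>
  cderive1 (fun t : R => f (log_coord (bch (log_vec z) (t%:C%C *: X)))) 0.

(* C-linear extension of right_der0 to X in nbar. *)
Definition right_der (X : g) : operator R d := fun f z =>
  \sum_i coord e i X * right_der0 (tnth e i) f z.

(* Ad (exp (- log_vec z)); ad (log_vec z) being nilpotent, the exponential
   series stops before the dimension of g. *)
Definition Ad_inv (z : M) (Y : g) : g :=
  \sum_(k < \dim {:g}) (k`!%:R)^-1 *: iter k (lie_br (- log_vec z)) Y.

Variables (h b : {vspace g}) (n : nat) (al : 'I_n -> hdual h) (q : 'I_n).

Definition pi_act (s : R[i]) (Y : g) : operator R d := fun f z =>
  let Yz := Ad_inv z Y in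
  let qq := parab b al q in
  let nb := nilrad_opp al q in
  s * fund_char al q (daddv_pi qq nb Yz) * f z
  - right_der (daddv_pi nb qq Yz) f z.

Definition conformally_invariant (s : R[i]) (m : nat) (D : 'I_m -> operator R d)
    : Prop :=
  [/\ forall i, diff_op (D i),
      forall x, indep_at D x &
      forall X : g, exists c : 'I_m -> 'I_m -> M -> R[i],
        (forall j i, smooth (c j i)) /\
        (forall i f x, smooth f ->
           pi_act s X (D i f) x - D i (pi_act s X f) x
             = \sum_j c j i x * D j f x)].

(* R (sigma (ttau2 S)), where sigma (A B) = (A B + B A) / 2 in U(nbar). *)
Definition Omega2 (S : tensor g) : operator R d := fun f x =>
  \sum_(i < \dim (gr al q 1)) \sum_(j < \dim (gr al q 1)) ttau2_coef S i j *
    (2^-1 * (right_der (kdual (gr al q (- 1)) i)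
               (right_der (kdual (gr al q (- 1)) j) f) x +
             right_der (kdual (gr al q (- 1)) j)
               (right_der (kdual (gr al q (- 1)) i) f) x)).

(* D is an Omega_2|_Vd system. *)
Definition Omega2_system (Vd : {vspace tensor g}) (m : nat)
    (D : 'I_m -> operator R d) : Prop :=
  exists2 Y : m.-tuple (tensor g), basis_of Vd Y &
    equivalent_lists (fun i => Omega2 (tnth Y i)) D.

End LineBundle.

(* Main.v *)
Require Import Defs.
From HB Require Import structures.
From mathcomp Require Import all_boot all_order all_algebra.
From mathcomp Require Import finmap complex.
From mathcomp Require Import all_classical all_reals all_analysis.
From mathcomp Require Import ring lra zify.

Set Implicit Arguments.
Unset Strict Implicit.
Unset Printing Implicit Defensive.

Import Order.TTheory GRing.Theory Num.Theory.
Import numFieldNormedType.Exports.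
Import passmx.

Local Open Scope ring_scope.

(** The operators [R(X)], [X] in [g(-1)], are derivations of smooth functions satisfying
    [R(X) R(Y) - R(Y) R(X) = R([X, Y])], and along them the section [phi(z) = Ad(exp(- z)) Y] satisfies
    [R(X) phi = [phi, X]].  Hence the commutator of [pi_s(Y)] with a second order operator
    [\sum c_ij R(F_i) R(F_j)], [c] symmetric, is the operator attached to the tensor transformed by the
    [g(0)]-component of [phi], plus a first order operator and a multiplication operator.  The latter
    vanishes because [c] is symmetric, and the former vanishes as soon as
    [s |alpha_q|^2 = c(mu) - c(nu) / 2], where [nu = mu + eps] and [c(mu)], [c(nu)] are the Casimir
    eigenvalues of [l] on [g(1)] and on [V(nu)].  For type 2 this gives [s = -1].  For type 1a the roots
    [mu], [eps] are orthogonal, and the Casimir difference is computed from the pairings of [mu] and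
    [eps] with the positive roots of [l]: either the Weyl group of [l] carries [mu] to [eps], which
    cancels the quadratic part, or [eps] is a highest weight of [g(1)] as well; what remains counts the
    pairs of roots of [g(1)] with sum [nu].  Linear independence holds because [V(nu)^*] injects into the quadratic forms on
    [g(1)]: a lowest weight vector of the kernel would act on [z(n)], after composition with root
    vectors of [mu] and [eps], as a nonzero multiple of a projection, which has nonzero trace. *)

(** * Linear algebra *)

(** The given structure is poor: a bracket linear on the left only, a nilpotent self-normalizing
    [h], a maximal solvable [b]. Root theory is rebuilt from this. Right linearity comes from the
    Jacobi identity and simplicity. Nondegeneracy of the Killing form is reached without Cartan's
    criterion: the radical is an ideal, and it is not everything because the Cartan integer of a
    simple root with itself is 2, whereas a zero form would give 0.

    The number c(mu) - c(nu) / 2 arises as follows. Paired with Y in g(1), the first order term of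
    the commutator contains the sum of the bilinear form over (z X, z' Y), for dual bases z, z' of
    l. The Casimir operator of a product is the sum of the Casimir operators of the factors plus
    twice this mixed sum, so the mixed sum is c(nu) / 2 - c(mu) times the form. The factor
    |alpha_q|^2 appears because the vector dual to the fundamental weight acts on g(1) by
    |alpha_q|^2 / 2. For type 2 the difference of eigenvalues is - |mu|^2, so that s = -1 rests on
    [mu], the highest root of g(1), being as long as alpha_q, the lowest one. *)

Section LfunRules.
Variables (F : fieldType) (V W : vectType F) (f : 'Hom(V, W)).
Lemma lfD x y : f (x + y) = f x + f y. Proof. exact: linearD. Qed.
Lemma lfB x y : f (x - y) = f x - f y. Proof. exact: linearB. Qed.
Lemma lfZ c x : f (c *: x) = c *: f x. Proof. exact: linearZ. Qed.
Lemma lf0 : f 0 = 0. Proof. exact: linear0. Qed.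
End LfunRules.

Section Coordinates.
Variables (F : fieldType) (V : vectType F).
Definition vco (i : 'I_(\dim {:V})) (x : V) : F := coord (vbasis {:V}) i x.
Lemma vco_ext x y : (forall i, vco i x = vco i y) -> x = y.
Proof.
move=> h; rewrite (coord_basis (vbasisP {:V}) (memvf x)) (coord_basis (vbasisP {:V}) (memvf y)).
by apply: eq_bigr => i _; rewrite -!/(vco _ _) h.
Qed.
Lemma vcoD i x y : vco i (x + y) = vco i x + vco i y. Proof. exact: linearD. Qed.
Lemma vcoN i x : vco i (- x) = - vco i x. Proof. exact: linearN. Qed.
Lemma vcoZ i c x : vco i (c *: x) = c * vco i x. Proof. exact: linearZ. Qed.
Lemma vco0 i : vco i 0 = 0. Proof. exact: linear0. Qed.
(** Derives an equation from a known one [l = r]: it is enough that [a - b = l - r] holds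
    identically, which [vring] can check. *)
Lemma eq_by (a b l r : V) : l = r -> a - b = l - r -> a = b.
Proof. by move=> -> /eqP; rewrite subrr subr_eq0 => /eqP. Qed.
Lemma eqD (a b l r : V) : a = b -> l = r -> a + l = b + r. Proof. by move=> -> ->. Qed.
Lemma eqB (a b l r : V) : a = b -> l = r -> a - l = b - r. Proof. by move=> -> ->. Qed.
Lemma eqZ c (a b : V) : a = b -> c *: a = c *: b. Proof. by move=> ->. Qed.
Definition vcoE := (vcoD, vcoN, vcoZ, vco0).
End Coordinates.
(* Vector space identities are checked coordinatewise by [ring]. *)
Ltac vring := apply: vco_ext => ?; rewrite ?vcoE; ring.

Section LinearAlgebra.
Variables (F : fieldType) (V : vectType F).
Implicit Types (f g : 'End(V)) (U W A B : {vspace V}).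

Definition geneig f (c : F) (x : V) := exists N, iter N (f - c *: \1%VF)%R x = 0.

Lemma lfun_subidE f c x : (f - c *: \1%VF)%R x = f x - c *: x.
Proof. by rewrite !lfunE /= !lfunE /= lfunE /= id_lfunE. Qed.

Lemma iter_lfunD f n x y : iter n f (x + y) = iter n f x + iter n f y.
Proof. by elim: n => //= n ->; rewrite linearD. Qed.

Lemma iter_lfunZ f n c x : iter n f (c *: x) = c *: iter n f x.
Proof. by elim: n => //= n ->; rewrite linearZ. Qed.

Lemma iter_lfun0 f n : iter n f 0 = 0.
Proof. by elim: n => //= n ->; rewrite linear0. Qed.

Lemma iter_lfunB f n x y : iter n f (x - y) = iter n f x - iter n f y.
Proof. by rewrite iter_lfunD -scaleN1r iter_lfunZ scaleN1r. Qed.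

Fixpoint lfun_pow f n : 'End(V) := if n is n'.+1 then (f \o lfun_pow f n')%VF else \1%VF.

Lemma lfun_powE f n x : lfun_pow f n x = iter n f x.
Proof. by elim: n => [|n IH] /=; rewrite ?id_lfunE // comp_lfunE IH. Qed.

Lemma iter_null_le f n m x : (n <= m)%N -> iter n f x = 0 -> iter m f x = 0.
Proof. by move=> /subnK <- h; rewrite iterD h iter_lfun0. Qed.

Lemma geneigD f c x y : geneig f c x -> geneig f c y -> geneig f c (x + y).
Proof.
move=> [n hn] [m hm]; exists (maxn n m).
by rewrite iter_lfunD (iter_null_le (leq_maxl n m)) // (iter_null_le (leq_maxr n m)) // addr0.
Qed.

Lemma geneigZ f c a x : geneig f c x -> geneig f c (a *: x).
Proof. by move=> [n hn]; exists n; rewrite iter_lfunZ hn scaler0. Qed.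

Lemma geneig_comm f c (h : 'End(V)) x :
  (forall y, h (f y) = f (h y)) -> geneig f c x -> geneig f c (h x).
Proof.
move=> hf [n hn]; exists n.
suff -> : iter n (f - c *: \1%VF)%R (h x) = h (iter n (f - c *: \1%VF)%R x) by rewrite hn linear0.
elim: n {hn} => //= n ->; rewrite !lfun_subidE.
by rewrite lfB lfZ hf.
Qed.

Lemma limg_memP f W : (forall x, x \in W -> f x \in W) <-> (f @: W <= W)%VS.
Proof.
split=> [h|/subvP h x xW]; last by apply: h; apply: memv_img.
by apply/subvP => _ /memv_imgP [x xW ->]; apply: h.
Qed.

(** Fitting's lemma. As long as [f] does not map [W] onto itself, [f @: W] has smaller dimension and
    the decomposition found there is pulled back: if [f x = a + b] and [b = f b'] with [b'] in [B],
    then [x - b'] is killed by one more power of [f]. *)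
Lemma fitting f W : (f @: W <= W)%VS -> exists N B,
  [/\ (f @: B <= B)%VS, (B <= W)%VS, (B :&: lker f = 0)%VS &
      forall x, x \in W -> exists a b, [/\ x = a + b, a \in W, iter N f a = 0 & b \in B]].
Proof.
have [n] := ubnP (\dim W); elim: n W => // n IH W; rewrite ltnS => dW sW.
have [eqW | neW] := eqVneq (f @: W)%VS W.
  exists 0%N, W; split; rewrite ?subvv //.
    apply/eqP; rewrite -dimv_eq0; have := limg_ker_dim f W.
    by rewrite eqW -[X in _ = X]add0n => /addIn ->.
  by move=> x xW; exists 0, x; rewrite add0r mem0v.
have dlt : (\dim (f @: W) < n)%N.
  apply: leq_trans dW; rewrite ltn_neqAle dimvS // andbT.
  by apply: contraNneq neW => e; rewrite eqEdim sW e leqnn.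
have [|N [B [sB BW BK hB]]] := IH _ dlt.
  exact: limgS.
exists N.+1, B; split=> //; first exact: subv_trans BW sW.
move=> x xW; have [a [b [e aW aN bB]]] := hB _ (memv_img f xW).
have fB : (f @: B == B)%VS.
  rewrite eqEdim sB /=; have := limg_ker_dim f B; rewrite BK dimv0 add0n => ->.
  exact: leqnn.
have [b' b'B eb] : exists2 b', b' \in B & b = f b'.
  by apply/memv_imgP; rewrite (eqP fB).
exists (x - b'), b'; split=> //; first by rewrite subrK.
  by rewrite memvB // (subvP (subv_trans BW sW)).
by rewrite iterSr linearB /= e eb addrK.
Qed.

Lemma iter_memv f W n x : (f @: W <= W)%VS -> x \in W -> iter n f x \in W.
Proof. by move=> /limg_memP h xW; elim: n => //= n IH; apply: h. Qed.

Lemma iter_null_inj f B n x : (f @: B <= B)%VS -> (B :&: lker f = 0)%VS ->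
  x \in B -> iter n f x = 0 -> x = 0.
Proof.
move=> sB BK xB; elim: n => //= n IH h; apply: IH.
apply/eqP; rewrite -memv0 -BK memv_cap iter_memv //=.
by rewrite memv_ker h.
Qed.

(* Since the f_i commute modulo U, the preimages of U can be intersected one at a time. *)
Lemma engel_mod (fs : seq 'End(V)) W U :
  ~ (W <= U)%VS ->
  (forall f, f \in fs -> [/\ forall x, x \in U -> f x \in U, forall x, x \in W -> f x \in W &
     forall x, x \in W -> exists k, iter k f x \in U]) ->
  (forall f g x, f \in fs -> g \in fs -> x \in W -> f (g x) - g (f x) \in U) ->
  exists x, [/\ x \in W, x \notin U & forall f, f \in fs -> f x \in U].
Proof.
elim: fs W => [|f fs IH] W WU hf hc.
  by move/negP/subvPn: WU => [x xW xU]; exists x.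
have [fU fW fN] := hf f (mem_head _ _).
pose W' := (W :&: (f @^-1: U))%VS.
have [||| x [xW' xU hx]] := IH W'.
- move=> sW'; apply: WU; apply/subvP => x xW; have [k] := fN x xW.
  elim: k => [//|k IHk /=] h; apply: IHk; apply: (subvP sW').
  rewrite memv_cap -memv_preim h andbT; apply: iter_memv xW; exact/limg_memP.
- move=> g gs; have [gU gW gN] := hf g (mem_behead (s := f :: fs) gs); split=> //.
    move=> x; rewrite !memv_cap -!memv_preim => /andP [xW fxU].
    rewrite gW //=; have := hc f g x (mem_head _ _) (mem_behead (s := f :: fs) gs) xW.
    by move=> h; have := memvD h (gU _ fxU); rewrite subrK.
  by move=> x; rewrite memv_cap => /andP [xW _]; apply: gN.
- move=> g h x gs hs; rewrite memv_cap => /andP [xW _].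
  by apply: hc => //; rewrite inE ?gs ?hs orbT.
move: xW'; rewrite memv_cap -memv_preim => /andP [xW fxU].
by exists x; split=> // g; rewrite inE => /orP [/eqP -> // | /hx].
Qed.

Definition tr f : F := \tr (mxof (vbasis {:V}) (vbasis {:V}) f).

Lemma tr_linear a f g : tr (a *: f + g) = a * tr f + tr g.
Proof. by rewrite /tr linearP mxtraceD mxtraceZ. Qed.

Lemma trD f g : tr (f + g) = tr f + tr g.
Proof. by have := tr_linear 1 f g; rewrite scale1r mul1r. Qed.

Lemma trZ a f : tr (a *: f) = a * tr f.
Proof. by rewrite /tr linearZ mxtraceZ. Qed.

Lemma trN f : tr (- f) = - tr f.
Proof. by rewrite -scaleN1r trZ mulN1r. Qed.

Lemma trB f g : tr (f - g) = tr f - tr g.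
Proof. by rewrite trD trN. Qed.

Lemma tr0 : tr 0 = 0.
Proof. by rewrite -(scale0r (0 : 'End(V))) trZ mul0r. Qed.

Lemma trC f g : tr (f \o g)%VF = tr (g \o f)%VF.
Proof. have bV := vbasisP {:V}.
by rewrite /tr (@mxof_comp _ _ _ _ _ _ _ bV g f) (@mxof_comp _ _ _ _ _ _ _ bV f g) mxtrace_mulC. Qed.

(** Change of basis. It lets the Killing form, defined through [vbasis], be computed in a basis of
    root vectors. *)
Lemma tr_basis n (X : n.-tuple V) f : basis_of {:V} X ->
  tr f = \sum_i coord X i (f X`_i).
Proof.
move=> bX.
have trE (Y : (\dim {:V}).-tuple V) : basis_of {:V} Y ->
    \tr (mxof Y Y f) = \sum_i coord Y i (f Y`_i).
  move=> bY; apply: eq_bigr => i _.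
  by rewrite !mxE /= vecof_delta.
have nE : n = \dim {:V} by rewrite -(size_basis bX).
move: X bX; rewrite nE => X bX.
rewrite -trE // /tr.
pose M := mxof X (vbasis {:V}) \1%VF; pose N := mxof (vbasis {:V}) X \1%VF.
have bV := vbasisP {:V}.
have -> : mxof X X f = M *m mxof (vbasis {:V}) (vbasis {:V}) f *m N.
  by rewrite /M /N -!mxof_comp // comp_lfun1r comp_lfun1l.
rewrite -mulmxA mxtrace_mulC -mulmxA.
have -> : N *m M = 1%:M by rewrite /N /M -mxof_comp // comp_lfun1l mxof1 // (basis_free bV).
by rewrite mulmx1.
Qed.

(** Among the subspaces contained in [P] take one of largest dimension: adjoining the line of any
    further vector of [P] would enlarge it. *)
Lemma vspace_of (P : V -> Prop) : P 0 -> (forall c x y, P x -> P y -> P (c *: x + y)) ->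
  exists W : {vspace V}, forall x, x \in W <-> P x.
Proof.
move=> P0 PL.
pose Q n := `[< exists W : {vspace V}, \dim W = n /\ forall x, x \in W -> P x >].
have Q0 : exists n, Q n.
  exists 0%N; apply/asboolP; exists 0%VS; split; first exact: dimv0.
  by move=> x; rewrite memv0 => /eqP ->.
have Qb n : Q n -> (n <= \dim {:V})%N.
  by move/asboolP => [W [<- _]]; apply: dimvS; exact: subvf.
have [n /asboolP [W [dW hW]] nmax] := ex_maxnP Q0 Qb.
exists W => x; split; first exact: hW.
move=> Px; suff : (<[x]> + W <= W)%VS by move/subv_trans/(_ (subvv _)); rewrite subv_add => /andP [h _]; rewrite memvE.
have sub : (W <= <[x]> + W)%VS by exact: addvSr.
rewrite -(geq_leqif (dimv_leqif_sup sub)) dW; apply: nmax; apply/asboolP.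
exists (<[x]> + W)%VS; split=> // y /memv_addP [u /vlineP [c ->] [v vW ->]].
by apply: PL => //; apply: hW.
Qed.

(** The map sending [x] to the sum of the [B x b_i *: b_i] over a basis of [W] is injective on [W]
    by nondegeneracy, hence onto [W], so the prescribed values of [phi] on the basis are
    attained. *)
Lemma form_represent (B : V -> V -> F) W (phi : V -> F) :
  (forall c x y z, B (c *: x + y) z = c * B x z + B y z) ->
  (forall c x y z, B z (c *: x + y) = c * B z x + B z y) ->
  (forall x, x \in W -> (forall y, y \in W -> B x y = 0) -> x = 0) ->
  (forall c x y, phi (c *: x + y) = c * phi x + phi y) ->
  exists2 x, x \in W & forall y, y \in W -> B x y = phi y.
Proof.
move=> Bl Br nd lphi; set b := vbasis W; have bW := vbasisP W.
pose T x := \sum_(i < \dim W) B x b`_i *: b`_i.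
have Tlin : linear T.
  move=> c x y; rewrite /T scaler_sumr -big_split; apply: eq_bigr => i _.
  by rewrite Bl scalerDl scalerA.
pose TL : {linear V -> V} := HB.pack T (GRing.isLinear.Build _ _ _ _ T Tlin).
pose f := linfun TL.
have fE x : f x = T x by rewrite lfunE.
have biW (i : 'I_(\dim W)) : b`_i \in W by apply/vbasis_mem/mem_nth; rewrite size_tuple.
have ext (psi psi' : V -> F) : (forall c x y, psi (c *: x + y) = c * psi x + psi y) ->
    (forall c x y, psi' (c *: x + y) = c * psi' x + psi' y) ->
    (forall i : 'I_(\dim W), psi b`_i = psi' b`_i) -> forall y, y \in W -> psi y = psi' y.
  move=> l l' e y yW; rewrite (coord_basis bW yW).
  have z0 p : (forall c x y, p (c *: x + y) = c * p x + p y) -> p 0 = 0 :> F.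
    by move=> lp; have := lp (-1) 0 0; rewrite scaler0 addr0 mulN1r addNr.
  apply: (big_ind (fun v => psi v = psi' v)); first by rewrite !z0.
    by move=> u v hu hv; rewrite -[u]scale1r l l' hu hv.
  by move=> i _; rewrite -[_ *: _]addr0 l l' e !z0.
have fW : (f @: W <= W)%VS.
  by apply/limg_memP => x _; rewrite fE; apply: memv_suml => i _; apply: memvZ.
have fK : (W :&: lker f = 0)%VS.
  apply/eqP; rewrite -subv0; apply/subvP => x; rewrite memv_cap memv_ker fE memv0 => /andP [xW /eqP Tx].
  apply/eqP/nd => //; apply: (ext _ (fun=> 0)) => [c u v|c u v|i]; first exact: Br.
    by rewrite mulr0 addr0.
  by move/freeP: (basis_free bW) => /(_ _ Tx i).
have eW : (f @: W == W)%VS.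
  by rewrite eqEdim fW /=; have := limg_ker_dim f W; rewrite fK dimv0 add0n => ->.
have : \sum_(i < \dim W) phi b`_i *: b`_i \in (f @: W)%VS.
  by rewrite (eqP eW); apply: memv_suml => i _; apply: memvZ.
move/memv_imgP => [x xW e]; exists x => //.
apply: ext => [c u v||i]; [exact: Br | exact: lphi |].
have : \sum_(j < \dim W) (B x b`_j - phi b`_j) *: b`_j = 0.
  under eq_bigr do rewrite scalerBl.
  by rewrite big_split /= sumrN e fE subrr.
move=> e0; move/freeP: (basis_free bW) => /(_ _ e0 i) /eqP; by rewrite subr_eq0 => /eqP.
Qed.

Lemma fitting_surj f B M b : (f @: B <= B)%VS -> (B :&: lker f = 0)%VS -> b \in B ->
  exists2 b', b' \in B & b = iter M f b'.
Proof.
move=> sB BK; elim: M b => [|M IH] b bB; first by exists b.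
have eB : (f @: B == B)%VS.
  by rewrite eqEdim sB /=; have := limg_ker_dim f B; rewrite BK dimv0 add0n => ->.
have : b \in (f @: B)%VS by rewrite (eqP eB).
move/memv_imgP => [c cB ->]; have [d dB ->] := IH c cB.
by exists d => //; rewrite iterS.
Qed.

End LinearAlgebra.

Section Closed.
Variables (F : numClosedFieldType) (V : vectType F).
Implicit Types (f g : 'End(V)) (U W A B : {vspace V}).

Lemma eigen_stable f W : (f @: W <= W)%VS -> W != 0%VS ->
  exists c v, [/\ v \in W, v != 0 & f v = c *: v].
Proof.
move=> sW W0; set b := vbasis W; pose n := \dim W.
pose A : 'M[F]_n := \matrix_(i, j) coord b j (f b`_i).
have [a /eigenvalueP [u uA u0]] := eigenvalue_closed A (etrans (lt0n _) (etrans (congr1 negb (dimv_eq0 W)) W0)).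
have bW := vbasisP W.
have vE (i : 'I_n) : f b`_i = \sum_j A i j *: b`_j.
  rewrite {1}(coord_basis bW (v := f b`_i)).
    by apply: eq_bigr => j _; rewrite mxE.
  by move/limg_memP: sW; apply; apply/vbasis_mem/mem_nth; rewrite size_tuple.
exists a, (\sum_i u 0 i *: b`_i); split.
- by apply: memv_suml => i _; apply/memvZ/vbasis_mem/mem_nth; rewrite size_tuple.
- apply: contraNneq u0 => h; apply/eqP/rowP => i; rewrite mxE.
  by apply: (freeP (X := b)) => //; exact: basis_free bW.
- rewrite linear_sum scaler_sumr.
  under eq_bigr => i _ do rewrite linearZ /= vE scaler_sumr.
  rewrite exchange_big; apply: eq_bigr => j _ /=.
  under eq_bigr do rewrite scalerA.
  rewrite -scaler_suml scalerA; congr (_ *: _).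
  by move/rowP: uA => /(_ j); rewrite !mxE.
Qed.

Lemma daddv_pi_l A B a b : (A :&: B = 0)%VS -> a \in A -> b \in B ->
  daddv_pi A B (a + b) = a.
Proof.
move=> d aA bB; have ab : a + b \in (A + B)%VS by rewrite memv_add.
have h := daddv_pi_add d ab.
have e : daddv_pi A B (a + b) - a = b - daddv_pi B A (a + b).
  apply/eqP; rewrite subr_eq addrAC eq_sym subr_eq h addrC. by [].
apply/eqP; rewrite -subr_eq0 -memv0 -d memv_cap memvB ?memv_pi //=.
by rewrite e memvB ?memv_pi.
Qed.

Lemma stable_subid f c U : (f @: U <= U)%VS <-> ((f - c *: \1%VF)%R @: U <= U)%VS.
Proof.
split=> /limg_memP h; apply/limg_memP => x xU.
  by rewrite lfun_subidE memvB ?memvZ ?h.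
by have := memvD (h x xU) (memvZ c xU); rewrite lfun_subidE subrK.
Qed.

(** Fitting's lemma for [f - c], with [c] an eigenvalue of [f] on [W]. The eigenvector is not in
    [B], so the dimension drops; this drives the inductions over generalized eigenvectors. *)
Lemma fit_split f W : (f @: W <= W)%VS -> W != 0%VS -> exists c A B,
  [/\ [/\ (A :&: B = 0)%VS, (\dim B < \dim W)%N, (B <= W)%VS & (A <= W)%VS],
      (f @: A <= A)%VS /\ (f @: B <= B)%VS,
      forall x, x \in W -> exists a b, [/\ x = a + b, a \in A & b \in B],
      forall a, a \in A -> geneig f c a &
      forall b, b \in B -> geneig f c b -> b = 0].
Proof.
move=> sW W0; have [c [v [vW v0 fv]]] := eigen_stable sW W0.
pose k := (f - c *: \1%VF)%R.
have sk U : (f @: U <= U)%VS <-> (k @: U <= U)%VS by exact: stable_subid.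
have [N [B [sB BW BK hB]]] := fitting (proj1 (sk W) sW).
have binj b : b \in B -> geneig f c b -> b = 0.
  by move=> bB [n hn]; apply: (iter_null_inj sB BK bB hn).
exists c, (W :&: lker (lfun_pow k N))%VS, B; split=> //.
- split=> //; last exact: capvSl.
    apply/eqP; rewrite -subv0; apply/subvP => x; rewrite !memv_cap -andbA => /and3P [xW xk xB].
    rewrite memv0; apply/eqP/binj => //; exists N; apply/eqP; by rewrite -lfun_powE -memv_ker.
  rewrite ltn_neqAle dimvS // andbT; apply: contraNneq v0 => dBW.
  have /eqP eBW : B == W by rewrite eqEdim BW dBW leqnn.
  apply/eqP/binj; first by rewrite eBW.
  by exists 1%N; rewrite /= lfun_subidE fv subrr.
- split; last exact/sk.
  apply/sk/limg_memP => x; rewrite !memv_cap !memv_ker !lfun_powE => /andP [xW /eqP xN].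
  have /limg_memP hk := proj1 (sk W) sW.
  by rewrite hk // -iterSr iterS xN linear0 eqxx.
- move=> x xW; have [a [b [e aW aN bB]]] := hB x xW; exists a, b; split=> //.
  by rewrite memv_cap aW memv_ker lfun_powE aN eqxx.
- move=> a; rewrite memv_cap => /andP [_ h]; exists N; apply/eqP.
  by rewrite -lfun_powE -memv_ker.
Qed.

(** Stands in for the direct sum decomposition into generalized eigenspaces: summands are split off
    one at a time by [fit_split]. *)
Lemma geneig_ind f W (P : V -> Prop) : (f @: W <= W)%VS -> P 0 ->
  (forall x y, P x -> P y -> P (x + y)) ->
  (forall c y, y \in W -> geneig f c y -> P y) -> forall y, y \in W -> P y.
Proof.
move=> sW P0 PD Pg; have [n] := ubnP (\dim W); elim: n W sW Pg => // n IH W sW Pg.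
rewrite ltnS => dW y yW.
have [W0 | W0] := eqVneq W 0%VS; first by move: yW; rewrite W0 memv0 => /eqP ->.
have [c [A [B [[_ dB BW AW] [_ sB] hAB hA _]]]] := fit_split sW W0.
have [a [b [-> aA bB]]] := hAB y yW.
apply: PD; first by apply: (Pg c) => //; [apply: (subvP AW)| apply: hA].
apply: (IH B) => //; last exact: leq_trans dB dW.
by move=> d z zB; apply: Pg; apply: (subvP BW).
Qed.

Lemma geneig_uniq f c d x : geneig f c x -> geneig f d x -> x != 0 -> c = d.
Proof.
move=> gc [m hm] x0; apply/eqP; apply: contraNT x0 => cd; apply/eqP.
elim: m x gc hm => [//|m IH] x [n hn].
rewrite iterSr => h.
have ex : (f - d *: \1%VF)%R x = 0.
  apply: IH => //; exists n.
  rewrite [in LHS]lfun_subidE iter_lfunB iter_lfunZ hn scaler0 subr0.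
  suff -> : iter n (f - c *: \1%VF)%R (f x) = f (iter n (f - c *: \1%VF)%R x) by rewrite hn linear0.
  elim: n {hn} => //= n ->; by rewrite !lfun_subidE lfB lfZ.
have fx : f x = d *: x by apply/eqP; rewrite -subr_eq0 -lfun_subidE ex.
have : (d - c) ^+ n *: x = 0.
  rewrite -hn; elim: n {hn} => [|n IHn]; first by rewrite expr0 scale1r.
  rewrite iterS -IHn lfun_subidE linearZ /= fx !scalerA -scalerBl; congr (_ *: _).
  by rewrite exprS mulrBl [d * _]mulrC.
by move/eqP; rewrite scaler_eq0 expf_eq0 subr_eq0 eq_sym (negPf cd) andbF => /eqP.
Qed.

(** Functional calculus for an arbitrary function [phi]. It is used with the identity, for the
    semisimple part of an operator, and with complex conjugation. *)
Lemma fun_calc (phi : F -> F) f W : (f @: W <= W)%VS ->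
  exists D : 'End(V), forall c y, y \in W -> geneig f c y -> D y = phi c *: y.
Proof.
have [n] := ubnP (\dim W); elim: n W => // n IH W; rewrite ltnS => dW sW.
have [W0 | W0] := eqVneq W 0%VS.
  by exists 0 => c y; rewrite W0 memv0 => /eqP ->; rewrite linear0 scaler0.
have [c [A [B [[dAB dB BW AW] [sA sB] hAB hA hB]]]] := fit_split sW W0.
have [D hD] := IH B (leq_trans dB dW) sB.
have dBA : (B :&: A = 0)%VS by rewrite capvC.
exists (phi c *: daddv_pi A B + (D \o daddv_pi B A)%VF)%R => d y yW gy.
rewrite lfunE /= lfunE /= comp_lfunE.
have [a [b [ey aA bB]]] := hAB y yW.
rewrite ey daddv_pi_l // [a + b]addrC daddv_pi_l // -[b + a]addrC -ey.
have [cd | cd] := eqVneq c d.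
  have b0 : b = 0.
    apply: hB => //; have -> : b = y + (-1) *: a by rewrite ey scaleN1r addrC addrA addNr add0r.
    by apply: geneigD; [rewrite cd | apply: geneigZ; apply: hA].
  by rewrite ey b0 linear0 !addr0 cd.
(* [a] and [b] are the components of [y] in stable subspaces with zero intersection, so [a] inherits
   the generalized eigenvalue [d] of [y]. As [d] differs from [c], this forces [a = 0]. *)
have ga : geneig f d a.
  have [N hN] := gy; exists N; move: hN; rewrite ey iter_lfunD => /eqP.
  rewrite addr_eq0 => /eqP h; apply/eqP; rewrite -memv0 -dAB memv_cap.
  apply/andP; split; first by apply: iter_memv aA; apply: (proj1 (stable_subid _ _ _)).
  by rewrite h memvN; apply: iter_memv bB; apply: (proj1 (stable_subid _ _ _)).
have a0 : a = 0.
  by apply/eqP; apply: contraNT cd => /(geneig_uniq (hA a aA) ga) ->.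
by move: gy; rewrite ey a0 scaler0 !add0r => gy; apply: hD.
Qed.

(** The list [s] consists of the roots of the characteristic polynomial with multiplicity, whose sum
    is read off the second coefficient. *)
Lemma tr_eigen f : exists s : seq F,
  [/\ tr f = \sum_(c <- s) c, forall c v, v != 0 -> f v = c *: v -> c \in s & forall c, c \in s -> exists2 v, v != 0 & f v = c *: v].
Proof.
pose n := \dim {:V}; pose b := vbasis {:V}; pose A : 'M[F]_n := mxof b b f.
have bV := vbasisP {:V}.
have [s es] := closed_field_poly_normal (char_poly A).
rewrite (monicP (char_poly_monic A)) scale1r in es.
exists s; split.
  have ss : size s = n by have := size_char_poly A; rewrite es size_prod_XsubC => -[].
  have [n0 | n0] := posnP n.
    have -> : s = [::] by apply/nilP; rewrite /nilp ss n0.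
    rewrite big_nil /tr /mxtrace big1 // => i _; by have := ltn_ord i; rewrite [X in (_ < X)%N]n0.
  have := char_poly_trace A n0; rewrite es; have := coefPn_prod_XsubC (ps := s).
  rewrite ss -lt0n n0 => -> // /oppr_inj. by move=> ->.
  move=> c v v0 fv.
  rewrite -root_prod_XsubC -es -eigenvalue_root_char; apply/eigenvalueP.
  exists (rVof b v); last by rewrite rVof_eq0.
  by rewrite mul_mxof rVofK // fv linearZ.
  move=> c cs; have : eigenvalue A c by rewrite eigenvalue_root_char es root_prod_XsubC.
move/eigenvalueP => [u uA u0]; exists (vecof b u); first by rewrite vecof_eq0.
apply: (can_inj (rVofK bV)); rewrite linearZ /= (vecofK bV) -uA mul_mxof.
by [].
Qed.

Lemma tr_eigen0 f : (forall c v, v != 0 -> f v = c *: v -> c = 0) -> tr f = 0.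
Proof.
move=> h; have [s [-> _ hs]] := tr_eigen f.
by rewrite big_seq big1 // => c /hs [v v0 fv]; apply: h fv.
Qed.

Lemma eigen_iter f c v n : f v = c *: v -> iter n f v = c ^+ n *: v.
Proof.
move=> fv; elim: n => [|n IH]; first by rewrite expr0 scale1r.
by rewrite iterS IH linearZ /= fv scalerA -exprSr.
Qed.

Lemma tr_nilp f : (forall x, exists n, iter n f x = 0) -> tr f = 0.
Proof.
move=> h; apply: tr_eigen0 => c v v0 fv; have [n] := h v.
rewrite (eigen_iter _ fv) => /eqP; rewrite scaler_eq0 (negPf v0) orbF expf_eq0.
by case/andP => _ /eqP.
Qed.

(** All eigenvalues are 0 or [r], and [r] occurs; in characteristic zero a positive multiple of [r]
    does not vanish. *)
Lemma tr_idem f r : r != 0 -> (forall x, f (f x) = r *: f x) -> (exists x, f x != 0) -> tr f != 0.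
Proof.
move=> r0 h [x fx]; have [s [-> sp hs]] := tr_eigen f.
have hs' c : c \in s -> c = 0 \/ c = r.
  move=> /hs [v v0 fv]; have := h v; rewrite fv linearZ /= fv !scalerA => /eqP.
  rewrite -subr_eq0 -scalerBl scaler_eq0 (negPf v0) orbF -mulrBl mulf_eq0 subr_eq0.
  by case/orP => /eqP ->; [right | left].
have rs : r \in s by apply: (sp r (f x)).
have -> : \sum_(c <- s) c = r *+ count_mem r s.
  elim: s hs' {sp hs rs} => [|c s IH] h'; first by rewrite big_nil.
  rewrite big_cons IH => [|d ds]; last by apply: h'; rewrite inE ds orbT.
  have [|->] := h' c (mem_head _ _); last by rewrite /= eqxx mulrS.
  by move=> ->; rewrite add0r /= [0 == r]eq_sym (negPf r0).
by rewrite mulrn_eq0 (negPf r0) orbF -lt0n -has_count has_pred1.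
Qed.
End Closed.

(** * Lie algebras and Cartan subalgebras *)

Local Notation br := lie_br.

(** * Linearity of the bracket in its second argument *)

Section LeftLinear.
Variables (K : numFieldType) (g : lie_algebra K).
Implicit Types (x y z u v w : g).

Lemma brDl x y z : br (x + y) z = br x z + br y z.
Proof. by have := lie_br_linl 1 x y z; rewrite !scale1r. Qed.

Lemma br0l z : br 0 z = 0 :> g.
Proof. by have := lie_br_linl (-1) 0 0 z; rewrite scaler0 addr0 scaleN1r addNr. Qed.

Lemma brZl c x z : br (c *: x) z = c *: br x z.
Proof. by have := lie_br_linl c x 0 z; rewrite br0l !addr0. Qed.

Lemma brNl x z : br (- x) z = - br x z.
Proof. by rewrite -scaleN1r brZl scaleN1r. Qed.

(** The Jacobi identity for three equal arguments reads [3 [x, 0] = 0], since [[x, x] = 0]. *)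
Lemma br0r x : br x 0 = 0.
Proof.
have := lie_br_jacobi x x x; rewrite lie_br_alt => /eqP.
by rewrite -!mulr2n -mulrSr -scaler_nat scaler_eq0 pnatr_eq0 => /eqP.
Qed.

(** Only the first slot is known to be linear, but the cyclic identity exchanges the three slots, so
    linearity can be transported to the other two. *)
Definition dbr z x y := br z (br x y).

Lemma dbr_cyc a b c : dbr a b c + dbr b c a + dbr c a b = 0.
Proof. exact: lie_br_jacobi. Qed.

Lemma dbr_linl c z z' x y : dbr (c *: z + z') x y = c *: dbr z x y + dbr z' x y.
Proof. by rewrite /dbr lie_br_linl. Qed.

Lemma dbr_alt z x : dbr z x x = 0.
Proof. by rewrite /dbr lie_br_alt br0r. Qed.

(* d is the additivity defect of a function of (z; v, w, u): symmetric in v, w,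
   additive in u and vanishing for u = v, it is also antisymmetric in v, u. *)
Lemma sym_alt_defect0 (d : g -> g -> g -> g) :
  (forall v w u, d v w u = d w v u) -> (forall v w u, d v w u = - d u w v) ->
  forall v w u, d v w u = 0.
Proof.
move=> s a v w u; have : d v w u = - d v w u.
  by rewrite {1}a s a opprK s a s.
by move/eqP; rewrite -addr_eq0 -mulr2n -scaler_nat scaler_eq0 pnatr_eq0 => /eqP.
Qed.

Lemma dbrDm z x x' y : dbr z (x + x') y = dbr z x y + dbr z x' y.
Proof.
pose d z v w u := dbr z (v + w) u - dbr z v u - dbr z w u.
pose d' z x y y' := dbr z x (y + y') - dbr z x y - dbr z x y'.
(* The cyclic identity turns the defect in the middle slot into one in the last slot, where [a]
   occupies the linear position; hence [d] is additive in its last argument. *)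
have dd' a b c v : d b v c a = - d' a b v c.
  have := dbr_cyc b (v + c) a; have := dbr_cyc b v a; have := dbr_cyc b c a.
  have := dbr_linl 1 v c a b; rewrite !scale1r /d /d' => -> h1 h2 h3.
  by apply: (eq_by (eqB h3 (eqD h1 h2))); vring.
have dz z0 v w : d z0 v w v = 0.
  by rewrite /d /dbr !brDl lie_br_alt br0r add0r subr0 subrr.
have dsym z0 v w u : d z0 v w u = d z0 w v u by rewrite /d addrC [w + v]addrC; vring.
have dadd z0 v w u u' : d z0 v w (u + u') = d z0 v w u + d z0 v w u'.
  by have := fun x y => dbr_linl 1 u u' x y; rewrite !dd' /d' !scale1r => h; rewrite !h; vring.
(* Associativity of addition makes the defect a 2-cocycle; together with [dz] this yields the
   antisymmetry that [sym_alt_defect0] asks for. *)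
have coc z0 u v w t : d z0 (u + v) w t + d z0 u v t = d z0 u (v + w) t + d z0 v w t.
  by rewrite /d !addrA; vring.
have anti z0 u u' w : d z0 u' w u = - d z0 u w u'.
  have := dz z0 (u + u') w; rewrite dadd => /eqP; rewrite addr_eq0 => /eqP h.
  have h1 := coc z0 u u' w u; rewrite !dz add0r addr0 in h1.
  have h2 := coc z0 u' u w u'; rewrite !dz add0r addr0 [u' + u]addrC in h2.
  by rewrite -h1 -h2.
have := sym_alt_defect0 (dsym z) (fun v w u => anti z u v w) x x' y; rewrite /d => h.
by apply/eqP; rewrite -subr_eq0 opprD addrA h.
Qed.

Lemma dbrDr z x y y' : dbr z x (y + y') = dbr z x y + dbr z x y'.
Proof.
have := dbr_cyc z x (y + y'); have := dbr_cyc z x y; have := dbr_cyc z x y'.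
have := dbr_linl 1 y y' z x; rewrite !scale1r => -> h1 h2 h3.
rewrite (dbrDm x y y' z) in h3.
by apply: (eq_by (eqB h3 (eqD h1 h2))); vring.
Qed.

Lemma dbr_anti z x y : dbr z x y = - dbr z y x.
Proof.
have := dbr_alt z (x + y); rewrite dbrDm !dbrDr !dbr_alt add0r addr0 => /eqP.
by rewrite addr_eq0 => /eqP.
Qed.

Lemma dbrZm c z x y : dbr z (c *: x) y = c *: dbr z x y.
Proof.
(* [e] is the defect of homogeneity in the middle slot; the same symmetry argument applies to it as
   to the additivity defect. *)
pose e x z y := dbr z (c *: x) y - c *: dbr z x y.
have esym x0 z0 y0 : e x0 z0 y0 = e x0 y0 z0.
  have h1 := dbr_cyc z0 (c *: x0) y0; have h2 := dbr_cyc z0 x0 y0.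
  have h3 : dbr (c *: x0) y0 z0 = c *: dbr x0 y0 z0 by rewrite /dbr brZl.
  rewrite h3 in h1; rewrite /e.
  have h4 := dbr_anti y0 z0 x0; have h5 := dbr_anti y0 z0 (c *: x0).
  by rewrite h4 in h2; rewrite h5 in h1; apply: (eq_by (eqB h1 (eqZ c h2))); vring.
have eD1 x0 x1 z0 y0 : e (x0 + x1) z0 y0 = e x0 z0 y0 + e x1 z0 y0.
  by rewrite /e scalerDr !dbrDm; vring.
have eD3 x0 z0 y0 y1 : e x0 z0 (y0 + y1) = e x0 z0 y0 + e x0 z0 y1.
  by rewrite /e !dbrDr; vring.
have ealt x0 z0 : e x0 z0 x0 = 0.
  by rewrite /e dbr_alt scaler0 subr0 /dbr brZl lie_br_alt scaler0 br0r.
have eanti x0 z0 y0 : e x0 z0 y0 = - e y0 z0 x0.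
  have := ealt (x0 + y0) z0; rewrite eD1 !eD3 !ealt add0r addr0 => /eqP.
  by rewrite addr_eq0 => /eqP.
have := sym_alt_defect0 (d := fun v w u => e u w v) (fun v w u => esym u w v) (fun v w u => eanti u w v) y z x.
by move/eqP; rewrite subr_eq0 => /eqP.
Qed.

Lemma brv_subP (U V W : {vspace g}) :
  (brv U V <= W)%VS <-> (forall x y, x \in vbasis U -> y \in vbasis V -> br x y \in W).
Proof.
split=> [/span_subvP h x y xU yV|h].
  by apply: h; apply: allpairs_f.
by apply/span_subvP => _ /allpairsP [[x y] /= [xU yV ->]]; apply: h.
Qed.

Hypothesis g_simple : simple_lie g.

Lemma br_kernel_line w : (forall c x, br x (c *: w) = 0) -> w = 0.
Proof.
move=> h; have [nz sp] := g_simple.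
have line y : y \in vbasis <[w]> -> forall x, br x y = 0.
  by move/vbasis_mem/vlineP => [c ->] x; apply: h.
have [|/eqP h0|hf] := sp <[w]>%VS.
- by apply/brv_subP => x y _ /line ->; apply: mem0v.
- by apply/eqP; rewrite -memv0 -(eqP h0) memv_line.
case: nz; apply/eqP; rewrite -subv0; apply/brv_subP => x y _.
move: line; rewrite hf => line /line ->; exact: mem0v.
Qed.

Lemma dbr_kernel w : (forall u v, dbr u v w = 0) -> forall v, br v w = 0.
Proof. by move=> h v; apply: br_kernel_line => c x; rewrite -brZl; apply: h. Qed.

(** The defect of linearity is killed by every double bracket, because [dbr] is already linear in
    each slot, and it is homogeneous in [x]; two uses of [br_kernel_line] then remove it. *)
Lemma br_linr c x y y' : br x (c *: y + y') = c *: br x y + br x y'.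
Proof.
pose w x := br x (c *: y + y') - c *: br x y - br x y'.
suff w0 : w x = 0.
  by apply/eqP; rewrite -subr_eq0 opprD addrA; apply/eqP.
have wl k x0 : w (k *: x0) = k *: w x0 by rewrite /w !brZl; vring.
(* Antisymmetry of the inner bracket is so far known only underneath further brackets, which
   suffices here. *)
have dbr3 u v x0 y0 : dbr u v (br x0 y0) = - dbr u v (br y0 x0).
  have e : br v (br x0 y0) = br (- v) (br y0 x0).
    by rewrite brNl; exact: dbr_anti.
  rewrite {1}/dbr e -/(dbr u (- v) _).
  rewrite -scaleN1r -(addr0 (_ *: v)).
  have := dbrDm u v (- v) (br y0 x0); rewrite subrr {1}/dbr br0l br0r => /eqP.
  by rewrite eq_sym addr_eq0 scaleN1r addr0 => /eqP ->; rewrite opprK.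
have dbrN u v t : dbr u v (- t) = - dbr u v t.
  by rewrite (dbr_anti u v (- t)) (dbr_anti u v t) -[in LHS](scaleN1r t) dbrZm scaleN1r.
have dbrZr k u v t : dbr u v (k *: t) = k *: dbr u v t.
  by rewrite dbr_anti dbrZm dbr_anti scalerN opprK.
have dw x0 u v : dbr u v (w x0) = 0.
  rewrite /w !dbrDr !dbrN dbrZr (dbr3 u v x0 (c *: y + y')) brDl brZl dbrDr dbrZr.
  by rewrite (dbr3 u v x0 y) (dbr3 u v x0 y'); vring.
apply: br_kernel_line => k x0; rewrite -wl.
exact: dbr_kernel.
Qed.

End LeftLinear.

(** Derived properties are made classes, so that later statements pick them up without naming
    them. *)
Class bilinear_lie (C : numClosedFieldType) (g : lie_algebra C) : Prop :=
  brR : forall c (x y y' : g), br x (c *: y + y') = c *: br x y + br x y'.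
Class nondeg_killing (C : numClosedFieldType) (g : lie_algebra C) : Prop :=
  nondeg : forall x : g, (forall y, killing x y = 0) -> x = 0.
Class is_cartan (C : numClosedFieldType) (g : lie_algebra C) (h : {vspace g}) : Prop :=
  h_cartan : cartan_subalgebra h.

(** * Invariance and nondegeneracy of the Killing form *)

Section Bilinear.
Context {C : numClosedFieldType} {g : lie_algebra C} {bil : bilinear_lie g}.
Implicit Types (x y z u v w : g) (U V W : {vspace g}).

Lemma brDr x y z : br x (y + z) = br x y + br x z.
Proof. by rewrite -{1}[y]scale1r brR scale1r. Qed.
Lemma brZr c x y : br x (c *: y) = c *: br x y.
Proof. by rewrite -{1}[c *: y]addr0 brR br0r addr0. Qed.
Lemma brNr x y : br x (- y) = - br x y.
Proof. by rewrite -scaleN1r brZr scaleN1r. Qed.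
Lemma brBr x y z : br x (y - z) = br x y - br x z.
Proof. by rewrite brDr brNr. Qed.
Lemma brBl x y z : br (x - y) z = br x z - br y z.
Proof. by rewrite brDl brNl. Qed.
Lemma br_anti x y : br x y = - br y x.
Proof.
have := lie_br_alt (x + y); rewrite brDr !brDl !lie_br_alt add0r addr0 => /eqP.
by rewrite addrC addr_eq0 => /eqP.
Qed.
Lemma jac x y z : br x (br y z) = br (br x y) z + br y (br x z).
Proof.
have h := lie_br_jacobi x y z; apply: (eq_by h).
by rewrite (br_anti z (br x y)) (br_anti z x) brNr; vring.
Qed.
Lemma br_sumr I r (P : pred I) (E : I -> g) x :
  br x (\sum_(i <- r | P i) E i) = \sum_(i <- r | P i) br x (E i).
Proof. by apply: (big_morph (br x)); [exact: brDr | exact: br0r]. Qed.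
Lemma br_suml I r (P : pred I) (E : I -> g) x :
  br (\sum_(i <- r | P i) E i) x = \sum_(i <- r | P i) br (E i) x.
Proof. by apply: (big_morph (fun z => br z x)); [move=> ? ?; exact: brDl | exact: br0l]. Qed.

Lemma adE x y : ad x y = br x y.
Proof.
pose L : {linear g -> g} := HB.pack (lie_br x) (GRing.isLinear.Build _ _ _ _ (lie_br x) (fun c a b => brR c x a b)).
by rewrite /ad -[lie_br x]/(L : g -> g) lfunE.
Qed.

Lemma ad_linear c x y : ad (c *: x + y) = (c *: ad x + ad y)%R.
Proof. by apply/lfunP => z; rewrite lfunE /= lfunE /= !adE lie_br_linl. Qed.

Lemma ad_br x y : ad (br x y) = ((ad x \o ad y)%VF - (ad y \o ad x)%VF)%R.
Proof.
apply/lfunP => z; rewrite add_lfunE opp_lfunE !comp_lfunE !adE jac.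
by rewrite addrK.
Qed.

Lemma killingE x y : killing x y = tr (ad x \o ad y)%VF. Proof. by []. Qed.

Lemma killingC x y : killing x y = killing y x.
Proof. by rewrite !killingE trC. Qed.

Lemma killing_linl c x y z : killing (c *: x + y) z = c * killing x z + killing y z.
Proof. by rewrite !killingE ad_linear comp_lfunDl -comp_lfunZl tr_linear. Qed.

Lemma killing_linr c x y z : killing z (c *: x + y) = c * killing z x + killing z y.
Proof. by rewrite !(killingC z) killing_linl. Qed.

Lemma killingDl x y z : killing (x + y) z = killing x z + killing y z.
Proof. by have := killing_linl 1 x y z; rewrite scale1r mul1r. Qed.
Lemma killing0l z : killing 0 z = 0.
Proof. by have := killing_linl (-1) 0 0 z; rewrite scaler0 addr0 mulN1r addNr. Qed.
Lemma killingZl c x z : killing (c *: x) z = c * killing x z.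
Proof. by have := killing_linl c x 0 z; rewrite killing0l !addr0. Qed.
Lemma killingNl x z : killing (- x) z = - killing x z.
Proof. by rewrite -scaleN1r killingZl mulN1r. Qed.
Lemma killingDr x y z : killing z (x + y) = killing z x + killing z y.
Proof. by rewrite !(killingC z) killingDl. Qed.
Lemma killing0r z : killing z 0 = 0. Proof. by rewrite killingC killing0l. Qed.
Lemma killingZr c x z : killing z (c *: x) = c * killing z x.
Proof. by rewrite !(killingC z) killingZl. Qed.
Lemma killingNr x z : killing z (- x) = - killing z x.
Proof. by rewrite !(killingC z) killingNl. Qed.
Lemma killing_suml I r (P : pred I) (E : I -> g) x :
  killing (\sum_(i <- r | P i) E i) x = \sum_(i <- r | P i) killing (E i) x.
Proof. by apply: (big_morph (fun z => killing z x)); [move=> ? ?; exact: killingDl | exact: killing0l]. Qed.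
Lemma killing_sumr I r (P : pred I) (E : I -> g) x :
  killing x (\sum_(i <- r | P i) E i) = \sum_(i <- r | P i) killing x (E i).
Proof. by rewrite killingC killing_suml; apply: eq_bigr => i _; rewrite killingC. Qed.

Lemma killing_inv x y z : killing (br x y) z = killing x (br y z).
Proof.
rewrite !killingE !ad_br comp_lfunDl comp_lfunDr comp_lfunNl comp_lfunNr !trB.
congr (_ - _); first by rewrite comp_lfunA.
by rewrite -comp_lfunA trC -comp_lfunA.
Qed.

Lemma killing_invN x y z : killing (br x y) z = - killing y (br x z).
Proof. by rewrite (br_anti x) killingNl killing_inv. Qed.

Lemma brvP U V W :
  (brv U V <= W)%VS <-> (forall x y, x \in U -> y \in V -> br x y \in W).
Proof.
split=> [h x y xU yV|h]; last first.
  by apply/brv_subP => x y /vbasis_mem xU /vbasis_mem yV; apply: h.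
rewrite (coord_vbasis xU) (coord_vbasis yV) br_suml.
apply: memv_suml => i _; rewrite br_sumr; apply: memv_suml => j _.
rewrite brZl brZr !memvZ //; apply: (proj1 (brv_subP _ _ _) h);
  by apply: mem_nth; rewrite size_tuple.
Qed.

Lemma brv_mem U V x y : x \in U -> y \in V -> br x y \in brv U V.
Proof. by move=> xU yV; apply: (proj1 (brvP U V _)). Qed.

Lemma brvS U V U' V' : (U <= U')%VS -> (V <= V')%VS -> (brv U V <= brv U' V')%VS.
Proof.
move=> /subvP hU /subvP hV; apply/brvP => x y xU yV.
by apply: brv_mem; [apply: hU | apply: hV].
Qed.

(** By invariance the radical of the form is an ideal; being proper it is zero. *)
Lemma killing_nondeg : simple_lie g -> (exists x y, killing x y != 0) ->
  forall x, (forall y, killing x y = 0) -> x = 0.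
Proof.
move=> [_ sp] [x0 [y0 k0]] x kx.
have [||W hW] := @vspace_of _ g (fun x => forall y, killing x y = 0).
- by move=> y; rewrite killing0l.
- by move=> c a b ha hb y; rewrite killing_linl ha hb mulr0 addr0.
have [|W0|Wf] := sp W.
- apply/brvP => a b _ /hW hb; apply/hW => y; by rewrite killing_invN hb oppr0.
- by have /hW := kx; rewrite W0 memv0 => /eqP.
have /hW h : x0 \in W by rewrite Wf memvf.
by rewrite h eqxx in k0.
Qed.

(** [ad z - (c + d)] acts on a bracket by the Leibniz rule with [ad z - c] and [ad z - d]; an
    induction on [n + m] replaces the binomial formula. *)
Lemma geneig_br z c d x y : geneig (ad z) c x -> geneig (ad z) d y ->
  geneig (ad z) (c + d) (br x y).
Proof.
move=> [n hn] [m hm]; exists (n + m)%N.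
have [k] := ubnP (n + m); elim: k n m x y hn hm => // k IH n m x y hn hm; rewrite ltnS => nk.
have dstep : (ad z - (c + d) *: \1%VF)%R (br x y) =
   br ((ad z - c *: \1%VF)%R x) y + br x ((ad z - d *: \1%VF)%R y).
  rewrite !lfun_subidE !adE jac brBl brBr brZl brZr scalerDl; vring.
case: n hn nk => [|n] hn nk.
  by move: hn => /= ->; rewrite br0l iter_lfun0.
case: m hm nk => [|m] hm nk.
  by have -> : y = 0 by []; rewrite br0r iter_lfun0.
rewrite addSn iterSr dstep iter_lfunD.
rewrite [X in X + _](_ : _ = 0) ?add0r.
  rewrite -addSnnS; apply: IH => //; first by rewrite -iterSr.
  by move: nk; rewrite addnS.
by apply: IH => //; rewrite -iterSr.
Qed.

Lemma geneig0E f x : geneig f 0 x <-> exists N, iter N f x = 0 :> g.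
Proof. by rewrite /geneig scale0r subr0. Qed.

(** * Cartan subalgebras are abelian and act diagonally *)

Section Cartan.
Context {h : {vspace g}} {hc : is_cartan h} {nd : nondeg_killing g}.

Let lc k := iter k (fun V => brv h V) h.

Lemma lcS k : (lc k.+1 <= lc k)%VS.
Proof.
elim: k => [|k IH]; first by have [[]] := h_cartan (h := h).
by apply: brvS => //; exact: subvv.
Qed.
Lemma lc_h k : (lc k <= h)%VS.
Proof. by elim: k => [|k IH]; [exact: subvv | apply: subv_trans (lcS k) IH]. Qed.

Lemma lc_nil : exists k, lc k = 0%VS. Proof. by have [[_]] := h_cartan (h := h). Qed.

Lemma h_br x y : x \in h -> y \in h -> br x y \in h.
Proof. by have [[/brvP H _] _] := h_cartan (h := h); apply: H. Qed.

Lemma h_norm x : (forall y, y \in h -> br x y \in h) -> x \in h.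
Proof. by have [_] := h_cartan (h := h); apply. Qed.

Lemma h_geneig z x : z \in h -> x \in h -> geneig (ad z) 0 x.
Proof.
move=> zh xh; apply/geneig0E; have [k lk] := lc_nil; exists k.
apply/eqP; rewrite -memv0 -lk; elim: k {lk} => //= k IH.
by rewrite adE; apply: brv_mem.
Qed.

Lemma geneig0_h_stable z x y : z \in h -> x \in h -> geneig (ad z) 0 y ->
  geneig (ad z) 0 (br x y).
Proof. by move=> zh xh gy; rewrite -(addr0 0); apply: geneig_br => //; apply: h_geneig. Qed.

Lemma null_space (s : seq g) : exists W : {vspace g},
  forall y, y \in W <-> forall z, z \in s -> geneig (ad z) 0 y.
Proof.
apply: vspace_of => [z _|c x y hx hy z zs]; first by exists 0%N.
by apply: geneigD; [apply/geneigZ/hx | apply: hy].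
Qed.

Lemma killing_iter z x y n : killing x (iter n (ad z) y) = (-1) ^+ n * killing (iter n (ad z) x) y.
Proof.
elim: n x => [|n IH] x; first by rewrite mul1r.
rewrite iterS adE killingC killing_invN killingC -(adE z x) IH -iterSr exprS mulN1r mulNr.
by [].
Qed.

(** The elements of [s] are peeled off one at a time. On the Fitting complement [B] the map [ad z]
    is bijective, while some power of [ad z] kills [x]; since [ad z] is skew, [x] is orthogonal to
    [B]. With [s] exhausted, [x] is orthogonal to everything. *)
Lemma killing_null (s : seq g) (W : {vspace g}) x :
  (forall z, z \in s -> z \in h) -> x \in h ->
  (forall y, y \in W <-> forall z, z \in s -> geneig (ad z) 0 y) ->
  (forall y, y \in W -> killing x y = 0) -> x = 0.
Proof.
elim: s W => [|z s IH] W sh xh hW kW; first by apply: nondeg => y; apply/kW/hW.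
have [W' hW'] := null_space s.
have zh : z \in h by apply: sh; rewrite mem_head.
have sh' t : t \in s -> t \in h by move=> ts; apply: sh; rewrite inE ts orbT.
apply: (IH W') => // y yW'.
have [|N [B [sB BW BK hB]]] := @fitting _ g (ad z) W'.
  apply/limg_memP => t /hW' ht; rewrite adE; apply/hW' => u us.
  by apply: geneig0_h_stable => //; [apply: sh' | apply: ht].
have [a [b [-> aW aN bB]]] := hB y yW'.
rewrite killingDr kW; last first.
  apply/hW => t; rewrite inE => /orP [/eqP -> | ts]; first by apply/geneig0E; exists N.
  by move/hW': aW; apply.
have /geneig0E [M hM] := h_geneig zh xh.
have [b' b'B ->] := fitting_surj M sB BK bB.
by rewrite killing_iter hM killing0l mulr0 addr0.
Qed.

(** [s] collects bases of the terms of the lower central series of [h]. Should the joint null space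
    [G] exceed [h], going up that series from its zero term with Engel's argument modulo [h] yields
    an [x] in [G] outside [h] with [[h, x]] inside [h], against self-normalization. *)
Lemma null_eq_h : exists s : seq g, (forall z, z \in s -> z \in h) /\
  forall y, (forall z, z \in s -> geneig (ad z) 0 y) -> y \in h.
Proof.
have [K lK] := lc_nil.
pose s := flatten [seq vbasis (lc k) : seq g | k <- iota 0 K.+1].
have sP z : reflect (exists2 k, (k <= K)%N & z \in vbasis (lc k)) (z \in s).
  apply: (iffP flatten_mapP) => [] [k kK zk]; exists k => //.
    by move: kK; rewrite mem_iota add0n ltnS => /andP [].
  by rewrite mem_iota add0n ltnS.
have sh z : z \in s -> z \in h.
  by move=> /sP [k _ /vbasis_mem zk]; apply: (subvP (lc_h k)).
exists s; split=> //; have [G hG] := null_space s.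
suff /subvP Gh : (G <= h)%VS by move=> y /hG; apply: Gh.
apply/negPn/negP => nGh.
have GP x y : x \in h -> y \in G -> br x y \in G.
  move=> xh /hG yG; apply/hG => z zs; apply: geneig0_h_stable => //; first exact: sh.
  exact: yG.
have key j : exists x, [/\ x \in G, x \notin h & forall z, z \in lc (K - j) -> br z x \in h].
  elim: j => [|j [x0 [x0G x0h hx0]]].
    move/subvPn: nGh => [x xG xh]; exists x; split=> // z.
    by rewrite subn0 lK memv0 => /eqP ->; rewrite br0l mem0v.
  rewrite subnS; case E : (K - j)%N hx0 => [|k] hx0 /=; first by exists x0.
  have [||W hW] := @vspace_of _ g (fun x => x \in G /\ forall z, z \in lc k.+1 -> br z x \in h).
  - by split; rewrite ?mem0v // => z _; rewrite br0r mem0v.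
  - move=> c x y [xG hx] [yG hy]; split; first by rewrite memvD ?memvZ.
    by move=> z zk; rewrite brR memvD ?memvZ ?hx ?hy.
  have Wst z x : z \in h -> x \in W -> br z x \in W.
    move=> zh /hW [xG hx]; apply/hW; split; first exact: GP.
    move=> u uk; rewrite jac memvD //.
      apply: hx; rewrite br_anti memvN; apply: (subvP (lcS k.+1)).
      exact: brv_mem.
    by apply: h_br => //; exact: hx.
  have kK : (k <= K)%N by apply: leq_trans (leq_subr j K); rewrite E.
  (* For [z] in the [k]-th term the operators [ad z] commute modulo [h] on [W], because their
     commutators come from the next term, which maps [W] into [h]. *)
  have [||| x [xW xh hx]] := @engel_mod _ g [seq ad z | z <- vbasis (lc k)] W h.
  - by move/subvP/(_ x0) => H; move/negP: x0h; apply; apply: H; apply/hW.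
  - move=> _ /mapP [z zk ->].
    have zh : z \in h by apply: (subvP (lc_h k)); apply: vbasis_mem.
    split=> [x xh|x xW|x xW]; rewrite ?adE; first exact: h_br.
      exact: Wst.
    have [/hG xG _] := proj1 (hW x) xW.
    have /geneig0E [N hN] := xG z (introT (sP z) (ex_intro2 _ _ k kK zk)).
    by exists N; rewrite hN mem0v.
  - move=> _ _ x /mapP [z zk ->] /mapP [z' zk' ->] xW; rewrite !adE jac addrK.
    have [_ hx] := proj1 (hW x) xW; apply: hx.
    by apply: brv_mem; [apply: (subvP (lc_h k))|]; apply: vbasis_mem.
  exists x; split=> //; first by have [] := proj1 (hW x) xW.
  move=> z zk; rewrite (coord_vbasis zk) br_suml; apply: memv_suml => i _.
  rewrite brZl memvZ // -adE; apply: hx; apply: map_f.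
  by apply: mem_nth; rewrite size_tuple.
have [x [xG xh hx]] := key K; rewrite subnn /= in hx.
by move/negP: xh; apply; apply: h_norm => y yh; rewrite br_anti memvN; apply: hx.
Qed.

Lemma killing_h_nondeg x : x \in h -> (forall y, y \in h -> killing x y = 0) -> x = 0.
Proof.
move=> xh kx; have [s [sh hs]] := null_eq_h; have [W hW] := null_space s.
by apply: (killing_null sh xh hW) => y /hW /hs; apply: kx.
Qed.

(** [s] represents the functional [y -> tr (D ad y)] under the Killing form. Since [ad (D x)] is the
    commutator of [D] and [ad x], the difference [D x - [s, x]] is orthogonal to everything. *)
Lemma derivation_inner (D : 'End(g)) :
  (forall x y, D (br x y) = br (D x) y + br x (D y)) -> exists s, forall x, D x = br s x.
Proof.
move=> der.
have [||||s _ hs] := @form_represent _ g (@killing _ g) fullv (fun y => tr (D \o ad y)%VF).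
- by move=> *; exact: killing_linl.
- by move=> *; exact: killing_linr.
- by move=> x _ hx; apply: nondeg => y; apply: hx; exact: memvf.
- move=> c x y; rewrite ad_linear comp_lfunDr -comp_lfunZr tr_linear.
  by [].
exists s => x; apply/eqP; rewrite -subr_eq0; apply/eqP; apply: nondeg => y.
rewrite killingDl killingNl killing_inv hs ?memvf // killingE.
have -> : ad (D x) = ((D \o ad x)%VF - (ad x \o D)%VF)%R.
  by apply/lfunP => z; rewrite add_lfunE opp_lfunE !comp_lfunE !adE der addrK.
rewrite ad_br comp_lfunDl comp_lfunDr comp_lfunNl comp_lfunNr !trB.
rewrite -comp_lfunA -[(ad x \o D \o ad y)%VF]comp_lfunA [tr (ad x \o _)%VF]trC -comp_lfunA.
by rewrite subrr.
Qed.

Lemma fullv_stable (f : 'End(g)) : (f @: fullv <= fullv)%VS. Proof. exact: subvf. Qed.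

(** The semisimple part [D] of [ad z] is a derivation, hence [D = ad s]. It vanishes on [h], so [s]
    lies in [h]; and [z - s] is ad-nilpotent and commutes with [h], so it is orthogonal to [h] and
    therefore zero. *)
Lemma center_semisimple z : z \in h -> (forall y, y \in h -> br z y = 0) ->
  forall c y, geneig (ad z) c y -> br z y = c *: y.
Proof.
move=> zh zc.
have [D hD] := fun_calc id (fullv_stable (ad z)).
have {}hD c y : geneig (ad z) c y -> D y = c *: y by move=> gy; apply: hD; rewrite ?memvf.
have der x y : D (br x y) = br (D x) y + br x (D y).
  have := memvf x; move: x; apply: (geneig_ind (fullv_stable (ad z))).
  - by rewrite lf0 !br0l lf0 addr0.
  - by move=> a b ha hb; rewrite brDl lfD ha hb lfD !brDl; vring.
  move=> c x _ gx.
  have := memvf y; move: y; apply: (geneig_ind (fullv_stable (ad z))).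
  - by rewrite lf0 !br0r lf0 addr0.
  - by move=> a b ha hb; rewrite brDr lfD ha hb lfD !brDr; vring.
  move=> d y _ gy; rewrite (hD _ _ (geneig_br gx gy)) (hD _ _ gx) (hD _ _ gy).
  by rewrite brZl brZr scalerDl.
have [s hs] := derivation_inner der.
have sc y : y \in h -> br s y = 0.
  move=> yh; rewrite -hs (hD 0) ?scale0r //; apply/geneig0E; exists 1%N.
  by rewrite /= adE zc.
have sh : s \in h by apply: h_norm => y /sc ->; exact: mem0v.
have znil x : exists N, iter N (ad (z - s)) x = 0.
  have := memvf x; move: x; apply: (geneig_ind (fullv_stable (ad z))).
  - by exists 0%N.
  - move=> a b [n hn] [m hm]; exists (maxn n m); rewrite iter_lfunD.
    by rewrite (iter_null_le (leq_maxl n m) hn) (iter_null_le (leq_maxr n m) hm) addr0.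
  move=> c y _ gy; have [N hN] := gy; exists N; rewrite -hN.
  have gk k : geneig (ad z) c (iter k (ad z - c *: \1%VF)%R y).
    exists N; rewrite -iterD addnC iterD hN; exact: iter_lfun0.
  elim: N {hN} => //= k ->.
  by rewrite lfun_subidE adE brBl -hs (hD _ _ (gk k)) -adE.
have zs0 : z - s = 0.
  apply: killing_h_nondeg; first by rewrite memvB.
  move=> y yh; rewrite killingE; apply: tr_nilp => x.
  have [N hN] := znil x; exists N.
  have cm t : ad (z - s) (ad y t) = ad y (ad (z - s) t).
    by rewrite !adE jac brBl zc // sc // subrr br0l add0r.
  have -> : iter N (ad (z - s) \o ad y)%VF x = iter N (ad y) (iter N (ad (z - s)) x).
    have cmi k t : iter k (ad y) (ad (z - s) t) = ad (z - s) (iter k (ad y) t).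
      by elim: k => //= k ->; rewrite cm.
    by elim: N {hN} => //= k ->; rewrite comp_lfunE cm cmi.
  by rewrite hN iter_lfun0.
move=> c y gy; rewrite -(hD _ _ gy) hs.
by move/eqP: zs0; rewrite subr_eq0 => /eqP ->.
Qed.

(** Let [P] act by the conjugate of each eigenvalue of [ad z]. It commutes with [ad a] for [a] in
    [h], so [tr (P ad [a, b]) = 0] and hence [tr (P ad z) = 0]. The eigenvalues of [P ad z] are
    squared moduli of those of [ad z], so all of them vanish. *)
Lemma center_derived z : z \in h -> (forall y, y \in h -> br z y = 0) -> z \in brv h h -> z = 0.
Proof.
move=> zh zc zd; have ss := center_semisimple zh zc.
have [P hP] := fun_calc Num.conj (fullv_stable (ad z)).
have {}hP c y : geneig (ad z) c y -> P y = c^* *: y by move=> gy; apply: hP; rewrite ?memvf.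
have Pc a y : a \in h -> P (br a y) = br a (P y).
  move=> ah; have := memvf y; move: y; apply: (geneig_ind (fullv_stable (ad z))).
  - by rewrite !(lf0, br0r).
  - by move=> u v hu hv; rewrite !(lfD, brDr) hu hv.
  move=> c y _ gy; rewrite (hP _ _ gy) brZr (hP c) //.
  rewrite -adE; apply: geneig_comm gy => t.
  by rewrite !adE jac (br_anti a z) zc // oppr0 br0l add0r.
have trP : tr (P \o ad z)%VF = 0.
  have lin c x y : tr (P \o ad (c *: x + y))%VF = c * tr (P \o ad x)%VF + tr (P \o ad y)%VF.
    by rewrite ad_linear comp_lfunDr -comp_lfunZr tr_linear.
  have t0 : tr (P \o ad 0)%VF = 0.
    by have := lin (-1) 0 0; rewrite scaler0 addr0 mulN1r addNr.
  have [||W hW] := @vspace_of _ g (fun x => tr (P \o ad x)%VF = 0) => //.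
    by move=> c x y hx hy; rewrite lin hx hy mulr0 addr0.
  apply/hW; apply: subvP zd; apply/brvP => a b ah bh; apply/hW.
  rewrite ad_br comp_lfunDr comp_lfunNr trB.
  have -> : (P \o (ad b \o ad a) = ad b \o (P \o ad a))%VF.
    by apply/lfunP => t; rewrite !comp_lfunE !adE Pc.
  by rewrite [tr (ad b \o _)%VF]trC -comp_lfunA subrr.
have [s [es sin sev]] := tr_eigen (P \o ad z)%VF.
have evP c d w : w != 0 -> ad z w = c *: w -> P (ad z w) = d *: w -> d = c * c^*.
  move=> w0 hw; rewrite hw lfZ (hP c); last by exists 1%N; rewrite /= lfun_subidE hw subrr.
  by rewrite scalerA => /eqP; rewrite -subr_eq0 -scalerBl scaler_eq0 (negPf w0) orbF subr_eq0 => /eqP <-.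
have sge d : d \in s -> 0 <= d.
  move=> /sev [v v0 hv].
  pose E := lker ((P \o ad z)%VF - d *: \1%VF)%R.
  have inE t : (t \in E) = (P (ad z t) == d *: t).
    by rewrite memv_ker lfun_subidE comp_lfunE subr_eq0.
  have [||c [w [wE w0 hw]]] := @eigen_stable _ g (ad z) E.
  - apply/limg_memP => t; rewrite !inE => /eqP ht.
    by rewrite [ad z (ad z t)]adE Pc // -[P (ad z t)]/(P (ad z t)) ht brZr adE.
  - apply: contraNneq v0 => E0; rewrite -memv0 -E0 inE -comp_lfunE hv //.
  - rewrite inE in wE; rewrite (evP c d w w0 hw (eqP wE)); exact: mul_conjC_ge0.
have s0 d : d \in s -> d = 0.
  move=> ds; move: trP; rewrite es big_seq => /eqP.
  by rewrite psumr_eq0 // => /allP /(_ d ds); rewrite ds => /eqP.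
apply: nondeg => y; rewrite killingE.
suff -> : ad z = 0 by rewrite comp_lfun0l tr0.
apply/lfunP => x; rewrite zero_lfunE.
have := memvf x; move: x; apply: (geneig_ind (fullv_stable (ad z))); first exact: lf0.
  by move=> a b ha hb; rewrite lfD ha hb addr0.
move=> c x _ gx; have [-> | x0] := eqVneq x 0; first by rewrite lf0.
have hx : ad z x = c *: x by rewrite adE (ss c).
have : c * c^* \in s.
  apply: (sin _ x) => //; rewrite comp_lfunE hx lfZ (hP _ _ gx) scalerA //.
by move/s0/eqP; rewrite mul_conjC_eq0 => /eqP c0; rewrite hx c0 scale0r.
Qed.

(** The last nonzero term of the lower central series is central in [h] and, unless it is [h]
    itself, contained in [[h, h]]; [center_derived] rules it out. *)
Lemma cartan_abelian x y : x \in h -> y \in h -> br x y = 0.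
Proof.
move=> xh yh; apply/eqP; rewrite -memv0.
suff <- : lc 1 = 0%VS by exact: brv_mem.
have [k] := lc_nil; elim: k => [lk|k IH lk].
  by apply/eqP; rewrite -subv0 -lk; exact: (lcS 0).
case: k IH lk => [//|k] IH lk; apply: IH; apply/eqP; rewrite -subv0.
apply/subvP => z zk; rewrite memv0; apply/eqP/center_derived.
- exact: (subvP (lc_h k.+1)).
- move=> t th; rewrite br_anti; apply/eqP; rewrite oppr_eq0 -memv0 -lk.
  exact: brv_mem.
- elim: k {lk} z zk => // k IH z zk; apply: IH; exact: (subvP (lcS k.+1)).
Qed.

Lemma cartan_diag z c y : z \in h -> geneig (ad z) c y -> br z y = c *: y.
Proof. by move=> zh; apply: center_semisimple => // t th; exact: cartan_abelian. Qed.

Lemma cartan_self_centralizing x : (forall y, y \in h -> br y x = 0) -> x \in h.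
Proof.
by move=> hx; apply: h_norm => y yh; rewrite br_anti hx // oppr0 mem0v.
Qed.

End Cartan.
End Bilinear.

(** * Roots *)

Section Chain.
Variables (K : numFieldType) (E : vectType K) (e f t : 'End(E)) (d : K).
Hypothesis eft : forall w, e (f w) = f (e w) + t w.
Hypothesis tf : forall w, t (f w) = f (t w) - d *: f w.

Lemma chain_t v c k : t v = c *: v -> t (iter k f v) = (c - k%:R * d) *: iter k f v.
Proof.
move=> tv; elim: k => [|k IH]; first by rewrite mul0r subr0.
by rewrite iterS tf IH lfZ -scalerBl; congr (_ *: _); rewrite mulrSr mulrDl mul1r opprD addrA.
Qed.

Lemma chain_e v c k : e v = 0 -> t v = c *: v ->
  e (iter k.+1 f v) = (k.+1%:R * (c - k%:R * d / 2)) *: iter k f v.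
Proof.
move=> ev tv; elim: k => [|k IH].
  by rewrite /= eft ev lf0 add0r tv mul0r mul0r subr0 mul1r.
rewrite iterS eft IH lfZ (chain_t _ tv) -iterS -scalerDl; congr (_ *: _).
by rewrite -!natr1; field.
Qed.

(** The sl_2 argument with an unnormalized [t]: applying [e] to the first vanishing iterate of [f]
    gives the coefficient of [chain_e] times a nonzero vector, so that coefficient is zero. *)
Lemma chain v c N : e v = 0 -> v != 0 -> t v = c *: v -> iter N f v = 0 ->
  exists k, [/\ c * 2 = k%:R * d, (forall j, (j <= k)%N -> iter j f v != 0) & iter k.+1 f v = 0].
Proof.
move=> ev v0 tv fN.
have exN : exists n, iter n f v == 0 by exists N; rewrite fN.
case: (ex_minnP exN) => -[|k] /eqP fk kmin; first by move: v0; rewrite (fk : v = 0) eqxx.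
have nz j : (j <= k)%N -> iter j f v != 0.
  by move=> jk; apply/negP => /kmin; rewrite ltnNge jk.
exists k; split=> //.
have := chain_e k ev tv; rewrite fk lf0 => /esym /eqP.
rewrite scaler_eq0 (negPf (nz k (leqnn k))) orbF mulf_eq0 pnatr_eq0 /= subr_eq0 => /eqP ->.
by rewrite divfK // pnatr_eq0.
Qed.
End Chain.

(** * Root spaces and root strings *)

Section Weights.
Context {C : numClosedFieldType} {g : lie_algebra C} {h : {vspace g}}.
Implicit Types (a b : hdual h) (x y H : g).

Lemma wtDl a b H : wt (a + b) H = wt a H + wt b H.
Proof. by rewrite /wt add_lfunE. Qed.
Lemma wt0l H : wt (0 : hdual h) H = 0.
Proof. by rewrite /wt zero_lfunE. Qed.
Lemma wtNl a H : wt (- a) H = - wt a H.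
Proof. by rewrite /wt opp_lfunE. Qed.
Lemma wtZl k a H : wt (k *: a) H = k * wt a H.
Proof. by rewrite /wt scale_lfunE. Qed.
Lemma wtDr a H H' : wt a (H + H') = wt a H + wt a H'.
Proof. by rewrite /wt !linearD. Qed.
Lemma wtZr k a H : wt a (k *: H) = k * wt a H.
Proof. by rewrite /wt !linearZ. Qed.
Lemma wt0r a : wt a 0 = 0. Proof. by rewrite -(scale0r 0) wtZr mul0r. Qed.
Lemma wt_sumr a I r (P : pred I) (F : I -> g) :
  wt a (\sum_(i <- r | P i) F i) = \sum_(i <- r | P i) wt a (F i).
Proof. by apply: (big_morph (wt a)); [exact: wtDr | exact: wt0r]. Qed.

Lemma wt_ext a b : (forall H, H \in h -> wt a H = wt b H) -> a = b.
Proof.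
move=> e; apply/lfunP => u; have := e (vsval u) (subvsP u).
by rewrite /wt vsvalK.
Qed.

Lemma hdual_of (phi : g -> C) :
  (forall k x y, phi (k *: x + y) = k * phi x + phi y) ->
  exists a : hdual h, forall H, H \in h -> wt a H = phi H.
Proof.
move=> lin.
pose f (u : subvs_of h) : C^o := phi (vsval u).
have flin : linear f by move=> k u v; rewrite /f linearP lin.
pose L : {linear subvs_of h -> C^o} := HB.pack f (GRing.isLinear.Build _ _ _ _ f flin).
exists (linfun L) => H Hh; rewrite /wt lfunE /= /f vsprojK //.
Qed.

Context {bil : bilinear_lie g}.

Lemma mem_bigcap_seq (V : vectType C) I (r : seq I) (F : I -> {vspace V}) (x : V) :
  (x \in (\bigcap_(i <- r) F i)%VS) = all (fun i => x \in F i) r.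
Proof. by elim: r => [|i r IH]; rewrite ?big_nil ?memvf // big_cons memv_cap IH. Qed.

Lemma root_spaceP a x :
  reflect (forall H, H \in h -> br H x = wt a H *: x) (x \in root_space a).
Proof.
have step H : (x \in lker (ad H - wt a H *: \1%VF)%R) = (br H x == wt a H *: x).
  by rewrite memv_ker lfun_subidE adE subr_eq0.
rewrite /root_space mem_bigcap_seq; apply: (iffP allP) => [hx|hx H /vbasis_mem Hh].
  move=> H Hh; rewrite (coord_vbasis Hh) br_suml wt_sumr scaler_suml.
  apply: eq_bigr => i _; rewrite brZl wtZr -scalerA; congr (_ *: _); apply/eqP.
  by rewrite -step; apply: hx; apply: mem_nth; rewrite size_tuple.
by rewrite step hx.
Qed.

Lemma br_root_space a b x y : x \in root_space a -> y \in root_space b ->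
  br x y \in root_space (a + b).
Proof.
move=> /root_spaceP hx /root_spaceP hy; apply/root_spaceP => H Hh.
by rewrite jac (hx H) // (hy H) // brZl brZr -scalerDl wtDl.
Qed.

Context {hc : is_cartan h} {nd : nondeg_killing g}.

Definition h_stable (W : {vspace g}) := forall H x, H \in h -> x \in W -> br H x \in W.

(** The basis vectors of [h] are diagonalized one after the other, each on the eigenspaces of the
    previous ones; on a joint eigenvector the eigenvalues assemble into a linear form on [h]. *)
Lemma weight_ind (W : {vspace g}) (P : g -> Prop) : h_stable W -> P 0 ->
  (forall x y, P x -> P y -> P (x + y)) ->
  (forall a x, x \in W -> x \in root_space a -> P x) -> forall x, x \in W -> P x.
Proof.
move=> sW P0 PD Pa.
have aux (s : seq g) : (forall z, z \in s -> z \in h) -> forall W, h_stable W ->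
    (forall x, x \in W -> (forall z, z \in s -> exists c, br z x = c *: x) -> P x) ->
    forall x, x \in W -> P x.
  elim: s => [_ W' _ PW x xW|z s IH sh W' sW' PW]; first exact: PW.
  have zh : z \in h by apply: sh; rewrite mem_head.
  apply: (geneig_ind (f := ad z)) => //.
    by apply/limg_memP => x xW; rewrite adE; exact: sW'.
  move=> c y yW gy; have zy : br z y = c *: y by exact: cartan_diag gy.
  have [||W'' hW''] := @vspace_of _ g (fun x => x \in W' /\ br z x = c *: x).
  - by split; rewrite ?mem0v // br0r scaler0.
  - move=> k u v [uW zu] [vW zv]; split; first by rewrite memvD ?memvZ.
    by rewrite brR zu zv; vring.
  apply: (IH _ W''); last by apply/hW''.
  - by move=> u us; apply: sh; rewrite inE us orbT.
  - move=> H x Hh /hW'' [xW zx]; apply/hW''; split; first exact: sW'.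
    by rewrite jac (cartan_abelian zh Hh) br0l add0r zx brZr.
  move=> x /hW'' [xW zx] hs; apply: PW => // u; rewrite inE => /orP [/eqP -> | us].
    by exists c.
  exact: hs.
apply: (aux (vbasis h)) => // [z /vbasis_mem //|x xW hx].
have [x0 | x0] := eqVneq x 0; first by rewrite x0.
have [||W' hW'] := @vspace_of _ g (fun z => exists c, br z x = c *: x).
- by exists 0; rewrite br0l scale0r.
- move=> k u v [c zu] [c' zv]; exists (k * c + c').
  by rewrite lie_br_linl zu zv scalerA scalerDl.
have hex z : exists c, z \in h -> br z x = c *: x.
  have [zh|] := boolP (z \in h); last by exists 0.
  suff /hW' [c hz] : z \in W' by exists c.
  rewrite (coord_vbasis zh); apply: memv_suml => i _; apply: memvZ; apply/hW'.
  by apply: hx; apply: mem_nth; rewrite size_tuple.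
pose phi z := sval (cid (hex z)).
have phiE z : z \in h -> br z x = phi z *: x := svalP (cid (hex z)).
(* [phi] is meaningful on [h] only; composing with the projection gives a linear form on all of [g],
   as [hdual_of] requires. *)
pose psi z := phi (projv h z).
have psi_lin k u v : psi (k *: u + v) = k * psi u + psi v.
  apply/eqP; rewrite -subr_eq0; apply/eqP.
  have : (psi (k *: u + v) - (k * psi u + psi v)) *: x = 0.
    rewrite /psi scalerBl scalerDl -scalerA -!phiE ?memv_proj // linearP.
    by rewrite lie_br_linl subrr.
  by move/eqP; rewrite scaler_eq0 (negPf x0) orbF => /eqP.
have [a ha] := hdual_of psi_lin.
apply: (Pa a) => //; apply/root_spaceP => H Hh.
by rewrite phiE // ha // /psi projv_id.
Qed.

(** Pick [H] on which [a] and the first weight [b] of [s] differ. Applying [ad H - b(H)] preserves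
    [W], removes the component of weight [b] and rescales [x] by a nonzero number. *)
Lemma weight_sep (W : {vspace g}) (s : seq (hdual h)) a x (f : hdual h -> g) :
  h_stable W -> a \notin s -> x \in root_space a ->
  (forall b, b \in s -> f b \in root_space b) ->
  x + \sum_(b <- s) f b \in W -> x \in W.
Proof.
move=> sW; elim: s x f => [|b s IH] x f as_ xa fs; first by rewrite big_nil addr0.
move: as_; rewrite inE negb_or => /andP [ab as_] xW.
have [H Hh Hab] : exists2 H, H \in h & wt a H != wt b H.
  apply: contrapT => hn; move/eqP: ab; apply; apply: wt_ext => H Hh.
  by apply/eqP; apply: contraT => e; case: hn; exists H.
have e0 : wt a H - wt b H != 0 by rewrite subr_eq0.
have /root_spaceP hx := xa.
have hsub u (v : hdual h) : u \in root_space v -> br H u - wt b H *: u = (wt v H - wt b H) *: u.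
  by move=> /root_spaceP hu; rewrite hu // scalerBl.
suff : (wt a H - wt b H) *: x \in W by rewrite rpredZeq (negPf e0).
apply: (IH _ (fun c => (wt c H - wt b H) *: f c)) => //; first exact: memvZ.
  by move=> c cs; apply/memvZ/fs; rewrite inE cs orbT.
have := memvB (sW H _ Hh xW) (memvZ (wt b H) xW).
rewrite brDr br_sumr scalerDr scaler_sumr opprD addrACA -sumrN -big_split /= big_cons.
rewrite (hsub x a) // (hsub (f b) b) ?fs ?mem_head // subrr scale0r add0r.
rewrite [X in _ + X](_ : _ = \sum_(c <- s) (wt c H - wt b H) *: f c) //.
rewrite big_seq [RHS]big_seq; apply: eq_bigr => c cs.
by rewrite (hsub _ c) // fs // inE cs orbT.
Qed.

Lemma h_stable0 : h_stable 0%VS.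
Proof. by move=> H x _; rewrite !memv0 => /eqP ->; rewrite br0r. Qed.

Lemma weight_indep (s : seq (hdual h)) a x (f : hdual h -> g) :
  a \notin s -> x \in root_space a ->
  (forall b, b \in s -> f b \in root_space b) ->
  x + \sum_(b <- s) f b = 0 -> x = 0.
Proof.
move=> as_ xa fs e; apply/eqP; rewrite -memv0.
by apply: (weight_sep h_stable0 as_ xa fs); rewrite e mem0v.
Qed.

Lemma span_weights (s : seq (hdual h)) (f : hdual h -> g) x : uniq s ->
  (forall a, a \in s -> f a \in root_space a) -> x \in <<map f s>>%VS ->
  exists2 f' : hdual h -> g, (forall a, a \in s -> f' a \in root_space a) & x = \sum_(a <- s) f' a.
Proof.
elim: s x => [|a s IH] x /=.
  by rewrite span_nil memv0 => _ _ /eqP ->; exists f; rewrite ?big_nil.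
case/andP=> as_ us fs; rewrite span_cons => /memv_addP [_ /vlineP [k ->] [v vs ->]].
have [|f' hf' ->] := IH v us _ vs; first by move=> b bs; apply: fs; rewrite inE bs orbT.
exists (fun c => if c == a then k *: f a else f' c).
  move=> b; rewrite inE; have [-> _ | _ /= bs] := eqVneq b a; last exact: hf'.
  by apply/memvZ/fs; rewrite mem_head.
rewrite big_cons eqxx; congr (_ + _); rewrite big_seq [RHS]big_seq.
apply: eq_bigr => b bs; case: eqP => // e; by move: as_; rewrite -e bs.
Qed.

Lemma free_weights (s : seq (hdual h)) (f : hdual h -> g) : uniq s ->
  (forall a, a \in s -> f a \in root_space a /\ f a != 0) -> free (map f s).
Proof.
elim: s => [|a s IH] /=; first by rewrite nil_free.
case/andP=> as_ us fs; rewrite free_cons IH ?andbT //; last first.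
  by move=> b bs; apply: fs; rewrite inE bs orbT.
have fs' b : b \in s -> f b \in root_space b.
  by move=> bs; have [] := fs b _; rewrite ?inE ?bs ?orbT.
have [fa fa0] := fs a (mem_head _ _).
apply: contra fa0 => /(span_weights us fs') [f' hf' e]; apply/eqP.
apply: (@weight_indep s a (f a) (fun b => - f' b)) => //.
  by move=> b bs; rewrite memvN hf'.
by rewrite sumrN e subrr.
Qed.

Fact isw_key : unit. Proof. exact: tt. Qed.
(* Locked, lest [done] tries to evaluate it. *)
Definition isw a : bool := locked_with isw_key (root_space a != 0%VS).
Lemma iswE a : isw a = (root_space a != 0%VS).
Proof. by rewrite /isw unlock. Qed.

Lemma iswP a : reflect (exists2 x, x \in root_space a & x != 0) (isw a).
Proof.
rewrite iswE; apply: (iffP idP) => [a0|[x xa x0]].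
  by exists (vpick (root_space a)); rewrite ?memv_pick ?vpick0.
by apply: contraNneq x0 => a0; rewrite -memv0 -a0.
Qed.

Lemma rootsE a : Defs.roots a <-> a != 0 /\ isw a.
Proof. by rewrite iswE; split=> [[/eqP h1 /eqP h2]|[/eqP h1 /eqP h2]]. Qed.

(** Root vectors of distinct roots are independent, so a list of distinct roots has at most [dim g]
    entries; a longest such list contains every root. *)
Lemma roots_seq_ex : exists s : seq (hdual h), uniq s /\
  forall a, (a \in s) = `[< Defs.roots a >].
Proof.
pose Q n := `[< exists s : seq (hdual h), [/\ uniq s, size s = n & forall a, a \in s -> Defs.roots a] >].
have Q0 : exists n, Q n by exists 0%N; apply/asboolP; exists [::].
have Qb n : Q n -> (n <= \dim {:g})%N.
  move/asboolP => [s [us <- hs]].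
  have fr : free (map (fun a : hdual h => vpick (root_space a)) s).
    apply: free_weights => // a /hs /rootsE [_ a0]; split; first exact: memv_pick.
    by rewrite vpick0 -iswE.
  by move: fr; rewrite /free size_map => /eqP <-; apply: dimvS; exact: subvf.
have [n /asboolP [s [us sn hs]] nmax] := ex_maxnP Q0 Qb.
exists s; split=> // a; apply/idP/asboolP => [/hs //|ra].
apply: contraT => as_; suff : (n.+1 <= n)%N by rewrite ltnn.
apply: nmax; apply/asboolP; exists (a :: s); split; rewrite /= ?as_ ?sn //.
by move=> b; rewrite inE => /orP [/eqP -> // | /hs].
Qed.

Definition rts : seq (hdual h) := sval (cid roots_seq_ex).
Lemma rts_uniq : uniq rts. Proof. exact: (proj1 (svalP (cid roots_seq_ex))). Qed.
Lemma mem_rts a : (a \in rts) = `[< Defs.roots a >].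
Proof. exact: (proj2 (svalP (cid roots_seq_ex))). Qed.
Lemma rtsP a : a \in rts <-> Defs.roots a.
Proof. by rewrite mem_rts; split=> /asboolP. Qed.
Lemma rts_isw a : a \in rts = (a != 0) && isw a.
Proof.
by apply/idP/andP => [/rtsP /rootsE //|/rootsE /rtsP].
Qed.

Lemma root_space0 x : (x \in root_space (0 : hdual h)) = (x \in h).
Proof.
apply/root_spaceP/idP => [hx|xh H Hh].
  by apply: cartan_self_centralizing => y yh; rewrite hx // wt0l scale0r.
by rewrite cartan_abelian // wt0l scale0r.
Qed.

Lemma killing_root_space a b x y : x \in root_space a -> y \in root_space b ->
  a + b != 0 -> killing x y = 0.
Proof.
move=> /root_spaceP hx /root_spaceP hy; apply: contraNeq => k0.
apply/eqP/wt_ext => H Hh; rewrite wtDl wt0l; apply/eqP.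
have : killing (br H x) y = - killing x (br H y) by exact: killing_invN.
rewrite hx // hy // killingZl killingZr => /eqP.
by rewrite -addr_eq0 -mulrDl mulf_eq0 (negPf k0) orbF.
Qed.

Lemma hvec_spec a : hvec a \in h /\ forall H, H \in h -> killing (hvec a) H = wt a H.
Proof.
apply: (@xgetPex _ 0 [set t | t \in h /\ forall H, H \in h -> killing t H = wt a H]%classic).
have [|||| t th ht] := @form_represent _ g (@killing _ g) h (wt a).
- by move=> *; exact: killing_linl.
- by move=> *; exact: killing_linr.
- exact: killing_h_nondeg.
- by move=> *; rewrite wtDr wtZr.
by exists t.
Qed.
Lemma hvec_h a : hvec a \in h. Proof. by have [] := hvec_spec a. Qed.
Lemma killing_hvec a H : H \in h -> killing (hvec a) H = wt a H.
Proof. by have [_] := hvec_spec a; apply. Qed.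

Lemma hform_wt a b : hform a b = wt a (hvec b).
Proof. by rewrite /hform killing_hvec ?hvec_h. Qed.
Lemma hformE a b : hform a b = killing (hvec a) (hvec b). Proof. by []. Qed.
Lemma hformC a b : hform a b = hform b a. Proof. exact: killingC. Qed.
Lemma hformDl a b c : hform (a + b) c = hform a c + hform b c.
Proof. by rewrite !hform_wt wtDl. Qed.
Lemma hformZl k a b : hform (k *: a) b = k * hform a b.
Proof. by rewrite !hform_wt wtZl. Qed.
Lemma hformNl a b : hform (- a) b = - hform a b.
Proof. by rewrite !hform_wt wtNl. Qed.
Lemma hform0l a : hform 0 a = 0. Proof. by rewrite hform_wt wt0l. Qed.
Lemma hformDr a b c : hform c (a + b) = hform c a + hform c b.
Proof. by rewrite !(hformC c) hformDl. Qed.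
Lemma hformZr k a b : hform b (k *: a) = k * hform b a.
Proof. by rewrite !(hformC b) hformZl. Qed.
Lemma hformNr a b : hform b (- a) = - hform b a.
Proof. by rewrite !(hformC b) hformNl. Qed.
Lemma hform0r a : hform a 0 = 0. Proof. by rewrite hformC hform0l. Qed.

(** Weight spaces whose weights do not add up to zero are orthogonal, so by nondegeneracy [x] must
    pair with something of weight [- a]. *)
Lemma dual_root_vector a x : x \in root_space a -> x != 0 ->
  exists2 y, y \in root_space (- a) & killing x y = 1.
Proof.
move=> xa x0.
have [y ya ky] : exists2 y, y \in root_space (- a) & killing x y != 0.
  apply: contrapT => hn; move/eqP: x0; apply; apply: nondeg => y.
  have := memvf y; move: y; apply: weight_ind.
  - by move=> *; rewrite memvf.
  - exact: killing0r.
  - by move=> u v hu hv; rewrite killingDr hu hv addr0.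
  move=> b y _ yb; have [e|] := eqVneq (a + b) 0; last exact: (killing_root_space xa yb).
  apply/eqP; apply: contraT => k0; case: hn; exists y => //.
  by move/eqP: e; rewrite addrC addr_eq0 => /eqP <-.
exists ((killing x y)^-1 *: y); first exact: memvZ.
by rewrite killingZr mulVf.
Qed.

Lemma isw_opp a : isw a -> isw (- a).
Proof.
move/iswP => [x xa x0]; have [y ya k1] := dual_root_vector xa x0.
apply/iswP; exists y => //; apply: contra_eqN k1 => /eqP ->.
by rewrite killing0r eq_sym oner_eq0.
Qed.

Lemma br_opp a x y : x \in root_space a -> y \in root_space (- a) ->
  br x y = killing x y *: hvec a.
Proof.
move=> xa ya; have xyh : br x y \in h by rewrite -root_space0 -(subrr a) br_root_space.
apply/eqP; rewrite -subr_eq0; apply/eqP/killing_h_nondeg.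
  by rewrite memvB ?memvZ ?hvec_h.
move=> H Hh; rewrite killingDl killingNl killingZl killing_hvec // killing_inv.
have /root_spaceP hy := ya.
by rewrite br_anti hy // wtNl scaleNr opprK killingZr mulrC subrr.
Qed.

(* The root spaces of b - k a are zero for large k, as there are finitely many roots. *)
Lemma lower_nil a b x y : a != 0 -> y \in root_space (- a) -> x \in root_space b ->
  exists N, iter N (ad y) x = 0.
Proof.
move=> a0 ya xb.
have itb k : iter k (ad y) x \in root_space (b - k%:R *: a).
  elim: k => [|k IH]; first by rewrite scale0r subr0.
  rewrite iterS adE [X in root_space X](_ : _ = - a + (b - k%:R *: a)).
    exact: br_root_space.
  by rewrite -natr1; vring.
apply: contrapT => hn.
pose s := [seq b - k%:R *: a | k <- iota 0 (size rts).+2].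
have us : uniq s.
  rewrite map_inj_uniq ?iota_uniq // => k l /addrI /oppr_inj /eqP.
  by rewrite -subr_eq0 -scalerBl scaler_eq0 (negPf a0) orbF subr_eq0 eqr_nat => /eqP.
have sub : {subset s <= 0 :: rts}.
  move=> _ /mapP [k _ ->]; rewrite inE rts_isw; case: eqP => //= _.
  apply/iswP; exists (iter k (ad y) x); first exact: itb.
  by apply/eqP => e; apply: hn; exists k.
by have := uniq_leq_size us sub; rewrite size_map size_iota /= ltnn.
Qed.

Lemma br_hvec a b x : x \in root_space b -> br (hvec a) x = hform b a *: x.
Proof. by move/root_spaceP => hx; rewrite hx ?hvec_h // hform_wt. Qed.

(** The weights separate the functionals on [h]: here [hvec a] acts by zero on all weight spaces, so
    it lies in the radical of the Killing form. *)
Lemma hform_eq0 a : (forall b, isw b -> hform b a = 0) -> a = 0.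
Proof.
move=> ha; apply: wt_ext => H Hh; rewrite wt0l -killing_hvec //.
suff -> : hvec a = 0 by rewrite killing0l.
apply: nondeg => y; rewrite killingE; suff -> : ad (hvec a) = 0 by rewrite comp_lfun0l tr0.
apply/lfunP => x; rewrite zero_lfunE adE.
have := memvf x; move: x; apply: weight_ind; first by move=> *; rewrite memvf.
- exact: br0r.
- by move=> u v hu hv; rewrite brDr hu hv addr0.
move=> b x _ xb; rewrite (br_hvec _ xb).
have [->|x0] := eqVneq x 0; first by rewrite scaler0.
by rewrite ha ?scale0r //; apply/iswP; exists x.
Qed.

(* The sl_2-triple (x, y, hvec a) acting on the string through a top weight b + p a. *)
Lemma string_top a b x y v : x \in root_space a -> y \in root_space (- a) -> killing x y = 1 ->
  a != 0 -> v \in root_space b -> v != 0 -> br x v = 0 ->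
  exists k, [/\ hform b a * 2 = k%:R * hform a a,
    (forall j, (j <= k)%N -> iter j (ad y) v != 0) & iter k.+1 (ad y) v = 0].
Proof.
move=> xa ya k1 a0 vb v0 xv.
have [N hN] := lower_nil a0 ya vb.
have exy : br x y = hvec a by rewrite (br_opp xa ya) k1 scale1r.
apply: (@chain _ _ (ad x) (ad y) (ad (hvec a)) (hform a a) _ _ v _ N) => //.
- by move=> w; rewrite !adE jac exy addrC.
- by move=> w; rewrite !adE jac (br_hvec _ ya) hformNl brZl scaleNr addrC.
- by rewrite adE.
- by rewrite adE (br_hvec _ vb).
Qed.

Lemma iter_root_space a b y v k : y \in root_space (- a) -> v \in root_space b ->
  iter k (ad y) v \in root_space (b - k%:R *: a).
Proof.
move=> ya vb; elim: k => [|k IH]; first by rewrite scale0r subr0.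
rewrite iterS adE [X in root_space X](_ : _ = - a + (b - k%:R *: a)).
  exact: br_root_space.
by rewrite -natr1; vring.
Qed.

Lemma root_pair a : Defs.roots a -> exists x y,
  [/\ x \in root_space a, y \in root_space (- a) & killing x y = 1].
Proof.
move/rootsE => [a0 /iswP [x xa x0]]; have [y ya k1] := dual_root_vector xa x0.
by exists x, y.
Qed.

(** Were [(a, a) = 0], the string relation [2 (b, a) = k (a, a)] would make [a] orthogonal to all
    weights. *)
Lemma hform_neq0 a : Defs.roots a -> hform a a != 0.
Proof.
move=> ra; have /rootsE [a0 _] := ra; have [x [y [xa ya k1]]] := root_pair ra.
apply/eqP => aa0; move/eqP: a0; apply; apply: hform_eq0 => b /iswP [u ub u0].
have [N hN] : exists N, iter N (ad x) u = 0.
  by apply: (@lower_nil (- a) b u x) => //; rewrite ?opprK // oppr_eq0; have [/eqP] := ra.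
have exN : exists n, iter n (ad x) u == 0 by exists N; rewrite hN.
case: (ex_minnP exN) => -[|n] /eqP xn nmin; first by rewrite -xn eqxx in u0.
pose v := iter n (ad x) u.
have v0 : v != 0 by apply/negP => /nmin; rewrite ltnn.
have xm : x \in root_space (- - a) by rewrite opprK.
have vb : v \in root_space (b - n%:R *: (- a)) by exact: iter_root_space.
have xv : br x v = 0 by rewrite -adE -iterS.
have [k [e _ _]] := string_top xa ya k1 (proj1 (proj1 (rootsE a) ra)) vb v0 xv.
move: e; rewrite aa0 mulr0 hformDl hformNl hformZl hformNl aa0 oppr0 mulr0 subr0 => /eqP.
by rewrite mulf_eq0 pnatr_eq0 orbF => /eqP.
Qed.

Lemma rootsN a : Defs.roots a -> Defs.roots (- a).
Proof. by move=> /rootsE [a0 wa]; apply/rootsE; rewrite oppr_eq0 a0 isw_opp. Qed.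

(** A nonzero vector [w] of weight [a] with [killing w y = 0] is killed by [y], hence starts a
    string in the direction [- a], whose length [k] would satisfy [k = -2]. *)
Lemma root_dim1 a x z : Defs.roots a -> x \in root_space a -> x != 0 -> z \in root_space a ->
  exists k, z = k *: x.
Proof.
move=> ra xa x0 za; have /rootsE [a0 _] := ra; have [y ya k1] := dual_root_vector xa x0.
exists (killing z y); apply/eqP; rewrite -subr_eq0; apply/eqP.
set w := z - _; have wa : w \in root_space a by rewrite memvB ?memvZ.
have kw : killing w y = 0 by rewrite killingDl killingNl killingZl k1 mulr1 subrr.
apply/eqP; apply: contraT => w0.
have xm : x \in root_space (- - a) by rewrite opprK.
have a0' : - a != 0 by rewrite oppr_eq0.
have k1' : killing y x = 1 by rewrite killingC.
have yw : br y w = 0 by rewrite br_anti (br_opp wa ya) kw scale0r oppr0.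
have [k [e _ _]] := string_top ya xm k1' a0' wa w0 yw.
move: e; rewrite hformNr hformNl hformNr opprK mulNr => /eqP.
rewrite eq_sym -addr_eq0 mulrC -mulrDr mulf_eq0 (negPf (hform_neq0 ra)) /=.
by rewrite -natrD pnatr_eq0 addn2.
Qed.

(* Climbing one weight at a time, so that p is maximal among consecutive weights. *)
Lemma string_climb a b : a != 0 -> isw b -> exists p,
  (forall j, (j <= p)%N -> isw (b + j%:R *: a)) /\ ~~ isw (b + p.+1%:R *: a).
Proof.
move=> a0 wb.
have [p hp] : exists p, ~~ isw (b + p%:R *: a).
  apply: contrapT => hn.
  pose s := [seq b + k%:R *: a | k <- iota 0 (size rts).+2].
  have us : uniq s.
    rewrite map_inj_uniq ?iota_uniq // => k l /addrI /eqP.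
    by rewrite -subr_eq0 -scalerBl scaler_eq0 (negPf a0) orbF subr_eq0 eqr_nat => /eqP.
  have sub : {subset s <= 0 :: rts}.
    move=> _ /mapP [k _ ->]; rewrite inE rts_isw; case: eqP => //= _.
    by apply: contraT => nw; case: hn; exists k.
  by have := uniq_leq_size us sub; rewrite size_map size_iota /= ltnn.
have ex : exists p, ~~ isw (b + p%:R *: a) by exists p.
case: (ex_minnP ex) => -[|m] hm mmin; first by rewrite scale0r addr0 wb in hm.
exists m; split=> // j jm; apply: contraT => /mmin; by rewrite ltnNge jm.
Qed.

(** [p] counts the steps from [b] up to the top of its string, and [k] is the length of the string
    measured from that top. *)
Lemma string_down a b : Defs.roots a -> isw b -> exists p k,
  [/\ hform b a * 2 = (k%:R - p%:R * 2) * hform a a,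
     ~~ isw (b + p.+1%:R *: a),
     (forall j, (j <= p)%N -> isw (b + j%:R *: a)) &
     (forall j, (j <= k)%N -> isw (b + p%:R *: a - j%:R *: a))].
Proof.
move=> ra wb; have /rootsE [a0 _] := ra; have [x [y [xa ya k1]]] := root_pair ra.
have [p [hp np]] := string_climb a0 wb.
have /iswP [v vb v0] := hp p (leqnn p).
have xv : br x v = 0.
  apply/eqP; apply: contraNT np => xv0; apply/iswP; exists (br x v); last exact: xv0.
  rewrite [X in root_space X](_ : _ = a + (b + p%:R *: a)); first exact: br_root_space.
  by rewrite -natr1; vring.
have [k [e hk _]] := string_top xa ya k1 a0 vb v0 xv.
exists p, k; split=> //.
  rewrite mulrBl -e hformDl hformZl; ring.
move=> j jk; apply/iswP; exists (iter j (ad y) v); last exact: hk.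
exact: iter_root_space.
Qed.

Lemma hform_int_uniq a b (n m : int) : Defs.roots a ->
  hform b a * 2 = n%:~R * hform a a -> hform b a * 2 = m%:~R * hform a a -> n = m.
Proof. by move=> ra -> /(mulIf (hform_neq0 ra)) /intr_inj. Qed.

Lemma hform_int a b : Defs.roots a -> isw b -> exists n : int, hform b a * 2 = n%:~R * hform a a.
Proof.
move=> ra wb; have [p [k [e _ _ _]]] := string_down ra wb.
by exists (k%:Z - p%:Z * 2); rewrite e rmorphB rmorphM.
Qed.

Lemma string_range a b (n : int) : Defs.roots a -> isw b -> hform b a * 2 = n%:~R * hform a a ->
  exists p : nat, [/\ 0 <= n + 2 * p%:Z, ~~ isw (b + p.+1%:R *: a) &
    forall m : int, - p%:Z <= m -> m <= n + p%:Z -> isw (b - m%:~R *: a)].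
Proof.
move=> ra wb en; have [p [k [e np _ hk]]] := string_down ra wb.
have nE : n = k%:Z - p%:Z * 2 by apply: (hform_int_uniq ra en); rewrite e rmorphB rmorphM.
exists p; split=> //; first by rewrite nE; lia.
move=> m pm mn; have := hk (absz (m + p%:Z)); rewrite (_ : b + _ - _ = b - m%:~R *: a).
  by apply; lia.
have -> : (absz (m + p%:Z))%:R = (m + p%:Z)%:~R :> C.
  by rewrite [in RHS](_ : m + p%:Z = Posz (absz (m + p%:Z))) //; lia.
by rewrite rmorphD /=; vring.
Qed.

Lemma string_sub a b (n : int) : Defs.roots a -> isw b -> hform b a * 2 = n%:~R * hform a a ->
  0 < n -> isw (b - a).
Proof.
move=> ra wb en n0; have [p [_ _ h']] := string_range ra wb en.
by have := h' 1; rewrite scale1r; apply; lia.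
Qed.

Lemma hform_intN a b (n : int) : hform b a * 2 = n%:~R * hform a a ->
  hform b (- a) * 2 = (- n)%:~R * hform (- a) (- a).
Proof. by move=> e; rewrite !(hformNr, hformNl) opprK rmorphN /= !mulNr e. Qed.

Lemma string_add a b (n : int) : Defs.roots a -> isw b -> hform b a * 2 = n%:~R * hform a a ->
  n < 0 -> isw (b + a).
Proof.
move=> ra wb en n0; rewrite -[a]opprK; apply: (string_sub (rootsN ra) wb (hform_intN en)).
by rewrite oppr_gt0.
Qed.

(** The string through [b] in the direction [- a] goes at least one step beyond [b]; for [n <= 0] it
    then extends at least as far on the other side. *)
Lemma string_skip a b (n : int) : Defs.roots a -> isw b -> hform b a * 2 = n%:~R * hform a a ->
  n <= 0 -> isw (b - a) -> isw (b + a).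
Proof.
move=> ra wb en n0 wba; have [p [_ np h']] := string_range (rootsN ra) wb (hform_intN en).
case: p np h' => [|p] np h'; first by rewrite scale1r wba in np.
by have := h' 1; rewrite scale1r opprK; apply; lia.
Qed.

(** The first string is only known to have length [n + 2 p] from its top; if that does not settle
    the matter, the string in the direction [- a] does. *)
Lemma string_refl a b (n : int) : Defs.roots a -> isw b -> hform b a * 2 = n%:~R * hform a a ->
  isw (b - n%:~R *: a).
Proof.
move=> ra wb en; have [p [_ _ h']] := string_range ra wb en.
have [pn|pn] := lerP (- p%:Z) n; first by apply: h' => //; lia.
have [q [_ _ h'']] := string_range (rootsN ra) wb (hform_intN en).
have := h'' (- n); rewrite (_ : b - _ = b - n%:~R *: a).
  by apply; lia.
by rewrite rmorphN /=; vring.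
Qed.

Lemma string_reflz a b (n : int) : Defs.roots a -> isw b -> hform b a * 2 = n%:~R * hform a a ->
  isw (b - a *~ n).
Proof. by move=> ra wb e; rewrite -scaler_int; apply: string_refl. Qed.

(** If [[x, z] = 0], then [z] tops a string of some length [k]. The true top [v] lies [p + 1] steps
    higher and has string length [k + 2 (p + 1)]. Descending from [v] one meets a multiple of [z]
    and can still go on for [k + 1] nonzero steps, which [z] does not allow. *)
Lemma br_neq0 a b x z : Defs.roots a -> Defs.roots b -> isw (a + b) ->
  x \in root_space a -> z \in root_space b -> x != 0 -> z != 0 -> br x z != 0.
Proof.
have arith (u w : nat) : (u.+1 + w.+1 <= u + w.+1.*2)%N by lia.
move=> ra rb wab xa zb x0 z0; apply/negP => /eqP xz.
have /rootsE [a0 _] := ra; have /rootsE [b0 wb] := rb.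
have [y ya k1] := dual_root_vector xa x0.
have [k [e _ hk]] := string_top xa ya k1 a0 zb z0 xz.
have [p [hp np]] := string_climb a0 wb.
case: p hp np => [|p] hp np; first by rewrite scale1r addrC wab in np.
have /iswP [v vb v0] := hp p.+1 (leqnn _).
have xv : br x v = 0.
  apply/eqP; apply: contraNT np => xv0; apply/iswP; exists (br x v); last exact: xv0.
  rewrite [X in root_space X](_ : _ = a + (b + p.+1%:R *: a)); first exact: br_root_space.
  by rewrite -[p.+2%:R]natr1; vring.
have [k' [e' hk' _]] := string_top xa ya k1 a0 vb v0 xv.
have kk : k' = (k + p.+1.*2)%N.
  apply/eqP; rewrite -(eqr_nat C); apply/eqP/(mulIf (hform_neq0 ra)).
  rewrite -e' hformDl hformZl mulrDl e -muln2 natrD natrM; ring.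
have fb : iter p.+1 (ad y) v \in root_space b.
  have := iter_root_space p.+1 ya vb; rewrite addrK.
  exact.
have [c ec] := root_dim1 rb zb z0 fb.
have le : (k.+1 + p.+1 <= k')%N by rewrite kk arith.
have := hk' _ le.
by rewrite iterD ec iter_lfunZ hk scaler0 eqxx.
Qed.

(** The trace is taken in a basis made of a basis of [h] and one vector for each root, on which the
    product of the two adjoint maps is diagonal. *)
Lemma killing_roots H H' : H \in h -> H' \in h ->
  killing H H' = \sum_(c <- rts) wt c H * wt c H'.
Proof.
move=> Hh Hh'; pose Y := [seq vpick (root_space c) | c <- rts]; pose X := vbasis h ++ Y.
have Yw c : c \in rts -> vpick (root_space c) \in root_space c /\ vpick (root_space c) != 0.
  by rewrite rts_isw iswE => /andP [_ wc]; rewrite memv_pick vpick0.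
have fX : free X.
  rewrite cat_free (basis_free (vbasisP h)) free_weights ?rts_uniq //=.
  apply/directv_addP/eqP; rewrite -subv0; apply/subvP => x; rewrite memv_cap memv0.
  rewrite (span_basis (vbasisP h)) => /andP [xh].
  case/(span_weights rts_uniq (fun c cr => proj1 (Yw c cr))) => f hf e; apply/eqP.
  apply: (@weight_indep rts 0 x (fun b => - f b)).
  - by rewrite rts_isw eqxx.
  - by rewrite root_space0.
  - by move=> b br_; rewrite memvN hf.
  by rewrite sumrN e subrr.
have bX : basis_of {:g} X.
  rewrite /basis_of fX andbT eqEsubv subvf /=; apply/subvP => x _.
  have := memvf x; move: x; apply: weight_ind; first by move=> *; rewrite memvf.
  - exact: mem0v.
  - by move=> u v; exact: memvD.
  move=> a x _ xa; have [-> | x0] := eqVneq x 0; first exact: mem0v.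
  rewrite span_cat; have [a0 | a0] := eqVneq a 0.
    apply: (subvP (addvSl _ _)); rewrite (span_basis (vbasisP h)) -root_space0 -a0 //.
  have ra : a \in rts by rewrite rts_isw a0; apply/iswP; exists x.
  have [pa p0] := Yw a ra; have [k ->] := root_dim1 (proj1 (rtsP a) ra) pa p0 xa.
  by apply: (subvP (addvSr _ _)); apply/memvZ/memv_span/map_f.
have eig a x : x \in root_space a -> (ad H \o ad H')%VF x = (wt a H * wt a H') *: x.
  by move=> /root_spaceP hx; rewrite comp_lfunE !adE hx // brZr hx // scalerA mulrC.
have sXY : size X = (\dim h + size rts)%N by rewrite size_cat size_tuple size_map.
pose lam (i : nat) := if (i < \dim h)%N then 0 else wt (nth 0 rts (i - \dim h)) H * wt (nth 0 rts (i - \dim h)) H'.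
rewrite killingE (tr_basis (X := in_tuple X)) //.
have step (i : 'I_(size X)) : coord (in_tuple X) i ((ad H \o ad H')%VF (in_tuple X)`_i) = lam i.
  have -> : (ad H \o ad H')%VF (in_tuple X)`_i = lam i *: (in_tuple X)`_i.
    rewrite /lam /= nth_cat size_tuple; case: ltnP => il.
      rewrite (eig 0) ?wt0l ?mul0r // root_space0; apply/vbasis_mem/mem_nth.
      by rewrite size_tuple.
    have ir : (i - \dim h < size rts)%N by rewrite ltn_subLR // -sXY.
    rewrite (nth_map 0) //; apply: eig.
    by have [] := Yw _ (mem_nth 0 ir).
  by rewrite linearZ /= coord_free // eqxx mulr1.
rewrite (eq_bigr _ (fun i _ => step i)) -(big_mkord xpredT lam) sXY.
rewrite (@big_cat_nat _ _ _ (\dim h)) ?leq_addr //=.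
rewrite [X in X + _]big_nat_cond big1 ?add0r; last first.
  by move=> i; rewrite andbT /lam => /andP [_ ->].
rewrite -{1}[\dim h]add0n big_addn addKn.
rewrite [RHS](big_nth 0) !big_mkord; apply: eq_bigr => i _.
by rewrite /lam ltnNge leq_addl /= addnK.
Qed.

Lemma hform_sum a b : hform a b = \sum_(c <- rts) hform c a * hform c b.
Proof.
rewrite /hform killing_roots ?hvec_h //; apply: eq_bigr => c _.
by rewrite !killing_hvec ?hvec_h.
Qed.

(** Put [n c = 2 (c, a) / (a, a)], an integer. That [(a, a)] is the sum of all [(c, a)^2] then says
    that [(a, a)] times the sum of all [(n c)^2] equals 4. *)
Lemma hform_gt0 a : Defs.roots a -> 0 < hform a a.
Proof.
move=> ra; have aa0 := hform_neq0 ra.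
have ex c : exists n : int, c \in rts -> hform c a * 2 = n%:~R * hform a a.
  have [cr|] := boolP (c \in rts); last by exists 0.
  by have /rtsP/rootsE [_ wc] := cr; have [n] := hform_int ra wc; exists n.
pose n c := sval (cid (ex c)).
have nE c : c \in rts -> hform c a * 2 = (n c)%:~R * hform a a := svalP (cid (ex c)).
pose q : C := \sum_(c <- rts) (n c)%:~R ^+ 2.
have e1 : q * (hform a a) ^+ 2 = \sum_(c <- rts) ((n c)%:~R * hform a a) ^+ 2.
  by rewrite /q mulr_suml; apply: eq_bigr => c _; rewrite exprMn.
have e2 : \sum_(c <- rts) ((n c)%:~R * hform a a) ^+ 2 = 4 * \sum_(c <- rts) hform c a * hform c a.
  rewrite mulr_sumr; apply: eq_big_seq => c cr; rewrite -nE //; ring.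
have e : hform a a * q = 4.
  apply: (mulIf aa0); rewrite -hform_sum in e2; rewrite -e2 -e1; ring.
have q0 : 0 <= q.
  by apply: sumr_ge0 => c _; rewrite -rmorphXn /= ler0z sqr_ge0.
rewrite lt_neqAle eq_sym aa0 /=.
have qn0 : q != 0.
  by apply: contra_eqN e => /eqP ->; rewrite mulr0 eq_sym pnatr_eq0.
have qp : 0 < q by rewrite lt_neqAle eq_sym qn0.
by rewrite -(pmulr_lge0 _ qp) e ler0n.
Qed.

End Weights.
#[global] Opaque killing hform hvec root_space rts.

Local Notation roots := Defs.roots.

(* A real part on C, kept abstract so that unification does not unfold complex numbers. *)
Class real_part (C : numClosedFieldType) (R : realFieldType) := RealPart {
  re_part : {additive C -> R};
  re_inj : {rmorphism R -> C};
  re_injM : forall k z, re_part (re_inj k * z) = k * re_part z;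
  re_ge0 : forall z, 0 <= z -> z = re_inj (re_part z);
  re_gt0 : forall z, 0 < z -> 0 < re_part z }.

(** * Positive definiteness on the real span of the roots *)

Section RealForm.
Context {C : numClosedFieldType} {R : realFieldType} {rp : real_part C R}.
Context {g : lie_algebra C} {h : {vspace g}}.
Context {bil : bilinear_lie g} {hc : is_cartan h} {nd : nondeg_killing g}.
Implicit Types (a b c : hdual h) (x y H : g).

Definition root_form a b : R := re_part (hform a b).

Lemma rfC a b : root_form a b = root_form b a. Proof. by rewrite /root_form hformC. Qed.
Lemma rfDl a b c : root_form (a + b) c = root_form a c + root_form b c.
Proof. by rewrite /root_form hformDl raddfD. Qed.
Lemma rfNl a b : root_form (- a) b = - root_form a b.
Proof. by rewrite /root_form hformNl raddfN. Qed.
Lemma rf0l a : root_form 0 a = 0. Proof. by rewrite /root_form hform0l raddf0. Qed.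
Lemma rfZl (k : R) a b : root_form (re_inj k *: a) b = k * root_form a b.
Proof. by rewrite /root_form hformZl re_injM. Qed.
Lemma rfDr a b c : root_form c (a + b) = root_form c a + root_form c b.
Proof. by rewrite !(rfC c) rfDl. Qed.
Lemma rfNr a b : root_form b (- a) = - root_form b a.
Proof. by rewrite !(rfC b) rfNl. Qed.
Lemma rf0r a : root_form a 0 = 0. Proof. by rewrite rfC rf0l. Qed.
Lemma rfZr (k : R) a b : root_form b (re_inj k *: a) = k * root_form b a.
Proof. by rewrite !(rfC b) rfZl. Qed.
Lemma rfMnl (n : nat) a b : root_form (a *+ n) b = n%:R * root_form a b.
Proof. by elim: n => [|n IH]; rewrite ?mul0r ?rf0l // mulrSr rfDl IH -natr1 mulrDl mul1r. Qed.
Lemma rfZzl (n : int) a b : root_form (a *~ n) b = n%:~R * root_form a b.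
Proof.
case: n => n; first exact: rfMnl.
by rewrite NegzE !mulrNz mulNr rfNl; congr (- _); exact: rfMnl.
Qed.
Lemma rfZzr (n : int) a b : root_form b (a *~ n) = n%:~R * root_form b a.
Proof. by rewrite !(rfC b) rfZzl. Qed.
Lemma rf_suml I r (P : pred I) (F : I -> hdual h) a :
  root_form (\sum_(i <- r | P i) F i) a = \sum_(i <- r | P i) root_form (F i) a.
Proof. by apply: (big_morph (root_form^~ a)); [move=> ? ?; exact: rfDl | exact: rf0l]. Qed.
Lemma rf_sumr I r (P : pred I) (F : I -> hdual h) a :
  root_form a (\sum_(i <- r | P i) F i) = \sum_(i <- r | P i) root_form a (F i).
Proof. by apply: (big_morph (root_form a)); [move=> ? ?; exact: rfDr | exact: rf0r]. Qed.

Lemma roots_isw a : roots a -> isw a. Proof. by move/rootsE => []. Qed.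
Lemma roots_neq0 a : roots a -> a != 0. Proof. by move/rootsE => []. Qed.
Lemma isw_roots a : isw a -> a != 0 -> roots a. Proof. by move=> ? ?; apply/rootsE. Qed.

Lemma re_injK k : re_part (re_inj k) = k.
Proof.
have e1 : re_part 1 = 1.
  by apply: (fmorph_inj re_inj); rewrite -re_ge0 ?ler01 // rmorph1.
by rewrite -[re_inj k]mulr1 re_injM e1 mulr1.
Qed.

Lemma hform_rf a b : roots a -> isw b -> hform b a = re_inj (root_form b a).
Proof.
move=> ra wb; have [n en] := hform_int ra wb.
have e : hform a a = re_inj (re_part (hform a a)) by apply/re_ge0/ltW/hform_gt0.
have e2 : hform b a = re_inj (n%:~R * re_part (hform a a) / 2).
  apply: (mulIf (_ : 2 != 0 :> C)); first by rewrite pnatr_eq0.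
  rewrite en {1}e !rmorphM /= fmorphV rmorph_nat rmorph_int divfK ?pnatr_eq0 //.
by rewrite /root_form {2}e2 re_injK.
Qed.

Lemma rf_gt0 a : roots a -> 0 < root_form a a.
Proof. by move=> ra; apply/re_gt0/hform_gt0. Qed.

Lemma rf_int a b : roots a -> isw b -> exists2 n : int, 2 * root_form b a = n%:~R * root_form a a &
  hform b a * 2 = n%:~R * hform a a.
Proof.
move=> ra wb; have [n en] := hform_int ra wb; exists n => //.
move: en; rewrite (hform_rf ra wb) (hform_rf ra (roots_isw ra)).
rewrite -(rmorph_int re_inj) -(rmorph_nat re_inj) -!rmorphM /= => /fmorph_inj <-.
by rewrite mulrC.
Qed.

Lemma rf_int_sign a b (n : int) : roots a -> 2 * root_form b a = n%:~R * root_form a a ->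
  (0 < root_form b a) = (0 < n) /\ (root_form b a < 0) = (n < 0).
Proof.
move=> ra e; have a0 := rf_gt0 ra; split.
  by rewrite -(ltr0z R) -(pmulr_lgt0 n%:~R a0) -e pmulr_rgt0.
by rewrite -(ltrz0 R) -(pmulr_llt0 n%:~R a0) -e pmulr_rlt0.
Qed.

Lemma rts_sub a b : roots a -> isw b -> 0 < root_form b a -> isw (b - a).
Proof.
move=> ra wb p; have [n e e'] := rf_int ra wb; apply: (string_sub ra wb e').
by have [<- _] := rf_int_sign ra e.
Qed.

Lemma rts_add a b : roots a -> isw b -> root_form b a < 0 -> isw (b + a).
Proof.
move=> ra wb p; have [n e e'] := rf_int ra wb; apply: (string_add ra wb e').
by have [_ <-] := rf_int_sign ra e.
Qed.

Lemma rts_skip a b : roots a -> isw b -> root_form b a <= 0 -> isw (b - a) -> isw (b + a).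
Proof.
move=> ra wb p; have [n e e'] := rf_int ra wb; apply: (string_skip ra wb e').
by have [e1 _] := rf_int_sign ra e; rewrite leNgt -e1 -leNgt.
Qed.

Lemma refl_isw a b : roots a -> isw b -> exists2 n : int,
  2 * root_form b a = n%:~R * root_form a a & isw (b - a *~ n).
Proof.
move=> ra wb; have [n e e'] := rf_int ra wb; exists n => //.
exact: (string_reflz ra wb e').
Qed.

Implicit Types (u v : hdual h).
(** Plays the part of membership in the real span of the roots, where [root_form] is positive
    definite. *)
Definition realw u := forall a, isw a -> hform u a = re_inj (root_form u a).

Lemma realw_root a : roots a -> realw a.
Proof. by move=> ra c wc; rewrite hformC (hform_rf ra wc) rfC. Qed.
Lemma realwD u v : realw u -> realw v -> realw (u + v).
Proof. by move=> hx hy a wa; rewrite hformDl hx // hy // rfDl rmorphD. Qed.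
Lemma realwZ (k : R) u : realw u -> realw (re_inj k *: u).
Proof. by move=> hx a wa; rewrite hformZl hx // rfZl rmorphM. Qed.
Lemma realw0 : realw 0.
Proof. by move=> a _; rewrite hform0l rf0l rmorph0. Qed.
Lemma realw_sum I r (P : pred I) (F : I -> hdual h) :
  (forall i, P i -> realw (F i)) -> realw (\sum_(i <- r | P i) F i).
Proof. by move=> hF; apply: (big_ind realw); [exact: realw0 | exact: realwD | exact: hF]. Qed.

Lemma rf_sum u v : realw u -> realw v -> root_form u v = \sum_(c <- rts) root_form c u * root_form c v.
Proof.
move=> hx hy; rewrite {1}/root_form hform_sum raddf_sum; apply: eq_big_seq => c /rtsP /roots_isw wc.
by rewrite hformC hx // (hformC c) hy // -rmorphM re_injK !(rfC c).
Qed.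

Lemma rf_ge0 u : realw u -> 0 <= root_form u u.
Proof. by move=> hx; rewrite rf_sum //; apply: sumr_ge0 => c _; rewrite -expr2 sqr_ge0. Qed.

Lemma rf_eq0 u : realw u -> root_form u u = 0 -> u = 0.
Proof.
move=> hx; rewrite rf_sum // => /eqP; rewrite psumr_eq0; last by move=> c _; rewrite -expr2 sqr_ge0.
move=> /allP e; apply: hform_eq0 => a wa.
have [-> | a0] := eqVneq a 0; first by rewrite hform0l.
have := e a (proj2 (rtsP a) (isw_roots wa a0)) => /=.
by rewrite mulf_eq0 orbb hformC hx // rfC => /eqP ->; rewrite rmorph0.
Qed.

End RealForm.

(** * Positive roots of a Borel subalgebra *)

Section Borel.
Context {C : numClosedFieldType} {R : realFieldType} {rp : real_part C R}.
Context {g : lie_algebra C} {h : {vspace g}}.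
Context {bil : bilinear_lie g} {hc : is_cartan h} {nd : nondeg_killing g}.
Implicit Types (a c : hdual h) (x y H : g).
Variable b : {vspace g}.
Hypothesis b_borel : borel_subalgebra b.
Hypothesis hb : (h <= b)%VS.

(** A set of roots is enumerated by a sublist of [rts], so [root_sum] is an ordinary finite sum of
    subspaces and admits an induction principle. *)
Lemma root_sumP (A : set (hdual h)) : (forall a, A a -> roots a) ->
  (forall a, A a -> (root_space a <= root_sum A)%VS) /\
  (forall P : g -> Prop, P 0 -> (forall x y, P x -> P y -> P (x + y)) ->
    (forall a x, A a -> x \in root_space a -> P x) -> forall x, x \in root_sum A -> P x).
Proof.
move=> Ar.
pose s : seq (hdual h) := [seq a <- @rts _ _ h bil | a \in A].
have sP a : a \in s <-> A a.
  rewrite mem_filter; split=> [/andP [/set_mem //]|Aa].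
  by rewrite mem_set //=; apply/rtsP/Ar.
have e : root_sum A = (\sum_(a <- s) root_space a)%VS.
  rewrite /root_sum (fsbigE s) ?filter_uniq ?rts_uniq //.
  - by rewrite big_filter_cond big_filter; apply: eq_bigl => a; rewrite andbb.
  - by move=> a /= /sP.
  by move=> a /sP ->.
split=> [a /sP as_|P P0 PD PA x].
  by rewrite e (big_rem a) //=; exact: addvSl.
have PA' a y : a \in s -> y \in root_space a -> P y by move/sP; exact: PA.
rewrite e; elim: {sP e} s x PA' => [|a s IH] x PA'; first by rewrite big_nil memv0 => /eqP ->.
rewrite big_cons => /memv_addP [u ua [v vs ->]]; apply: PD.
  by apply: (PA' a) => //; exact: mem_head.
by apply: IH vs => c y cs; apply: PA'; rewrite inE cs orbT.
Qed.

Let bsub x y : x \in b -> y \in b -> br x y \in b.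
Proof. by have [[/brvP H _] _] := b_borel; apply: H. Qed.

Lemma b_h_stable : h_stable (h := h) b.
Proof. by move=> H x Hh xb; apply: bsub => //; apply: (subvP hb). Qed.

Let pos := pos_roots (h := h) b.

Lemma pos_root a : pos a -> roots a. Proof. by case. Qed.
Lemma pos_mem a x : pos a -> x \in root_space a -> x \in b.
Proof. by case=> _ /subvP h'; apply: h'. Qed.
Lemma mem_pos a x : roots a -> x \in root_space a -> x != 0 -> x \in b -> pos a.
Proof.
move=> ra xa x0 xb; split=> //; apply/subvP => z za.
by have [k ->] := root_dim1 ra xa x0 za; apply: memvZ.
Qed.

Lemma posD a c : pos a -> pos c -> isw (a + c) -> a + c != 0 -> pos (a + c).
Proof.
move=> pa pc wac ac0; have [ra rc] := (pos_root pa, pos_root pc).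
have /iswP [x xa x0] := roots_isw ra; have /iswP [z zc z0] := roots_isw rc.
apply: (@mem_pos _ (br x z)); first exact: isw_roots.
- exact: br_root_space.
- exact: (br_neq0 ra rc wac xa zc x0 z0).
- by apply: bsub; [apply: (pos_mem pa) | apply: (pos_mem pc)].
Qed.

(** The sl_2 triple of [a] would lie in [b]; as it reproduces itself under brackets it would survive
    in every derived algebra, against solvability. *)
Lemma pos_opp a : pos a -> ~ pos (- a).
Proof.
move=> pa pna; have ra := pos_root pa; have aa0 : hform a a != 0 by exact: hform_neq0.
have [x [y [xa ya k1]]] := root_pair ra.
have exy : br x y = hvec a by rewrite (br_opp xa ya) k1 scale1r.
have [[_ [k ek]] _] := b_borel.
have inD j : [/\ x \in iter j (fun V => brv V V) b, y \in iter j (fun V => brv V V) b &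
    hvec a \in iter j (fun V => brv V V) b].
  elim: j => [|j [xj yj tj]] /=.
    by split; [exact: (pos_mem pa xa) | exact: (pos_mem pna ya) | exact: (subvP hb _ (hvec_h a))].
  split; last by rewrite -exy; apply: brv_mem.
    have -> : x = (hform a a)^-1 *: br (hvec a) x.
      by rewrite (br_hvec _ xa) scalerA mulVf ?scale1r.
    by apply/memvZ/brv_mem.
  have -> : y = (- hform a a)^-1 *: br (hvec a) y.
    by rewrite (br_hvec _ ya) hformNl scalerA mulVf ?scale1r // oppr_eq0.
  by apply/memvZ/brv_mem.
have [+ _ _] := inD k; rewrite ek memv0 => /eqP x0.
by move: k1; rewrite x0 killing0l => /eqP; rewrite eq_sym oner_eq0.
Qed.

(* Two of the summands have negative inner product, hence can be replaced by their sum. *)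
Lemma pos_sum_neq0 (l : seq (hdual h)) : l != [::] -> (forall a, a \in l -> pos a) ->
  \sum_(a <- l) a != 0.
Proof.
have [n] := ubnP (size l); elim: n l => // n IH [//|a l] sl _ hl.
apply/negP => /eqP s0; rewrite big_cons in s0.
have pa : pos a by apply: hl; rewrite mem_head.
have ra := pos_root pa.
have hl' c : c \in l -> pos c by move=> cl; apply: hl; rewrite inE cl orbT.
have [c cl ac] : exists2 c, c \in l & root_form c a < 0.
  apply: contrapT => hn.
  have : 0 < root_form (a + \sum_(c <- l) c) a.
    rewrite rfDl rf_suml ltr_pwDl ?rf_gt0 // big_seq; apply: sumr_ge0 => c cl.
    by rewrite leNgt; apply/negP => lt; apply: hn; exists c.
  by rewrite s0 rf0l ltxx.
have pc := hl' c cl; have rc := pos_root pc.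
have wca : isw (c + a) by apply: rts_add => //; exact: roots_isw.
have ca0 : c + a != 0.
  apply/eqP => /eqP; rewrite addrC addr_eq0 => /eqP e.
  by apply: (pos_opp pc); rewrite -e.
have pca : pos (c + a) := posD pc pa wca ca0.
have := IH ((c + a) :: rem c l); rewrite big_cons /= size_rem // => H.
suff : c + a + \sum_(d <- rem c l) d != 0.
  by move: s0; rewrite (big_rem c cl) /= addrCA addrA => ->; rewrite eqxx.
apply: H => //.
  by move: sl; rewrite /= ltnS; case: (l) cl => //= d l' _; rewrite ltnS.
by move=> d; rewrite inE => /orP [/eqP -> // | /mem_rem /hl'].
Qed.

Lemma borel_ind (P : g -> Prop) : P 0 -> (forall x y, P x -> P y -> P (x + y)) ->
  (forall x, x \in h -> P x) -> (forall a x, pos a -> x \in root_space a -> P x) ->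
  forall x, x \in b -> P x.
Proof.
move=> P0 PD Ph Pp; apply: (weight_ind b_h_stable) => // a x xb xa.
have [-> // | x0] := eqVneq x 0.
have [a0 | a0] := eqVneq a 0; first by apply: Ph; rewrite -root_space0 -a0.
have ra : roots a by apply: isw_roots => //; apply/iswP; exists x.
exact: (Pp a x (mem_pos ra xa x0 xb) xa).
Qed.

Section Closed.
Variable S : hdual h -> Prop.
Hypothesis Sr : forall a, S a -> roots a.
Hypothesis SD : forall a c, S a -> S c -> isw (a + c) -> a + c != 0 -> S (a + c).
Hypothesis S0 : forall l, l != [::] -> (forall a, a \in l -> S a) -> \sum_(a <- l) a != 0.

(** [c] is below [a] when [a] arises from [c] by adding a nonempty sum of elements of [S]. The
    number of roots below serves as a height before simple roots are available. *)
Definition below a c := `[< exists l, [/\ l != [::], S c, forall d, d \in l -> S d & a = c + \sum_(d <- l) d] >].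
Definition depth a := count (below a) rts.

Lemma depthD a c : S a -> S c -> (depth a < depth (a + c)%R)%N.
Proof.
move=> Sa Sc.
have sub d : below a d || (d == a) -> below (a + c) d.
  case/orP => [/asboolP [l [l0 Sd Sl e]]|/eqP ->]; apply/asboolP.
    exists (c :: l); split=> //; last by rewrite big_cons e; vring.
    by move=> t; rewrite inE => /orP [/eqP -> // | /Sl].
  by exists [:: c]; split=> //; [move=> t; rewrite inE => /eqP -> | rewrite big_seq1].
have na : ~~ below a a.
  apply/asboolP => -[l [l0 _ Sl]] /eqP; rewrite -subr_eq0 opprD addrA subrr add0r oppr_eq0.
  by move/negP: (S0 l0 Sl).
have ar : a \in rts by apply/rtsP/Sr.
apply: leq_trans (sub_count sub rts).
have -> : count (fun d => below a d || (d == a)) rts = (depth a + count (pred1 a) rts)%N.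
  have e0 : count (predI (below a) (pred1 a)) rts = 0%N.
    rewrite -(count_pred0 (rts : seq (hdual h))); apply: eq_count => d /=.
    by case: eqP => [->|_]; rewrite ?andbF // (negPf na).
  by rewrite /depth -(count_predUI (below a) (pred1 a) rts) [X in (_ + X)%N]e0 addn0.
by rewrite count_uniq_mem ?rts_uniq // ar addn1.
Qed.

Lemma S_sum_root a c : S a -> S c -> isw (a + c) -> S (a + c).
Proof.
move=> Sa Sc w; apply: SD => //.
have := @S0 [:: a; c]; rewrite big_cons big_seq1; apply=> //.
by move=> d; rewrite !inE => /orP [] /eqP ->.
Qed.

(** Brackets of root vectors raise [depth] strictly, and [depth] is at most the number of roots, so
    the derived series dies. The set [S] is abstract so that it may be the positive roots enlarged
    by one root and its sums. *)
Lemma closed_solvable : solvable_subalgebra (h + root_sum S)%VS.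
Proof.
have [RS_sub RS_ind] := root_sumP Sr.
pose Sk k a := S a /\ (k <= depth a)%N.
have Skr k a : Sk k a -> roots a by move=> [/Sr].
have brS k k' x y : x \in root_sum (Sk k) -> y \in root_sum (Sk k') -> br x y \in root_sum (Sk k.+1).
  move=> xk yk'; move: y yk'; apply: (proj2 (root_sumP (Skr k'))).
  - by rewrite br0r mem0v.
  - by move=> u v hu hv; rewrite brDr memvD.
  move=> c y [Sc _] yc; move: x xk; apply: (proj2 (root_sumP (Skr k))).
  - by rewrite br0l mem0v.
  - by move=> u v hu hv; rewrite brDl memvD.
  move=> a x [Sa ka] xa; have [-> | n0] := eqVneq (br x y) 0; first exact: mem0v.
  have hin : br x y \in root_space (a + c) by exact: br_root_space.
  have Sac : S (a + c) by apply: S_sum_root => //; apply/iswP; exists (br x y).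
  apply: (subvP (proj1 (root_sumP (Skr k.+1)) (a + c) _)) => //; split=> //.
  exact: leq_ltn_trans ka (depthD Sa Sc).
have S0E x : x \in root_sum S -> x \in root_sum (Sk 0).
  move: x; apply: RS_ind; [exact: mem0v | by move=> *; apply: memvD |].
  move=> a x Sa xa; apply: (subvP (proj1 (root_sumP (Skr 0)) a _)) => //.
have brh x y : x \in h -> y \in root_sum S -> br x y \in root_sum S.
  move=> xh; move: y; apply: RS_ind; first by rewrite br0r mem0v.
    by move=> u v hu hv; rewrite brDr memvD.
  move=> a y Sa /[dup] ya /root_spaceP hy; rewrite hy //; apply: memvZ.
  exact: (subvP (RS_sub a Sa)).
have SS x y : x \in root_sum S -> y \in root_sum S -> br x y \in root_sum S.
  move=> /S0E xs /S0E ys; have := brS _ _ _ _ xs ys.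
  move: (br x y); apply: (proj2 (root_sumP (Skr 1%N))); [exact: mem0v | by move=> *; apply: memvD |].
  by move=> a z [Sa _] za; apply: (subvP (RS_sub a Sa)).
have D1 x y : x \in (h + root_sum S)%VS -> y \in (h + root_sum S)%VS -> br x y \in root_sum S.
  move=> /memv_addP [u uh [v vs ->]] /memv_addP [u' uh' [v' vs' ->]].
  rewrite brDl !brDr (cartan_abelian uh uh') add0r.
  apply: memvD; first exact: brh.
  by apply: memvD; [rewrite br_anti memvN; exact: brh | exact: SS].
split; first by apply/brvP => x y xs ys; apply: (subvP (addvSr _ _)); apply: D1.
(* One step of the series removes [h], and depths range from 0 to [size rts]. *)
exists (size (rts : seq (hdual h))).+2.
have it k : (iter k.+1 (fun V => brv V V) (h + root_sum S) <= root_sum (Sk k))%VS.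
  elim: k => [|k IH]; first by apply/brvP => x y xs ys; apply/S0E/D1.
  by apply/brvP => x y /(subvP IH) xs /(subvP IH) ys; apply: brS ys.
apply/eqP; rewrite -subv0; apply: subv_trans (it _) _; apply/subvP.
apply: (proj2 (root_sumP (Skr _))); [exact: mem0v | by move=> *; apply: memvD |].
by move=> a z [_]; rewrite ltnNge (leq_trans (count_size _ _)).
Qed.
End Closed.

Lemma pos_depth a c : pos a -> pos c -> (depth pos a < depth pos (a + c)%R)%N.
Proof.
have H1 a' : pos a' -> roots a' by exact: pos_root.
have H2 a' c' : pos a' -> pos c' -> isw (a' + c') -> a' + c' != 0 -> pos (a' + c') by exact: posD.
have H3 (l : seq (hdual h)) : l != [::] -> (forall a', a' \in l -> pos a') -> \sum_(a' <- l) a' != 0.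
  exact: pos_sum_neq0.
by move=> pa pc; apply: (depthD H1 H3 pa pc).
Qed.

(** Induction on [depth]: a positive root that is not simple is a sum of two positive roots of
    smaller depth. *)
Lemma pos_simple_sum a : pos a -> exists l : seq (hdual h), [/\ l != [::],
  (forall c, c \in l -> simple_roots b c) & a = \sum_(c <- l) c].
Proof.
have [n] := ubnP (depth pos a); elim: n a => // n IH a; rewrite ltnS => da pa.
have [sa | ns] := pselect (simple_roots b a).
  exists [:: a]; split=> //; last by rewrite big_seq1.
  by move=> c; rewrite inE => /eqP ->.
have [a1 [a2 [p1 p2 e]]] : exists a1 a2, [/\ pos a1, pos a2 & a = a1 + a2].
  by apply: contrapT => hn; apply: ns; split.
have d1 := pos_depth p1 p2; have d2 := pos_depth p2 p1.
rewrite addrC in d2; rewrite -e in d1 d2.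
have [l1 [l10 s1 e1]] := IH a1 (leq_trans d1 da) p1.
have [l2 [l20 s2 e2]] := IH a2 (leq_trans d2 da) p2.
exists (l1 ++ l2); split.
- by case: (l1) l10.
- by move=> c; rewrite mem_cat => /orP [/s1 | /s2].
by rewrite big_cat /= -e1 -e2.
Qed.

(* Adding a or -a to pos does not create zero sums; maximality of b then forces it into pos. *)
Lemma pos_max a : roots a ->
  (forall (l : seq (hdual h)), l != [::] -> (forall c, c \in l -> pos c \/ c = a) -> \sum_(c <- l) c != 0) ->
  pos a.
Proof.
move=> ra z0.
pose S c := roots c /\ exists l : seq (hdual h), [/\ l != [::], forall d, d \in l -> pos d \/ d = a &
  c = \sum_(d <- l) d].
have S_sum (l : seq (hdual h)) : (forall c, c \in l -> S c) -> l != [::] -> exists l' : seq (hdual h), [/\ l' != [::],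
    forall d, d \in l' -> pos d \/ d = a & \sum_(c <- l) c = \sum_(d <- l') d].
  elim: l => // c l IH hl _; have [_ [lc [lc0 hlc ec]]] := hl c (mem_head _ _).
  case: l IH hl => [|c' l] IH hl; first by exists lc; rewrite big_seq1.
  have [|//|l' [l'0 hl' e']] := IH; first by move=> d dl; apply: hl; rewrite inE dl orbT.
  exists (lc ++ l'); split; first by case: (lc) lc0.
    by move=> d; rewrite mem_cat => /orP [/hlc | /hl'].
  by rewrite big_cons e' big_cat /= -ec.
have Sr c : S c -> roots c by case.
have SD c d : S c -> S d -> isw (c + d) -> c + d != 0 -> S (c + d).
  move=> Sc Sd w n0; split; first exact: isw_roots.
  have [||l [l0 hl e]] := @S_sum [:: c; d] => //.
    by move=> t; rewrite !inE => /orP [] /eqP ->.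
  by exists l; rewrite -e big_cons big_seq1.
have S0 (l : seq (hdual h)) : l != [::] -> (forall c, c \in l -> S c) -> \sum_(c <- l) c != 0.
  by move=> l0 hl; have [l' [l'0 hl' ->]] := S_sum l hl l0; apply: z0.
have sol := closed_solvable Sr SD S0.
have Spos c : pos c -> S c.
  move=> pc; split; first exact: pos_root.
  exists [:: c]; split=> //; last by rewrite big_seq1.
  by move=> d; rewrite inE => /eqP ->; left.
have [RS_sub _] := root_sumP Sr.
have sub : (b <= h + root_sum S)%VS.
  apply/subvP; apply: borel_ind; [exact: mem0v | by move=> *; apply: memvD | |].
    exact: (subvP (addvSl _ _)).
  by move=> c x /Spos Sc xc; apply: (subvP (addvSr _ _)); apply: (subvP (RS_sub c Sc)).
have [_ bmax] := b_borel; have eb := bmax _ sol sub.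
have /iswP [x xa x0] := roots_isw ra; apply: (mem_pos ra xa x0).
rewrite -eb; apply: (subvP (addvSr _ _)); apply: (subvP (RS_sub a _)) => //.
split=> //; exists [:: a]; split=> //; last by rewrite big_seq1.
by move=> d; rewrite inE => /eqP ->; right.
Qed.

(** If neither [a] nor [- a] is positive, [pos_max] supplies relations [m a + P = 0] and
    [- m' a + P' = 0] with [P], [P'] nonempty sums of positive roots; [m'] times the first plus [m]
    times the second is a vanishing sum of positive roots. *)
Lemma pos_or_neg a : roots a -> pos a \/ pos (- a).
Proof.
move=> ra; have [pa | npa] := pselect (pos a); first by left.
have [pna | npna] := pselect (pos (- a)); first by right.
have key c : roots c -> ~ pos c -> exists m (l : seq (hdual h)),
    [/\ (0 < m)%N, l != [::], forall d, d \in l -> pos d & \sum_(d <- l) d = - (c *+ m)].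
  move=> rc npc; apply: contrapT => hn; apply: npc; apply: pos_max => // l l0 hl.
  apply/negP => /eqP s0; apply: hn.
  exists (count_mem c l), [seq d <- l | d != c].
  have e : \sum_(d <- l) d = c *+ count_mem c l + \sum_(d <- [seq d <- l | d != c]) d.
    elim: (l) => [|d l' IH]; first by rewrite !big_nil addr0.
    rewrite big_cons IH /=; case: eqP => [->|_] /=.
      by rewrite addrA -mulrS.
    by rewrite big_cons addrCA.
  have e' : \sum_(d <- [seq d <- l | d != c]) d = - (c *+ count_mem c l).
    by apply/eqP; rewrite -addr_eq0 addrC -e s0.
  have posl d : d \in [seq d <- l | d != c] -> pos d.
    by rewrite mem_filter => /andP [/eqP dc /hl []].
  have c0 := roots_neq0 rc.
  have f0 : [seq d <- l | d != c] != [::].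
    apply/eqP => f0; move: e'; rewrite f0 big_nil => /esym /eqP; rewrite oppr_eq0.
    rewrite -scaler_nat scaler_eq0 (negPf c0) orbF pnatr_eq0 => /eqP m0.
    move: f0 => /(congr1 size); rewrite size_filter /= => f0.
    have := count_predC (pred1 c) l; rewrite m0 [count (predC _) _]f0 => /esym /size0nil l0'.
    by rewrite l0' in l0.
  split=> //; rewrite lt0n; apply/eqP => m0.
  by move/negP: (pos_sum_neq0 f0 posl); rewrite e' m0 mulr0n oppr0 eqxx; apply.
have [m [l [m0 l0 hl e]]] := key a ra npa.
have [m' [l' [m0' l0' hl' e']]] := key (- a) (rootsN ra) npna.
have sm k (s : seq (hdual h)) : \sum_(d <- flatten (nseq k s)) d = (\sum_(d <- s) d) *+ k.
  by elim: k => [|k IH]; rewrite ?big_nil // big_cat /= IH mulrS.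
have : \sum_(d <- flatten (nseq m' l) ++ flatten (nseq m l')) d != 0.
  apply: pos_sum_neq0; first by case: (m') m0' => // k _; case: (l) l0.
  by move=> d; rewrite mem_cat => /orP [] /flattenP [s /nseqP [-> _]]; [apply: hl | apply: hl'].
by rewrite big_cat /= !sm e e' !mulNrn opprK -!mulrnA mulnC addNr eqxx.
Qed.

End Borel.

Class simple_system (C : numClosedFieldType) (g : lie_algebra C) (h b : {vspace g}) n
    (al : 'I_n -> hdual h) : Prop := SimpleSystem {
  ss_borel : borel_subalgebra b;
  ss_hb : (h <= b)%VS;
  ss_inj : injective al;
  ss_range : range al = simple_roots b }.

(** * Simple roots, fundamental weights and degrees *)

Section Simple.
Context {C : numClosedFieldType} {R : realFieldType} {rp : real_part C R}.
Context {g : lie_algebra C} {h : {vspace g}}.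
Context {bil : bilinear_lie g} {hc : is_cartan h} {nd : nondeg_killing g}.
Context {b : {vspace g}} {n : nat} {al : 'I_n -> hdual h} {ss : simple_system b al}.
Implicit Types (a c : hdual h) (x y H : g) (i j q : 'I_n).
Local Notation pos := (pos_roots (h := h) b).

Lemma al_simple i : simple_roots b (al i).
Proof. by rewrite -ss_range; exists i. Qed.
Lemma al_pos i : pos (al i). Proof. by have [] := al_simple i. Qed.
Lemma al_root i : roots (al i). Proof. exact: (pos_root (al_pos i)). Qed.

Lemma root_pos_or_neg a : roots a -> pos a \/ pos (- a).
Proof. exact: (pos_or_neg ss_borel ss_hb). Qed.

(** A positive product makes the difference a root, and whichever sign it has, one of the two simple
    roots becomes a sum of positive roots. *)
Lemma al_rf_le0 i j : i != j -> root_form (al i) (al j) <= 0.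
Proof.
move=> ij; rewrite leNgt; apply/negP => p.
have w : isw (al i - al j) by apply: rts_sub => //; [exact: al_root | exact/roots_isw/al_root].
have n0 : al i - al j != 0.
  by rewrite subr_eq0; apply: contra ij => /eqP /(@ss_inj _ _ _ _ _ _ ss) ->.
have [_ si] := al_simple i; have [_ sj] := al_simple j.
have [pp | pn] := root_pos_or_neg (isw_roots w n0).
  by apply: si; exists (al j), (al i - al j); split; [exact: al_pos | | rewrite addrC subrK].
by apply: sj; exists (al i), (- (al i - al j)); split; [exact: al_pos | | rewrite opprB addrC subrK].
Qed.

Lemma pos_comb a : pos a -> exists c : 'I_n -> nat, a = \sum_i al i *+ c i.
Proof.
move=> pa; have [l [_ hl ->]] := pos_simple_sum ss_borel ss_hb pa.
elim: l hl => [|d l IH] hl.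
  by exists (fun => 0%N); rewrite big_nil big1.
have [|c ec] := IH; first by move=> t tl; apply: hl; rewrite inE tl orbT.
have : simple_roots b d by apply: hl; exact: mem_head.
rewrite -ss_range => -[i _ <-].
exists (fun j => (i == j) + c j)%N; rewrite big_cons ec.
under [RHS]eq_bigr do rewrite mulrnDr.
rewrite big_split /=; congr (_ + _).
by rewrite (bigD1 i) //= eqxx mulr1n big1 ?addr0 // => j /negPf; rewrite eq_sym => ->.
Qed.

Lemma nat_comb0 (c : 'I_n -> nat) : \sum_i al i *+ c i = 0 -> forall i, c i = 0%N.
Proof.
move=> e i; apply/eqP/negPn/negP => ci.
have sm (s : seq 'I_n) : \sum_(d <- flatten [seq nseq (c j) (al j) | j <- s]) d = \sum_(j <- s) al j *+ c j.
  elim: s => [|j s IH]; first by rewrite !big_nil.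
  by rewrite /= big_cat big_cons /= IH big_nseq iter_addr_0.
have : \sum_(d <- flatten [seq nseq (c j) (al j) | j <- index_enum 'I_n]) d != 0.
  apply: (pos_sum_neq0 ss_borel ss_hb).
    apply/eqP => f0; have : al i \in flatten [seq nseq (c j) (al j) | j <- index_enum 'I_n].
      apply/flatten_mapP; exists i; first by rewrite mem_index_enum.
      by rewrite mem_nseq lt0n ci eqxx.
    by rewrite f0.
  by move=> d /flatten_mapP [j _ /nseqP [-> _]]; exact: al_pos.
by rewrite sm e eqxx.
Qed.

Lemma realw_al i : realw (al i). Proof. exact/realw_root/al_root. Qed.

(** Split the combination as [P - M] with natural coefficients of disjoint support. Orthogonality to
    all simple roots gives [P = M], and then [(P, P) = (M, P) <= 0]. *)
Lemma int_comb0 (v : 'I_n -> int) : (forall j, \sum_i (v i)%:~R * root_form (al i) (al j) = 0) ->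
  forall i, v i = 0.
Proof.
move=> e0.
pose p i : nat := if 0 <= v i then `|v i|%N else 0%N.
pose m i : nat := if 0 <= v i then 0%N else `|v i|%N.
have vE i : v i = (p i)%:Z - (m i)%:Z by rewrite /p /m; case: ifP => ?; lia.
have pm i : (p i * m i = 0)%N by rewrite /p /m; case: ifP => ?; rewrite ?muln0 ?mul0n.
have mE (a : hdual h) k : a *+ k = a *~ k%:Z by [].
have rMn k : realw (\sum_i al i *+ k i).
  apply: realw_sum => i _.
  by rewrite -scaler_nat -(rmorph_nat re_inj); apply/realwZ/realw_al.
pose P := \sum_i al i *+ p i; pose M := \sum_i al i *+ m i.
have eM : M = P.
  have r : realw (P - M).
    apply: realwD; first exact: rMn.
    by rewrite -scaleN1r -(rmorphN1 re_inj); apply/realwZ/rMn.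
  apply/eqP; rewrite eq_sym -subr_eq0; apply/eqP; apply: (rf_eq0 r).
  have -> : P - M = \sum_i al i *~ v i.
    by rewrite -sumrB; apply: eq_bigr => i _; rewrite vE mulrzBr !mE.
  rewrite rf_sumr big1 // => j _; rewrite rfZzr rf_suml.
  by under eq_bigr do rewrite rfZzl; rewrite e0 mulr0.
have P0 : P = 0.
  apply: (rf_eq0 (rMn _)); apply/eqP; rewrite eq_le rf_ge0 ?andbT; last exact: rMn.
  rewrite -[X in root_form _ X]eM rf_suml sumr_le0 // => i _; rewrite rf_sumr sumr_le0 // => j _.
  rewrite !mE rfZzl rfZzr -!pmulrn.
  have [<- | ij] := eqVneq i j.
    by rewrite mulrA -natrM pm mul0r.
  by rewrite mulr_ge0_le0 ?ler0n // mulr_ge0_le0 ?ler0n ?al_rf_le0.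
move=> i; rewrite vE; have M0 : M = 0 by rewrite eM.
by rewrite (nat_comb0 P0) (nat_comb0 M0).
Qed.

(** By [int_comb0] the integer Cartan matrix has nonzero determinant; a row of its inverse over [R]
    gives the coefficients of the weight. *)
Lemma fund_ex q : exists w, realw w /\ forall i, cartan_int w (al i) = (i == q)%:R.
Proof.
have [A eA] : exists A : 'I_n * 'I_n -> int, forall ij,
    2 * root_form (al ij.1) (al ij.2) = (A ij)%:~R * root_form (al ij.2) (al ij.2).
  have ex (ij : 'I_n * 'I_n) : {k : int | 2 * root_form (al ij.1) (al ij.2) = k%:~R * root_form (al ij.2) (al ij.2)}.
    apply: cid; have [k e _] := rf_int (al_root ij.2) (roots_isw (al_root ij.1)).
    by exists k.
  by exists (fun ij => sval (ex ij)) => ij; exact: svalP (ex ij).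
pose M : 'M[int]_n := \matrix_(i, j) A (i, j).
have dM : \det M != 0.
  apply/det0P => -[v v0 ev]; move/eqP: v0; apply; apply/rowP => i; rewrite mxE.
  apply: (@int_comb0 (fun i => v 0 i)) => j.
  have : (v *m M) 0 j = 0 by rewrite ev mxE.
  rewrite mxE => /(congr1 (fun k : int => k%:~R * root_form (al j) (al j))).
  rewrite mul0r rmorph_sum mulr_suml /= => s0.
  apply: (mulfI (_ : 2 != 0 :> R)); first by rewrite pnatr_eq0.
  rewrite mulr0 -[RHS]s0 mulr_sumr; apply: eq_bigr => k _.
  by rewrite mulrCA (eA (k, j)) mxE rmorphM /= mulrA.
pose N : 'M[R]_n := map_mx intr M.
have NU : N \in unitmx.
  by rewrite unitmxE det_map_mx unitfE intr_eq0.
pose w : hdual h := \sum_i re_inj (real_part := rp) (invmx N q i) *: al i.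
have rw : realw w by apply: realw_sum => i _; apply/realwZ/realw_al.
exists w; split=> // j.
have e : 2 * root_form w (al j) = (j == q)%:R * root_form (al j) (al j).
  have : (invmx N *m N) q j = (j == q)%:R by rewrite mulVmx // mxE eq_sym.
  rewrite mxE => <-; rewrite rf_suml mulr_sumr mulr_suml; apply: eq_bigr => i _.
  by rewrite rfZl !mxE -mulrA -(eA (i, j)) mulrCA.
rewrite /cartan_int -(mulr_natl (hform w (al j)) 2) (rw _ (roots_isw (al_root j))) (hform_rf (al_root j) (roots_isw (al_root j))).
rewrite -(rmorph_nat re_inj) -rmorphM e -fmorphV -rmorphM mulfK ?rmorph_nat //.
by rewrite gt_eqF ?rf_gt0 //; exact: al_root.
Qed.

Definition lam q : hdual h := fund_weight al q.
Lemma lam_int q i : cartan_int (lam q) (al i) = (i == q)%:R.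
Proof.
have [w [_ hw]] := fund_ex q.
exact: (@xgetPex _ 0 [set w | forall i : 'I_n, cartan_int w (al i) = (i == q)%:R]%classic (ex_intro _ w hw)).
Qed.

Lemma lam_al q i : hform (lam q) (al i) * 2 = (i == q)%:R * hform (al i) (al i).
Proof. by rewrite -(lam_int q) /cartan_int mulfVK ?hform_neq0 ?mulr_natr //; exact: al_root. Qed.

Lemma root_comb a : roots a -> exists c : 'I_n -> int, a = \sum_i al i *~ c i.
Proof.
case/root_pos_or_neg => /pos_comb [c e]; first by exists (fun i => c i).
exists (fun i => - (c i)%:Z); rewrite -[LHS]opprK e -sumrN.
by apply: eq_bigr => i _; rewrite mulrNz.
Qed.

Lemma hform_al_ext u v : (forall i, hform u (al i) = hform v (al i)) -> u = v.
Proof.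
move=> e; apply/eqP; rewrite -subr_eq0; apply/eqP/hform_eq0 => a wa.
have [-> | a0] := eqVneq a 0; first exact: hform0l.
have [c ->] := root_comb (isw_roots wa a0).
rewrite hformC hform_wt; apply: (big_ind (fun a => wt (u - v) (hvec a) = 0)).
- by rewrite -hform_wt hform0r.
- by move=> x y hx hy; rewrite -hform_wt hformDr !hform_wt hx hy addr0.
move=> i _; rewrite -hform_wt -scaler_int hformZr hformDl hformNl e subrr mulr0 //.
Qed.

Lemma realw_lam q : realw (lam q).
Proof.
have [w [rw hw]] := fund_ex q; suff -> : lam q = w by [].
apply: hform_al_ext => i; have := lam_int q i; rewrite -(hw i) /cartan_int.
move/(mulIf (invr_neq0 (hform_neq0 (al_root i)))).
have n2 : 2 != 0 :> C by rewrite pnatr_eq0.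
by rewrite -(mulr_natr (hform _ _) 2) -(mulr_natr (hform w _) 2) => /(mulIf n2).
Qed.

(** For a root this is the coefficient of [al q]; writing it as a pairing with the fundamental
    weight makes it additive on all functionals. *)
Definition dg q a : R := 2 * root_form (lam q) a / root_form (al q) (al q).
Lemma dgD q a c : dg q (a + c) = dg q a + dg q c.
Proof. by rewrite /dg rfDr mulrDr mulrDl. Qed.
Lemma dgN q a : dg q (- a) = - dg q a.
Proof. by rewrite /dg rfNr mulrN mulNr. Qed.
Lemma dg0 q : dg q 0 = 0. Proof. by rewrite /dg rf0r mulr0 mul0r. Qed.
Lemma dgZz q a k : dg q (a *~ k) = k%:~R * dg q a.
Proof. by rewrite /dg rfZzr; ring. Qed.
Lemma dg_sum q I r (P : pred I) (F : I -> hdual h) :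
  dg q (\sum_(i <- r | P i) F i) = \sum_(i <- r | P i) dg q (F i).
Proof. by apply: (big_morph (dg q)); [move=> ? ?; exact: dgD | exact: dg0]. Qed.
Lemma dg_al q i : dg q (al i) = (i == q)%:R.
Proof.
have e : 2 * root_form (lam q) (al i) = (i == q)%:R * root_form (al i) (al i).
  apply: (fmorph_inj re_inj); rewrite !rmorphM -(realw_lam q (roots_isw (al_root i))).
  rewrite -(hform_rf (al_root i) (roots_isw (al_root i))) !rmorph_nat mulrC; exact: lam_al.
rewrite /dg e; case: eqP => [->|_]; last by rewrite mul0r mul0r.
by rewrite mul1r divff // gt_eqF // rf_gt0 //; exact: al_root.
Qed.
Lemma dg_comb q (c : 'I_n -> int) : dg q (\sum_i al i *~ c i) = (c q)%:~R.
Proof.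
rewrite dg_sum (bigD1 q) //= dgZz dg_al eqxx mulr1 big1 ?addr0 // => i iq.
by rewrite dgZz dg_al (negPf iq) mulr0.
Qed.
Lemma dg_pos q a : pos a -> exists k : nat, dg q a = k%:R.
Proof. by move/pos_comb => [c ->]; exists (c q); rewrite (dg_comb q c). Qed.
Lemma dg_pos0 a : pos a -> (forall q, dg q a = 0) -> False.
Proof.
move=> pa e; have [c ec] := pos_comb pa.
move/negP: (roots_neq0 (pos_root pa)); apply; rewrite ec big1 // => i _.
by have := e i; rewrite ec (dg_comb i c) => /eqP; rewrite intr_eq0 => /eqP [->].
Qed.
Definition height a : R := \sum_q dg q a.
Lemma htD a c : height (a + c) = height a + height c.
Proof. by rewrite /height -big_split; apply: eq_bigr => q _; rewrite dgD. Qed.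
Lemma htN a : height (- a) = - height a.
Proof. by rewrite /height -sumrN; apply: eq_bigr => q _; rewrite dgN. Qed.
Lemma htZz a k : height (a *~ k) = k%:~R * height a.
Proof. by rewrite /height mulr_sumr; apply: eq_bigr => q _; rewrite dgZz. Qed.
Lemma ht_pos a : pos a -> exists2 k : nat, (0 < k)%N & height a = k%:R.
Proof.
move=> pa; have [c ec] := pos_comb pa.
exists (\sum_q c q)%N.
  rewrite lt0n; apply/eqP => s0; apply: (dg_pos0 pa) => q.
  rewrite ec (dg_comb q c); apply/eqP; rewrite intr_eq0; apply/eqP; congr Posz.
  by move/eqP: s0; rewrite sum_nat_eq0 => /forallP /(_ q) /eqP.
by rewrite natr_sum; apply: eq_bigr => q _; rewrite ec (dg_comb q c).
Qed.
Lemma ht_gt0 a : pos a -> 0 < height a.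
Proof. by case/ht_pos => k k0 ->; rewrite ltr0n. Qed.
Lemma dg_pos_ge0 q a : pos a -> 0 <= dg q a.
Proof. by case/(dg_pos q) => k ->; rewrite ler0n. Qed.
Lemma dg_int q a : roots a -> exists k : int, dg q a = k%:~R.
Proof. by case/root_comb => c ->; exists (c q); rewrite dg_comb. Qed.
Lemma dg_gt0_pos q a : roots a -> 0 < dg q a -> pos a.
Proof.
move=> ra p; have [//|/(dg_pos_ge0 q)] := root_pos_or_neg ra.
by rewrite dgN oppr_ge0 leNgt p.
Qed.

Lemma levi_rootsE q a : levi_roots al q a <-> roots a /\ dg q a = 0.
Proof.
split=> -[ra ha]; split=> //.
  have : hform (lam q) a = 0.
    have [|k u v eu ev|W hW] := @vspace_of _ _ (fun c => hform (lam q) c = 0).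
    - exact: hform0r.
    - by rewrite hformDr hformZr eu ev mulr0 addr0.
    apply/hW; apply: (subvP _ _ ha); rewrite span_def big_map big_filter big_enum_cond.
    apply/subv_sumP => i /andP [_ iq]; rewrite -memvE; apply/hW.
    have := lam_al q i; rewrite (negPf iq) mul0r => /eqP.
    by rewrite mulf_eq0 pnatr_eq0 orbF => /eqP.
  rewrite (realw_lam q (roots_isw ra)) => /eqP; rewrite fmorph_eq0 => /eqP e.
  by rewrite /dg e mulr0 mul0r.
have [c ec] := root_comb ra; rewrite ec; apply: memv_suml => i _.
have [-> | iq] := eqVneq i q.
  move: ha; rewrite ec dg_comb => /eqP; rewrite intr_eq0 => /eqP ->.
  by rewrite mulr0z mem0v.
rewrite -scaler_int; apply/memvZ/memv_span/map_f.
by rewrite mem_filter iq mem_enum.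
Qed.

Lemma graded_rootsE q (k : int) a : graded_roots al q k a <-> roots a /\ dg q a = k%:~R.
Proof.
split=> [[ra [c [e <-]]]|[ra ha]]; split=> //; first by rewrite e dg_comb.
have [c ec] := root_comb ra; exists c; split=> //.
by move: ha; rewrite ec dg_comb => /eqP; rewrite eqr_int => /eqP.
Qed.

End Simple.

Section Reflection.
Context {C : numClosedFieldType} {R : realFieldType} {rp : real_part C R}.
Context {g : lie_algebra C} {h : {vspace g}}.
Context {bil : bilinear_lie g} {hc : is_cartan h} {nd : nondeg_killing g}.
Implicit Types (a c u v : hdual h).

Definition sr c a : hdual h := a - re_inj (real_part := rp) (2 * root_form a c / root_form c c) *: c.

Lemma sr_isw c a : roots c -> isw a -> isw (sr c a).
Proof.
move=> rc wa; have [n e w] := refl_isw rc wa.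
have c0 : root_form c c != 0 by rewrite gt_eqF // rf_gt0.
by rewrite /sr e mulfK // rmorph_int scaler_int.
Qed.
Lemma srD c u v : sr c (u + v) = sr c u + sr c v.
Proof. by rewrite /sr rfDl mulrDr mulrDl rmorphD scalerDl opprD addrACA. Qed.
Lemma srN c u : sr c (- u) = - sr c u.
Proof. by rewrite /sr rfNl mulrN mulNr rmorphN scaleNr opprD. Qed.
Lemma srB c u v : sr c (u - v) = sr c u - sr c v. Proof. by rewrite srD srN. Qed.
Lemma sr_rf c u v : roots c -> root_form (sr c u) (sr c v) = root_form u v.
Proof.
move=> rc; rewrite /sr !rfDl !rfDr !rfNl !rfNr !rfZl !rfZr (rfC c v).
have c0 : root_form c c != 0 by rewrite gt_eqF // rf_gt0.
by field.
Qed.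
Lemma sr_id c : roots c -> sr c c = - c.
Proof.
move=> rc; have c0 : root_form c c != 0 by rewrite gt_eqF // rf_gt0.
by rewrite /sr mulfK // rmorph_nat scaler_nat mulr2n opprD addNKr // addrA subrr add0r.
Qed.
Lemma srZ c (k : R) u : sr c (re_inj k *: u) = re_inj k *: sr c u.
Proof. by rewrite /sr rfZl scalerBr scalerA -rmorphM; congr (_ - re_inj _ *: _); ring. Qed.
Lemma srK c : roots c -> involutive (sr c).
Proof.
move=> rc u; rewrite {2}/sr srB srZ sr_id // /sr; vring.
Qed.
Lemma sr_root c a : roots c -> roots a -> roots (sr c a).
Proof.
move=> rc ra; apply: isw_roots; first by apply: sr_isw => //; exact: roots_isw.
apply/eqP => e; have := roots_neq0 ra; rewrite -(srK rc a) e.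
by rewrite /sr rf0l mulr0 mul0r rmorph0 scale0r subrr eqxx.
Qed.
End Reflection.

(** * Gradings *)

Class two_step (C : numClosedFieldType) (g : lie_algebra C) (h b : {vspace g}) n
    (al : 'I_n -> hdual h) q : Prop :=
  two_stepP : brv (nilrad b al q) (brv (nilrad b al q) (nilrad b al q)) = 0%VS.

Section Grading.
Context {C : numClosedFieldType} {R : realFieldType} {rp : real_part C R}.
Context {g : lie_algebra C} {h : {vspace g}}.
Context {bil : bilinear_lie g} {hc : is_cartan h} {nd : nondeg_killing g}.
Context {b : {vspace g}} {n : nat} {al : 'I_n -> hdual h} {ss : simple_system b al}.
Context {q : 'I_n} {ts : two_step b al q}.
Implicit Types (a c u v : hdual h) (x y z H : g).
Local Notation pos := (pos_roots (h := h) b).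
Local Notation dq := (dg (rp := rp) (al := al) q).
Local Notation ht := (height (rp := rp) (al := al)).

Lemma pos_ht0 a : pos a -> 0 < ht a. Proof. exact: ht_gt0. Qed.

Lemma posDw a c : pos a -> pos c -> isw (a + c) -> pos (a + c).
Proof.
move=> pa pc w; apply: (posD ss_borel) => //; apply/eqP => e.
have := addr_gt0 (pos_ht0 pa) (pos_ht0 pc).
by rewrite -htD e /height big1 ?ltxx // => i _; exact: dg0.
Qed.

Lemma dg_pos_case a : pos a -> dq a = 0 \/ 1 <= dq a.
Proof.
move=> /(dg_pos q) [[|k] ->]; first by left.
by right; rewrite ler1n.
Qed.

(** Induction on height. When one summand [c2] has degree zero, the other is split as [f1 + f2]; by
    the Jacobi identity a vector of weight [c2] has a nonzero bracket with a root vector of [f1] or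
    of [f2], and [c2] is absorbed there. *)
Lemma pos_split a : pos a -> 1 < dq a -> exists a1 a2,
  [/\ pos a1, pos a2, 0 < dq a1, 0 < dq a2 & a = a1 + a2].
Proof.
move=> pa; have [k _ ek] := ht_pos pa; have [N] := ubnP k.
elim: N k a pa ek => // N IH k a pa ek; rewrite ltnS => kN da.
have [a1 [a2 [p1 p2 e]]] : exists a1 a2, [/\ pos a1, pos a2 & a = a1 + a2].
  apply: contrapT => ns; have : simple_roots b a by split.
  rewrite -(@ss_range _ _ _ _ _ _ ss) => -[i _ ei]; move: da; rewrite -ei dg_al.
  by case: eqP => _; rewrite ?ltxx // ltr10.
have key c1 c2 : pos c1 -> pos c2 -> a = c1 + c2 -> dq c2 = 0 -> exists a1 a2,
    [/\ pos a1, pos a2, 0 < dq a1, 0 < dq a2 & a = a1 + a2].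
  move=> pc1 pc2 ea d2.
  have [k1 k10 e1] := ht_pos pc1; have [k2 k20 e2] := ht_pos pc2.
  have lt1 : (k1 < N)%N.
    apply: leq_trans kN; move: ek; rewrite ea htD e1 e2 -natrD => /eqP; rewrite eqr_nat => /eqP <-.
    by rewrite -[X in (X < _)%N]addn0 ltn_add2l.
  have d1 : 1 < dq c1 by move: da; rewrite ea dgD d2 addr0.
  have [f1 [f2 [pf1 pf2 df1 df2 ef]]] := IH k1 c1 pc1 e1 lt1 d1.
  have rt t : pos t -> roots t by exact: pos_root.
  have /iswP [x1 x1f x10] := roots_isw (rt _ pf1).
  have /iswP [x2 x2f x20] := roots_isw (rt _ pf2).
  have /iswP [y yf y0] := roots_isw (rt _ pc2).
  have w0 : br x1 x2 != 0.
    by apply: (br_neq0 (rt _ pf1) (rt _ pf2) _ x1f x2f x10 x20); rewrite -ef; apply/roots_isw/rt.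
  have wf : br x1 x2 \in root_space c1 by rewrite ef; exact: br_root_space.
  have : br y (br x1 x2) != 0.
    apply: (br_neq0 (rt _ pc2) (rt _ pc1) _ yf wf y0 w0).
    by rewrite addrC -ea; apply/roots_isw/rt.
  rewrite jac; have [z1 | n1 _] := eqVneq (br y x1) 0.
    rewrite z1 br0l add0r; have [-> | n2 _] := eqVneq (br y x2) 0; first by rewrite br0r eqxx.
    exists f1, (c2 + f2); split=> //; last by rewrite ea ef; vring.
      by apply: posDw => //; apply/iswP; exists (br y x2) => //; exact: br_root_space.
    by rewrite dgD d2 add0r.
  exists (c2 + f1), f2; split=> //; last by rewrite ea ef; vring.
    by apply: posDw => //; apply/iswP; exists (br y x1) => //; exact: br_root_space.
  by rewrite dgD d2 add0r.
have [d1 | d1] := dg_pos_case p1; first by apply: (key a2 a1) => //; rewrite addrC.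
have [d2 | d2] := dg_pos_case p2; first exact: (key a1 a2).
by exists a1, a2; split=> //; apply: lt_le_trans ltr01 _.
Qed.

Lemma nilrad_rootsE a : (pos `\` levi_roots al q)%classic a <-> roots a /\ 0 < dq a.
Proof.
split=> [[pa nl]|[ra da]].
  have ra := pos_root pa; split=> //; have [d0|] := dg_pos_case pa; last exact: lt_le_trans.
  by case: nl; apply/levi_rootsE.
split; first exact: (dg_gt0_pos ra da).
by move/levi_rootsE => [_ e]; move: da; rewrite e ltxx.
Qed.

Lemma root_sum_mem (A : set (hdual h)) a x : (forall c, A c -> roots c) -> A a ->
  x \in root_space a -> x \in root_sum A.
Proof. by move=> /root_sumP [h1 _] /h1 /subvP; apply. Qed.

Lemma nilrad_mem a x : roots a -> 0 < dq a -> x \in root_space a -> x \in nilrad b al q.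
Proof.
move=> ra da; apply: root_sum_mem; first by move=> c /nilrad_rootsE [].
by apply/nilrad_rootsE.
Qed.

(** A root of degree above 2 would be a sum of three roots of positive degree whose root vectors
    have a nonzero iterated bracket, against two-step nilpotency. *)
Lemma dg_le2 a : roots a -> dq a <= 2.
Proof.
move=> ra; rewrite leNgt; apply/negP => da.
have pa : pos a by apply: (dg_gt0_pos ra (lt_trans _ da)).
have rt t : pos t -> roots t by exact: pos_root.
have key c1 c2 : pos c1 -> pos c2 -> 0 < dq c2 -> a = c1 + c2 -> 1 < dq c1 -> False.
  move=> pc1 pc2 d2 ea d1.
  have [f1 [f2 [pf1 pf2 df1 df2 ef]]] := pos_split pc1 d1.
  have /iswP [x1 x1f x10] := roots_isw (rt _ pf1).
  have /iswP [x2 x2f x20] := roots_isw (rt _ pf2).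
  have /iswP [y yf y0] := roots_isw (rt _ pc2).
  have w0 : br x1 x2 != 0.
    by apply: (br_neq0 (rt _ pf1) (rt _ pf2) _ x1f x2f x10 x20); rewrite -ef; apply/roots_isw/rt.
  have wf : br x1 x2 \in root_space c1 by rewrite ef; exact: br_root_space.
  have /negP : br y (br x1 x2) != 0.
    apply: (br_neq0 (rt _ pc2) (rt _ pc1) _ yf wf y0 w0).
    by rewrite addrC -ea; apply/roots_isw/rt.
  apply; rewrite -memv0 -(@two_stepP _ _ _ _ _ _ _ ts).
  apply: brv_mem; first exact: (nilrad_mem (rt _ pc2) d2 yf).
  by apply: brv_mem; [exact: (nilrad_mem (rt _ pf1) df1 x1f) | exact: (nilrad_mem (rt _ pf2) df2 x2f)].
have d1 : 1 < dq a by apply: lt_trans da; rewrite ltr1n.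
have [a1 [a2 [p1 p2 dp1 dp2 e]]] := pos_split pa d1.
have [k1 e1] := dg_pos q p1; have [k2 e2] := dg_pos q p2.
move: da dp1 dp2; rewrite e dgD e1 e2 -natrD !ltr_nat !ltr0n => da k10 k20.
have [l1 | l1] := ltnP 1 k1.
  by apply: (key a1 a2) => //; rewrite ?e1 ?e2 ?ltr0n ?ltr1n.
by apply: (key a2 a1) => //; rewrite ?e1 ?e2 ?ltr0n ?ltr1n //; [rewrite addrC | lia].
Qed.

Lemma dg_ge2 a : roots a -> - 2 <= dq a.
Proof. by move/rootsN/dg_le2; rewrite dgN lerNl. Qed.

Definition lp a := (levi_roots al q `&` pos_roots b)%classic a.
Lemma lpE a : lp a <-> pos a /\ dq a = 0.
Proof.
split=> [[/levi_rootsE [_ ?] ?]|[pa da]] //; split=> //; apply/levi_rootsE; split=> //.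
exact: (pos_root pa).
Qed.

Lemma lp_or_neg a : roots a -> dq a = 0 -> lp a \/ lp (- a).
Proof.
move=> ra da; have [p | p] := root_pos_or_neg (ss := ss) ra; [left | right]; apply/lpE => //.
by rewrite dgN da oppr0.
Qed.

(** If [a] were a sum of two positive roots, one of them would have degree 0 and could be
    subtracted; hence [a] is simple, and [al q] is the only simple root of degree 1. *)
Lemma grade1_lowest a : roots a -> dq a = 1 -> (forall c, lp c -> ~ isw (a - c)) -> a = al q.
Proof.
move=> ra da na; have pa : pos a by apply: (dg_gt0_pos ra (q := q)); rewrite da ltr01.
have : simple_roots b a.
  split=> // -[a1 [a2 [p1 p2 e]]].
  have rt t : pos t -> roots t by exact: pos_root.
  have [k1 e1] := dg_pos q p1; have [k2 e2] := dg_pos q p2.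
  have : (k1 + k2 = 1)%N by apply/eqP; rewrite -(eqr_nat R) natrD -e1 -e2 -dgD -e da.
  case: k1 e1 => [|k1] e1 => [_|].
    by apply: (na a1); [apply/lpE | rewrite e [a1 + a2]addrC addrK; apply/roots_isw/rt].
  case: k2 e2 => [|k2] e2; last by lia.
  by move=> _; apply: (na a2); [apply/lpE | rewrite e addrK; apply/roots_isw/rt].
rewrite -(@ss_range _ _ _ _ _ _ ss) => -[i _ ei]; move: da; rewrite -ei dg_al.
by case: eqP => [-> //|_] /eqP; rewrite eq_sym oner_eq0.
Qed.

Lemma dgZ (k : R) a : dq (re_inj k *: a) = k * dq a.
Proof. by rewrite /dg rfZr; ring. Qed.
Lemma dg_sr c a : dq c = 0 -> dq (sr c a) = dq a.
Proof. by move=> dc; rewrite /sr dgD dgN dgZ dc mulr0 subr0. Qed.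

(* Both a + c and a - c being roots is invariant under reflection, and impossible for a = mu; descending
   by reflections in the roots of l keeps this property and ends at the lowest root of g(1). *)
Lemma highest_length mu : roots mu -> dq mu = 1 -> (forall c, lp c -> ~ isw (mu + c)) ->
  root_form mu mu = root_form (al q) (al q).
Proof.
move=> rmu dmu hmu.
pose E a := forall c, roots c -> dq c = 0 -> isw (a + c) -> isw (a - c) -> False.
assert (main : forall (N k : nat) a, (k < N)%N -> roots a -> dq a = 1 -> ht a = k%:R ->
    root_form a a = root_form mu mu -> E a -> root_form mu mu = root_form (al q) (al q)).

  elim=> // N IH k a; rewrite ltnS => kN ra da hta na Ea.
  have [[c [lc rac]]|nc] := pselect (exists c, lp c /\ 0 < root_form a c).
    have [pc dc] := proj1 (lpE c) lc; have rc := pos_root pc.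
    have rs : roots (sr c a) by exact: sr_root.
    have ds : dq (sr c a) = 1 by rewrite dg_sr.
    have ps : pos (sr c a) by apply: (dg_gt0_pos (q := q) rs); rewrite ds ltr01.
    have [k' _ ek'] := ht_pos ps.
    apply: (IH k' (sr c a)) => //; last 2 first.
    - by rewrite sr_rf.
    - move=> f rf' df w1 w2; apply: (Ea (sr c f)).
      + exact: sr_root.
      + by rewrite dg_sr.
      + by rewrite -[a](srK rc) -srD; apply: sr_isw.
      by rewrite -[a](srK rc) -srB; apply: sr_isw.
    apply: leq_trans kN; rewrite -(ltr_nat R) -ek' -hta.
    have [m em _] := refl_isw rc (roots_isw ra).
    have m0 : 0 < m by have [<- _] := rf_int_sign rc em.
    rewrite /sr em mulfK ?gt_eqF ?rf_gt0 // rmorph_int scaler_int htD htN htZz.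
    by rewrite gtrBl mulr_gt0 ?ltr0z // pos_ht0.
  rewrite -na; suff -> : a = al q by [].
  (* No positive root of l pairs positively with [a] any more, so if [a - c] were a weight, [a + c]
     would be one too, which [E] forbids. *)
  apply: grade1_lowest => // c lc w.
  have [pc dc] := proj1 (lpE c) lc; have rc := pos_root pc.
  apply: (Ea c) => //; apply: (rts_skip rc (roots_isw ra)) => //.
  by rewrite leNgt; apply/negP => p; apply: nc; exists c.
have pm : pos mu by apply: (dg_gt0_pos (q := q) rmu); rewrite dmu ltr01.
have [k _ ek] := ht_pos pm; apply: (main k.+1 k mu) => // c rc dc w1 w2.
by have [/hmu //|/hmu] := lp_or_neg rc dc.
Qed.

(** The grading element: the vector dual to the fundamental weight, scaled to have eigenvalue [dq a]
    on the root space of [a]. *)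
Definition Hq : g := re_inj (real_part := rp) (2 / root_form (al q) (al q)) *: hvec (lam (al := al) q).
Lemma Hq_h : Hq \in h. Proof. by apply/memvZ/hvec_h. Qed.
Lemma br_Hq a x : isw a -> x \in root_space a -> br Hq x = re_inj (dq a) *: x.
Proof.
move=> wa xa; rewrite /Hq brZl (br_hvec _ xa) scalerA hformC (realw_lam q wa) -rmorphM.
by congr (re_inj _ *: _); rewrite /dg mulrAC.
Qed.

(** Degrees are taken as eigenvalues of [Hq]. Unlike [gr] this also covers degree 0, where it
    describes the Levi factor, and degrees add under brackets by the Jacobi identity. *)
Definition graded (k : int) x : Prop := br Hq x = k%:~R *: x.
Lemma Gr0 k : graded k 0. Proof. by rewrite /graded br0r scaler0. Qed.
Lemma GrD k x y : graded k x -> graded k y -> graded k (x + y).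
Proof. by rewrite /graded brDr scalerDr => -> ->. Qed.
Lemma GrZ k (s : C) x : graded k x -> graded k (s *: x).
Proof. by rewrite /graded brZr => ->; rewrite !scalerA mulrC. Qed.
Lemma GrN k x : graded k x -> graded k (- x).
Proof. by rewrite /graded brNr scalerN => ->. Qed.
Lemma Gr_br i j x y : graded i x -> graded j y -> graded (i + j) (br x y).
Proof. by rewrite /graded jac => -> ->; rewrite brZl brZr -scalerDl -rmorphD. Qed.
Lemma Gr_br0 k x y : graded 0 x -> graded k y -> graded k (br x y).
Proof. by move=> gx gy; rewrite -[k]add0r; exact: Gr_br. Qed.
Lemma Gr_uniq i j x : graded i x -> graded j x -> i != j -> x = 0.
Proof.
rewrite /graded => -> e ij; apply/eqP; move/eqP: e; rewrite -subr_eq0 -scalerBl -rmorphB scaler_eq0.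
by rewrite intr_eq0 subr_eq0 (negPf ij).
Qed.
Lemma Gr_killing i j x y : graded i x -> graded j y -> i + j != 0 -> killing x y = 0.
Proof.
move=> gx gy ij; have e := killing_invN Hq x y; rewrite gx gy killingZl killingZr in e.
apply: (mulfI (_ : (i + j)%:~R != 0 :> C)); first by rewrite intr_eq0.
by rewrite mulr0 rmorphD mulrDl e addNr.
Qed.
Lemma Gr_root a x (k : int) : isw a -> dq a = k%:~R -> x \in root_space a -> graded k x.
Proof. by move=> wa e xa; rewrite /graded (br_Hq wa xa) e rmorph_int. Qed.

Lemma h_stable_full : h_stable (h := h) {:g}. Proof. by move=> *; exact: memvf. Qed.

Lemma Gr_sep k : exists2 W : {vspace g}, h_stable (h := h) W & forall x, x \in W <-> graded k x.
Proof.
have [|s x y gx gy|W hW] := @vspace_of _ _ (graded k); [exact: Gr0 | by apply: GrD => //; exact: GrZ |].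
exists W => // H x Hh /hW gx; apply/hW.
by rewrite /graded jac (cartan_abelian Hq_h Hh) br0l add0r gx brZr.
Qed.

Lemma Gr_ind k (P : g -> Prop) : P 0 -> (forall x y, P x -> P y -> P (x + y)) ->
  (k = 0 -> forall x, x \in h -> P x) ->
  (forall a x, roots a -> dq a = k%:~R -> x \in root_space a -> P x) -> forall x, graded k x -> P x.
Proof.
move=> P0 PD Ph Pr; have [W hs hW] := Gr_sep k.
suff H x : x \in W -> P x by move=> x /hW /H.
apply: (weight_ind hs) => // a {}x xW xa; have [-> // | x0] := eqVneq x 0.
have wa : isw a by apply/iswP; exists x.
have e : dq a = k%:~R.
  move/hW: xW; rewrite /graded (br_Hq wa xa) => /eqP; rewrite -subr_eq0 -scalerBl scaler_eq0 (negPf x0) orbF.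
  by rewrite subr_eq0 -(rmorph_int (re_inj (real_part := rp))) => /eqP /fmorph_inj.
have [a0 | a0] := eqVneq a 0; last by apply: (Pr a) => //; exact: isw_roots.
apply: Ph; last by rewrite -root_space0 -a0.
by apply/eqP; rewrite -(intr_eq0 R) -e a0 dg0.
Qed.

Lemma h_Gr0 x : x \in h -> graded 0 x.
Proof. by move=> xh; rewrite /graded (cartan_abelian Hq_h xh) scale0r. Qed.

Lemma grP (k : int) x : k != 0 -> x \in gr al q k <-> graded k x.
Proof.
move=> k0; have rg a : graded_roots al q k a -> roots a by case.
split.
  move: x; apply: (proj2 (root_sumP rg)); [exact: Gr0 | by move=> *; exact: GrD |].
  move=> a x /(proj1 (graded_rootsE (rp := rp) q k a)) [ra da].
  by apply: Gr_root => //; exact: roots_isw.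
move: x; apply: Gr_ind; [exact: mem0v | by move=> *; exact: memvD | by move=> e; rewrite e in k0 |].
by move=> a x ra da xa; apply: (root_sum_mem rg _ xa); apply/(graded_rootsE (rp := rp)).
Qed.

Lemma leviP x : x \in levi al q <-> graded 0 x.
Proof.
have rg a : levi_roots al q a -> roots a by case.
split.
  case/memv_addP => u uh [v vl ->]; apply: GrD; first exact: h_Gr0.
  move: v vl; apply: (proj2 (root_sumP rg)); [exact: Gr0 | by move=> *; exact: GrD |].
  by move=> a y /(levi_rootsE (rp := rp)) [ra da]; apply: Gr_root => //; exact: roots_isw.
move: x; apply: Gr_ind; [exact: mem0v | by move=> *; exact: memvD | |].
  by move=> _ x; apply: (subvP (addvSl _ _)).
move=> a x ra da xa; apply: (subvP (addvSr _ _)); apply: (root_sum_mem rg _ xa).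
by apply/levi_rootsE.
Qed.

Lemma Gr_big k x : 2 < k -> graded k x -> x = 0.
Proof.
move=> k2; move: x; apply: Gr_ind => // [x y -> ->|k0|a x ra da xa]; first exact: addr0.
  by move: k2; rewrite k0.
by have := dg_le2 ra; rewrite da -[2]/(2%:Z%:~R) ler_int leNgt k2.
Qed.

Lemma Gr_small k x : k < - 2 -> graded k x -> x = 0.
Proof.
move=> k2; move: x; apply: Gr_ind => // [x y -> ->|k0|a x ra da xa]; first exact: addr0.
  by move: k2; rewrite k0.
by have := dg_ge2 ra; rewrite da -[- 2]/((- 2%:Z)%:~R) ler_int leNgt k2.
Qed.

Lemma nilradP x : x \in nilrad b al q <-> exists u v : g, [/\ graded 1 u, graded 2 v & x = u + v].
Proof.
have rg a : (pos `\` levi_roots al q)%classic a -> roots a by case/nilrad_rootsE.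
split.
  move: x; apply: (proj2 (root_sumP rg)).
  - by exists 0, 0; split; [exact: Gr0 | exact: Gr0 | rewrite addr0].
  - move=> _ _ [u [v [gu gv ->]]] [u' [v' [gu' gv' ->]]].
    by exists (u + u'), (v + v'); split; [exact: GrD | exact: GrD | rewrite addrACA].
  move=> a x /nilrad_rootsE [ra da] xa; have [k ek] := dg_int q ra.
  have k0 : 0 < k by move: da; rewrite ek ltr0z.
  have k2 : k <= 2 by have := dg_le2 ra; rewrite ek -[2]/(2%:Z%:~R) ler_int.
  have [k1 | k1] := eqVneq k 1.
    exists x, 0; split; [|exact: Gr0|by rewrite addr0].
    by apply: (Gr_root (roots_isw ra) _ xa); rewrite ek k1.
  have k2' : k = 2 by lia.
  exists 0, x; split; [exact: Gr0| |by rewrite add0r].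
  by apply: (Gr_root (roots_isw ra) _ xa); rewrite ek k2'.
move=> [u [v [gu gv ->]]]; apply: memvD.
  move: u gu; apply: Gr_ind; [exact: mem0v | by move=> *; exact: memvD | by [] |].
  by move=> a y ra da ya; apply: (nilrad_mem ra _ ya); rewrite da.
move: v gv; apply: Gr_ind; [exact: mem0v | by move=> *; exact: memvD | by [] |].
by move=> a y ra da ya; apply: (nilrad_mem ra _ ya); rewrite da ltr0z.
Qed.

Lemma nilrad_oppP x : x \in nilrad_opp al q <-> exists u v : g, [/\ graded (-1) u, graded (-2) v & x = u + v].
Proof.
split.
  by case/memv_addP => u /grP gu [v /grP gv ->]; exists u, v; split; [exact: gu | exact: gv |].
by move=> [u [v [gu gv ->]]]; apply: memv_add; apply/grP.
Qed.

Lemma parabP x : x \in parab b al q <-> exists u v w : g, [/\ graded 0 u, graded 1 v, graded 2 w & x = u + v + w].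
Proof.
split.
  case/memv_addP => u /leviP gu [_ /nilradP [v [w [gv gw ->]]] ->].
  by exists u, v, w; split=> //; rewrite addrA.
move=> [u [v [w [gu gv gw ->]]]]; rewrite -addrA; apply: memv_add; first exact/leviP.
by apply/nilradP; exists v, w.
Qed.

Lemma Gr_dec x : exists x' : int -> g, (forall k, graded k (x' k)) /\
  x = x' (-2) + x' (-1) + x' 0 + x' 1 + x' 2.
Proof.
move: x (memvf x); apply: (weight_ind h_stable_full).
- by exists (fun => 0); split=> [k|]; [exact: Gr0 | rewrite !addr0].
- move=> x y [x' [gx ->]] [y' [gy ->]]; exists (fun k => x' k + y' k); split; last by vring.
  by move=> k; apply: GrD.
move=> a x _ xa; have [-> | x0] := eqVneq x 0.
  by exists (fun => 0); split=> [k|]; [exact: Gr0 | rewrite !addr0].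
have wa : isw a by apply/iswP; exists x.
have [k [ek k2 k2']] : exists k : int, [/\ dq a = k%:~R, -2 <= k & k <= 2].
  have [a0 | a0] := eqVneq a 0; first by exists 0; rewrite a0 dg0.
  have ra := isw_roots wa a0; have [k ek] := dg_int q ra; exists k; split=> //.
    by have := dg_ge2 ra; rewrite ek -[- 2]/((- 2%:Z)%:~R) ler_int.
  by have := dg_le2 ra; rewrite ek -[2]/(2%:Z%:~R) ler_int.
exists (fun j => if j == k then x else 0); split.
  by move=> j; case: eqP => [->|_]; [exact: (Gr_root wa ek xa) | exact: Gr0].
have : [|| k == -2, k == -1, k == 0, k == 1 | k == 2] by lia.
by case/or4P => [|||/orP []] /eqP -> /=; rewrite ?addr0 ?add0r.
Qed.

Lemma Gr_nondeg k x : graded k x -> (forall y, graded (- k) y -> killing x y = 0) -> x = 0.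
Proof.
move=> gx hx; apply: nd => y; have [y' [gy ->]] := Gr_dec y.
rewrite !killingDr.
have H j : killing x (y' j) = 0.
  have [kj | kj] := eqVneq (k + j) 0; last exact: (Gr_killing gx (gy j)).
  by apply: hx; have -> : - k = j by lia.
by rewrite !H !addr0.
Qed.

(** The vector dual to the weight lies in [h], hence is orthogonal to all root spaces. The Killing
    pairing thus replaces the projection onto [h], and its invariance becomes available. *)
Lemma fund_charE Y : fund_char al q Y = killing (hvec (lam (al := al) q)) Y.
Proof.
have rg a : (@roots _ _ h) a -> roots a by [].
have d0 : (h :&: root_sum (@roots _ _ h) = 0)%VS.
  apply/eqP; rewrite -subv0; apply/subvP => x; rewrite memv_cap memv0 => /andP [xh xr].
  apply/eqP; apply: (killing_h_nondeg xh) => y yh.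
  move: x xr {xh}; apply: (proj2 (root_sumP rg)); first exact: killing0l.
    by move=> x z ex ez; rewrite killingDl ex ez addr0.
  move=> a x ra xa; apply: (killing_root_space xa (b := 0)); first by rewrite root_space0.
  by rewrite addr0 (roots_neq0 ra).
have [u [v [uh vr ->]]] : exists u v : g, [/\ u \in h, v \in root_sum (@roots _ _ h) & Y = u + v].
  move: Y (memvf Y); apply: (weight_ind h_stable_full).
  - by exists 0, 0; rewrite !mem0v addr0.
  - move=> _ _ [u [v [uh vh ->]]] [u' [v' [uh' vh' ->]]].
    by exists (u + u'), (v + v'); rewrite !memvD // addrACA.
  move=> a x _ xa; have [a0 | a0] := eqVneq a 0.
    by exists x, 0; rewrite mem0v addr0 -root_space0 -a0.
  have [-> | x0] := eqVneq x 0; first by exists 0, 0; rewrite !mem0v addr0.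
  have ra : roots a by apply: isw_roots => //; apply/iswP; exists x.
  by exists 0, x; rewrite mem0v add0r (root_sum_mem rg ra xa).
rewrite /fund_char (daddv_pi_l d0 uh vr) killingDr -(killing_hvec _ uh).
suff -> : killing (hvec (lam (al := al) q)) v = 0 by rewrite addr0.
move: v vr; apply: (proj2 (root_sumP rg)); first exact: killing0r.
  by move=> x z ex ez; rewrite killingDr ex ez addr0.
move=> a x ra xa; apply: (killing_root_space (a := 0) _ xa); first by rewrite root_space0 hvec_h.
by rewrite add0r (roots_neq0 ra).
Qed.

End Grading.

(** * Modules over the Levi factor *)

Class lie_module (C : numClosedFieldType) (g : lie_algebra C) (E : vectType C)
    (act : g -> E -> E) : Prop := LieModule {
  act_linl : forall c x y v, act (c *: x + y) v = c *: act x v + act y v;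
  act_linr : forall c x u v, act x (c *: u + v) = c *: act x u + act x v;
  act_br : forall x y v, act (br x y) v = act x (act y v) - act y (act x v) }.

Section Act.
Context {C : numClosedFieldType} {g : lie_algebra C} {E : vectType C} {act : g -> E -> E}.
Context {lm : lie_module act}.
Implicit Types (x y : g) (u v : E).
Lemma actDl x y v : act (x + y) v = act x v + act y v.
Proof. by rewrite -[x]scale1r act_linl !scale1r. Qed.
Lemma act0l v : act 0 v = 0.
Proof. by have /eqP := actDl 0 0 v; rewrite addr0 addrC -subr_eq subrr eq_sym => /eqP. Qed.
Lemma actZl c x v : act (c *: x) v = c *: act x v.
Proof. by rewrite -[c *: x]addr0 act_linl act0l addr0. Qed.
Lemma actDr x u v : act x (u + v) = act x u + act x v.
Proof. by rewrite -[u]scale1r act_linr !scale1r. Qed.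
Lemma act0r x : act x 0 = 0.
Proof. by have /eqP := actDr x 0 0; rewrite addr0 addrC -subr_eq subrr eq_sym => /eqP. Qed.
Lemma actZr c x v : act x (c *: v) = c *: act x v.
Proof. by rewrite -[c *: v]addr0 act_linr act0r addr0. Qed.
Lemma actBr x u v : act x (u - v) = act x u - act x v.
Proof. by rewrite -scaleN1r actDr actZr scaleN1r. Qed.
Lemma act_sumr I r (P : pred I) (F : I -> E) x :
  act x (\sum_(i <- r | P i) F i) = \sum_(i <- r | P i) act x (F i).
Proof. by apply: (big_morph (act x)); [move=> ? ?; exact: actDr | exact: act0r]. Qed.

Lemma act_comm x y v : br x y = 0 -> act x (act y v) = act y (act x v).
Proof. by move=> e; apply/eqP; rewrite -subr_eq0 -act_br e act0l. Qed.

Definition actf x : 'End(E) := linfun (act x).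
Lemma actfE x v : actf x v = act x v.
Proof.
pose L : {linear E -> E} := HB.pack (act x) (GRing.isLinear.Build _ _ _ _ (act x) (fun c a b => act_linr c x a b)).
by rewrite /actf -[act x]/(L : E -> E) lfunE.
Qed.
End Act.

#[global] Instance ad_module (C : numClosedFieldType) (g : lie_algebra C) (bil : bilinear_lie g) :
  lie_module (@lie_br _ g).
Proof.
split=> [c x y v|c x u v|x y v]; [exact: lie_br_linl | exact: brR |].
by rewrite jac addrK.
Qed.

Section LeviModule.
Context {C : numClosedFieldType} {R : realFieldType} {rp : real_part C R}.
Context {g : lie_algebra C} {h : {vspace g}}.
Context {bil : bilinear_lie g} {hc : is_cartan h} {nd : nondeg_killing g}.
Context {b : {vspace g}} {n : nat} {al : 'I_n -> hdual h} {ss : simple_system b al}.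
Context {q : 'I_n} {ts : two_step b al q}.
Context {E : vectType C} {act : g -> E -> E} {lm : lie_module act}.
Implicit Types (a : hdual h) (x y z H : g) (u v w : E).
Local Notation pos := (pos_roots (h := h) b).
Local Notation dq := (dg (rp := rp) (al := al) q).
Local Notation ht := (height (rp := rp) (al := al)).
Local Notation lp := (lp (b := b) (al := al) (q := q)).
Local Notation levi := (levi al q).
Local Notation stable := (levi_stable al q act).

Lemma h_levi x : x \in h -> x \in levi.
Proof. exact: (subvP (addvSl _ _)). Qed.
Lemma root_levi a x : roots a -> dq a = 0 -> x \in root_space a -> x \in levi.
Proof. by move=> ra da xa; apply/leviP; apply: (Gr_root (roots_isw ra) _ xa). Qed.

Lemma levi_br x y : x \in levi -> y \in levi -> br x y \in levi.
Proof.
move=> /(leviP (rp := rp)) gx /(leviP (rp := rp)) gy; apply/(leviP (rp := rp)).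
have e : graded (rp := rp) (al := al) (q := q) (0 + 0) (br x y) by exact: Gr_br.
by rewrite addr0 in e.
Qed.

Lemma real_argmin (s : seq C) : s != [::] -> exists2 c, c \in s &
  forall c' : C, c' \in s -> re_part (real_part := rp) c <= re_part c'.
Proof.
elim: s => // c [|d s] IH _; first by exists c => [|c']; rewrite inE // => /eqP ->.
have [//|m ms hm] := IH.
have [l | l] := leP (re_part (real_part := rp) c) (re_part m).
  exists c; first exact: mem_head.
  by move=> c'; rewrite inE => /orP [/eqP -> //|/hm]; exact: le_trans.
exists m; first by rewrite inE ms orbT.
by move=> c'; rewrite inE => /orP [/eqP ->|/hm //]; exact: ltW.
Qed.

(** It acts on root spaces by height, so its eigenvalues order the weights of a module. *)
Definition H0 : g := \sum_(i < n) Hq (rp := rp) (al := al) (q := i).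
Lemma H0_h : H0 \in h. Proof. by apply: memv_suml => i _; exact: Hq_h. Qed.
Lemma br_H0 a x : isw a -> x \in root_space a -> br H0 x = re_inj (ht a) *: x.
Proof.
move=> wa xa; rewrite /H0 br_suml.
have -> : re_inj (ht a) = \sum_(i < n) re_inj (real_part := rp) (dg (rp := rp) (al := al) i a).
  exact: rmorph_sum.
by rewrite scaler_suml; apply: eq_bigr => i _; exact: br_Hq.
Qed.

Lemma common_eigen (s : seq g) (W : {vspace E}) : (forall x, x \in s -> x \in h) ->
  (forall x u, x \in h -> u \in W -> act x u \in W) -> W != 0%VS ->
  exists v, [/\ v \in W, v != 0 & forall x, x \in s -> exists c, act x v = c *: v].
Proof.
elim: s W => [|x s IH] W hs st W0.
  by exists (vpick W); rewrite memv_pick vpick0.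
have xh : x \in h by apply: hs; exact: mem_head.
have sf : (actf (act := act) x @: W <= W)%VS.
  by apply/limg_memP => u uW; rewrite actfE; apply: st.
have [c [v [vW v0 ev]]] := eigen_stable sf W0.
have [|k u w [uW eu] [wW ew]|W' hW'] := @vspace_of _ _ (fun u => u \in W /\ act x u = c *: u).
- by rewrite mem0v act0r scaler0.
- split; first by apply: memvD => //; exact: memvZ.
  by rewrite actDr actZr eu ew scalerDr !scalerA mulrC.
have [||| w [wW' w0 hw]] := IH W'.
- by move=> y ys; apply: hs; rewrite inE ys orbT.
- move=> y u yh /hW' [uW eu]; apply/hW'; split; first exact: st.
  by rewrite (act_comm _ (cartan_abelian xh yh)) eu actZr.
- apply/negP => /eqP e; move/negP: v0; apply; rewrite -memv0 -e; apply/hW'.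
  by rewrite -actfE.
have [wW ew] := proj1 (hW' w) wW'; exists w; split=> // y.
by rewrite inE => /orP [/eqP -> | /hw //]; exists c.
Qed.

Lemma weight_vector (W : {vspace E}) :
  (forall x u, x \in h -> u \in W -> act x u \in W) -> W != 0%VS ->
  exists v (chi : hdual h), [/\ v \in W, v != 0 & forall H, H \in h -> act H v = wt chi H *: v].
Proof.
move=> st W0; have [|v [vW v0 hv]] := common_eigen (s := vbasis h) _ st W0.
  by move=> x xs; exact: vbasis_mem.
have hv' H : H \in h -> exists c, act H v = c *: v.
  move=> Hh; rewrite (coord_vbasis Hh).
  apply: (big_ind (fun H => exists c, act H v = c *: v)).
  - by exists 0; rewrite act0l scale0r.
  - by move=> x y [c ec] [d ed]; exists (c + d); rewrite actDl ec ed scalerDl.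
  move=> i _; have [|c ec] := hv (vbasis h)`_i; first by apply: mem_nth; rewrite size_tuple.
  by exists (coord (vbasis h) i H * c); rewrite actZl ec scalerA.
have [i vi] : exists i, vco i v != 0.
  apply: contrapT => hn; move/eqP: v0; apply; apply: vco_ext => i; rewrite vco0.
  by apply/eqP/negPn/negP => n0; apply: hn; exists i.
have [|chi hchi] := @hdual_of _ _ h (fun x => vco i (act x v) / vco i v).
  by move=> k x y; rewrite act_linl vcoD vcoZ mulrDl mulrA.
exists v, chi; split=> // H Hh; have [c ec] := hv' H Hh.
by rewrite ec hchi // ec vcoZ mulfK.
Qed.

(** Among the eigenvalues of [H0] on [K] take one of least real part: a negative root vector of l
    would lower it by a positive height. A weight vector is then chosen inside that eigenspace. *)
Lemma lowest_vector (K : {vspace E}) : stable K -> K != 0%VS ->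
  exists v (chi : hdual h), [/\ v \in K, v != 0, forall H, H \in h -> act H v = wt chi H *: v &
    forall a x, lp a -> x \in root_space (- a) -> act x v = 0].
Proof.
move=> st K0.
have sth x u : x \in h -> u \in K -> act x u \in K by move=> xh; apply: st; exact: h_levi.
have [s [_ sc _]] := tr_eigen (actf (act := act) H0).
pose ev c := `[< exists u, [/\ u \in K, u != 0 & act H0 u = c *: u] >].
have s0 : [seq c <- s | ev c] != [::].
  have [v [chi [vK v0 hv]]] := weight_vector sth K0.
  have : wt chi H0 \in [seq c <- s | ev c].
    rewrite mem_filter; apply/andP; split; last by apply: (sc _ v) => //; rewrite actfE hv // H0_h.
    by apply/asboolP; exists v; rewrite hv // H0_h.
  by case: [seq _ <- _ | _].
have [c] := real_argmin s0; rewrite mem_filter => /andP [/asboolP [u [uK u0 eu]] _] hmin.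
have [|k w w' [wW ew] [wW' ew']|W hW] := @vspace_of _ _ (fun w => w \in K /\ act H0 w = c *: w).
- by rewrite mem0v act0r scaler0.
- split; first by apply: memvD => //; exact: memvZ.
  by rewrite actDr actZr ew ew' scalerDr !scalerA mulrC.
have W0 : W != 0%VS.
  by apply/negP => /eqP e; move/negP: u0; apply; rewrite -memv0 -e; apply/hW.
have stW x w : x \in h -> w \in W -> act x w \in W.
  move=> xh /hW [wK ew]; apply/hW; split; first exact: sth.
  by rewrite (act_comm _ (cartan_abelian H0_h xh)) ew actZr.
have [v [chi [vW v0 hv]]] := weight_vector stW W0; have [vK e] := proj1 (hW v) vW.
exists v, chi; split=> // a x la xa; apply/eqP/negPn/negP => n0.
have [pa da] := proj1 (lpE a) la.
have ra : roots (- a) by exact: rootsN (pos_root pa).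
have eH : act H0 (act x v) = (c - re_inj (ht a)) *: act x v.
  have eb : act (br H0 x) v = act H0 (act x v) - act x (act H0 v) by exact: act_br.
  rewrite (br_H0 (roots_isw ra) xa) e actZl actZr in eb.
  by apply: (eq_by (esym eb)); rewrite htN rmorphN; vring.
have xK : act x v \in K.
  by apply: st => //; apply: (root_levi ra _ xa); rewrite dgN da oppr0.
have hm : c - re_inj (ht a) \in [seq c <- s | ev c].
  rewrite mem_filter (sc _ (act x v)) ?actfE // andbT; apply/asboolP; by exists (act x v).
have := hmin _ hm; rewrite raddfB /= re_injK.
have p : 0 < ht a by exact: ht_gt0.
by rewrite lerBrDr gerDl leNgt p.
Qed.

(* The least subspace containing v and stable under the negative root vectors of l is l-stable. *)
Lemma highest_generates (V W : {vspace E}) v (nu : hdual h) :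
  levi_irreducible al q act V -> v \in V -> v != 0 ->
  (forall H, H \in h -> act H v = wt nu H *: v) ->
  (forall a x, lp a -> x \in root_space a -> act x v = 0) ->
  v \in W -> (forall a x w, lp a -> x \in root_space (- a) -> w \in V -> w \in W -> act x w \in W) ->
  (V <= W)%VS.
Proof.
move=> [stV _ irr] vV v0 hv ev vW fW.
pose good (U : {vspace E}) := [/\ (U <= V)%VS, v \in U &
  forall a x w, lp a -> x \in root_space (- a) -> w \in U -> act x w \in U].
have lneg a x : lp a -> x \in root_space (- a) -> x \in levi.
  move=> la xa; have [pa da] := proj1 (lpE (rp := rp) a) la.
  by apply: (root_levi (rootsN (pos_root pa)) _ xa); rewrite dgN da oppr0.
have ex : exists k, `[< exists2 U, good U & \dim U = k >].
  by exists (\dim V); apply/asboolP; exists V => //; split=> // a x w la xa wV; apply: stV => //; exact: lneg xa.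
have [U [UV vU fU] dU] : exists2 U, good U & \dim U = ex_minn ex by case: ex_minnP => k /asboolP.
have minU U' : good U' -> (U' <= U)%VS -> U' = U.
  move=> gU' sU; apply/eqP; rewrite eqEdim sU dU; case: ex_minnP => k _; apply.
  by apply/asboolP; exists U'.
(* [U] has least dimension among the candidates. The vectors of [U] that l maps into [U] form
   another candidate inside it, so they exhaust [U], and [U] is l-stable. *)
have [|k w w' [wU hw] [wU' hw']|U' hU'] := @vspace_of _ _ (fun w => w \in U /\ forall x, x \in levi -> act x w \in U).
- by split=> [|x _]; rewrite ?act0r mem0v.
- split=> [|x xl]; first by apply: memvD => //; exact: memvZ.
  by rewrite act_linr; apply: memvD; [apply: memvZ; exact: hw | exact: hw'].
have sU' : (U' <= U)%VS by apply/subvP => w /hU' [].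
have gU' : good U'.
  split; [exact: subv_trans sU' UV | |].
    apply/hU'; split=> // x /leviP; move: x; apply: Gr_ind.
    - by rewrite act0l mem0v.
    - by move=> x y hx hy; rewrite actDl memvD.
    - by move=> _ x xh; rewrite hv // memvZ.
    move=> a x ra da xa; have [la | la] := lp_or_neg (ss := ss) ra da.
      by rewrite (ev a x la xa) mem0v.
    by apply: (fU (- a)) => //; rewrite opprK.
  move=> a x w la xa /hU' [wU hw]; apply/hU'; split; first exact: (fU a x w la xa wU).
  move=> y yl; have xl := lneg a x la xa.
  have -> : act y (act x w) = act (br y x) w + act x (act y w) by rewrite act_br subrK.
  apply: memvD; last by apply: (fU a) => //; exact: hw.
  by apply: hw; exact: levi_br.
have eU := minU U' gU' sU'.
have stU : stable U by move=> x w xl; rewrite -eU => /hU' [_]; rewrite eU; apply.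
have [e | e] := irr U stU UV.
  by move: vU; rewrite e memv0 (negPf v0).
rewrite -e -(minU (U :&: W)%VS) ?capvSr ?capvSl //; split.
- by apply: subv_trans UV; exact: capvSl.
- by rewrite memv_cap vU.
move=> a x w la xa; rewrite !memv_cap => /andP [wU wW].
by rewrite (fU a) //= (fW a) //; exact: (subvP UV).
Qed.

End LeviModule.

(** * The Casimir operator of the Levi factor *)

Section Casimir.
Context {C : numClosedFieldType} {R : realFieldType} {rp : real_part C R}.
Context {g : lie_algebra C} {h : {vspace g}}.
Context {bil : bilinear_lie g} {hc : is_cartan h} {nd : nondeg_killing g}.
Context {b : {vspace g}} {n : nat} {al : 'I_n -> hdual h} {ss : simple_system b al}.
Context {q : 'I_n} {ts : two_step b al q}.
Implicit Types (a : hdual h) (x y H : g).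
Local Notation dq := (dg (rp := rp) (al := al) q).
Local Notation lp := (lp (b := b) (al := al) (q := q)).
Local Notation levi := (levi al q).

(** This is [(nu, nu + 2 rho)], where [2 rho] is the sum of the positive roots of l. *)
Definition casimir_value (nu : hdual h) : C :=
  hform nu nu + \sum_(c <- rts | `[< lp c >]) hform nu c.

(** Dual bases of l under the Killing form of [g], described by the expansions they provide. The
    last clause, quantified over all modules, is the value of the Casimir operator on a highest
    weight vector. *)
Definition dual_pairs (P : seq (g * g)) : Prop :=
  [/\ forall z, z \in P -> z.1 \in levi /\ z.2 \in levi,
      forall x, x \in levi -> x = \sum_(z <- P) killing x z.1 *: z.2,
      forall x, x \in levi -> x = \sum_(z <- P) killing x z.2 *: z.1 &
      forall (E : vectType C) (act : g -> E -> E) (lm : lie_module act) v (nu : hdual h),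
        (forall H, H \in h -> act H v = wt nu H *: v) ->
        (forall a x, lp a -> x \in root_space a -> act x v = 0) ->
        \sum_(z <- P) act z.1 (act z.2 v) = casimir_value nu *: v].

Lemma h_pairs : exists P : seq (g * g),
  [/\ forall z, z \in P -> z.1 \in h /\ z.2 \in h,
      forall x, x \in h -> x = \sum_(z <- P) killing x z.1 *: z.2 &
      forall x, x \in h -> x = \sum_(z <- P) killing x z.2 *: z.1].
Proof.
have ex (i : 'I_(\dim h)) : {y | y \in h /\ forall x, x \in h -> killing y x = coord (vbasis h) i x}.
  apply: cid.
  have [c x y z|c x y z|x xh|c x y|y yh hy] := @form_represent _ _ (fun x y => killing x y) h (coord (vbasis h) i).
  - exact: killing_linl.
  - exact: killing_linr.
  - exact: killing_h_nondeg.
  - by rewrite linearP.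
  by exists y.
pose hd i := sval (ex i).
have hdh i : hd i \in h by case: (svalP (ex i)).
have hdE i x : x \in h -> killing (hd i) x = coord (vbasis h) i x.
  by move=> xh; have [_] := svalP (ex i); apply.
have bh (i : 'I_(\dim h)) : (vbasis h)`_i \in h.
  by apply: vbasis_mem; apply: mem_nth; rewrite size_tuple.
exists [seq ((vbasis h)`_(i : 'I_(\dim h)), hd i) | i <- index_enum 'I_(\dim h)].
have e2 x : x \in h -> x = \sum_i killing x (hd i) *: (vbasis h)`_i.
  by move=> xh; rewrite {1}(coord_vbasis xh); apply: eq_bigr => i _; rewrite killingC hdE.
split=> [z /mapP [i _ ->]|x xh|x xh]; [by split; [exact: bh | exact: hdh] | | by rewrite big_map; exact: e2].
rewrite big_map.
apply/eqP; rewrite -subr_eq0; apply/eqP; apply: killing_h_nondeg.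
  by apply: memvB => //; apply: memv_suml => i _; apply: memvZ; exact: hdh.
move=> y yh /=; rewrite killingDl killingNl killing_suml {1}(e2 y yh) killing_sumr.
rewrite -sumrB big1 // => i _; rewrite killingZl killingZr (killingC y) (killingC (hd i)).
by rewrite mulrC subrr.
Qed.

Lemma dual_pairs_ex : exists P, dual_pairs P.
Proof.
have [Ph [Phh Ph1 Ph2]] := h_pairs.
have ex (a : hdual h) : {p : g * g | roots a ->
    [/\ p.1 \in root_space a, p.2 \in root_space (- a) & killing p.1 p.2 = 1]}.
  apply: cid; have [ra | nra] := pselect (roots a); last by exists (0, 0).
  by have [x [y [h1 h2 h3]]] := root_pair ra; exists (x, y).
pose p a := sval (ex a).
have pP a : roots a -> [/\ (p a).1 \in root_space a, (p a).2 \in root_space (- a) & killing (p a).1 (p a).2 = 1].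
  exact: svalP (ex a).
pose lr := [seq a <- (@rts _ _ h bil) | dq a == 0].
have lrP a : a \in lr -> roots a /\ dq a = 0.
  by rewrite mem_filter => /andP [/eqP da /rtsP ra].
have lru : uniq lr by apply: filter_uniq; exact: rts_uniq.
have lrN a : roots a -> dq a = 0 -> - a \in lr.
  move=> ra da; rewrite mem_filter dgN da oppr0 eqxx /=; apply/rtsP.
  exact: rootsN.
exists (Ph ++ [seq p a | a <- lr]).
have lev z : z \in Ph ++ [seq p a | a <- lr] -> z.1 \in levi /\ z.2 \in levi.
  rewrite mem_cat => /orP [/Phh [z1 z2]|/mapP [a /lrP [ra da] ->]]; first by split; exact: h_levi.
  have [pa1 pa2 _] := pP a ra; split; first exact: (root_levi ra da pa1).
  have ra' : roots (- a) by exact: rootsN.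
  by apply: (root_levi ra' _ pa2); rewrite dgN da oppr0.
have kh a x y : roots a -> x \in h -> y \in root_space a -> killing x y = 0.
  move=> ra xh ya; apply: (killing_root_space (a := 0) _ ya); first by rewrite root_space0.
  by rewrite add0r roots_neq0.
(* Both expansions are instances of one: [s] is the identity or the sign change, according to which
   member of a pair serves as the test vector. *)
have complete (f f' : g * g -> g) (s : hdual h -> hdual h) :
    (forall a c, s a = c -> a = s c) ->
    (forall z, z \in Ph -> f z \in h) ->
    (forall x, x \in h -> x = \sum_(z <- Ph) killing x (f z) *: f' z) ->
    (forall a, a \in lr -> [/\ s a \in lr, f (p a) \in root_space (s a),
       f' (p a) \in root_space (- s a) & killing (f' (p a)) (f (p a)) = 1]) ->
    forall x, x \in levi -> x = \sum_(z <- Ph ++ [seq p a | a <- lr]) killing x (f z) *: f' z.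
  move=> sK fh ch fr x /(leviP (rp := rp)); move: x; apply: Gr_ind.
  - by rewrite big1 // => z _; rewrite killing0l scale0r.
  - move=> x y ex' ey; rewrite {1}ex' {1}ey -big_split; apply: eq_bigr => z _.
    by rewrite killingDl scalerDl.
  - move=> _ x xh; rewrite big_cat /= -ch // big_map big_seq big1 ?addr0 // => a /fr [sa fa _ _].
    by rewrite (kh (s a)) ?scale0r //; case/lrP: sa.
  move=> a x ra da xa; rewrite big_cat /= [X in X + _]big_seq big1 ?add0r => [|z zP]; last first.
    by rewrite killingC (kh a) ?scale0r //; exact: fh.
  have al' : s (- a) \in lr by have [] := fr _ (lrN a ra da).
  rewrite big_map (bigD1_seq (s (- a))) //= big_seq_cond big1 ?addr0 => [|c /andP [cl ca]].
    have [_ p1 p2 p3] := fr _ al'.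
    have e : s (s (- a)) = - a by rewrite -(sK (- a) (s (- a))).
    rewrite e opprK in p1 p2.
    have p20 : f' (p (s (- a))) != 0.
      by apply/eqP => e'; move: p3; rewrite e' killing0l => /eqP; rewrite eq_sym oner_eq0.
    have [k ek] := root_dim1 ra p2 p20 xa.
    by rewrite ek killingZl p3 mulr1.
  have [_ p1 _ _] := fr c cl; rewrite (killing_root_space xa p1) ?scale0r //.
  apply: contra ca => /eqP e; apply/eqP; apply: sK.
  by apply/eqP; rewrite -addr_eq0 addrC e.
split=> //.
- apply: (complete fst snd id) => // [z /Phh [] //|a al']; split=> //.
  + by have [] := pP a (proj1 (lrP a al')).
  + by have [] := pP a (proj1 (lrP a al')).
  by rewrite killingC; have [] := pP a (proj1 (lrP a al')).
- apply: (complete snd fst -%R) => // [a c <-|z /Phh [] //|a al']; first by rewrite opprK.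
  have [ra da] := lrP a al'; have [p1 p2 p3] := pP a ra.
  by split; rewrite ?opprK //; exact: lrN.
move=> E act lm v nu hv ev; rewrite big_cat big_map scalerDl; congr (_ + _).
  have -> : hform nu nu = \sum_(z <- Ph) wt nu z.1 * wt nu z.2.
    have e := Ph1 _ (hvec_h nu); rewrite hform_wt {1}e wt_sumr.
    apply: eq_big_seq => z /Phh [z1 z2]; rewrite wtZr killing_hvec //.
  rewrite scaler_suml; apply: eq_big_seq => z /Phh [z1 z2].
  by rewrite hv // actZr hv // scalerA mulrC.
rewrite big_filter scaler_suml [RHS]big_mkcond [LHS]big_mkcond.
apply: eq_big_seq => a /rtsP ra; have [p1 p2 p3] := pP a ra.
case: ifPn => [/eqP da | da]; last first.
  case: ifPn => // /asboolP /(lpE (rp := rp)) [_ da']; by rewrite da' eqxx in da.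
have [la | la] := lp_or_neg (ss := ss) ra da.
  have -> : `[< lp a >] by apply/asboolP.
  have e : act (p a).1 (act (p a).2 v) = act (br (p a).1 (p a).2) v + act (p a).2 (act (p a).1 v).
    by rewrite act_br subrK.
  rewrite e (ev a _ la p1) act0r addr0 (br_opp p1 p2) p3 scale1r hv ?hvec_h //.
  by rewrite hform_wt.
case: ifPn => [/asboolP /(lpE (rp := rp)) [pa _]|_].
  by have [pna _] := proj1 (lpE (rp := rp) _) la; case: (pos_opp ss_borel ss_hb pa pna).
by rewrite (ev _ _ la p2) act0r.
Qed.

Section Invariance.
Variable P : seq (g * g).
Hypothesis PP : dual_pairs P.
Context {E : vectType C} {act : g -> E -> E} {lm : lie_module act}.
Implicit Types (u v w : E).

Definition cas v := \sum_(z <- P) act z.1 (act z.2 v).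

(** Expanding the first member of each pair in the dual basis produces a double sum that is
    symmetric in the two members. *)
Lemma cas_sym (F : vectType C) (Phi : g -> g -> F) :
  (forall c x y z, Phi (c *: x + y) z = c *: Phi x z + Phi y z) ->
  (forall c x y z, Phi z (c *: x + y) = c *: Phi z x + Phi z y) ->
  \sum_(z <- P) Phi z.1 z.2 = \sum_(z <- P) Phi z.2 z.1.
Proof.
move=> Pl Pr; have [Pm P1 P2 _] := PP.
have l0 z : Phi 0 z = 0 by have := Pl (-1) 0 0 z; rewrite scaler0 addr0 scaleN1r addNr.
have r0 z : Phi z 0 = 0 by have := Pr (-1) 0 0 z; rewrite scaler0 addr0 scaleN1r addNr.
have sl (G : g * g -> g) (k : g * g -> C) z : Phi (\sum_(w <- P) k w *: G w) z = \sum_(w <- P) k w *: Phi (G w) z.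
  by elim: (P) => [|w s IH]; rewrite ?big_nil // !big_cons Pl IH.
have sr' (G : g * g -> g) (k : g * g -> C) z : Phi z (\sum_(w <- P) k w *: G w) = \sum_(w <- P) k w *: Phi z (G w).
  by elim: (P) => [|w s IH]; rewrite ?big_nil // !big_cons Pr IH.
transitivity (\sum_(z <- P) \sum_(w <- P) killing z.1 w.1 *: Phi w.2 z.2).
  by apply: eq_big_seq => z /Pm [z1 _]; rewrite {1}(P1 _ z1) sl.
rewrite exchange_big; apply: eq_big_seq => z /Pm [z1 _].
by rewrite [in RHS](P1 _ z1) sr'; apply: eq_bigr => w _; rewrite killingC.
Qed.

(** The tensor formed by the pairs is l-invariant: [ad x] is skew, so its matrix in one basis is
    minus the transpose of its matrix in the dual one. *)
Lemma cas_inv (F : vectType C) (Phi : g -> g -> F) x : x \in levi ->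
  (forall c x y z, Phi (c *: x + y) z = c *: Phi x z + Phi y z) ->
  (forall c x y z, Phi z (c *: x + y) = c *: Phi z x + Phi z y) ->
  \sum_(z <- P) (Phi (br x z.1) z.2 + Phi z.1 (br x z.2)) = 0.
Proof.
move=> xl Pl Pr; have [Pm P1 P2 _] := PP.
have l0 z : Phi 0 z = 0 by have := Pl (-1) 0 0 z; rewrite scaler0 addr0 scaleN1r addNr.
have r0 z : Phi z 0 = 0 by have := Pr (-1) 0 0 z; rewrite scaler0 addr0 scaleN1r addNr.
have sl (G : g * g -> g) (k : g * g -> C) z : Phi (\sum_(w <- P) k w *: G w) z = \sum_(w <- P) k w *: Phi (G w) z.
  by elim: (P) => [|w s IH]; rewrite ?big_nil // !big_cons Pl IH.
have sr' (G : g * g -> g) (k : g * g -> C) z : Phi z (\sum_(w <- P) k w *: G w) = \sum_(w <- P) k w *: Phi z (G w).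
  by elim: (P) => [|w s IH]; rewrite ?big_nil // !big_cons Pr IH.
rewrite big_split /=.
have -> : \sum_(z <- P) Phi z.1 (br x z.2) = \sum_(z <- P) \sum_(w <- P) killing (br x z.2) w.1 *: Phi z.1 w.2.
  apply: eq_big_seq => z /Pm [_ z2]; rewrite {1}(P1 (br x z.2)) ?sr' //.
  exact: levi_br.
rewrite exchange_big /= -big_split big_seq big1 // => w /Pm [w1 _].
rewrite {1}(P2 (br x w.1)) ?sl; last exact: levi_br.
rewrite -big_split big1 //= => z _.
by rewrite killing_invN killing_invN (killingC z.2) killing_invN (killingC w.1); vring.
Qed.

Lemma cas_comm x v : x \in levi -> act x (cas v) = cas (act x v).
Proof.
move=> xl; apply/eqP; rewrite -subr_eq0; apply/eqP.
rewrite -[RHS](@cas_inv _ (fun y z => act y (act z v)) x xl).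
- rewrite /cas act_sumr -sumrB; apply: eq_bigr => z _.
  by rewrite (act_br x z.1) (act_br x z.2) actBr; vring.
- by move=> c y z w; rewrite act_linl.
by move=> c y z w; rewrite act_linl act_linr.
Qed.

Lemma cas_lin c u v : cas (c *: u + v) = c *: cas u + cas v.
Proof.
rewrite /cas scaler_sumr -big_split; apply: eq_bigr => z _.
by rewrite !act_linr.
Qed.

Lemma casD u v : cas (u + v) = cas u + cas v.
Proof. by rewrite -[u]scale1r cas_lin !scale1r. Qed.
Lemma cas0 : cas 0 = 0.
Proof. by rewrite /cas big1 // => z _; rewrite !act0r. Qed.
Lemma casZ c v : cas (c *: v) = c *: cas v.
Proof. by rewrite -[c *: v]addr0 cas_lin cas0 addr0. Qed.

(** The eigenspace of the Casimir operator is l-stable and contains the highest weight vector, so it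
    is all of [V]. *)
Lemma cas_irreducible (V : {vspace E}) nu :
  levi_irreducible al q act V -> highest_weight b al q act V nu ->
  forall v, v \in V -> cas v = casimir_value nu *: v.
Proof.
move=> [stV _ irr] [v0 [v0V v00 hv ev]].
have [|c u w [uV eu] [wV ew]|U hU] := @vspace_of _ _ (fun v => v \in V /\ cas v = casimir_value nu *: v).
- by rewrite mem0v scaler0 cas0.
- split; first by apply: memvD => //; exact: memvZ.
  by rewrite cas_lin eu ew scalerDr !scalerA mulrC.
have stU : levi_stable al q act U.
  move=> x w xl /hU [wV ew]; apply/hU; split; first exact: stV.
  by rewrite -cas_comm // ew actZr.
have UV : (U <= V)%VS by apply/subvP => w /hU [].
have v0U : v0 \in U.
  apply/hU; split=> //; have [_ _ _ H] := PP; by rewrite /cas (H _ act lm v0 nu).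
have [e | e] := irr U stU UV; first by case: v00; apply/eqP; rewrite -memv0 -e.
by move=> v; rewrite -e => /hU [].
Qed.
End Invariance.

Lemma hw_root mu : highest_weight b al q (@lie_br _ g) (gr al q 1) mu ->
  [/\ roots mu, dq mu = 1 & forall c, lp c -> ~ isw (mu + c)].
Proof.
move=> [v [vg v0 hv ev]].
have vmu : v \in root_space mu by apply/root_spaceP.
have wmu : isw mu by apply/iswP; exists v => //; apply/eqP.
have gv : graded (rp := rp) (al := al) (q := q) 1 v by apply/grP.
have dmu : dq mu = 1.
  have e := br_Hq (rp := rp) (al := al) (q := q) wmu vmu.
  rewrite /graded in gv; rewrite gv scale1r in e.
  have e' : (re_inj (dq mu) - 1) *: v = 0 by rewrite scalerBl -e scale1r subrr.
  move/eqP: e'; rewrite scaler_eq0 => /orP [|/eqP //].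
  by rewrite subr_eq0 -(rmorph1 (re_inj (real_part := rp))) => /eqP /fmorph_inj.
have rmu : roots mu.
  apply: isw_roots => //; apply/eqP => e; move: dmu; rewrite e dg0 => /eqP.
  by rewrite eq_sym oner_eq0.
split=> // c lc w; have rc : roots c by have [/levi_rootsE [] ] := lc.
have /iswP [x xc x0] := roots_isw rc.
have v0' : v != 0 by apply/eqP.
have n0 : br x v != 0 by apply: (br_neq0 rc rmu _ xc vmu x0 v0'); rewrite addrC.
by rewrite (ev c x lc xc) eqxx in n0.
Qed.

(* Every nonzero l-submodule of g(1) contains the lowest root space, so the eigenvalues agree. *)
Lemma cas_g1 P mu : dual_pairs P -> highest_weight b al q (@lie_br _ g) (gr al q 1) mu ->
  forall x, graded (rp := rp) (al := al) (q := q) 1 x ->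
  cas P (act := @lie_br _ g) x = casimir_value mu *: x.
Proof.
move=> PP hmu; have [rmu dmu _] := hw_root hmu.
pose eigenp c x := graded (rp := rp) (al := al) (q := q) 1 x /\ cas P (act := @lie_br _ g) x = c *: x.
have low c x : eigenp c x -> x != 0 -> exists y, [/\ y \in root_space (al q), y != 0 & eigenp c y].
  move=> ex x0.
  have [|k u w [gu eu] [gw ew]|U hU] := @vspace_of _ _ (eigenp c).
  - split; first exact: Gr0.
    by rewrite scaler0 cas0.
  - split; first by apply: GrD => //; exact: GrZ.
    by rewrite cas_lin eu ew scalerDr !scalerA mulrC.
  have U0 : U != 0%VS.
    by apply/negP => /eqP e; move/negP: x0; apply; rewrite -memv0 -e; apply/hU.
  have stU : levi_stable al q (@lie_br _ g) U.
    move=> y w yl /hU [gw ew]; apply/hU; split; last by rewrite -cas_comm // ew brZr.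
    have gy : graded (rp := rp) (al := al) (q := q) 0 y by apply/leviP.
    by exact: Gr_br0.
  have [y [chi [yU y0 hy fy]]] := lowest_vector stU U0.
  have ychi : y \in root_space chi by apply/root_spaceP.
  have [gy ey] := proj1 (hU y) yU.
  have wchi : isw chi by apply/iswP; exists y.
  have dchi : dq chi = 1.
    have e := br_Hq (rp := rp) (al := al) (q := q) wchi ychi.
    rewrite /graded in gy; rewrite gy scale1r in e.
    have e' : (re_inj (dq chi) - 1) *: y = 0 by rewrite scalerBl -e scale1r subrr.
    move/eqP: e'; rewrite scaler_eq0 (negPf y0) orbF.
    by rewrite subr_eq0 -(rmorph1 (re_inj (real_part := rp))) => /eqP /fmorph_inj.
  have rchi : roots chi.
    apply: isw_roots => //; apply/eqP => e; move: dchi; rewrite e dg0 => /eqP.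
    by rewrite eq_sym oner_eq0.
  suff e : chi = al q by exists y; rewrite -e.
  apply: (grade1_lowest rchi dchi) => a la w.
  have ra : roots a by have [/levi_rootsE [] ] := la.
  have ra' : roots (- a) by exact: rootsN.
  have /iswP [z za z0] := roots_isw ra'.
  have n0 : br z y != 0 by apply: (br_neq0 ra' rchi _ za ychi z0 y0); rewrite addrC.
  by rewrite (fy a z la za) eqxx in n0.
have [v [vg v0 hv ev]] := hmu.
have ev' : eigenp (casimir_value mu) v.
  split; first exact/grP.
  by have [_ _ _ H] := PP; rewrite /cas (H _ (@lie_br _ g) _ v mu).
have v0' : v != 0 by apply/eqP.
have [y [yq y0 [gy ey]]] := low _ _ ev' v0'.
apply: Gr_ind => //.
- by rewrite scaler0 cas0.
- move=> x z ex ez; by rewrite scalerDr -ex -ez casD.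
move=> a x ra da xa; have [-> | x0] := eqVneq x 0.
  by rewrite scaler0 cas0.
have gx : graded (rp := rp) (al := al) (q := q) 1 x by exact: (Gr_root (roots_isw ra) da xa).
have cxa : cas P (act := @lie_br _ g) x \in root_space a.
  apply/root_spaceP => H Hh; have e := cas_comm PP (act := @lie_br _ g) x (h_levi Hh).
  rewrite e; move/root_spaceP: xa => -> //.
  by rewrite casZ.
have [c ec] := root_dim1 ra xa x0 cxa.
have [y' [y'q y'0 [gy' ey']]] := low c x (conj gx ec) x0.
have [k ek] := root_dim1 (al_root q) y'q y'0 yq.
have k0 : k != 0 by apply: contraNneq y0 => k0; rewrite ek k0 scale0r.
rewrite ec; congr (_ *: _).
have e : casimir_value mu *: y = c *: y.
  by rewrite -ey ek casZ ey' !scalerA mulrC.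
have e' : (casimir_value mu - c) *: y = 0 by rewrite scalerBl e subrr.
by move/eqP: e'; rewrite scaler_eq0 (negPf y0) orbF subr_eq0 => /eqP.
Qed.

End Casimir.

(** * Tensors, their invariant form and their endomorphisms *)

Section Tensors.
Context {C : numClosedFieldType} {g : lie_algebra C} {bil : bilinear_lie g}.
Implicit Types (x y z a b c d : g) (S T : tensor g) (f k : 'End(g)) (U V : {vspace g}).
Local Notation e := (vbasis {:g}).

Lemma tens_entry x y i j : tens x y i j = vco i x * vco j y.
Proof. by rewrite /tens !mxE big_ord1 !mxE. Qed.

Lemma lin_entry (s : C) S T i j : (s *: S + T) i j = s * S i j + T i j.
Proof. by rewrite mxE; congr (_ + _); rewrite mxE. Qed.
Lemma tens_linl (s : C) x y z : tens (s *: x + y) z = s *: tens x z + tens y z.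
Proof. by apply/matrixP => i j; rewrite lin_entry !tens_entry vcoD vcoZ; ring. Qed.
Lemma tens_linr (s : C) x y z : tens z (s *: x + y) = s *: tens z x + tens z y.
Proof. by apply/matrixP => i j; rewrite lin_entry !tens_entry vcoD vcoZ; ring. Qed.
Lemma tens0l z : tens 0 z = 0.
Proof. by apply/matrixP => i j; rewrite tens_entry mxE vco0 mul0r. Qed.
Lemma tens0r z : tens z 0 = 0.
Proof. by apply/matrixP => i j; rewrite tens_entry mxE vco0 mulr0. Qed.
Lemma tensZl (s : C) x z : tens (s *: x) z = s *: tens x z.
Proof. by rewrite -[s *: x]addr0 tens_linl tens0l addr0. Qed.
Lemma tensDl x y z : tens (x + y) z = tens x z + tens y z.
Proof. by rewrite -[x]scale1r tens_linl !scale1r. Qed.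
Lemma tensDr x y z : tens z (x + y) = tens z x + tens z y.
Proof. by rewrite -[x]scale1r tens_linr !scale1r. Qed.
Lemma tensNr x z : tens z (- x) = - tens z x.
Proof. by rewrite -scaleN1r -[_ *: x]addr0 tens_linr tens0r addr0 scaleN1r. Qed.
Lemma entryD S T i j : (S + T) i j = S i j + T i j. Proof. by rewrite mxE. Qed.
Lemma entryN S i j : (- S) i j = - S i j. Proof. by rewrite mxE. Qed.
Definition mxD_entry := (entryD, entryN).
Lemma tensNl x z : tens (- x) z = - tens x z.
Proof. by rewrite -scaleN1r tensZl scaleN1r. Qed.

Lemma tens_ind (P : tensor g -> Prop) : P 0 -> (forall S T, P S -> P T -> P (S + T)) ->
  (forall x y, P (tens x y)) -> forall T, P T.
Proof.
move=> P0 PD Pp T.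
have -> : T = \sum_i \sum_j tens (T i j *: e`_i) e`_j.
  rewrite {1}[T]matrix_sum_delta; apply: eq_bigr => i _; apply: eq_bigr => j _.
  apply/matrixP => k l; rewrite tens_entry !mxE vcoZ /vco !coord_free ?(basis_free (vbasisP _)) //.
  by rewrite -mulrA -natrM mulnb (eq_sym i) (eq_sym j).
by apply: big_ind => // i _; apply: big_ind.
Qed.

Lemma tensv_ind U V (P : tensor g -> Prop) : P 0 -> (forall S T, P S -> P T -> P (S + T)) ->
  (forall x y, x \in U -> y \in V -> P (tens x y)) -> forall T, T \in tensv U V -> P T.
Proof.
move=> P0 PD Pp T; rewrite /tensv => hT.
have [s hs] : exists s : seq (tensor g), s = [seq tens x y | x <- vbasis U, y <- vbasis V] by eexists.
rewrite -hs in hT; rewrite (coord_span (X := in_tuple s) hT).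
apply: big_ind => // i _; have : (in_tuple s)`_i \in s by apply: mem_nth.
rewrite [in X in _ \in X]hs => /allpairsP [[x y] /= [xU yV ->]].
by rewrite -tensZl; apply: Pp; [apply/memvZ/vbasis_mem | exact: vbasis_mem].
Qed.

Lemma tens_map_linr f k (s : C) S T : tens_map f k (s *: S + T) = s *: tens_map f k S + tens_map f k T.
Proof. by rewrite /tens_map mulmxDr mulmxDl -scalemxAr -scalemxAl. Qed.
Lemma tens_mapD f k S T : tens_map f k (S + T) = tens_map f k S + tens_map f k T.
Proof. by rewrite -[S]scale1r tens_map_linr !scale1r. Qed.
Lemma tens_map0 f k : tens_map f k 0 = 0.
Proof. by rewrite /tens_map mulmx0 mul0mx. Qed.
Lemma tens_map_pure f k x y : tens_map f k (tens x y) = tens (f x) (k y).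
Proof.
by rewrite /tens_map /tens !(rVof_app _ (vbasisP _)) trmx_mul !mulmxA.
Qed.

Lemma tens_act_linr x (s : C) S T : tens_act x (s *: S + T) = s *: tens_act x S + tens_act x T.
Proof. by rewrite /tens_act !tens_map_linr scalerDr addrACA. Qed.
Lemma tens_actD x S T : tens_act x (S + T) = tens_act x S + tens_act x T.
Proof. by rewrite -[S]scale1r tens_act_linr !scale1r. Qed.
Lemma tens_act0 x : tens_act x 0 = 0.
Proof. by rewrite /tens_act !tens_map0 addr0. Qed.
Lemma tens_act_pure x a b : tens_act x (tens a b) = tens (br x a) b + tens a (br x b).
Proof. by rewrite /tens_act !tens_map_pure !id_lfunE !adE. Qed.

#[local] Opaque tens_act tens_map.

#[global] Instance tens_module : lie_module (@tens_act _ g).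
Proof.
split=> [s x y T|s x S T|x y T]; last 1 first.
- move: T; apply: tens_ind; first by rewrite !tens_act0 subrr.
    move=> S T eS eT; rewrite (tens_actD (br x y) S T) (tens_actD x S T) (tens_actD y S T).
    rewrite (tens_actD x (tens_act y S) (tens_act y T)) (tens_actD y (tens_act x S) (tens_act x T)) eS eT.
    move: (tens_act x (tens_act y S)) (tens_act x (tens_act y T)) (tens_act y (tens_act x S)) (tens_act y (tens_act x T)).
    by move=> A B A' B'; rewrite opprD addrACA.
  move=> a b; rewrite !tens_act_pure !tens_actD !tens_act_pure.
  rewrite (act_br x y a) (act_br x y b) /= tensDl tensNl tensDr tensNr.
  by apply/matrixP => i j; rewrite !mxD_entry; ring.
- move: T; apply: tens_ind; first by rewrite !tens_act0 scaler0 addr0.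
    move=> S T eS eT; rewrite !(tens_actD _ S T) eS eT.
    move: (tens_act x S) (tens_act x T) (tens_act y S) (tens_act y T) => A B A' B'.
    by rewrite scalerDr addrACA.
  by move=> a b; rewrite !tens_act_pure !lie_br_linl tens_linl tens_linr scalerDr; apply: addrACA.
exact: tens_act_linr.
Qed.

Lemma tens_killing_linl (s : C) T T' S :
  tens_killing (s *: T + T') S = s * tens_killing T S + tens_killing T' S.
Proof.
rewrite /tens_killing mulr_sumr -big_split; apply: eq_bigr => i _.
rewrite mulr_sumr -big_split; apply: eq_bigr => j _.
rewrite mulr_sumr -big_split; apply: eq_bigr => k _.
rewrite mulr_sumr -big_split; apply: eq_bigr => l _.
by rewrite !mxE /=; ring.
Qed.
Lemma tens_killing_linr (s : C) T T' S :
  tens_killing S (s *: T + T') = s * tens_killing S T + tens_killing S T'.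
Proof.
rewrite /tens_killing mulr_sumr -big_split; apply: eq_bigr => i _.
rewrite mulr_sumr -big_split; apply: eq_bigr => j _.
rewrite mulr_sumr -big_split; apply: eq_bigr => k _.
rewrite mulr_sumr -big_split; apply: eq_bigr => l _.
by rewrite !mxE /=; ring.
Qed.
Lemma tens_killing0l S : tens_killing 0 S = 0.
Proof. by rewrite /tens_killing !big1 // => i _; rewrite big1 // => j _; rewrite big1 // => k _; rewrite big1 // => l _; rewrite mxE !mul0r. Qed.
Lemma tens_killing0r S : tens_killing S 0 = 0.
Proof. by rewrite /tens_killing !big1 // => i _; rewrite big1 // => j _; rewrite big1 // => k _; rewrite big1 // => l _; rewrite mxE mulr0 !mul0r. Qed.
Lemma tens_killingDl T T' S : tens_killing (T + T') S = tens_killing T S + tens_killing T' S.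
Proof. by rewrite -[T]scale1r tens_killing_linl scale1r mul1r. Qed.
Lemma tens_killingDr T T' S : tens_killing S (T + T') = tens_killing S T + tens_killing S T'.
Proof. by rewrite -[T]scale1r tens_killing_linr scale1r mul1r. Qed.
Lemma tens_killingZl s T S : tens_killing (s *: T) S = s * tens_killing T S.
Proof. by rewrite -[s *: T]addr0 tens_killing_linl tens_killing0l addr0. Qed.
Lemma tens_killingZr s T S : tens_killing S (s *: T) = s * tens_killing S T.
Proof. by rewrite -[s *: T]addr0 tens_killing_linr tens_killing0r addr0. Qed.
Lemma tens_killing_sumr I r (P : pred I) F S :
  tens_killing S (\sum_(i <- r | P i) F i) = \sum_(i <- r | P i) tens_killing S (F i).
Proof. by apply: (big_morph (tens_killing S)); [move=> ? ?; exact: tens_killingDr | exact: tens_killing0r]. Qed.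

Lemma killing_coord x y : killing x y = \sum_i \sum_k vco i x * vco k y * killing e`_i e`_k.
Proof.
rewrite {1}(coord_vbasis (memvf x)) killing_suml; apply: eq_bigr => i _.
rewrite {1}(coord_vbasis (memvf y)) killing_sumr; apply: eq_bigr => k _.
by rewrite killingZl killingZr mulrA.
Qed.

Lemma tens_killing_pure a b c d : tens_killing (tens a b) (tens c d) = killing a c * killing b d.
Proof.
rewrite (killing_coord a) (killing_coord b) mulr_suml /tens_killing; apply: eq_bigr => i _.
rewrite exchange_big mulr_suml; apply: eq_bigr => k _.
rewrite mulr_sumr; apply: eq_bigr => j _; rewrite mulr_sumr; apply: eq_bigr => l _.
by rewrite !tens_entry; ring.
Qed.

Lemma tens_killing_inv z S T : tens_killing (tens_act z S) T = - tens_killing S (tens_act z T).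
Proof.
move: S; apply: tens_ind; first by rewrite tens_act0 !tens_killing0l oppr0.
  move=> S S' e1 e2; rewrite tens_actD (tens_killingDl (tens_act z S) (tens_act z S')).
  by rewrite (tens_killingDl S S') e1 e2 opprD.
move=> a b; move: T; apply: tens_ind; first by rewrite tens_act0 !tens_killing0r oppr0.
  move=> T T' e1 e2; rewrite tens_actD (tens_killingDr (tens_act z T) (tens_act z T')).
  by rewrite (tens_killingDr T T') e1 e2 opprD.
move=> c d; rewrite !tens_act_pure tens_killingDl tens_killingDr !tens_killing_pure.
by rewrite !(killing_invN z); ring.
Qed.

Definition rk1 a b : 'End(g) := linfun (fun x => killing b x *: a).
Lemma rk1E a b x : rk1 a b x = killing b x *: a.
Proof.
have lin : linear (fun x => killing b x *: a).
  by move=> s y z /=; rewrite killing_linr scalerDl scalerA.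
pose L : {linear g -> g} := HB.pack (fun x => killing b x *: a) (GRing.isLinear.Build _ _ _ _ _ lin).
have e : linfun L x = killing b x *: a by rewrite lfunE.
by rewrite -e.
Qed.
Lemma tr_rk1 a b : tr (rk1 a b) = killing b a.
Proof.
rewrite (tr_basis _ (vbasisP _)) [in RHS](coord_vbasis (memvf a)) killing_sumr.
by apply: eq_bigr => i _; rewrite rk1E killingZr linearZ /= mulrC.
Qed.

(** Identifies the tensor of [a] and [b] with the rank one map [rk1 a b], which makes traces and
    eigenvalues available. *)
Definition hat S : 'End(g) := \sum_i \sum_j S i j *: rk1 e`_i e`_j.
Lemma hat_lin s S T : hat (s *: S + T) = (s *: hat S + hat T)%R.
Proof.
rewrite /hat scaler_sumr -big_split; apply: eq_bigr => i _.
rewrite scaler_sumr -big_split; apply: eq_bigr => j _.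
by rewrite !mxE scalerDl scalerA.
Qed.
Lemma hat0 : hat 0 = 0.
Proof. by rewrite /hat big1 // => i _; rewrite big1 // => j _; rewrite mxE scale0r. Qed.
Lemma hatD S T : hat (S + T) = (hat S + hat T)%R.
Proof. by rewrite -[S]scale1r hat_lin !scale1r. Qed.
Lemma hatZ s S : hat (s *: S) = (s *: hat S)%R.
Proof. by rewrite -[s *: S]addr0 hat_lin hat0 addr0. Qed.
Lemma hat_pure a b x : hat (tens a b) x = killing b x *: a.
Proof.
rewrite /hat sum_lfunE [in RHS](coord_vbasis (memvf a)) scaler_sumr; apply: eq_bigr => i _.
rewrite sum_lfunE [in RHS](coord_vbasis (memvf b)) killing_suml scaler_suml; apply: eq_bigr => j _.
by rewrite scale_lfunE rk1E tens_entry killingZl !scalerA -/(vco i a) -/(vco j b); congr (_ *: _); ring.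
Qed.
Lemma hat_pureE a b : hat (tens a b) = rk1 a b.
Proof. by apply/lfunP => x; rewrite hat_pure rk1E. Qed.
Lemma hat_act z S x : hat (tens_act z S) x = br z (hat S x) - hat S (br z x).
Proof.
move: S; apply: tens_ind; first by rewrite tens_act0 hat0 !zero_lfunE br0r subrr.
  move=> S T e1 e2; rewrite tens_actD (hatD (tens_act z S) (tens_act z T)) (hatD S T).
  by rewrite !add_lfunE e1 e2 brDr; vring.
move=> a b; rewrite tens_act_pure hatD add_lfunE !hat_pure brZr.
by rewrite (killing_invN z) scaleNr.
Qed.
Lemma hat_killing S c d : tens_killing S (tens c d) = killing (hat S d) c.
Proof.
move: S; apply: tens_ind; first by rewrite tens_killing0l hat0 zero_lfunE killing0l.
  by move=> S T e1 e2; rewrite tens_killingDl hatD add_lfunE killingDl e1 e2.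
by move=> a b; rewrite tens_killing_pure hat_pure killingZl mulrC.
Qed.
Lemma hat_eq0 S T : (forall x, hat S x = 0) -> tens_killing S T = 0.
Proof.
move=> h0; move: T; apply: tens_ind; first exact: tens_killing0r.
  by move=> T T' e1 e2; rewrite tens_killingDr e1 e2 addr0.
by move=> c d; rewrite hat_killing h0 killing0l.
Qed.
End Tensors.

(** * Quadratic forms on g(1) attached to tensors *)

Section Form.
Context {C : numClosedFieldType} {R : realFieldType} {rp : real_part C R}.
Context {g : lie_algebra C} {h : {vspace g}}.
Context {bil : bilinear_lie g} {hc : is_cartan h} {nd : nondeg_killing g}.
Context {b : {vspace g}} {n : nat} {al : 'I_n -> hdual h} {ss : simple_system b al}.
Context {q : 'I_n} {ts : two_step b al q}.
Implicit Types (a c : hdual h) (x y z X Y : g) (S T : tensor g).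
Local Notation dq := (dg (rp := rp) (al := al) q).
Local Notation Gr := (graded (rp := rp) (al := al) (q := q)).
Local Notation lp := (lp (b := b) (al := al) (q := q)).
Local Notation levi := (levi al q).
Local Notation gr := (gr al q).

(** The coordinate functional, extended to [g] by a projection, is represented by some vector; only
    its component of degree [k'] matters, since the other components are orthogonal to [gr k]. *)
Lemma kdualP (k k' : int) (i : 'I_(\dim (gr k))) : k != 0 -> k + k' = 0 ->
  kdual (gr k') i \in gr k' /\
  forall j : 'I_(\dim (gr k)), killing (kdual (gr k') i) (vbasis (gr k))`_j = (i == j)%:R.
Proof.
move=> k0 kk.
apply: (@xgetPex _ 0 [set x | x \in gr k' /\ forall j : 'I_(\dim (gr k)),
  killing x (vbasis (gr k))`_j = (i == j)%:R]%classic).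
pose U := gr k.
have [s x y z|s x y z|x _ hx|s x y|x _ hx] := @form_represent _ _ (fun x y : g => killing x y) fullv
  (fun y => coord (vbasis U) i (projv U y)).
- exact: killing_linl.
- exact: killing_linr.
- by apply: nondeg => y; apply: hx; exact: memvf.
- by rewrite !linearP.
have [x' [gx' ex]] := Gr_dec (rp := rp) (al := al) (q := q) x.
have k'0 : k' != 0 by lia.
exists (x' k'); split; first by apply/(grP (rp := rp)).
move=> j; have jU : (vbasis U)`_j \in U by apply: vbasis_mem; apply: mem_nth; rewrite size_tuple.
have gj : Gr k (vbasis U)`_j by apply/(grP (rp := rp)).
have <- : killing x (vbasis U)`_j = (i == j)%:R.
  rewrite hx ?memvf // projv_id // coord_free ?(basis_free (vbasisP _)) //.
  by rewrite eq_sym.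
have H (m : int) : m != k' -> killing (x' m) (vbasis U)`_j = 0.
  by move=> mk; apply: (Gr_killing (gx' m) gj); lia.
(* A nonzero basis vector of degree [k] is at hand, so [k], and with it [k'], lies between -2 and 2,
   where [Gr_dec] has its components. *)
have kb : [|| k' == -2, k' == -1, k' == 0, k' == 1 | k' == 2].
  apply/negPn/negP => kb; have : (2 < k) || (k < -2) by lia.
  have vj0 : (vbasis U)`_j != 0 by apply: (free_not0 (basis_free (vbasisP U))); apply: mem_nth; rewrite size_tuple.
  by case/orP => [/Gr_big|/Gr_small] /(_ _ gj) e; rewrite e eqxx in vj0.
rewrite [in RHS]ex !killingDl.
case/or4P: kb => [|||/orP []] /eqP e.
- by rewrite e (H (-1)) ?(H 0) ?(H 1) ?(H 2) ?addr0 //; lia.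
- by rewrite e (H (-2)) ?(H 0) ?(H 1) ?(H 2) ?addr0 ?add0r //; lia.
- by rewrite e (H (-2)) ?(H (-1)) ?(H 1) ?(H 2) ?addr0 ?add0r //; lia.
- by rewrite e (H (-2)) ?(H (-1)) ?(H 0) ?(H 2) ?addr0 ?add0r //; lia.
by rewrite e (H (-2)) ?(H (-1)) ?(H 0) ?(H 1) ?addr0 ?add0r //; lia.
Qed.

Lemma kdual_mem k k' i : k != 0 -> k + k' = 0 -> Gr k' (kdual (U := gr k) (gr k') i).
Proof. by move=> k0 kk; apply/(grP (rp := rp)); [lia | have [] := kdualP i k0 kk]. Qed.

Lemma gr_basis (k : int) (i : 'I_(\dim (gr k))) : k != 0 -> Gr k (vbasis (gr k))`_i.
Proof.
by move=> k0; apply/(grP (rp := rp)) => //; apply: vbasis_mem; apply: mem_nth; rewrite size_tuple.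
Qed.

Lemma kdual_dec2 (k k' : int) x : k != 0 -> k + k' = 0 -> Gr k x ->
  x = \sum_(i < \dim (gr k)) killing x (kdual (gr k') i) *: (vbasis (gr k))`_i.
Proof.
move=> k0 kk gx; have xU : x \in gr k by apply/(grP (rp := rp)).
rewrite {1}(coord_vbasis xU); apply: eq_bigr => i _; congr (_ *: _).
have [_ hi] := kdualP i k0 kk.
rewrite [x in RHS](coord_vbasis xU) killing_suml (bigD1 i) //= killingZl killingC hi eqxx mulr1.
by rewrite big1 ?addr0 // => j ji; rewrite killingZl killingC hi eq_sym (negPf ji) mulr0.
Qed.

Lemma kdual_dec (k k' : int) (c : g) : k != 0 -> k + k' = 0 -> Gr k' c ->
  c = \sum_(i < \dim (gr k)) killing c (vbasis (gr k))`_i *: kdual (gr k') i.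
Proof.
move=> k0 kk gc; apply/eqP; rewrite -subr_eq0; apply/eqP.
apply: (Gr_nondeg (rp := rp) (al := al) (q := q) (k := k')).
  apply: GrD => //; apply: GrN; apply: big_ind; [exact: Gr0 | by move=> *; exact: GrD |].
  by move=> i _; apply: GrZ; exact: kdual_mem.
move=> y; have -> : - k' = k by lia.
move=> gy; rewrite killingDl killingNl {1}(kdual_dec2 k0 kk gy) killing_sumr killing_suml -sumrB big1 // => i _.
by rewrite killingZl killingZr (killingC y) mulrC subrr.
Qed.

Definition pol X Y : 'End(g) := ((ad X \o ad Y)%VF + (ad Y \o ad X)%VF)%R.
(** The polarization of [ttau2 S]: one factor 1/2 comes from [tau2], the other compensates the two
    summands of [pol]. *)
Definition bS S X Y : C := 4^-1 * tens_killing S (tens_map (pol X Y) \1%VF (omega al q)).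

Lemma polE X Y x : pol X Y x = br X (br Y x) + br Y (br X x).
Proof. by rewrite /pol add_lfunE !comp_lfunE !adE. Qed.
Lemma pol_lin (s : C) X X' Y x : pol (s *: X + X') Y x = s *: pol X Y x + pol X' Y x.
Proof. by rewrite !polE !lie_br_linl brR; vring. Qed.

(** Pairing with [c] in the second factor of [omega] returns the expansion of [c] in the dual basis,
    so [omega] acts as the identity of g(-2). *)
Lemma omega_form (f : 'End(g)) (a c : g) : Gr (-2) c ->
  tens_killing (tens a c) (tens_map f \1%VF (omega al q)) = killing a (f c).
Proof.
move=> gc; have k0 : 2 != 0 :> int by [].
have kk : 2 + - 2%:Z = 0 by [].
rewrite {2}(kdual_dec k0 kk gc) /omega.
elim: (index_enum _) => [|i s IH]; first by rewrite !big_nil tens_map0 tens_killing0r lf0 killing0r.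
rewrite !big_cons tens_mapD tens_killingDr IH lfD killingDr; congr (_ + _).
by rewrite tens_map_pure id_lfunE tens_killing_pure lfZ killingZr mulrC.
Qed.

Lemma bS_pure (a c : g) X Y : Gr (-2) c ->
  bS (tens a c) X Y = 4^-1 * (killing a (br X (br Y c)) + killing a (br Y (br X c))).
Proof. by move=> gc; rewrite /bS omega_form // polE killingDr. Qed.

Lemma bS0 X Y : bS 0 X Y = 0. Proof. by rewrite /bS tens_killing0l mulr0. Qed.
Lemma bSD S T X Y : bS (S + T) X Y = bS S X Y + bS T X Y.
Proof. by rewrite /bS tens_killingDl mulrDr. Qed.
Lemma bSZ s S X Y : bS (s *: S) X Y = s * bS S X Y.
Proof. by rewrite /bS tens_killingZl mulrCA. Qed.
Lemma bS_sym S X Y : bS S X Y = bS S Y X.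
Proof. by rewrite /bS /pol addrC. Qed.
Lemma tens_map_linl (f f' : 'End(g)) (s : C) (k : 'End(g)) T : (forall x, f x = s *: f' x + k x) ->
  tens_map f \1%VF T = s *: tens_map f' \1%VF T + tens_map k \1%VF T.
Proof.
move=> e; move: T; apply: tens_ind; first by rewrite !tens_map0 scaler0 addr0.
  by move=> S T eS eT; rewrite !(tens_mapD _ _ S T) eS eT scalerDr addrACA.
by move=> a c; rewrite !tens_map_pure e tens_linl.
Qed.
Lemma bS_linl S (s : C) X X' Y : bS S (s *: X + X') Y = s * bS S X Y + bS S X' Y.
Proof.
rewrite /bS (@tens_map_linl _ (pol X Y) s (pol X' Y)); last exact: pol_lin.
by rewrite tens_killingDr tens_killingZr mulrDr mulrCA.
Qed.
Lemma bS_linr S (s : C) X X' Y : bS S Y (s *: X + X') = s * bS S Y X + bS S Y X'.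
Proof. by rewrite !(bS_sym S Y) bS_linl. Qed.
Lemma bS_0l S Y : bS S 0 Y = 0.
Proof. by have /eqP := bS_linl S (-1) 0 0 Y; rewrite scaler0 addr0 mulN1r addNr => /eqP. Qed.
Lemma bS_Dl S X X' Y : bS S (X + X') Y = bS S X Y + bS S X' Y.
Proof. by rewrite -[X]scale1r bS_linl scale1r mul1r. Qed.
Lemma bS_Zl S s X Y : bS S (s *: X) Y = s * bS S X Y.
Proof. by rewrite -[s *: X]addr0 bS_linl bS_0l addr0. Qed.
Lemma bS_Dr S X X' Y : bS S Y (X + X') = bS S Y X + bS S Y X'.
Proof. by rewrite !(bS_sym S Y) bS_Dl. Qed.
Lemma bS_Zr S s X Y : bS S Y (s *: X) = s * bS S Y X.
Proof. by rewrite !(bS_sym S Y) bS_Zl. Qed.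
Lemma bS_suml S I r (P : pred I) F Y :
  bS S (\sum_(i <- r | P i) F i) Y = \sum_(i <- r | P i) bS S (F i) Y.
Proof. by apply: (big_morph (bS S ^~ Y)); [move=> ? ?; exact: bS_Dl | exact: bS_0l]. Qed.
Lemma bS_sumr S I r (P : pred I) F Y :
  bS S Y (\sum_(i <- r | P i) F i) = \sum_(i <- r | P i) bS S Y (F i).
Proof. by rewrite bS_sym bS_suml; apply: eq_bigr => i _; rewrite bS_sym. Qed.

Lemma ttau2E S X : ttau2 al q S X = bS S X X.
Proof.
rewrite /ttau2 /tau2 tens_killingZr /bS (@tens_map_linl (pol X X) (ad X \o ad X)%VF 1 (ad X \o ad X)%VF).
  by rewrite scale1r tens_killingDr; field.
by move=> x; rewrite scale1r /pol add_lfunE.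
Qed.

Lemma coefE S (i j : 'I_(\dim (gr 1))) : ttau2_coef S i j = bS S (vbasis (gr 1))`_i (vbasis (gr 1))`_j.
Proof.
rewrite /ttau2_coef !ttau2E !bS_Dl !bS_Dr (bS_sym S (vbasis (gr 1))`_j (vbasis (gr 1))`_i).
have ar (p1 p2 p3 : C) : 2^-1 * (p1 + p2 + (p2 + p3) - p1 - p3) = p2 by field.
exact: ar.
Qed.

Local Notation TV := (tensv levi (gr (- 2%:Z))).

Lemma TV_ind (Q : tensor g -> Prop) : Q 0 -> (forall S T, Q S -> Q T -> Q (S + T)) ->
  (forall a c : g, Gr 0 a -> Gr (-2) c -> Q (tens a c)) -> forall S, S \in TV -> Q S.
Proof.
move=> Q0 QD Qp; apply: tensv_ind => // a c /(leviP (rp := rp)) ga /(grP (rp := rp)) gc.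
by apply: Qp => //; exact: gc.
Qed.

(** On a pure tensor [bS_pure] eliminates [omega]; what remains is the Jacobi identity and the
    invariance of the Killing form. *)
Lemma bS_eq Z S X Y : Z \in levi -> S \in TV ->
  bS (tens_act Z S) X Y = - bS S (br Z X) Y - bS S X (br Z Y).
Proof.
move=> /(leviP (rp := rp)) gZ; move: S; apply: TV_ind.
- by rewrite tens_act0 !bS0 oppr0 addr0.
- move=> S T e1 e2; rewrite tens_actD (bSD (tens_act Z S)) e1 e2 !(bSD S T).
  have ar (p1 p2 p3 p4 : C) : - p1 - p2 + (- p3 - p4) = - (p1 + p3) - (p2 + p4) by ring.
  exact: ar.
move=> a c ga gc; have gZc : Gr (-2) (br Z c) by exact: Gr_br0.
rewrite tens_act_pure bSD !bS_pure // !(killing_invN Z a).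
rewrite (jac Z X (br Y c)) (jac Z Y c) (jac Z Y (br X c)) (jac Z X c) !brDr !killingDr; ring.
Qed.

(** Turns values of the form into traces, so that nonvanishing can be read off eigenvalues. *)
Lemma bS_tr S X Y : S \in TV -> bS S X Y = 4^-1 * tr (pol X Y \o hat S)%VF.
Proof.
move: S; apply: TV_ind.
- by rewrite bS0 hat0 comp_lfun0r tr0 mulr0.
- by move=> S T e1 e2; rewrite bSD e1 e2 hatD comp_lfunDr trD mulrDr.
move=> a c ga gc; rewrite bS_pure // hat_pureE; congr (_ * _).
have -> : (pol X Y \o rk1 a c)%VF = rk1 (pol X Y a) c.
  by apply/lfunP => x; rewrite comp_lfunE !rk1E lfZ.
rewrite tr_rk1 polE killingDr !(killingC c) (killing_invN X) (killing_invN Y a) (killing_invN Y).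
by rewrite (killing_invN X a) !opprK addrC.
Qed.

Lemma hat_grade S k x : S \in TV -> Gr k x -> k != 2 -> hat S x = 0.
Proof.
move=> + gx k2; move: S; apply: TV_ind; first by rewrite hat0 zero_lfunE.
  by move=> S T e1 e2; rewrite hatD add_lfunE e1 e2 addr0.
by move=> a c ga gc; rewrite hat_pure (Gr_killing gc gx) ?scale0r //; lia.
Qed.

Lemma hat_weight S (chi a : hdual h) x : (forall H, H \in h -> tens_act H S = wt chi H *: S) ->
  x \in root_space a -> hat S x \in root_space (a + chi).
Proof.
move=> hS xa; apply/root_spaceP => H Hh; have e : hat (tens_act H S) x = br H (hat S x) - hat S (br H x) by exact: hat_act.
rewrite hS // hatZ scale_lfunE in e; move/root_spaceP: xa => /(_ H Hh) eH.
by rewrite eH lfZ in e; apply: (eq_by (esym e)); rewrite wtDl; vring.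
Qed.

End Form.

#[global] Opaque bS tens_act tens_map tens_killing hat omega.

(** * Special constituents *)

Section Special.
Context {C : numClosedFieldType} {R : realFieldType} {rp : real_part C R}.
Context {g : lie_algebra C} {h : {vspace g}}.
Context {bil : bilinear_lie g} {hc : is_cartan h} {nd : nondeg_killing g}.
Context {b : {vspace g}} {n : nat} {al : 'I_n -> hdual h} {ss : simple_system b al}.
Context {q : 'I_n} {ts : two_step b al q}.
Implicit Types (a : hdual h) (x y X Y : g) (S T : tensor g).
Local Notation dq := (dg (rp := rp) (al := al) q).
Local Notation Gr := (graded (rp := rp) (al := al) (q := q)).
Local Notation lp := (lp (b := b) (al := al) (q := q)).
Local Notation levi := (levi al q).
Local Notation gr := (gr al q).
Local Notation TV := (tensv levi (gr (- 2%:Z))).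
Local Notation bS := (bS (al := al) (q := q)).
Local Notation rf := (root_form (rp := rp)).

Variables (mu eps : hdual h).
Hypotheses (rmu : roots mu) (dmu : dq mu = 1) (hmu : forall a, lp a -> ~ isw (mu + a)).
Hypotheses (reps : roots eps) (deps : dq eps = 1).
Let nu := mu + eps.
Hypothesis nu_isw : ~ isw nu.

Variables (V Vd : {vspace tensor g}).
Hypothesis Virr : levi_irreducible al q (@tens_act C g) V.
Hypothesis Vhw : highest_weight b al q (@tens_act C g) V nu.
Hypothesis Vdual : dual_constituent al q V Vd.

Let VdTV S : S \in Vd -> S \in TV.
Proof. by have [/subvP + _ _ _] := Vdual; apply. Qed.

(** [hat S0] shifts weights by [- nu] and sees only degree 2, so it can be nonzero only on root
    spaces of roots [a] of degree 2 for which [a - nu] is a weight; it is not zero because [nu] is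
    not a weight. *)
Lemma hat_J S0 x a : S0 \in TV -> (forall H, H \in h -> tens_act H S0 = wt (- nu) H *: S0) ->
  x \in root_space a -> hat S0 x != 0 -> [/\ roots a, dq a = 2, roots (nu - a) & roots (a - nu)].
Proof.
move=> S0T hS xa n0; have x0 : x != 0 by apply: contraNneq n0 => ->; rewrite lf0.
have wa : isw a by apply/iswP; exists x.
have a0 : a != 0.
  apply/eqP => a0; rewrite a0 root_space0 in xa.
  by rewrite (hat_grade S0T (h_Gr0 xa)) ?eqxx in n0.
have ra := isw_roots wa a0.
have [k ek] := dg_int (rp := rp) q ra.
have k2 : k = 2.
  by apply/eqP/negPn/negP => k2; rewrite (hat_grade S0T (Gr_root wa ek xa) k2) eqxx in n0.
have w : isw (a - nu) by apply/iswP; exists (hat S0 x) => //; exact: hat_weight.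
have r1 : roots (a - nu).
  by apply: isw_roots => //; rewrite subr_eq0; apply: contraPneq wa => ->; exact: nu_isw.
split; [exact: ra | by rewrite ek k2 | by rewrite -opprB; exact: rootsN | exact: r1].
Qed.

(** A lowest weight vector orthogonal to the highest weight vector of [V] would be orthogonal to all
    of [V], by [highest_generates], hence zero. Pairing nontrivially with that vector forces the
    weight [- nu]. *)
Lemma lowest_dual (K : {vspace tensor g}) : levi_stable al q (@tens_act C g) K -> (K <= Vd)%VS -> K != 0%VS ->
  exists S1, [/\ S1 \in K, exists x, hat S1 x != 0, forall H, H \in h -> tens_act H S1 = wt (- nu) H *: S1 &
    forall a x, lp a -> x \in root_space (- a) -> tens_act x S1 = 0].
Proof.
move=> stK KV K0'; have [VdT Vdst perV perVd] := Vdual.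
have [S1 [chi [S1K S10 hS1 fS1]]] := lowest_vector stK K0'.
have S1V : S1 \in Vd := subvP KV _ S1K.
have [v [vV /eqP v0 hv ev]] := Vhw.
have pv : tens_killing S1 v != 0.
  apply/negP => /eqP pv; move/eqP: S10; apply; apply: perVd => // T TinV.
  have [|s A B eA eB|W hW] := @vspace_of _ _ (fun T => tens_killing S1 T = 0).
  - exact: tens_killing0r.
  - by rewrite tens_killing_linr eA eB mulr0 addr0.
  apply/hW; apply: (subvP _ _ TinV).
  apply: (highest_generates Virr vV v0 hv) => //; first exact/hW.
  move=> a x w la xa _ /hW ew; apply/hW.
  have e : tens_killing (tens_act x S1) w = - tens_killing S1 (tens_act x w) by exact: tens_killing_inv.
  by rewrite (fS1 a x la xa) tens_killing0l in e; apply/eqP; rewrite -oppr_eq0 -e.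
have chiE : chi = - nu.
  apply: wt_ext => H Hh.
  have e : tens_killing (tens_act H S1) v = - tens_killing S1 (tens_act H v) by exact: tens_killing_inv.
  rewrite hS1 // hv // tens_killingZl tens_killingZr -mulNr in e.
  by rewrite (mulIf pv e) wtNl.
rewrite chiE in hS1; exists S1; split=> //.
apply: contrapT => hn; move/negP: pv; apply; apply/eqP; apply: hat_eq0 => x.
by apply/eqP/negPn/negP => nx; apply: hn; exists x.
Qed.

(** A lowest weight vector of [Vd] has a nonzero endomorphism, and [hat_J] locates the root spaces
    on which it lives. *)
Lemma J_ex : exists a, [/\ roots a, dq a = 2 & roots (nu - a)].
Proof.
have [VdT Vdst perV perVd] := Vdual.
have Vd0 : Vd != 0%VS.
  apply/eqP => Vd0; have [v [vV v0 _ _]] := Vhw; apply: v0; apply: perV => // S.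
  by rewrite Vd0 memv0 => /eqP ->; rewrite tens_killing0l.
have [S1 [S1V [x /negP nx] hS1 fS1]] := lowest_dual Vdst (subvv _) Vd0.
apply: contrapT => hn; apply: nx.
move: x (memvf x); apply: (weight_ind h_stable_full); first by rewrite lf0.
  by move=> x y /eqP ex /eqP ey; rewrite lfD ex ey addr0.
move=> a x _ xa; apply/negPn/negP => nx; apply: hn; exists a.
by have [] := hat_J (VdTV S1V) hS1 xa nx.
Qed.

(* The combinatorial conditions shared by types 1a and 2. *)
Variables K0 K1 K2 : R.
Hypothesis admissible : forall a, roots a -> dq a = 2 -> roots (nu - a) ->
  [/\ isw (a - mu), rf a mu = K1 /\ rf a eps = K2, rf a nu = K0, rf a a <= K0 & rf (nu - a) (nu - a) <= K0].
Hypothesis eps_down : forall a, lp a -> rf eps a = 0 -> ~ isw (eps - a).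

(* hat S0, composed with ad x ad y for root vectors x, y of mu and eps, is a nonzero multiple of a
   projection, so its trace does not vanish. *)
Lemma lowest_form_neq0 S0 (xm xe : g) : S0 \in TV -> (exists x, hat S0 x != 0) ->
  (forall H, H \in h -> tens_act H S0 = wt (- nu) H *: S0) ->
  (forall a x, lp a -> x \in root_space (- a) -> tens_act x S0 = 0) ->
  xm \in root_space mu -> xm != 0 -> xe \in root_space eps -> xe != 0 ->
  bS S0 xm xe != 0.
Proof.
move=> S0T nz hS fS xmm xm0 xee xe0.
have wm (a : hdual h) x : x \in root_space a -> x != 0 -> isw a by move=> xa x0; apply/iswP; exists x.
have comm0 : br xm xe = 0.
  apply/eqP/negPn/negP => n0; apply: nu_isw; apply: (wm _ (br xm xe)) => //.
  exact: br_root_space.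
pose Phi : 'End(g) := ((ad xm \o ad xe)%VF \o hat S0)%VF.
have PhiE x : Phi x = br xm (br xe (hat S0 x)) by rewrite /Phi !comp_lfunE !adE.
have polPhi : (pol xm xe \o hat S0)%VF = (2 *: Phi)%R.
  apply/lfunP => x; rewrite comp_lfunE polE scale_lfunE PhiE.
  by rewrite (jac xe xm) (br_anti xe xm) comm0 oppr0 br0l add0r scaler_nat mulr2n.
suff trPhi : tr Phi != 0.
  by rewrite bS_tr // polPhi trZ !mulf_neq0 // ?invr_eq0 pnatr_eq0.
have hw x a : x \in root_space a -> hat S0 x \in root_space (a - nu) by exact: hat_weight.
have J a x := @hat_J S0 x a S0T hS.
have [x0 [a0 [x0a n0]]] : exists x a, x \in root_space a /\ hat S0 x != 0.
  apply: contrapT => hn; have [x /negP] := nz; apply.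
  move: x (memvf x); apply: (weight_ind h_stable_full); first by rewrite lf0.
    by move=> x y /eqP ex /eqP ey; rewrite lfD ex ey addr0.
  by move=> a x _ xa; apply/negPn/negP => nx; apply: hn; exists x, a.
have [r0 d0 rd0 rd0'] := J a0 x0 x0a n0.
have x00 : x0 != 0 by apply: contraNneq n0 => ->; rewrite lf0.
(* [hat S0] subtracts [nu = mu + eps] and the two brackets restore it, so [Phi] preserves weights
   and is a scalar on each root space. *)
have Phiw x a : x \in root_space a -> Phi x \in root_space a.
  move=> xa; rewrite PhiE; have -> : a = mu + (eps + (a - nu)) by rewrite /nu; vring.
  by apply: br_root_space => //; apply: br_root_space => //; exact: hw.
have [f ef] := root_dim1 r0 x0a x00 (Phiw x0 a0 x0a).
have [w0 [e1 e2] e3 e4 e5] := admissible r0 d0 rd0.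
have ram : roots (a0 - mu).
  apply: isw_roots => //; apply/eqP => e; have : dq (a0 - mu) = 1 by rewrite dgD dgN d0 dmu; ring.
  by rewrite e dg0 => /eqP; rewrite eq_sym oner_eq0.
have f0 : f != 0.
  have ee : eps + (a0 - nu) = a0 - mu by rewrite /nu; vring.
  have n1 : br xe (hat S0 x0) != 0.
    by apply: (br_neq0 reps rd0' _ xee (hw _ _ x0a) xe0 n0); rewrite ee.
  have y1 : br xe (hat S0 x0) \in root_space (a0 - mu).
    by rewrite -ee; apply: br_root_space => //; exact: hw.
  have : Phi x0 != 0.
    rewrite PhiE; apply: (br_neq0 rmu ram _ xmm y1 xm0 n1).
    by rewrite addrC subrK; exact: roots_isw.
  by apply: contraNneq => f0; rewrite ef f0 scale0r.
(* [y] annihilates [S0], which is a lowest weight vector, and kills [xm] and [xe] because [mu - a]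
   and [eps - a] are not weights; hence it commutes with [Phi]. *)
have lowcomm a y x : lp a -> rf mu a = 0 -> rf eps a = 0 -> y \in root_space (- a) ->
    Phi (br y x) = br y (Phi x).
  move=> la ma ea ya; have [pa _] := proj1 (lpE (rp := rp) a) la; have ra := pos_root pa.
  have ram' : roots (- a) by exact: rootsN.
  have ym : br y xm = 0.
    apply/eqP/negPn/negP => n1; apply: (hmu la).
    have w : isw (mu - a) by rewrite addrC; apply: (wm _ (br y xm)) => //; exact: br_root_space.
    by apply: (rts_skip ra (roots_isw rmu)) => //; rewrite ma.
  have ye : br y xe = 0.
    apply/eqP/negPn/negP => n1; apply: (eps_down la ea).
    by rewrite addrC; apply: (wm _ (br y xe)) => //; exact: br_root_space.
  have e : hat (tens_act y S0) x = br y (hat S0 x) - hat S0 (br y x) by exact: hat_act.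
  rewrite (fS a y la ya) hat0 zero_lfunE in e.
  have e' : hat S0 (br y x) = br y (hat S0 x) by apply/eqP; rewrite eq_sym -subr_eq0 -e.
  by rewrite !PhiE e' (jac y xm) ym br0l add0r (jac y xe) ye br0l add0r.
have key a x : x \in root_space a -> hat S0 x != 0 -> Phi x = f *: x.
  move=> xa nx; have [ra da rd rd'] := J a x xa nx.
  have x0' : x != 0 by apply: contraNneq nx => ->; rewrite lf0.
  have [e|ne] := eqVneq a a0.
    rewrite e in xa; have [k ->] := root_dim1 r0 x0a x00 xa.
    by rewrite lfZ ef !scalerA mulrC.
  have [w [e1' e2'] e3' e4' e5'] := admissible ra da rd.
  (* Otherwise [a] and [nu - a0] have squared length at most [K0] and product at least [K0], so they
     coincide, which their degrees 2 and 0 forbid. *)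
  have p : 0 < rf a a0.
    rewrite ltNge; apply/negP => np.
    have : rf (a - (nu - a0)) (a - (nu - a0)) <= 0.
      have e : rf a (nu - a0) = K0 - rf a a0 by rewrite rfDr rfNr e3'.
      rewrite rfDl rfDr (rfDr _ _ (- (nu - a0))) !rfNl !rfNr (rfC (nu - a0) a) e.
      lra.
    have rw : realw (a - (nu - a0)).
      apply: realwD; first exact: realw_root.
      by rewrite -scaleN1r -(rmorphN1 (re_inj (real_part := rp))); apply/realwZ/realw_root.
    move=> le0; have /(rf_eq0 rw) e : rf (a - (nu - a0)) (a - (nu - a0)) = 0.
      by apply/eqP; rewrite eq_le le0 rf_ge0.
    have : dq (a - (nu - a0)) = 2 by rewrite !dgD !dgN !dgD dgN dmu deps da d0; ring.
    by rewrite e dg0 => /eqP; rewrite eq_sym pnatr_eq0.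
  (* [a - a0] is a root of l orthogonal to [mu] and [eps]; a root vector of it or of its negative
     carries one of the two root spaces to the other and transports the scalar [f]. *)
  have rb : roots (a - a0).
    by apply: isw_roots; [apply: rts_sub => //; exact: roots_isw | rewrite subr_eq0].
  have db : dq (a - a0) = 0 by rewrite dgD dgN da d0 subrr.
  have mb : rf mu (a - a0) = 0 by rewrite rfDr rfNr rfC e1' rfC e1 subrr.
  have eb : rf eps (a - a0) = 0 by rewrite rfDr rfNr rfC e2' rfC e2 subrr.
  have [lb | lb] := lp_or_neg (ss := ss) rb db.
    have rb' : roots (- (a - a0)) by exact: rootsN.
    have /iswP [y yb y0] := roots_isw rb'.
    have [c ec] := root_dim1 ra xa x0' (Phiw x a xa).
    have yx : br y x \in root_space a0.
      by have -> : a0 = - (a - a0) + a by [vring]; exact: br_root_space.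
    have nyx : br y x != 0.
      apply: (br_neq0 rb' ra _ yb xa y0 x0').
      by have -> : - (a - a0) + a = a0 by [vring]; exact: roots_isw.
    have [k ek] := root_dim1 r0 x0a x00 yx.
    have : Phi (br y x) = c *: br y x by rewrite (lowcomm _ _ _ lb) // ec brZr.
    rewrite {1}ek lfZ ef scalerA mulrC -scalerA -ek => /eqP; rewrite -subr_eq0 -scalerBl scaler_eq0 (negPf nyx) orbF.
    by rewrite subr_eq0 ec => /eqP ->.
  have /iswP [y yb y0] := roots_isw rb.
  have yb' : y \in root_space (- - (a - a0)) by rewrite opprK.
  have yx : br y x0 \in root_space a.
    by have -> : a = (a - a0) + a0 by [vring]; exact: br_root_space.
  have nyx : br y x0 != 0.
    by apply: (br_neq0 rb r0 _ yb x0a y0 x00); rewrite subrK; exact: roots_isw.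
  have [k ->] := root_dim1 ra yx nyx xa.
  by rewrite lfZ (lowcomm _ _ _ lb) ?rfNr ?mb ?eb ?oppr0 // ef brZr !scalerA mulrC.
apply: (tr_idem f0); last by exists x0; rewrite ef scaler_eq0 negb_or f0.
move=> x; move: x (memvf x); apply: (weight_ind h_stable_full).
- by rewrite !lf0 scaler0.
- by move=> x y ex ey; rewrite !lfD ex ey scalerDr.
move=> a x _ xa; have [z | nz'] := eqVneq (hat S0 x) 0.
  by rewrite (PhiE x) z !br0r lf0 scaler0.
by rewrite (key a x xa nz') lfZ (key a x xa nz').
Qed.

(** The tensors of [Vd] with zero form make up an l-submodule; if nonzero, it would contain a lowest
    weight vector, whose form does not vanish at root vectors of [mu] and [eps]. *)
Lemma bS_inj S : S \in Vd -> (forall X Y, Gr 1 X -> Gr 1 Y -> bS S X Y = 0) -> S = 0.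
Proof.
move=> SV hS; have [VdT Vdst perV perVd] := Vdual.
have [|s T T' [TV' hT] [T'V hT']|K hK] := @vspace_of _ _ (fun S => S \in Vd /\
   forall X Y, Gr 1 X -> Gr 1 Y -> bS S X Y = 0).
- by split=> [|X Y _ _]; [exact: mem0v | exact: bS0].
- split; first by apply: memvD => //; exact: memvZ.
  by move=> X Y gX gY; rewrite bSD bSZ hT // hT' // mulr0 addr0.
apply/eqP/negPn/negP => S0.
have K0' : K != 0%VS.
  by apply/negP => /eqP e; move/negP: S0; apply; rewrite -memv0 -e; apply/hK.
have stK : levi_stable al q (@tens_act C g) K.
  move=> x T xl /hK [TVd hT]; apply/hK; split; first exact: Vdst.
  move=> X Y gX gY; have gx : Gr 0 x by apply/(leviP (rp := rp)).
  rewrite bS_eq //; last exact: VdTV.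
  by rewrite (hT _ _ (Gr_br0 gx gX) gY) (hT _ _ gX (Gr_br0 gx gY)) oppr0 addr0.
have KV : (K <= Vd)%VS by apply/subvP => T /hK [].
have [S1 [S1K nz hS1 fS1]] := lowest_dual stK KV K0'.
have [S1V bS1] := proj1 (hK S1) S1K.
have /iswP [xm xmm xm0] := roots_isw rmu; have /iswP [xe xee xe0] := roots_isw reps.
have : bS S1 xm xe != 0.
  exact: (lowest_form_neq0 (VdTV S1V) nz hS1 fS1).
rewrite bS1 ?eqxx //.
  by apply: (Gr_root (roots_isw rmu) _ xmm); rewrite dmu.
by apply: (Gr_root (roots_isw reps) _ xee); rewrite deps.
Qed.

Section Key.
Variable P : seq (g * g).
Hypothesis PP : dual_pairs (b := b) (al := al) (q := q) P.
Hypothesis mu_hw : highest_weight b al q (@lie_br _ g) (gr 1) mu.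
Local Notation cas_val := (casimir_value (b := b) (al := al) (q := q)).
Local Notation bpairs := (fun S X Y => \sum_(z <- P) bS S (br z.1 X) (br z.2 Y)).

(** The Casimir operator is symmetric for the pairing of [Vd] with [V], so its eigenvalue passes to
    the dual. *)
Lemma cas_dual S : S \in Vd -> cas P (act := @tens_act C g) S = cas_val nu *: S.
Proof.
move=> SV; have [VdT Vdst _ perVd] := Vdual; have [Pm _ _ _] := PP.
apply/eqP; rewrite -subr_eq0; apply/eqP; apply: perVd => [|T TinV].
  apply: memvB; last exact: memvZ.
  by rewrite /cas big_seq; apply: memv_suml => z /Pm [z1 z2]; apply: (Vdst) => //; exact: Vdst.
have sumE (F : g * g -> tensor g) : tens_killing (\sum_(z <- P) F z) T = \sum_(z <- P) tens_killing (F z) T.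
  by elim: (P) => [|z s IH]; rewrite ?big_nil ?tens_killing0l // !big_cons tens_killingDl IH.
rewrite -scaleN1r scalerA tens_killingDl tens_killingZl.
have -> : tens_killing (cas P (act := @tens_act C g) S) T = tens_killing S (cas P (act := @tens_act C g) T).
  rewrite /cas sumE tens_killing_sumr.
  rewrite (cas_sym PP (Phi := fun x y => (tens_killing S (tens_act x (tens_act y T)) : C^o))).
  - by apply: eq_bigr => z _; rewrite !tens_killing_inv opprK.
  - by move=> s x y z; rewrite act_linl tens_killing_linr.
  by move=> s x y z; rewrite act_linl act_linr tens_killing_linr.
by rewrite (cas_irreducible PP Virr Vhw TinV) tens_killingZr mulN1r mulNr subrr.
Qed.

(** By equivariance of [bS], the Casimir operator acting on [S] can be moved to the arguments: it
    gives the Casimir eigenvalues of [X] and of [Y] plus twice the mixed sum. *)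
Lemma bpairs_val S X Y : S \in Vd -> Gr 1 X -> Gr 1 Y ->
  2 * bpairs S X Y = (cas_val nu - 2 * cas_val mu) * bS S X Y.
Proof.
move=> SV gX gY; have [VdT Vdst _ _] := Vdual; have [Pm _ _ _] := PP.
have e : bS (cas P (act := @tens_act C g) S) X Y = cas_val nu * bS S X Y by rewrite cas_dual // bSZ.
have bsum (F : g * g -> tensor g) : bS (\sum_(z <- P) F z) X Y = \sum_(z <- P) bS (F z) X Y.
  by elim: (P) => [|z s IH]; rewrite ?big_nil ?bS0 // !big_cons bSD IH.
have lin1 (c : C) x y z : (bS S (br z (br (c *: x + y) X)) Y : C^o) = c *: (bS S (br z (br x X)) Y : C^o) + bS S (br z (br y X)) Y.
  by rewrite lie_br_linl brR bS_linl.
have cX : \sum_(z <- P) bS S (br z.2 (br z.1 X)) Y = cas_val mu * bS S X Y.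
  rewrite -(cas_sym PP (Phi := fun x y => (bS S (br x (br y X)) Y : C^o))).
  - by rewrite -bS_suml [\sum_(z <- P) _](cas_g1 PP mu_hw gX) bS_Zl.
  - by move=> c x y z; rewrite lie_br_linl bS_linl.
  by move=> c x y z; rewrite lie_br_linl brR bS_linl.
have cY : \sum_(z <- P) bS S X (br z.2 (br z.1 Y)) = cas_val mu * bS S X Y.
  rewrite -(cas_sym PP (Phi := fun x y => (bS S X (br x (br y Y)) : C^o))).
  - by rewrite -bS_sumr [\sum_(z <- P) _](cas_g1 PP mu_hw gY) bS_Zr.
  - by move=> c x y z; rewrite lie_br_linl bS_linr.
  by move=> c x y z; rewrite lie_br_linl brR bS_linr.
have cXY : \sum_(z <- P) bS S (br z.2 X) (br z.1 Y) = bpairs S X Y.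
  rewrite -(cas_sym PP (Phi := fun x y => (bS S (br x X) (br y Y) : C^o))).
  - by [].
  - by move=> c x y z; rewrite lie_br_linl bS_linl.
  by move=> c x y z; rewrite lie_br_linl bS_linr.
have e2 : bS (cas P (act := @tens_act C g) S) X Y =
    \sum_(z <- P) (bS S (br z.2 (br z.1 X)) Y + bS S X (br z.2 (br z.1 Y)) +
      (bS S (br z.1 X) (br z.2 Y) + bS S (br z.2 X) (br z.1 Y))).
  rewrite bsum; apply: eq_big_seq => z /Pm [z1 z2].
  have tS := VdTV SV; have t2 : tens_act z.2 S \in TV by apply: VdTV; exact: Vdst.
  rewrite (bS_eq _ _ z1 t2) !(bS_eq _ _ z2 tS).
  have ar (p1 p2 p3 p4 : C) : - (- p1 - p2) - (- p3 - p4) = p1 + p4 + (p2 + p3) by ring.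
  exact: ar.
rewrite !big_split /= cX cY cXY e in e2.
move: (bpairs S X Y) e2 => B e2; rewrite mulrBl e2; ring.
Qed.

Lemma br_lam X : Gr 1 X -> br (hvec (lam (al := al) q)) X = re_inj (rf (al q) (al q) / 2) *: X.
Proof.
rewrite /graded /Hq brZl scale1r => e; rewrite -[in RHS]e scalerA -rmorphM.
have p : rf (al q) (al q) != 0 by rewrite gt_eqF //; apply: rf_gt0; exact: (al_root (ss := ss)).
rewrite (_ : rf (al q) (al q) / 2 * _ = 1) ?rmorph1 ?scale1r //.
by field.
Qed.

Local Notation F := (fun i : 'I_(\dim (gr 1)) => kdual (gr (- 1)) i).

(** Both sides lie in g(-1), so they are tested against [Y] in g(1): the left side becomes minus the
    mixed sum of [bpairs_val], the right side [s |alpha_q|^2 bS S X Y]. *)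
Lemma key_identity S X (s : C) : S \in Vd -> Gr 1 X ->
  s * re_inj (rf (al q) (al q)) = cas_val mu - cas_val nu / 2 ->
  \sum_i \sum_j ttau2_coef S i j *: br (br X (F i)) (F j) =
  2 * s *: (\sum_i \sum_j ttau2_coef S i j *: (killing (hvec (lam (al := al) q)) (br X (F i)) *: F j)).
Proof.
move=> SV gX hs.
have k0 : 1 != 0 :> int by [].
have kk : 1 + - 1 = 0 :> int by [].
have gF i : Gr (-1) (F i) by exact: kdual_mem.
have gsum (G : 'I_(\dim (gr 1)) -> 'I_(\dim (gr 1)) -> g) : (forall i j, Gr (-1) (G i j)) ->
    Gr (-1) (\sum_i \sum_j ttau2_coef S i j *: G i j).
  move=> hG; apply: big_ind; [exact: Gr0 | by move=> *; exact: GrD |] => i _.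
  apply: big_ind; [exact: Gr0 | by move=> *; exact: GrD |] => j _; exact: GrZ.
have gXF i : Gr 0 (br X (F i)).
  have e : Gr (1 - 1) (br X (F i)) by exact: Gr_br.
  by rewrite subrr in e.
apply/eqP; rewrite -subr_eq0; apply/eqP; apply: (Gr_nondeg (rp := rp) (al := al) (q := q) (k := -1)).
  apply: GrD; first by apply: gsum => i j; exact: Gr_br0.
  by apply/GrN/GrZ/gsum => i j; exact: GrZ.
move=> Y; rewrite opprK => gY; rewrite killingDl killingNl killingZl.
have bex X1 Y1 : Gr 1 X1 -> Gr 1 Y1 ->
    bS S X1 Y1 = \sum_i \sum_j ttau2_coef S i j * (killing X1 (F i) * killing Y1 (F j)).
  move=> g1 g2; rewrite {1}(kdual_dec2 k0 kk g1) bS_suml; apply: eq_bigr => i _.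
  rewrite bS_Zl {1}(kdual_dec2 k0 kk g2) bS_sumr mulr_sumr; apply: eq_bigr => j _.
  by rewrite bS_Zr coefE; ring.
have [Pm P1 P2 _] := PP.
have e1 : killing (\sum_i \sum_j ttau2_coef S i j *: br (br X (F i)) (F j)) Y = - bpairs S X Y.
  have eb : bpairs S X Y = \sum_i \sum_j ttau2_coef S i j *
      (\sum_(z <- P) killing (br z.1 X) (F i) * killing (br z.2 Y) (F j)).
    transitivity (\sum_(z <- P) \sum_i \sum_j ttau2_coef S i j *
        (killing (br z.1 X) (F i) * killing (br z.2 Y) (F j))).
      apply: eq_big_seq => z /Pm [z1 z2].
      have [gz1 gz2] : Gr 0 z.1 /\ Gr 0 z.2 by split; apply/(leviP (rp := rp)).
      by rewrite (bex _ _ (Gr_br0 gz1 gX) (Gr_br0 gz2 gY)).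
    rewrite exchange_big; apply: eq_bigr => i _; rewrite exchange_big; apply: eq_bigr => j _.
    by rewrite mulr_sumr.
  rewrite eb killing_suml -sumrN; apply: eq_bigr => i _.
  rewrite killing_suml -sumrN; apply: eq_bigr => j _.
  rewrite killingZl -mulrN; congr (_ * _).
  have xl : br X (F i) \in levi by apply/(leviP (rp := rp)).
  rewrite {1}(P1 _ xl) br_suml killing_suml -sumrN; apply: eq_bigr => z _.
  rewrite brZl killingZl (br_anti X) killingNl (killing_inv (F i)) (br_anti X) killingNr opprK.
  rewrite (killingC (F i)) (killing_invN z.2 (F j)) (killingC (F j)); ring.
have e2 : killing (\sum_i \sum_j ttau2_coef S i j *: (killing (hvec (lam (al := al) q)) (br X (F i)) *: F j)) Y =
    re_inj (rf (al q) (al q) / 2) * bS S X Y.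
  rewrite bex // mulr_sumr killing_suml; apply: eq_bigr => i _.
  rewrite mulr_sumr killing_suml; apply: eq_bigr => j _.
  rewrite !killingZl -killing_inv br_lam // killingZl (killingC (F j)); ring.
rewrite e1 e2; have e3 := bpairs_val SV gX gY.
have e4 : re_inj (rf (al q) (al q)) = 2 * re_inj (rf (al q) (al q) / 2).
  by rewrite -(rmorph_nat (re_inj (real_part := rp))) -rmorphM mulrC divfK // pnatr_eq0.
move: hs e3; rewrite e4.
set B := bpairs S X Y; move: (re_inj _) (cas_val nu) (cas_val mu) (bS S X Y) B => r cn cm bb B hs e3.
have e5 : s * (2 * r) * bb = (cm - cn / 2) * bb by rewrite hs.
have n2 : 2 != 0 :> C by rewrite pnatr_eq0.
apply: (mulfI n2); rewrite mulr0.
have -> : 2 * (- B - 2 * s * (r * bb)) = - (2 * B) - 2 * (s * (2 * r) * bb) by ring.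
by rewrite e3 e5; field.
Qed.
End Key.
End Special.

Lemma card_fset_set (T : choiceType) (A : set T) (s : seq T) : uniq s ->
  (forall a, A a <-> a \in s) -> #|` fset_set A| = size s.
Proof.
move=> us sP.
have As : A = [set` s]%classic by apply/seteqP; split=> a; move/sP.
have fA : finite_set A by rewrite As; exact: finite_seq.
have -> : fset_set A = [fset a in s]%fset.
  by apply/fsetP => a; rewrite in_fset_set // in_fset; apply/idP/idP => [/set_mem/sP|/sP/mem_set].
by rewrite card_fseq undup_id.
Qed.

(** * The special parameter from pairings of roots *)

Section Combinatorics.
Context {C : numClosedFieldType} {R : realFieldType} {rp : real_part C R}.
Context {g : lie_algebra C} {h : {vspace g}}.
Context {bil : bilinear_lie g} {hc : is_cartan h} {nd : nondeg_killing g}.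
Context {b : {vspace g}} {n : nat} {al : 'I_n -> hdual h} {ss : simple_system b al}.
Context {q : 'I_n} {ts : two_step b al q}.
Implicit Types (a c : hdual h) (S T : tensor g).
Local Notation dq := (dg (rp := rp) (al := al) q).
Local Notation Gr := (graded (rp := rp) (al := al) (q := q)).
Local Notation lp := (lp (b := b) (al := al) (q := q)).
Local Notation gr := (gr al q).
Local Notation rf := (root_form (rp := rp)).
Local Notation cas_val := (casimir_value (b := b) (al := al) (q := q)).

Lemma two_neq1 : 2 != 1 :> R. Proof. by apply/eqP => e; lra. Qed.
Lemma dq_neq0 a : dq a != 0 -> a != 0.
Proof. by apply: contraNneq => ->; rewrite dg0. Qed.

Lemma realwB a c : roots a -> roots c -> realw (rp := rp) (a - c).
Proof.
move=> ra rc; apply: realwD; first exact: realw_root.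
by rewrite -scaleN1r -(rmorphN1 (re_inj (real_part := rp))); apply/realwZ/realw_root.
Qed.

Lemma rf_sub a c : rf (a - c) (a - c) = rf a a + rf c c - 2 * rf a c.
Proof. by rewrite !rfDl !rfDr !rfNl !rfNr (rfC c a); ring. Qed.
Lemma rf_add a c : rf (a + c) (a + c) = rf a a + rf c c + 2 * rf a c.
Proof. by rewrite !rfDl !rfDr (rfC c a); ring. Qed.

Lemma close_eq a c : roots a -> roots c -> rf a a + rf c c - 2 * rf a c <= 0 -> a = c.
Proof.
move=> ra rc; rewrite -rf_sub => le0; have rw := realwB ra rc.
apply/eqP; rewrite -subr_eq0; apply/eqP; apply: (rf_eq0 rw).
by apply/eqP; rewrite eq_le le0 rf_ge0.
Qed.

Lemma cas_re mu : realw (rp := rp) mu ->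
  cas_val mu = re_inj (real_part := rp) (rf mu mu + \sum_(c <- rts | `[< lp c >]) rf mu c) + (hform mu mu - re_inj (rf mu mu)).
Proof.
move=> rw; rewrite /casimir_value rmorphD rmorph_sum /=.
rewrite [in RHS]addrC addrA subrK; congr (_ + _).
rewrite big_seq_cond [RHS]big_seq_cond; apply: eq_bigr => c /andP [/rtsP rc _].
by rewrite rw //; exact: roots_isw.
Qed.

Lemma cas_diff mu eps (s : R) : roots mu -> roots eps -> rf mu mu = rf (al q) (al q) ->
  s * rf (al q) (al q) = 2^-1 * (rf mu mu - rf eps eps - 2 * rf mu eps +
     \sum_(c <- rts | `[< lp c >]) rf (mu - eps) c) ->
  re_inj (real_part := rp) s * re_inj (rf (al q) (al q)) = cas_val mu - cas_val (mu + eps) / 2.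
Proof.
move=> rm re eL es; rewrite -rmorphM es.
have hmm : hform mu mu = re_inj (rf mu mu) by exact: (hform_rf rm (roots_isw rm)).
have hee : hform eps eps = re_inj (rf eps eps) by exact: (hform_rf re (roots_isw re)).
have hme : hform mu eps = re_inj (rf mu eps) by exact: (hform_rf re (roots_isw rm)).
have rw : realw (rp := rp) (mu + eps) by apply: realwD; exact: realw_root.
rewrite (cas_re (realw_root rm)) (cas_re rw) hmm subrr addr0.
have -> : hform (mu + eps) (mu + eps) = re_inj (rf (mu + eps) (mu + eps)).
  by rewrite hformDl !hformDr (hformC eps mu) hmm hee hme rf_add -!rmorphD; congr (re_inj _); ring.
rewrite subrr addr0 -(rmorph_nat (re_inj (real_part := rp))) -fmorphV -rmorphM -rmorphB.
congr (re_inj _); rewrite rf_add.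
have -> : \sum_(c <- rts | `[< lp c >]) rf (mu - eps) c =
    \sum_(c <- rts | `[< lp c >]) rf mu c - \sum_(c <- rts | `[< lp c >]) rf eps c.
  by rewrite -sumrB; apply: eq_bigr => c _; rewrite rfDl rfNl.
have -> : \sum_(c <- rts | `[< lp c >]) rf (mu + eps) c =
    \sum_(c <- rts | `[< lp c >]) rf mu c + \sum_(c <- rts | `[< lp c >]) rf eps c.
  by rewrite -big_split; apply: eq_bigr => c _; rewrite rfDl.
by field.
Qed.

(** For [eps = mu] the sums over the roots of l cancel and [- (mu, mu)] is left, which is
    [- |alpha_q|^2] by the assumption on lengths. *)
Lemma type2_val mu : roots mu -> rf mu mu = rf (al q) (al q) ->
  re_inj (real_part := rp) (- 1) * re_inj (rf (al q) (al q)) = cas_val mu - cas_val (mu + mu) / 2.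
Proof.
move=> rm eL; apply: cas_diff => //; rewrite -eL.
rewrite (eq_bigr (fun => 0)); last by move=> c _; rewrite subrr rf0l.
by rewrite big1 //; field.
Qed.

Section Highest.
Variable mu : hdual h.
Hypotheses (rmu : roots mu) (dmu : dq mu = 1) (hmu : forall a, lp a -> ~ isw (mu + a)).

Lemma not_both a : roots a -> dq a = 0 -> isw (mu + a) -> isw (mu - a) -> False.
Proof. by move=> ra da w1 w2; have [/hmu|/hmu] := lp_or_neg (ss := ss) ra da. Qed.

Lemma lp_root a : lp a -> roots a /\ dq a = 0.
Proof. by case/(lpE (rp := rp)) => pa da; split=> //; exact: pos_root pa. Qed.

Lemma lp_down a : lp a -> rf mu a = 0 -> ~ isw (mu - a).
Proof.
move=> la e w; apply: (hmu la); have [ra _] := lp_root la.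
by apply: (rts_skip ra (roots_isw rmu)) => //; rewrite e.
Qed.

Lemma mu_gt0 : 0 < rf mu mu. Proof. exact: rf_gt0. Qed.

(** Put [d = 2 mu - a]. The integers [k = 2 (a, mu) / (mu, mu)] and [l], defined likewise from [d],
    add up to 4. For [k >= 3] both [mu + d] and [mu - d] would be weights; for [l >= 3] reflecting
    [d] in [mu] gives a root of degree below -2. So [k = l = 2]. *)
Lemma type2_admissible : ~ isw (mu + mu) -> forall a, roots a -> dq a = 2 -> roots (mu + mu - a) ->
  [/\ isw (a - mu), rf a mu = rf mu mu /\ rf a mu = rf mu mu, rf a (mu + mu) = 2 * rf mu mu,
      rf a a <= 2 * rf mu mu & rf (mu + mu - a) (mu + mu - a) <= 2 * rf mu mu].
Proof.
move=> nn a ra da rd; set d := mu + mu - a in rd *.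
have dd : dq d = 0 by rewrite /d !dgD dgN dmu da; ring.
have M0 := mu_gt0.
have [k ek wk] := refl_isw rmu (roots_isw ra).
have [l el wl] := refl_isw rmu (roots_isw rd).
have kl : k + l = 4.
  have : (k + l)%:~R = 4%:~R :> R.
    apply: (mulIf (lt0r_neq0 M0)); rewrite rmorphD mulrDl -ek -el /d !rfDl rfNl.
    by rewrite -[4%:~R]/(4 : R); ring.
  by move/eqP; rewrite eqr_int => /eqP.
have k2 : k = 2.
  apply/eqP; rewrite eq_le; apply/andP; split.
    rewrite leNgt; apply/negP => k3.
    have p : 0 < rf a mu by have [-> _] := rf_int_sign rmu ek; lia.
    have w1 : isw (mu - d).
      have -> : mu - d = a - mu by rewrite /d; vring.
      exact: (rts_sub rmu (roots_isw ra) p).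
    have [l0 | l0] := leP l 0.
      apply: (not_both rd dd _ w1); apply: (rts_skip rd (roots_isw rmu)) => //.
      have [e _] := rf_int_sign rmu el; rewrite rfC leNgt e; lia.
    have k3' : k = 3 by lia.
    (* With [k = 3] the weight [mu + d] is minus the reflection of [a] in [mu]. *)
    apply: (not_both rd dd _ w1); have -> : mu + d = - (a - mu *~ k); last exact: isw_opp.
    by rewrite k3' /d -scaler_int -[3%:~R]/(3 : C); vring.
  rewrite leNgt; apply/negP => k1.
  have l3 : 3 <= l by lia.
  have dl : dq (d - mu *~ l) = - l%:~R by rewrite dgD dgN dgZz dmu dd mulr1 add0r.
  have rl : roots (d - mu *~ l).
    apply: isw_roots => //; apply: dq_neq0; rewrite dl oppr_eq0 intr_eq0; lia.
  have ge : - 2 <= dq (d - mu *~ l) by exact: dg_ge2.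
  move: ge; rewrite dl lerN2 -[2]/(2%:~R) ler_int; lia.
have l2 : l = 2 by lia.
have e1 : rf a mu = rf mu mu.
  by move: ek; rewrite k2 -[2%:~R]/(2 : R) => /(mulfI (_ : 2 != 0 :> R)); apply; rewrite pnatr_eq0.
have e2 : rf d mu = rf mu mu.
  by move: el; rewrite l2 -[2%:~R]/(2 : R) => /(mulfI (_ : 2 != 0 :> R)); apply; rewrite pnatr_eq0.
have len c : roots c -> rf c mu = rf mu mu -> rf c c <= 2 * rf mu mu.
  move=> rc e; have [m em _] := rf_int rc (roots_isw rmu); rewrite rfC e in em.
  have em' : 2 * rf mu c = m%:~R * rf c c by rewrite rfC e.
  have m0 : 0 < m by have [<- _] := rf_int_sign rc em'; rewrite rfC e.
  rewrite em; have c0 : 0 < rf c c by exact: rf_gt0.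
  by apply: ler_peMl; [exact: ltW | rewrite -[1]/(1%:~R) ler_int].
split; [| by split | by rewrite rfDr e1; ring | exact: len | exact: len].
by apply: (rts_sub rmu (roots_isw ra)); rewrite e1.
Qed.

Section Type1a.
Variable eps : hdual h.
Hypotheses (reps : roots eps) (deps : dq eps = 1).
Hypotheses (nsum : ~ roots (mu + eps)) (neq : eps <> mu).
Hypotheses (lmu : forall c, roots c -> rf c c <= rf mu mu) (leps : forall c, roots c -> rf c c <= rf eps eps).
Hypothesis J_ex : exists a, [/\ roots a, dq a = 2 & roots (mu + eps - a)].
Let L := rf mu mu.

Lemma len_eps : rf eps eps = L.
Proof. by apply/eqP; rewrite eq_le lmu // leps. Qed.
Lemma L_gt0 : 0 < L. Proof. exact: mu_gt0. Qed.

Lemma nsum_isw : ~ isw (mu + eps).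
Proof. by move=> w; apply: nsum; apply: isw_roots => //; apply: dq_neq0; rewrite dgD dmu deps gt_eqF // addr_gt0. Qed.

(** No root is longer than [a], so [k >= 2] would give [|a - c|^2 <= 0]. *)
Lemma long_pair a c : roots a -> roots c -> rf a a = L -> c <> a ->
  exists2 k : int, 2 * rf c a = k%:~R * L & k <= 1.
Proof.
move=> ra rc aL ca; have [k ek _] := rf_int ra (roots_isw rc); rewrite aL in ek.
exists k => //; rewrite leNgt; apply/negP => k2; apply: ca; apply: close_eq => //.
have := lmu rc; have L0 := L_gt0; rewrite aL ek -/L => le.
have : 2 * L <= k%:~R * L by rewrite ler_wpM2r ?(ltW L0) // -[2]/(2%:~R) ler_int; lia.
lra.
Qed.

Lemma long_pair_abs a c : roots a -> roots c -> rf a a = L -> c <> a -> c <> - a ->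
  exists k : int, [/\ 2 * rf c a = k%:~R * L, -1 <= k & k <= 1].
Proof.
move=> ra rc aL c1 c2; have [k ek k1] := long_pair ra rc aL c1.
have rc' : roots (- c) by exact: rootsN.
have [|k' ek' k1'] := long_pair ra rc' aL.
  by move=> e; apply: c2; rewrite -e opprK.
exists k; split=> //; have : (- k)%:~R = k'%:~R :> R.
  by apply: (mulIf (lt0r_neq0 L_gt0)); rewrite -ek' rfNl mulrN ek rmorphN mulNr.
move/eqP; rewrite eqr_int => /eqP; lia.
Qed.

Lemma dq_neq a c : dq a != dq c -> a <> c.
Proof. by move=> /eqP ne e; apply: ne; rewrite e. Qed.

(** The product is not negative, as [mu + eps] is not a weight. Were it [L / 2], splitting [nu] as
    [a + (nu - a)] with [a] of degree 2 would write [2 (nu, mu) = 3 L] as a sum of two terms of at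
    most [L]. *)
Lemma mu_eps0 : rf mu eps = 0.
Proof.
have [k ek k1] := long_pair rmu reps erefl neq.
have k0 : 0 <= k.
  rewrite leNgt; apply/negP => kn; apply: nsum_isw; rewrite addrC.
  apply: rts_add => //; first exact: roots_isw.
  by have [_ ->] := rf_int_sign rmu ek.
have [k1' | k1'] := eqVneq k 1; last first.
  have k0' : k = 0 by lia.
  move: ek; rewrite k0' mul0r => /eqP; rewrite mulf_eq0 pnatr_eq0 /= rfC => /eqP //.
have [a [ra da rd]] := J_ex.
have dd : dq (mu + eps - a) = 0 by rewrite !dgD dgN dmu deps da; ring.
have [k3 ek3 lk3] : exists2 k : int, 2 * rf a mu = k%:~R * L & k <= 1.
  by apply: long_pair => //; apply: dq_neq; rewrite da dmu two_neq1.
have [k4 ek4 lk4] : exists2 k : int, 2 * rf (mu + eps - a) mu = k%:~R * L & k <= 1.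
  by apply: long_pair => //; apply: dq_neq; rewrite dd dmu eq_sym oner_eq0.
have : (k3 + k4)%:~R = 3%:~R :> R.
  apply: (mulIf (lt0r_neq0 L_gt0)); rewrite rmorphD mulrDl -ek3 -ek4 !rfDl rfNl.
  have : 2 * rf eps mu = L by rewrite ek k1' mul1r.
  rewrite -/L -[3%:~R]/(3 : R) => e; have -> : 3 * L = 2 * L + 2 * rf eps mu by rewrite e; ring.
  by ring.
move/eqP; rewrite eqr_int => /eqP; lia.
Qed.

(** [2 (nu, mu) = 2 L] is the sum of two multiples of [L], each at most [L], so both equal [L];
    likewise for [eps]. *)
Lemma split_pair a : roots a -> roots (mu + eps - a) -> a <> mu -> a <> eps ->
  2 * rf a mu = L /\ 2 * rf a eps = L.
Proof.
move=> ra rd am ae.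
have dm : mu + eps - a <> mu.
  by move=> e; apply: ae; apply: (eq_by (esym e)); vring.
have de : mu + eps - a <> eps.
  by move=> e; apply: am; apply: (eq_by (esym e)); vring.
have [k1 e1 l1] := long_pair rmu ra erefl am.
have [k2 e2 l2] := long_pair rmu rd erefl dm.
have [k3 e3 l3] := long_pair reps ra len_eps ae.
have [k4 e4 l4] := long_pair reps rd len_eps de.
have s1 : (k1 + k2)%:~R = 2%:~R :> R.
  apply: (mulIf (lt0r_neq0 L_gt0)); rewrite rmorphD mulrDl -e1 -e2 !rfDl rfNl (rfC eps) mu_eps0.
  by rewrite -/L -[2%:~R]/(2 : R); ring.
have s2 : (k3 + k4)%:~R = 2%:~R :> R.
  apply: (mulIf (lt0r_neq0 L_gt0)); rewrite rmorphD mulrDl -e3 -e4 !rfDl rfNl mu_eps0 len_eps.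
  by rewrite -[2%:~R]/(2 : R); ring.
move/eqP: s1; rewrite eqr_int => /eqP s1; move/eqP: s2; rewrite eqr_int => /eqP s2.
have k11 : k1 = 1 by lia.
have k31 : k3 = 1 by lia.
by rewrite e1 e3 k11 k31 mul1r.
Qed.

Lemma type1a_admissible a : roots a -> dq a = 2 -> roots (mu + eps - a) ->
  [/\ isw (a - mu), rf a mu = L / 2 /\ rf a eps = L / 2, rf a (mu + eps) = L,
      rf a a <= L & rf (mu + eps - a) (mu + eps - a) <= L].
Proof.
move=> ra da rd.
have am : a <> mu by apply: dq_neq; rewrite da dmu two_neq1.
have ae : a <> eps by apply: dq_neq; rewrite da deps two_neq1.
have [e1 e2] := split_pair ra rd am ae.
have e1' : rf a mu = L / 2 by rewrite -e1; field.
have e2' : rf a eps = L / 2 by rewrite -e2; field.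
split; [| by split | by rewrite rfDr e1' e2'; field | exact: lmu | exact: lmu].
by apply: rts_sub => //; [exact: roots_isw | rewrite e1' divr_gt0 // L_gt0].
Qed.

(** With [a] orthogonal to [eps], the root [eps - a] would be longer than the long root [eps]. *)
Lemma eps_down a : lp a -> rf eps a = 0 -> ~ isw (eps - a).
Proof.
move=> la e w; have [ra da] := lp_root la.
have r1 : roots (eps - a) by apply: isw_roots => //; apply: dq_neq0; rewrite dgD dgN da subr0 deps oner_eq0.
have := leps r1; rewrite rf_sub e mulr0 subr0 gerDl leNgt; move/negP; apply; exact: rf_gt0.
Qed.

Hypothesis dominant : forall a, lp a -> 0 <= rf (mu + eps) a.

(** Pairings with the long roots [mu] and [eps] are 0 or [L / 2] up to sign; [mu] being highest
    excludes a negative one with [mu], and dominance of [nu] bounds the one with [eps]. *)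
Lemma lp_cases a : lp a ->
  [\/ rf a mu = 0 /\ (rf a eps = 0 \/ rf a eps = L / 2),
      rf a mu = L / 2 /\ (rf a eps = 0 \/ rf a eps = L / 2) |
      rf a mu = L / 2 /\ rf a eps = - (L / 2)].
Proof.
move=> la; have [ra da] := lp_root la.
have nda c : dq c = 1 -> a <> c /\ a <> - c.
  by move=> dc; split; apply: dq_neq; rewrite da ?dgN dc eq_sym ?oppr_eq0 oner_eq0.
have [nm nm'] := nda _ dmu; have [ne ne'] := nda _ deps.
have [k [ek k1 k2]] := long_pair_abs rmu ra erefl nm nm'.
have [l [el l1 l2]] := long_pair_abs reps ra len_eps ne ne'.
have k0 : 0 <= k.
  rewrite leNgt; apply/negP => kn; apply: (hmu la); rewrite addrC.
  apply: rts_add => //; first exact: roots_isw.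
  by have [_ ->] := rf_int_sign rmu ek.
have kl : 0 <= k + l.
  have d := dominant la; rewrite rfC rfDr in d; have L0 := L_gt0.
  rewrite -(ler_int R) -(pmulr_lge0 _ L0) rmorphD mulrDl -ek -el -mulrDr mulr_ge0 //.
have half (x : R) (m : int) : 2 * x = m%:~R * L -> x = m%:~R * (L / 2) by move=> e; rewrite mulrA -e; field.
have {}ek := half _ _ ek; have {}el := half _ _ el.
have [k0' | k1'] : k = 0 \/ k = 1 by lia.
  have [l0 | l1'] : l = 0 \/ l = 1 by lia.
    by constructor 1; rewrite ek el k0' l0 !mul0r; split=> //; left.
  by constructor 1; rewrite ek el k0' l1' mul0r mul1r; split=> //; right.
have [l0 | [l1' | l1']] : l = 0 \/ l = 1 \/ l = -1 by lia.
- by constructor 2; rewrite ek el k1' l0 mul0r mul1r; split=> //; left.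
- by constructor 2; rewrite ek el k1' l1' mul1r; split=> //; right.
by constructor 3; rewrite ek el k1' l1' mul1r mulN1r.
Qed.

(** Such a root [c] gives the decomposition of [nu] as [(mu - c) + (eps + c)] into roots of g(1). *)
Definition typeX a := `[< lp a >] && (rf a eps < 0).

(** Termwise: a pairing [t] equal to 0 or [L / 2] satisfies [t = 2 t^2 / L], while for [t = - L / 2]
    the two sides differ by [L]. *)
Lemma diff_sum : \sum_(c <- rts | `[< lp c >]) rf (mu - eps) c =
  2 / L * (\sum_(c <- rts | `[< lp c >]) rf c mu ^+ 2 - \sum_(c <- rts | `[< lp c >]) rf c eps ^+ 2) +
  (count typeX rts)%:R * L.
Proof.
have -> : (count typeX rts)%:R * L = \sum_(c <- rts | `[< lp c >]) (if rf c eps < 0 then L else 0).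
  rewrite -sum1_count natr_sum mulr_suml /typeX big_mkcondr /=.
  by apply: eq_bigr => c _; case: ifP; rewrite ?mul1r.
rewrite -sumrB mulr_sumr -big_split /=.
apply: eq_bigr => c /asboolP lc; rewrite rfC rfDr rfNr; have L0 := L_gt0.
have l0 : L != 0 by rewrite gt_eqF.
have h0 : 0 < L / 2 by rewrite divr_gt0.
case: (lp_cases lc) => [[-> [] ->]|[-> [] ->]|[-> ->]].
- by rewrite ltxx; field.
- by rewrite ltNge (ltW h0) /=; field.
- by rewrite ltxx; field.
- by rewrite ltNge (ltW h0) /=; field.
by rewrite oppr_lt0 h0; field.
Qed.

(** The sum runs over all roots of l, not only the positive ones, so as to be invariant under
    reflections in roots of l. *)
Definition sqsum (x : hdual h) : R := \sum_(c <- rts | dq c == 0) rf c x ^+ 2.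

Lemma sqsum_lp x : sqsum x = 2 * \sum_(c <- rts | `[< lp c >]) rf c x ^+ 2.
Proof.
rewrite /sqsum (bigID (fun c => `[< lp c >])) /= mulr_natl mulr2n; congr (_ + _).
  rewrite big_seq_cond [RHS]big_seq_cond; apply: eq_bigl => c; case: (c \in rts) => //=.
  by case: asboolP => [/lp_root [_ ->]|]; rewrite ?eqxx // andbF.
have pr : perm_eq [seq - c | c <- (@rts _ _ h bil)] rts.
  apply: uniq_perm; [by rewrite map_inj_uniq ?rts_uniq //; exact: oppr_inj | exact: rts_uniq |].
  move=> c; apply/mapP/idP => [[d /rtsP rd ->]|/rtsP rd]; first by apply/rtsP; exact: rootsN.
  by exists (- c); rewrite ?opprK //; apply/rtsP; exact: rootsN.
rewrite -(perm_big _ pr) big_map /=.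
under eq_bigr do rewrite rfNl sqrrN.
rewrite [LHS]big_seq_cond [RHS]big_seq_cond.
apply: eq_bigl => c; case: (boolP (c \in rts)) => //= /rtsP rc.
rewrite dgN oppr_eq0; case: asboolP => [l1|l1]; case: asboolP => [l2|l2]; rewrite ?andbF ?andbT //.
- have [p1 _] := proj1 (lpE (rp := rp) _) l1; have [p2 _] := proj1 (lpE (rp := rp) _) l2.
  by case: (pos_opp ss_borel ss_hb p2 p1).
- by have [_ ->] := lp_root l2; rewrite eqxx.
by apply/negbTE/eqP => dc; have [] := lp_or_neg (ss := ss) rc dc.
Qed.

Lemma sqsum_sr c x : roots c -> dq c = 0 -> sqsum (sr (rp := rp) c x) = sqsum x.
Proof.
move=> rc dc; have pr : perm_eq [seq sr (rp := rp) c a | a <- (@rts _ _ h bil)] rts.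
  apply: uniq_perm; [| exact: rts_uniq |].
    by rewrite map_inj_uniq ?rts_uniq //; exact: (can_inj (srK rc)).
  move=> a; apply/mapP/idP => [[d /rtsP rd ->]|/rtsP ra]; first by apply/rtsP; exact: sr_root.
  by exists (sr (rp := rp) c a); [apply/rtsP; exact: sr_root | rewrite srK].
rewrite /sqsum -(perm_big _ pr) big_map; apply: eq_big => [a|a _]; first by rewrite dg_sr.
by rewrite sr_rf.
Qed.

(** Let [x] be the reflection of [mu] in [a0]. It is long and pairs positively with [eps]: either
    [x = eps], or [x - eps] is a root of l whose reflection takes [x] to [eps]. *)
Lemma sqsum_eq a0 : lp a0 -> isw (eps + a0) -> sqsum mu = sqsum eps.
Proof.
move=> la w; have [ra da] := lp_root la; have L0 := L_gt0.
have r1 : roots (eps + a0) by apply: isw_roots => //; apply: dq_neq0; rewrite dgD da addr0 deps oner_eq0.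
have neg : rf a0 eps < 0.
  have := leps r1; rewrite rf_add -addrA gerDl => le; have a0p : 0 < rf a0 a0 by exact: rf_gt0.
  have : 2 * rf eps a0 < 0 by rewrite -(ltrD2l (rf a0 a0)) addr0; exact: le_lt_trans le a0p.
  by rewrite pmulr_rlt0 // rfC.
have [em ee] : rf a0 mu = L / 2 /\ rf a0 eps = - (L / 2).
  have h0 : 0 < L / 2 by rewrite divr_gt0.
  by case: (lp_cases la) => [[_ [] e]|[_ [] e]|//]; rewrite e ?ltxx // ltNge (ltW h0) in neg.
pose x := sr (rp := rp) a0 mu; have rx : roots x by exact: sr_root.
have xL : rf x x = L by rewrite /x sr_rf.
have [k ek _] := rf_int ra (roots_isw rmu).
have a0p : 0 < rf a0 a0 by exact: rf_gt0.
have kE : k%:~R * rf a0 a0 = L by rewrite -ek rfC em; field.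
have k1 : 1 <= k.
  have : 0 < k by rewrite -(ltr0z R) -(pmulr_lgt0 _ a0p) kE.
  lia.
have xE : x = mu - re_inj (real_part := rp) k%:~R *: a0.
  by rewrite /x /sr ek mulfK // gt_eqF.
have xe : rf x eps = k%:~R * (L / 2) by rewrite xE rfDl rfNl rfZl mu_eps0 ee; ring.
rewrite -(sqsum_sr mu ra da) -/x.
have [-> // | ne] := eqVneq x eps.
have k1' : k = 1.
  apply/eqP; rewrite eq_le k1 andbT leNgt; apply/negP => k2; move/eqP: ne; apply.
  apply: close_eq => //; rewrite xL len_eps xe.
  have : 2 * L <= k%:~R * L by rewrite ler_wpM2r ?(ltW L0) // -[2]/(2%:~R) ler_int; lia.
  lra.
rewrite k1' mul1r in xe.
have rb : roots (x - eps).
  apply: isw_roots; last by rewrite subr_eq0.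
  by apply: rts_sub => //; [exact: roots_isw | rewrite xe divr_gt0].
have db : dq (x - eps) = 0 by rewrite dgD dgN /x dg_sr // dmu deps subrr.
rewrite -(sqsum_sr x rb db); congr sqsum.
have bL : rf (x - eps) (x - eps) = L by rewrite rf_sub xL len_eps xe; field.
have xb : rf x (x - eps) = L / 2 by rewrite rfDr rfNr xL xe; field.
rewrite /sr bL xb (_ : 2 * (L / 2) / L = 1) ?rmorph1 ?scale1r; last by field; rewrite gt_eqF.
by vring.
Qed.

Section Eval.
Variable P : seq (g * g).
Hypothesis PP : dual_pairs (b := b) (al := al) (q := q) P.
Hypothesis mu_hw : highest_weight b al q (@lie_br _ g) (gr 1) mu.

(** If some [eps + a] is a weight, [sqsum_eq] cancels the quadratic part of [diff_sum]. If none is,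
    no root has [typeX], and a root vector of [eps] is a highest weight vector in g(1), where the
    Casimir operator is a scalar; so [mu] and [eps], being equally long, have equal sums over the
    roots of l. *)
Lemma half_sum : \sum_(c <- rts | `[< lp c >]) rf (mu - eps) c = (count typeX rts)%:R * L.
Proof.
have [[a0 [la w]]|none] := pselect (exists a, lp a /\ isw (eps + a)).
  rewrite diff_sum; have := sqsum_eq la w; rewrite !sqsum_lp => /(mulfI (_ : 2 != 0 :> R)) ->.
    by rewrite subrr mulr0 add0r.
  by rewrite pnatr_eq0.
have c0 : count typeX rts = 0%N.
  apply/eqP; rewrite -leqn0 -(count_pred0 (@rts _ _ h bil)); apply: sub_count => a /andP [/asboolP la neg].
  have [ra _] := lp_root la; exfalso; apply: none; exists a; split=> //.
  by apply: rts_add => //; [exact: roots_isw | rewrite rfC].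
rewrite c0 mul0r.
have /iswP [v va v0] := roots_isw reps.
have gv : Gr 1 v by apply: (Gr_root (roots_isw reps) _ va); rewrite deps.
have e1 := cas_g1 PP mu_hw gv.
have e2 : cas P (act := @lie_br _ g) v = cas_val eps *: v.
  have [_ _ _ H] := PP; rewrite /cas (H _ (@lie_br _ g) _ v eps) //; first exact/root_spaceP.
  move=> a x la xa; apply/eqP/negPn/negP => n0; apply: none; exists a; split=> //.
  by rewrite addrC; apply/iswP; exists (br x v) => //; exact: br_root_space.
have : cas_val mu = cas_val eps.
  apply/eqP; rewrite -subr_eq0; have : (cas_val mu - cas_val eps) *: v = 0 by rewrite scalerBl -e1 e2 subrr.
  by move/eqP; rewrite scaler_eq0 (negPf v0) orbF.
rewrite (cas_re (realw_root rmu)) (cas_re (realw_root reps)).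
rewrite (hform_rf rmu (roots_isw rmu)) (hform_rf reps (roots_isw reps)) !subrr !addr0 => /fmorph_inj.
rewrite len_eps => /addrI e; under eq_bigr do rewrite rfDl rfNl.
by rewrite sumrB e subrr.
Qed.

(** For a root [a] counted here other than [mu] and [eps], [split_pair] makes [mu - a] a positive
    root of l that pairs negatively with [eps]. The two extra elements [mu] and [eps] account for
    the [- 1] in the special value. *)
Lemma card_pairs : #|` fset_set (roots_in_compl (mu + eps) (gr 1))| = (count typeX rts).+2.
Proof.
set A := roots_in_compl _ _.
have AP a : A a <-> [/\ roots a, dq a = 1 & roots (mu + eps - a)].
  split=> [[[ra /subvP sub] rd]|[ra da rd]].
    split=> //; have /iswP [x xa x0] := roots_isw ra.
    have gx : Gr 1 x by apply/(grP (rp := rp)) => //; exact: sub.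
    have [k ek] := dg_int (rp := rp) q ra.
    have gx' : Gr k x by exact: (Gr_root (roots_isw ra) ek xa).
    have [k1 | k1] := eqVneq k 1; first by rewrite ek k1.
    by rewrite (Gr_uniq gx' gx k1) eqxx in x0.
  split=> //; split=> //; apply/subvP => x xa; apply/(grP (rp := rp)) => //.
  by apply: (Gr_root (roots_isw ra) _ xa); rewrite da.
pose s := mu :: eps :: [seq mu - a | a <- @rts _ _ h bil & typeX a].
have tX a : typeX a -> [/\ lp a, rf a mu = L / 2 & rf a eps = - (L / 2)].
  move=> /andP [/asboolP la neg]; have h0 : 0 < L / 2 by rewrite divr_gt0 // L_gt0.
  by case: (lp_cases la) => [[_ [] e]|[_ [] e]|[e1 e2]]; rewrite ?e ?ltxx // ?[_ < 0]ltNge ?(ltW h0) // in neg.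
have h0 : 0 < L / 2 by rewrite divr_gt0 // L_gt0.
have pmu c : lp c -> 0 <= rf c mu.
  by move=> lc; case: (lp_cases lc) => [[-> _]|[-> _]|[-> _]]; rewrite ?(ltW h0).
have sP a : A a <-> a \in s.
  rewrite AP /s !inE; split=> [[ra da rd]|].
    have [//|/eqP am] := eqVneq a mu; have [//|/eqP ae] := eqVneq a eps; apply/orP; right.
    have [e1 e2] := split_pair ra rd am ae.
    have e1' : rf a mu = L / 2 by rewrite -e1; field.
    have e2' : rf a eps = L / 2 by rewrite -e2; field.
    have rc : roots (mu - a).
      apply: isw_roots; last by rewrite subr_eq0 eq_sym; apply/eqP.
      by apply: rts_sub => //; [exact: roots_isw | rewrite rfC e1'].
    have dc : dq (mu - a) = 0 by rewrite dgD dgN dmu da subrr.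
    have lc : lp (mu - a).
      have [//|/pmu] := lp_or_neg (ss := ss) rc dc.
      by rewrite rfNl rfDl rfNl e1' -/L oppr_ge0 leNgt; have -> : L - L / 2 = L / 2 by [field]; rewrite h0.
    apply/mapP; exists (mu - a); last by vring.
    rewrite mem_filter; apply/andP; split; last by apply/rtsP.
    by apply/andP; split; [apply/asboolP | rewrite rfDl rfNl mu_eps0 e2' sub0r oppr_lt0].
  case/or3P => [/eqP ->|/eqP ->|/mapP [c]].
  - by split=> //; have -> : mu + eps - mu = eps by vring.
  - by split=> //; have -> : mu + eps - eps = mu by vring.
  rewrite mem_filter => /andP [/tX [lc e1 e2] _] ->; have [rc dc] := lp_root lc.
  have d1 : dq (mu - c) = 1 by rewrite dgD dgN dmu dc subr0.
  have -> : mu + eps - (mu - c) = eps + c by vring.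
  split=> //; apply: isw_roots.
  - by apply: rts_sub => //; [exact: roots_isw | rewrite rfC e1].
  - by apply: dq_neq0; rewrite d1 oner_eq0.
  - by apply: rts_add => //; [exact: roots_isw | rewrite rfC e2 oppr_lt0].
  by apply: dq_neq0; rewrite dgD dc addr0 deps oner_eq0.
have us : uniq s.
  rewrite /s /= inE negb_or eq_sym; apply/and3P; split.
  - apply/andP; split; first exact/eqP.
    apply/mapP => -[c]; rewrite mem_filter => /andP [/tX [lc _ _] _] e.
    have [rc _] := lp_root lc; move/negP: (roots_neq0 rc); apply; apply/eqP.
    by apply: (eq_by e); vring.
  - apply/mapP => -[c]; rewrite mem_filter => /andP [/tX [lc e1 _] _] e.
    have : rf eps mu = L - rf c mu by rewrite e rfDl rfNl.
    rewrite rfC mu_eps0 e1 => /esym; have -> : L - L / 2 = L / 2 by field.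
    by move/eqP; rewrite gt_eqF.
  rewrite map_inj_uniq ?filter_uniq ?rts_uniq // => c d e.
  by apply: (eq_by (esym e)); vring.
by rewrite (card_fset_set us sP) /s /= size_map size_filter.
Qed.

Lemma type1a_val (N := #|` fset_set (roots_in_compl (mu + eps) (gr 1))|) : rf mu mu = rf (al q) (al q) ->
  re_inj (real_part := rp) (N%:R / 2 - 1) * re_inj (rf (al q) (al q)) = cas_val mu - cas_val (mu + eps) / 2.
Proof.
move=> e; apply: cas_diff => //; rewrite half_sum len_eps mu_eps0 /N card_pairs -e -/L.
by rewrite -[X in X%:R]addn2 natrD; field.
Qed.
End Eval.
End Type1a.
End Highest.

(** The iterates of a lowering operator on [v] belong to distinct eigenvalues of [hvec a], so in
    finite dimension one of them vanishes and [chain] applies. *)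
Lemma hw_dominant (E : vectType C) (act : g -> E -> E) (lm : lie_module act) v nu a :
  v != 0 -> (forall H, H \in h -> act H v = wt nu H *: v) ->
  (forall a x, lp a -> x \in root_space a -> act x v = 0) -> lp a -> 0 <= rf nu a.
Proof.
move=> v0 hv ev la; have [pa da] := proj1 (lpE (rp := rp) a) la; have ra := pos_root pa.
have [x [y [xa ya k1]]] := root_pair ra.
have exy : br x y = hvec a by rewrite (br_opp xa ya) k1 scale1r.
have eft w : actf (act := act) x (actf (act := act) y w) = actf (act := act) y (actf (act := act) x w) + actf (act := act) (hvec a) w.
  by rewrite !actfE -exy act_br addrCA subrr addr0.
have tf w : actf (act := act) (hvec a) (actf (act := act) y w) =
    actf (act := act) y (actf (act := act) (hvec a) w) - hform a a *: actf (act := act) y w.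
  rewrite !actfE; have e : act (br (hvec a) y) w = act (hvec a) (act y w) - act y (act (hvec a) w) by exact: act_br.
  rewrite (br_hvec _ ya) hformNl actZl in e; apply: (eq_by (esym e)); vring.
have hh : actf (act := act) (hvec a) v = hform nu a *: v by rewrite actfE hv ?hvec_h // hform_wt.
have ex : actf (act := act) x v = 0 by rewrite actfE (ev a x la xa).
have aa0 : hform a a != 0 by exact: hform_neq0.
have [N eN] : exists N, iter N (actf (act := act) y) v = 0.
  apply: contrapT => hn; have [s [_ sc _]] := tr_eigen (actf (act := act) (hvec a)).
  pose l := [seq hform nu a - k%:R * hform a a | k <- iota 0 (size s).+1].
  have : (size l <= size s)%N.
    apply: uniq_leq_size.
      rewrite map_inj_uniq ?iota_uniq // => k k' /addrI /oppr_inj /(mulIf aa0) /eqP.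
      by rewrite eqr_nat => /eqP.
    move=> c /mapP [k _ ->]; apply: (sc _ (iter k (actf (act := act) y) v)).
      by apply/eqP => e; apply: hn; exists k.
    exact: (chain_t tf).
  by rewrite size_map size_iota ltnn.
have [k [ek _ _]] := chain eft tf ex v0 hh eN.
have e : 2 * rf nu a = k%:R * rf a a.
  have := congr1 (re_part (real_part := rp)) ek.
  rewrite -[k%:R](rmorph_nat (re_inj (real_part := rp))) re_injM mulr_natr mulr2n raddfD /=.
  by move=> <-; rewrite /root_form; ring.
have : 0 <= 2 * rf nu a by rewrite e mulr_ge0 ?ler0n // ltW // rf_gt0.
by rewrite pmulr_rge0.
Qed.
End Combinatorics.

(** * From special constituents to conformal data *)

Section Special.
Context {C : numClosedFieldType} {R : realFieldType} {rp : real_part C R}.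
Context {g : lie_algebra C} {h : {vspace g}}.
Context {bil : bilinear_lie g} {hc : is_cartan h} {nd : nondeg_killing g}.
Context {b : {vspace g}} {n : nat} {al : 'I_n -> hdual h} {ss : simple_system b al}.
Context {q : 'I_n} {ts : two_step b al q}.
Local Notation dq := (dg (rp := rp) (al := al) q).
Local Notation rf := (root_form (rp := rp)).
Local Notation Gr := (graded (rp := rp) (al := al) (q := q)).
Local Notation lp := (lp (b := b) (al := al) (q := q)).
Local Notation gr := (gr al q).
Local Notation nb := (nilrad_opp al q).

Lemma gr1_roots a : roots_in (gr 1) a -> roots a /\ dq a = 1.
Proof.
move=> [ra /subvP sub]; split=> //; have /iswP [x xa x0] := roots_isw ra.
have gx : Gr 1 x by apply/(grP (rp := rp)) => //; exact: sub.
have [k ek] := dg_int (rp := rp) q ra.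
have gx' : Gr k x by exact: (Gr_root (roots_isw ra) ek xa).
have [k1 | k1] := eqVneq k 1; first by rewrite ek k1.
by rewrite (Gr_uniq gx' gx k1) eqxx in x0.
Qed.

Lemma long_rf (mu c : hdual h) : long_root mu -> roots c -> rf c c <= rf mu mu.
Proof.
move=> [rm hm] rc; have := hm c rc; rewrite le_eqVlt => /orP [/eqP E | lt].
  by rewrite /root_form E.
by rewrite -subr_ge0 /root_form -raddfB; apply/ltW/re_gt0; rewrite subr_gt0.
Qed.

(** All five degrees are inhabited. The bound guarantees that the exponential series in [Ad_inv],
    cut at [dim g] terms, keeps its powers up to the fourth. *)
Lemma dim_ge5 mu a : roots mu -> dq mu = 1 -> roots a -> dq a = 2 -> (5 <= \dim {:g})%N.
Proof.
move=> rm dm ra da.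
have rv (c : hdual h) (k : int) : roots c -> dq c = k%:~R -> exists2 x, Gr k x & x != 0.
  move=> rc dc; have /iswP [x xa x0] := roots_isw rc.
  by exists x => //; exact: (Gr_root (roots_isw rc) dc xa).
have [x1 g1 n1] : exists2 x, Gr 1 x & x != 0 by apply: (rv mu 1 rm); rewrite dm.
have [x2 g2 n2] : exists2 x, Gr 2 x & x != 0 by apply: (rv a 2 ra); rewrite da.
have [y1 h1 m1] : exists2 x, Gr (-1) x & x != 0 by apply: (rv (- mu) (-1) (rootsN rm)); rewrite dgN dm.
have [y2 h2 m2] : exists2 x, Gr (-2) x & x != 0.
  by apply: (rv (- a) (-2) (rootsN ra)); rewrite dgN da.
have n0 : hvec mu != 0.
  by apply: contraNneq (hform_neq0 rm) => E; rewrite hformE E killing0l.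
pose xs (k : int) : g := if k == -2 then y2 else if k == -1 then y1 else if k == 0 then hvec mu
  else if k == 1 then x1 else if k == 2 then x2 else 0.
have gxs k : Gr k (xs k).
  rewrite /xs; case: eqP => [->//|_]; case: eqP => [->//|_]; case: eqP => [->|_].
    by apply: h_Gr0; exact: hvec_h.
  by case: eqP => [->//|_]; case: eqP => [->//|_]; exact: Gr0.
have nxs (i : 'I_5) : xs (i%:Z - 2) != 0 by case: i => [[|[|[|[|[|i]]]]]].
pose X := [tuple xs (i%:Z - 2) | i < 5].
have Xi (i : 'I_5) : X`_i = xs (i%:Z - 2) by rewrite -tnth_nth tnth_mktuple.
have fX : free X.
  apply/freeP => k hk i.
  have [y gy ny] : exists2 y, Gr (- (i%:Z - 2)) y & killing (xs (i%:Z - 2)) y != 0.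
    apply: contrapT => hn; move/negP: (nxs i); apply; apply/eqP.
    apply: (Gr_nondeg (gxs _)) => y gy; apply/eqP/negPn/negP => ny.
    by apply: hn; exists y.
  have := congr1 (fun v => killing v y) hk; rewrite killing_suml killing0l (bigD1 i) //=.
  rewrite big1 => [|j ji].
    by rewrite addr0 killingZl Xi => /eqP; rewrite mulf_eq0 (negPf ny) orbF => /eqP.
  rewrite killingZl Xi (Gr_killing (gxs _) gy) ?mulr0 //.
  apply: contra ji => /eqP E; apply/eqP/val_inj => /=; lia.
have : (\dim <<X>> <= \dim {:g})%N by apply: dimvS; exact: subvf.
by move: fX; rewrite /free => /eqP ->; rewrite size_tuple.
Qed.

Variables (mu eps : hdual h) (V Vd : {vspace tensor g}).
Hypothesis mu_hw : highest_weight b al q (@lie_br _ g) (gr 1) mu.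
Hypothesis Virr : levi_irreducible al q (@tens_act _ g) V.
Hypothesis Vhw : highest_weight b al q (@tens_act _ g) V (mu + eps).
Hypothesis eps1 : roots_in (gr 1) eps.
Hypothesis Vdual : dual_constituent al q V Vd.
Local Notation L := (killing (hvec (lam (al := al) q))).
Local Notation bS := (bS (al := al) (q := q)).
Local Notation F := (fun i : 'I_(\dim (gr 1)) => kdual (gr (- 1)) i).

(** What the analytic part takes from the algebra: enough terms of the exponential series,
    injectivity of [S -> bS S] for linear independence, and the identity that makes the first order
    term of the commutator vanish. *)
Definition conformal_data (s : C) :=
  [/\ (5 <= \dim {:g})%N,
      forall S, S \in Vd -> (forall X X', Gr 1 X -> Gr 1 X' -> bS S X X' = 0) -> S = 0 &
      forall S X, S \in Vd -> Gr 1 X ->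
        \sum_i \sum_j ttau2_coef S i j *: br (br X (F i)) (F j) =
        2 * s *: (\sum_i \sum_j ttau2_coef S i j *: (L (br X (F i)) *: F j))].

Lemma conformal_of_admissible (K0 K1 K2 s : R) : ~ roots (mu + eps) ->
  (forall a, roots a -> dq a = 2 -> roots (mu + eps - a) ->
    [/\ isw (a - mu), rf a mu = K1 /\ rf a eps = K2, rf a (mu + eps) = K0,
        rf a a <= K0 & rf (mu + eps - a) (mu + eps - a) <= K0]) ->
  (forall a, lp a -> rf eps a = 0 -> ~ isw (eps - a)) ->
  (forall P, dual_pairs (b := b) (al := al) (q := q) P ->
    re_inj (real_part := rp) s * re_inj (rf (al q) (al q)) =
    casimir_value (b := b) (al := al) (q := q) mu - casimir_value (b := b) (al := al) (q := q) (mu + eps) / 2) ->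
  conformal_data (re_inj (real_part := rp) s).
Proof.
move=> nsum adm down sval.
have [rmu dmu hmu] : [/\ roots mu, dq mu = 1 & forall c, lp c -> ~ isw (mu + c)] by exact: hw_root.
have [reps deps] := gr1_roots eps1.
have nu_isw : ~ isw (mu + eps) by exact: (nsum_isw (rp := rp) (al := al) (q := q) dmu deps nsum).
have [a [ra da _]] : exists a, [/\ roots a, dq a = 2 & roots (mu + eps - a)].
  exact: (J_ex (rp := rp) nu_isw Virr Vhw Vdual).
have dim5 := dim_ge5 rmu dmu ra da.
have [P PP] : exists P, dual_pairs (b := b) (al := al) (q := q) P by exact: dual_pairs_ex.
split=> //.
  by move=> S SV hS; exact: (bS_inj rmu dmu hmu reps deps nu_isw Virr Vhw Vdual adm down SV hS).
by move=> S X SV gX; exact: (key_identity Virr Vhw Vdual PP mu_hw SV gX (sval P PP)).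
Qed.

Lemma conformal_1a : type_1a mu eps ->
  conformal_data (#|` fset_set (roots_in_compl (mu + eps) (gr 1))|%:R / 2 - 1).
Proof.
move=> [nsum neq lmu leps].
have [rmu dmu hmu] : [/\ roots mu, dq mu = 1 & forall c, lp c -> ~ isw (mu + c)] by exact: hw_root.
have [reps deps] := gr1_roots eps1.
have nu_isw : ~ isw (mu + eps) by exact: (nsum_isw (rp := rp) (al := al) (q := q) dmu deps nsum).
have J : exists a, [/\ roots a, dq a = 2 & roots (mu + eps - a)].
  exact: (J_ex (rp := rp) nu_isw Virr Vhw Vdual).
have lm (c : hdual h) : roots c -> rf c c <= rf mu mu by move=> rc; exact: (long_rf lmu rc).
have le (c : hdual h) : roots c -> rf c c <= rf eps eps by move=> rc; exact: (long_rf leps rc).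
have dom a : lp a -> 0 <= rf (mu + eps) a.
  have [v [vV /eqP v0 hv ev]] := Vhw => la.
  by apply: (hw_dominant (act := @tens_act _ g) _ v0 hv _ la) => c x [lc pc]; apply: ev.
have E : (#|` fset_set (roots_in_compl (mu + eps) (gr 1))|%:R / 2 - 1 : C) =
    re_inj (real_part := rp) (#|` fset_set (roots_in_compl (mu + eps) (gr 1))|%:R / 2 - 1).
  by rewrite rmorphB rmorph1 rmorphM fmorphV !rmorph_nat.
rewrite E.
apply: (conformal_of_admissible nsum (type1a_admissible rmu dmu reps deps nsum neq lm le J)).
  by move=> a la; exact: (eps_down deps le la).
move=> P PP; apply: (type1a_val rmu dmu hmu reps deps nsum neq lm le J dom PP mu_hw).
exact: highest_length.
Qed.

Lemma conformal_2 : type_2 mu eps -> conformal_data (-1).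
Proof.
move=> [em nsum].
have [rmu dmu hmu] : [/\ roots mu, dq mu = 1 & forall c, lp c -> ~ isw (mu + c)] by exact: hw_root.
have nw : ~ isw (mu + mu) by exact: (nsum_isw (rp := rp) (al := al) (q := q) dmu dmu nsum).
have E : (-1 : C) = re_inj (real_part := rp) (-1) by rewrite rmorphN1.
rewrite E.
apply: (conformal_of_admissible (K0 := 2 * rf mu mu) (K1 := rf mu mu) (K2 := rf mu mu)); rewrite em.
- exact: nsum.
- exact: (type2_admissible rmu dmu hmu nw).
- by move=> a la; exact: (lp_down rmu hmu la).
by move=> P PP; apply: type2_val => //; exact: highest_length.
Qed.

End Special.

(** * Smooth functions *)

Local Open Scope classical_set_scope.
Local Open Scope ring_scope.

Lemma eps3 (R : realType) (A B L a b e : R) : `|a - A| < e / 3 -> `|a + b - L| < e / 3 -> `|b - B| < e / 3 ->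
  `|L - (A + B)| <= e.
Proof.
rewrite !ltr_norml ler_norml => /andP [? ?] /andP [? ?] /andP [? ?].
by apply/andP; split; lra.
Qed.
Lemma eps2 (R : realType) (A B a e : R) : `|a - A| < e / 2 -> `|a - B| < e / 2 -> `|A - B| <= e.
Proof.
rewrite !ltr_norml ler_norml => /andP [? ?] /andP [? ?].
by apply/andP; split; lra.
Qed.
Lemma mixed_quot (R : realType) (p0 p1 p2 p3 t X Y : R) : t != 0 ->
  p1 - p2 - (p3 - p0) = t * (t * X) -> p1 - p3 - (p2 - p0) = t * (t * Y) -> X = Y.
Proof.
by move=> t0 e1 e2; apply: (mulfI t0); apply: (mulfI t0); rewrite -e1 -e2; ring.
Qed.

(** * Directional derivatives: linearity in the direction and mixed derivatives *)

Section Directional.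
Context {R : realType} {V : normedModType R}.
Implicit Types (f : V -> R) (x u v : V) (e t : R).

Lemma quot_lim f x v e : derivable f x v -> 0 < e ->
  exists2 dl, 0 < dl & forall t, t != 0 -> `|t| < dl ->
    `|t^-1 * (f (x + t *: v) - f x) - 'D_v f x| < e.
Proof.
move=> df e0; have /cvgrPdist_lt /(_ e e0) : (fun h => h^-1 *: ((f \o shift x) (h *: v) - f x)) @ 0^' --> 'D_v f x by exact: df.
move=> /nbhs_ballP [dl /= dl0 hd]; exists dl => // t t0 tl.
have := hd t; rewrite -ball_normE /= sub0r normrN => /(_ tl t0).
by move=> H; rewrite distrC [x + t *: v]addrC; exact: H.
Qed.

Lemma cont_eps (G : V -> R) x e : {for x, continuous G} -> 0 < e ->
  exists2 dl, 0 < dl & forall y, `|y - x| < dl -> `|G y - G x| < e.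
Proof.
move=> /cvgrPdist_lt cG e0; have /nbhs_ballP [dl /= dl0 hd] := cG e e0.
exists dl => // y yx; have := hd y; rewrite -ball_normE /= distrC => /(_ yx).
by rewrite distrC.
Qed.

Lemma line_is_derive f x v (s : R) : derivable f (x + s *: v) v ->
  is_derive s 1 (fun t => f (x + t *: v)) ('D_v f (x + s *: v)).
Proof.
move=> df.
have e : (fun h => h^-1 *: (((fun t => f (x + t *: v)) \o shift s) (h *: (1 : R)) - f (x + s *: v))) =
   (fun h => h^-1 *: ((f \o shift (x + s *: v)) (h *: v) - f (x + s *: v))).
  apply/funext => h; congr (_ *: (f _ - _)); rewrite /shift /=.
  by rewrite scalerDl [h *: 1]mulr1 addrCA.
by split; [rewrite /derivable e | rewrite /derive e].
Qed.

Lemma MVT_line f x v t : 0 < t -> (forall y, derivable f y v) ->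
  exists2 c, (0 < c < t) & f (x + t *: v) - f x = t * 'D_v f (x + c *: v).
Proof.
move=> t0 df; have dl s : is_derive s (1 : R) (fun t => f (x + t *: v)) ('D_v f (x + s *: v)).
  exact: line_is_derive.
have [|c c0t e] := MVT t0 (fun s _ => dl s).
  by apply: derivable_within_continuous => s _; exact: ex_derive.
exists c; first by move: c0t; rewrite in_itv.
by move: e; rewrite subr0 scale0r addr0 mulrC.
Qed.

Lemma small_step (u v : V) dl : 0 < dl -> exists2 t0, 0 < t0 &
  forall t a c, 0 < t -> t <= t0 -> 0 <= a -> a <= t -> 0 <= c -> c <= t -> `|a *: u + c *: v| < dl.
Proof.
move=> dl0; pose K := `|u| + `|v| + 1.
have K0 : 0 < K by rewrite ltr_wpDl // addr_ge0.
exists (dl / K / 2); first by rewrite !divr_gt0.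
move=> t a c t0 tle a0 at' c0 ct.
apply: le_lt_trans (ler_normD _ _) _; rewrite !normrZ !ger0_norm //.
apply: (@le_lt_trans _ _ (t * K)).
  rewrite /K mulrDr mulr1 mulrDr -addrA lerD ?ler_wpM2r //.
  by apply: (le_trans (ler_wpM2r (normr_ge0 _) ct)); rewrite lerDl ltW.
apply: (@le_lt_trans _ _ (dl / 2)).
  by rewrite -ler_pdivlMr // mulrAC.
by rewrite ltr_pdivrMr // ltr_pMr // ltr1n.
Qed.

Lemma eps_eq (a c : R) : (forall e, 0 < e -> `|a - c| <= e) -> a = c.
Proof.
move=> h; apply/eqP; rewrite -subr_eq0 -normr_le0; apply/ler_addgt0Pr => e e0.
by rewrite add0r; exact: h.
Qed.

(** [Ck] speaks of directional derivatives only, so additivity in the direction has to be proved: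
    step along [u], then use the mean value theorem along [v] and the continuity of the derivative
    in the direction [v]. *)
Lemma deriveD_dir f x u v : (forall y, derivable f y v) -> {for x, continuous (fun y => 'D_v f y)} ->
  derivable f x u -> derivable f x (u + v) -> 'D_(u + v) f x = 'D_u f x + 'D_v f x.
Proof.
move=> dv cv du duv; apply: eps_eq => e e0; have e3 : 0 < e / 3 by rewrite divr_gt0.
have [d1 d10 h1] := quot_lim du e3; have [d2 d20 h2] := quot_lim duv e3.
have [d3 d30 h3] := cont_eps cv e3; have [t0 t00 ht] := small_step u v d30.
pose t := Num.min (Num.min (d1 / 2) (d2 / 2)) t0.
have tp : 0 < t by rewrite !lt_min !divr_gt0 // t00.
have td1 : t < d1.
  by apply: (@le_lt_trans _ _ (d1 / 2)); [rewrite !ge_min lexx | rewrite ltr_pdivrMr // ltr_pMr // ltr1n].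
have td2 : t < d2.
  by apply: (@le_lt_trans _ _ (d2 / 2)); [rewrite !ge_min lexx orbT | rewrite ltr_pdivrMr // ltr_pMr // ltr1n].
have tt0 : t <= t0 by rewrite ge_min lexx orbT.
have tn : t != 0 by rewrite gt_eqF.
have [c /andP [c0 ct] ec] := MVT_line (x + t *: u) tp dv.
have {}h1 := h1 t tn; have {}h2 := h2 t tn; rewrite (gtr0_norm tp) in h1 h2.
have {}h1 := h1 td1; have {}h2 := h2 td2.
have {}h3 := h3 (x + t *: u + c *: v); rewrite [_ - x]addrC addrA addrA addNr add0r in h3.
have {}h3 := h3 (ht t t c tp tt0 (ltW tp) (lexx _) (ltW c0) (ltW ct)).
have eq : t^-1 * (f (x + t *: (u + v)) - f x) =
    t^-1 * (f (x + t *: u) - f x) + 'D_v f (x + t *: u + c *: v).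
  rewrite scalerDr addrA -[f (x + t *: u + _)](subrK (f (x + t *: u))) ec.
  by field.
by rewrite eq in h2; exact: eps3 h1 h2 h3.
Qed.

Lemma deriveZ_dir f x v (c : R) : derivable f x v -> derivable f x (c *: v) ->
  'D_(c *: v) f x = c * 'D_v f x.
Proof.
move=> dv dcv; have [-> | c0] := eqVneq c 0; first by rewrite scale0r derive0 mul0r.
have cn : 0 < `|c| by rewrite normr_gt0.
apply: eps_eq => e e0; have e2 : 0 < e / 2 by rewrite divr_gt0.
have e2c : 0 < e / 2 / `|c| by rewrite divr_gt0.
have [d1 d10 h1] := quot_lim dcv e2; have [d2 d20 h2] := quot_lim dv e2c.
pose t := Num.min (d1 / 2) (d2 / `|c| / 2).
have tp : 0 < t by rewrite lt_min !divr_gt0.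
have tn : t != 0 by rewrite gt_eqF.
have td1 : t < d1.
  by apply: (@le_lt_trans _ _ (d1 / 2)); [rewrite !ge_min lexx | rewrite ltr_pdivrMr // ltr_pMr // ltr1n].
have td2 : t * `|c| < d2.
  apply: (@le_lt_trans _ _ (d2 / 2)); last by rewrite ltr_pdivrMr // ltr_pMr // ltr1n.
  by rewrite -ler_pdivlMr // mulrAC ge_min lexx orbT.
have {}h1 := h1 t tn; rewrite (gtr0_norm tp) in h1; have {}h1 := h1 td1.
have tc0 : t * c != 0 by rewrite mulf_neq0.
have {}h2 := h2 (t * c) tc0; rewrite normrM (gtr0_norm tp) in h2; have {}h2 := h2 td2.
have eq : t^-1 * (f (x + t *: (c *: v)) - f x) = c * ((t * c)^-1 * (f (x + (t * c) *: v) - f x)).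
  by rewrite scalerA; field; rewrite c0.
rewrite eq in h1; set A := (t * c)^-1 * _ in h1 h2.
have h3 : `|c * A - c * 'D_v f x| < e / 2 by rewrite -mulrBr normrM mulrC -ltr_pdivlMr.
exact: eps2 h1 h3.
Qed.

(** The second difference of [f] over a small parallelogram is [t^2] times either mixed derivative
    at some nearby point, by the mean value theorem applied twice; continuity then identifies the
    two limits. *)
Lemma schwarz f x u v : (forall y, derivable f y u) -> (forall y, derivable f y v) ->
  (forall y, derivable (fun z => 'D_u f z) y v) -> (forall y, derivable (fun z => 'D_v f z) y u) ->
  {for x, continuous (fun y => 'D_v (fun z => 'D_u f z) y)} ->
  {for x, continuous (fun y => 'D_u (fun z => 'D_v f z) y)} ->
  'D_v (fun z => 'D_u f z) x = 'D_u (fun z => 'D_v f z) x.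
Proof.
move=> du dv duv dvu c1 c2; apply: eps_eq => e e0; have e2 : 0 < e / 2 by rewrite divr_gt0.
have [d1 d10 h1] := cont_eps c1 e2; have [d2 d20 h2] := cont_eps c2 e2.
have [t1 t10 ht1] := small_step u v d10; have [t2 t20 ht2] := small_step u v d20.
pose t := Num.min t1 t2; have tp : 0 < t by rewrite lt_min t10.
have tt1 : t <= t1 by rewrite ge_min lexx.
have tt2 : t <= t2 by rewrite ge_min lexx orbT.
have key (a c : V) : (forall y, derivable f y a) -> (forall y, derivable (fun z => 'D_a f z) y c) ->
    exists s1 s2, [/\ 0 < s1 < t, 0 < s2 < t & f (x + t *: a + t *: c) - f (x + t *: c) - (f (x + t *: a) - f x) =
      t * (t * 'D_c (fun z => 'D_a f z) (x + s1 *: a + s2 *: c))].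
  move=> da dac; pose phi y := f (y + t *: c) - f y.
  have dshift y : is_derive y a (fun z => f (z + t *: c)) ('D_a f (y + t *: c)).
    have eq : (fun h => h^-1 *: (((fun z => f (z + t *: c)) \o shift y) (h *: a) - f (y + t *: c))) =
      (fun h => h^-1 *: ((f \o shift (y + t *: c)) (h *: a) - f (y + t *: c))).
      by apply/funext => h; rewrite /shift /= addrA.
    by split; [rewrite /derivable eq; exact: da | rewrite /derive eq].
  have dphi y : derivable phi y a by apply: derivableB; [exact: ex_derive | exact: da].
  have [s1 s1t e1] := MVT_line x tp dphi.
  have Dphi y : 'D_a phi y = 'D_a f (y + t *: c) - 'D_a f y.
    have [dd de] := dshift y; rewrite -de; apply: deriveB; [exact: dd | exact: da].
  have [s2 s2t e2'] := MVT_line (x + s1 *: a) tp dac.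
  exists s1, s2; split=> //; rewrite -e2' -Dphi -e1 /phi.
  by rewrite -!addrA; congr (_ + _); rewrite !opprD !opprK [RHS]addrCA.
have [s1 [s2 [/andP [s1p s1t] /andP [s2p s2t] es]]] := key u v du duv.
have [r1 [r2 [/andP [r1p r1t] /andP [r2p r2t] er]]] := key v u dv dvu.
have eq : 'D_v (fun z => 'D_u f z) (x + s1 *: u + s2 *: v) = 'D_u (fun z => 'D_v f z) (x + r1 *: v + r2 *: u).
  have t0 : t != 0 by rewrite gt_eqF.
  have e1 : x + t *: u + t *: v = x + t *: v + t *: u by exact: addrAC.
  by rewrite e1 in es; exact: (mixed_quot t0 es er).
have {}h1 := h1 (x + s1 *: u + s2 *: v); rewrite [_ - x]addrC addrA addrA addNr add0r in h1.
have {}h1 := h1 (ht1 t s1 s2 tp tt1 (ltW s1p) (ltW s1t) (ltW s2p) (ltW s2t)).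
have {}h2 := h2 (x + r1 *: v + r2 *: u); rewrite [_ - x]addrC addrA addrA addNr add0r [r1 *: v + _]addrC in h2.
have {}h2 := h2 (ht2 t r2 r1 tp tt2 (ltW r2p) (ltW r2t) (ltW r1p) (ltW r1t)).
by rewrite eq in h1; exact: eps2 h1 h2.
Qed.
End Directional.

Section RealSmooth.
Context {R : realType} {d : nat}.
Local Notation M := 'rV[R]_d.
Implicit Types (f k : M -> R) (x u v : M).

Lemma Ck_cont n f : Ck n f -> continuous f. Proof. by case: n => [|n] []. Qed.
Lemma Ck_der n f v : Ck n.+1 f -> forall x, derivable f x v.
Proof. by case=> _ h x; have [] := h v. Qed.
Lemma Ck_D n f v : Ck n.+1 f -> Ck n (fun x => 'D_v f x).
Proof. by case=> _ h; have [] := h v. Qed.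
Lemma CkS n f : Ck n.+1 f -> Ck n f.
Proof.
elim: n f => [|n IH] f [cf hf]; first by [].
by split=> // v; have [h1 h2] := hf v; split=> //; exact: IH.
Qed.

Lemma CkD n f k : Ck n f -> Ck n k -> Ck n (fun x => f x + k x).
Proof.
elim: n f k => [|n IH] f k cf ck.
  split; last by [].
  by move=> x; apply: continuousD; [exact: (Ck_cont cf) | exact: (Ck_cont ck)].
split=> [x|v]; first by apply: continuousD; [exact: (Ck_cont cf) | exact: (Ck_cont ck)].
split=> [x|]; first by apply: (@derivableD _ _ _ f k x v); [exact: (@Ck_der _ f v cf _) | exact: (@Ck_der _ k v ck _)].
rewrite (_ : (fun x => _) = (fun x => 'D_v f x + 'D_v k x)).
  by apply: IH; exact: Ck_D.
by apply/funext => x; rewrite -(@deriveD _ _ _ f k x v) //; [exact: (@Ck_der _ f v cf _) | exact: (@Ck_der _ k v ck _)].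
Qed.

Lemma CkM n f k : Ck n f -> Ck n k -> Ck n (fun x => f x * k x).
Proof.
elim: n f k => [|n IH] f k cf ck.
  split; last by [].
  by move=> x; apply: continuousM; [exact: (Ck_cont cf) | exact: (Ck_cont ck)].
split=> [x|v]; first by apply: continuousM; [exact: (Ck_cont cf) | exact: (Ck_cont ck)].
split=> [x|]; first by apply: (@derivableM _ _ f k x v); [exact: (@Ck_der _ f v cf _) | exact: (@Ck_der _ k v ck _)].
rewrite (_ : (fun x => _) = (fun x => f x * 'D_v k x + k x * 'D_v f x)).
  by apply: CkD; apply: IH; (exact: Ck_D || exact: CkS).
by apply/funext => x; rewrite -[RHS](@deriveM _ _ f k x v) //; [exact: (@Ck_der _ f v cf _) | exact: (@Ck_der _ k v ck _)].
Qed.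

Lemma Ck_cst n (c : R) : Ck n (fun _ : M => c).
Proof.
elim: n c => [|n IH] c; first by split=> //; exact: cst_continuous.
split=> [|v]; first exact: cst_continuous.
split=> [x|]; first exact: derivable_cst.
rewrite (_ : 'D_v (fun=> c) = (fun=> 0)) //; apply/funext => x; exact: derive_cst.
Qed.

Lemma coord_derive (i : 'I_d) x v : is_derive x v (fun y : M => y 0 i) (v 0 i).
Proof.
have e (h : R) : h != 0 -> h^-1 *: (((fun y : M => y 0 i) \o shift x) (h *: v) - x 0 i) = v 0 i.
  by move=> h0; rewrite /shift /= !mxE addrK [_ *: _]mulKf.
have c : (fun h : R => h^-1 *: (((fun y : M => y 0 i) \o shift x) (h *: v) - x 0 i)) @ 0^' --> v 0 i.
  apply: cvg_near_cst; rewrite near_withinE; near=> h => /= h0; rewrite e //.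
split; first by apply/cvg_ex; exists (v 0 i).
exact: cvg_lim.
Unshelve. all: by end_near.
Qed.

Lemma Ck_coord n (i : 'I_d) : Ck n (fun x : M => x 0 i).
Proof.
have cc : continuous (fun x : M => x 0 i) by exact: coord_continuous.
case: n => [|n]; first by [].
split=> // v; split=> [x|]; first by have [] := coord_derive i x v.
rewrite (_ : (fun x => _) = (fun=> v 0 i)); first exact: Ck_cst.
by apply/funext => x; have [_ ->] := coord_derive i x v.
Qed.

Lemma CkV n f : (forall x, f x != 0) -> Ck n f -> Ck n (fun x => (f x)^-1).
Proof.
move=> f0; elim: n => [|n IH] cf.
  split; last by [].
  by move=> x; apply: continuousV => //; exact: (Ck_cont cf).
split=> [x|v]; first by apply: continuousV => //; exact: (Ck_cont cf).
split=> [x|]; first by apply: derivableV => //; exact: (@Ck_der _ f v cf _).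
rewrite (_ : (fun x => _) = (fun x => (-1) * ((f x)^-1 * (f x)^-1) * 'D_v f x)).
  apply: CkM; last exact: Ck_D.
  by apply: CkM; [exact: Ck_cst | apply: CkM; apply: IH; exact: CkS].
apply/funext => x; rewrite deriveV //; last exact: (@Ck_der _ f v cf _).
by rewrite -exprVn expr2 mulN1r.
Qed.
End RealSmooth.

(** * Smooth complex valued functions *)

Section ComplexSmooth.
Context {R : realType} {d : nat}.
Local Notation M := 'rV[R]_d.
Local Notation C := R[i].
Local Notation Re := complex.Re.
Local Notation Im := complex.Im.
Implicit Types (f k : M -> C) (x u v : M).

Lemma cReD (a c : C) : Re (a + c) = Re a + Re c. Proof. by case: a c => [? ?] [? ?]. Qed.
Lemma cImD (a c : C) : Im (a + c) = Im a + Im c. Proof. by case: a c => [? ?] [? ?]. Qed.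
Lemma cReM (a c : C) : Re (a * c) = Re a * Re c - Im a * Im c. Proof. by case: a c => [? ?] [? ?]. Qed.
Lemma cImM (a c : C) : Im (a * c) = Re a * Im c + Im a * Re c. Proof. by case: a c => [? ?] [? ?]. Qed.
Lemma C_ext (a c : C) : Re a = Re c -> Im a = Im c -> a = c.
Proof. by case: a c => [? ?] [? ?] /= -> ->. Qed.

Lemma smooth_re f : smooth f -> forall n, Ck n (fun x => Re (f x)). Proof. by move=> h n; have [] := h n. Qed.
Lemma smooth_im f : smooth f -> forall n, Ck n (fun x => Im (f x)). Proof. by move=> h n; have [] := h n. Qed.

Lemma smoothD f k : smooth f -> smooth k -> smooth (fun x => f x + k x).
Proof.
move=> hf hk n; split.
  rewrite (_ : (fun x => _) = (fun x => Re (f x) + Re (k x))); last by apply/funext => x; exact: cReD.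
  by apply: CkD; exact: smooth_re.
rewrite (_ : (fun x => _) = (fun x => Im (f x) + Im (k x))); last by apply/funext => x; exact: cImD.
by apply: CkD; exact: smooth_im.
Qed.

Lemma smooth_cst (c : C) : smooth (fun _ : M => c).
Proof. by move=> n; split; exact: Ck_cst. Qed.

Lemma smoothM f k : smooth f -> smooth k -> smooth (fun x => f x * k x).
Proof.
move=> hf hk n; split.
  rewrite (_ : (fun x => _) = (fun x => Re (f x) * Re (k x) + (-1) * (Im (f x) * Im (k x)))).
    by apply: CkD; [|apply: CkM; first exact: Ck_cst]; apply: CkM; (exact: smooth_re || exact: smooth_im).
  by apply/funext => x; rewrite cReM mulN1r.
rewrite (_ : (fun x => _) = (fun x => Re (f x) * Im (k x) + Im (f x) * Re (k x))).
  by apply: CkD; apply: CkM; (exact: smooth_re || exact: smooth_im).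
by apply/funext => x; rewrite cImM.
Qed.

Lemma smoothZ (c : C) f : smooth f -> smooth (fun x => c * f x).
Proof. by apply: smoothM; exact: smooth_cst. Qed.
Lemma smoothN f : smooth f -> smooth (fun x => - f x).
Proof.
move=> hf; rewrite (_ : (fun x => _) = (fun x => (-1) * f x)); first exact: smoothZ.
by apply/funext => x; rewrite mulN1r.
Qed.
Lemma smoothB f k : smooth f -> smooth k -> smooth (fun x => f x - k x).
Proof. by move=> hf hk; apply: smoothD => //; exact: smoothN. Qed.
Lemma smooth_sum I (r : seq I) (P : pred I) (F : I -> M -> C) :
  (forall i, P i -> smooth (F i)) -> smooth (fun x => \sum_(i <- r | P i) F i x).
Proof.
move=> hF; elim: r => [|i r IH].
  by rewrite (_ : (fun x => _) = (fun=> 0)); [exact: smooth_cst | apply/funext => x; rewrite big_nil].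
have [Pi | nPi] := boolP (P i).
  rewrite (_ : (fun x => _) = (fun x => F i x + \sum_(j <- r | P j) F j x)).
    by apply: smoothD => //; exact: hF.
  by apply/funext => x; rewrite big_cons Pi.
rewrite (_ : (fun x => _) = (fun x => \sum_(j <- r | P j) F j x)) //.
by apply/funext => x; rewrite big_cons (negPf nPi).
Qed.
Lemma smooth_prod I (r : seq I) (F : I -> M -> C) :
  (forall i, smooth (F i)) -> smooth (fun x => \prod_(i <- r) F i x).
Proof.
move=> hF; elim: r => [|i r IH].
  by rewrite (_ : (fun x => _) = (fun=> 1)); [exact: smooth_cst | apply/funext => x; rewrite big_nil].
rewrite (_ : (fun x => _) = (fun x => F i x * \prod_(j <- r) F j x)); first by apply: smoothM.
by apply/funext => x; rewrite big_cons.
Qed.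
Lemma smooth_coord (i : 'I_d) : smooth (fun x : M => (x 0 i)%:C%C).
Proof. by move=> n; split; [exact: Ck_coord | exact: Ck_cst]. Qed.
Lemma smoothV f : (forall x, f x != 0) -> smooth f -> smooth (fun x => (f x)^-1).
Proof.
move=> f0 hf n.
pose N x := Re (f x) * Re (f x) + Im (f x) * Im (f x).
have N0 x : N x != 0.
  apply/negP => /eqP e; move/negP: (f0 x); apply; apply/eqP.
  have /eqP := e; rewrite /N -!expr2 paddr_eq0 ?sqr_ge0 // !sqrf_eq0 => /andP [/eqP e1 /eqP e2].
  exact: C_ext.
have cN : Ck n N by apply: CkD; apply: CkM; (exact: smooth_re || exact: smooth_im).
have eV x : (f x)^-1 = (Re (f x) * (N x)^-1 +i* ((-1) * Im (f x) * (N x)^-1))%C.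
  apply: (mulfI (f0 x)); rewrite divff //; apply: C_ext; rewrite ?cReM ?cImM /=.
    by have n0 := N0 x; move: n0; rewrite /N => n0; field.
  by ring.
split.
  rewrite (_ : (fun x => _) = (fun x => Re (f x) * (N x)^-1)); last by apply/funext => x; rewrite eV.
  by apply: CkM; [exact: smooth_re | exact: CkV].
rewrite (_ : (fun x => _) = (fun x => (-1) * Im (f x) * (N x)^-1)); last by apply/funext => x; rewrite eV.
by apply: CkM; [apply: CkM; [exact: Ck_cst | exact: smooth_im] | exact: CkV].
Qed.

Lemma Re_der f v x : smooth f -> derivable (fun y => Re (f y)) x v.
Proof. by move=> hf; have c := smooth_re hf 1; exact: (@Ck_der _ _ _ _ v c x). Qed.
Lemma Im_der f v x : smooth f -> derivable (fun y => Im (f y)) x v.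
Proof. by move=> hf; have c := smooth_im hf 1; exact: (@Ck_der _ _ _ _ v c x). Qed.

Lemma smooth_D f v : smooth f -> smooth (fun x => cderive f x v).
Proof. by move=> hf n; split; apply: Ck_D; [exact: smooth_re | exact: smooth_im]. Qed.

Lemma cderiveD f k x v : smooth f -> smooth k ->
  cderive (fun y => f y + k y) x v = cderive f x v + cderive k x v.
Proof.
move=> hf hk; apply: C_ext; rewrite ?cReD ?cImD /=.
  rewrite (_ : (fun y => _) = (fun y => Re (f y) + Re (k y))); last by apply/funext => y; exact: cReD.
  by apply: deriveD; exact: Re_der.
rewrite (_ : (fun y => _) = (fun y => Im (f y) + Im (k y))); last by apply/funext => y; exact: cImD.
by apply: deriveD; exact: Im_der.
Qed.

Lemma cderive_cst (c : C) x v : cderive (fun=> c) x v = 0.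
Proof. by apply: C_ext => /=; exact: derive_cst. Qed.

Lemma cderiveM f k x v : smooth f -> smooth k ->
  cderive (fun y => f y * k y) x v = cderive f x v * k x + f x * cderive k x v.
Proof.
move=> hf hk.
have dM (a c : M -> R) : derivable a x v -> derivable c x v ->
    derivable (fun y => a y * c y) x v /\ 'D_v (fun y => a y * c y) x = a x * 'D_v c x + c x * 'D_v a x.
  by move=> da dc; split; [exact: (derivableM da dc) | exact: (deriveM da dc)].
have rf : derivable (fun y => Re (f y)) x v by exact: Re_der.
have mf : derivable (fun y => Im (f y)) x v by exact: Im_der.
have rk : derivable (fun y => Re (k y)) x v by exact: Re_der.
have mk : derivable (fun y => Im (k y)) x v by exact: Im_der.
have [d1 e1] := dM _ _ rf rk; have [d2 e2] := dM _ _ mf mk.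
have [d3 e3] := dM _ _ rf mk; have [d4 e4] := dM _ _ mf rk.
apply: C_ext; rewrite ?cReD ?cImD ?cReM ?cImM /=.
  rewrite (_ : (fun y => _) = (fun y => Re (f y) * Re (k y) - Im (f y) * Im (k y))); last by apply/funext => y; exact: cReM.
  have -> : 'D_v (fun y => Re (f y) * Re (k y) - Im (f y) * Im (k y)) x =
     'D_v (fun y => Re (f y) * Re (k y)) x - 'D_v (fun y => Im (f y) * Im (k y)) x by exact: (deriveB d1 d2).
  by rewrite e1 e2; ring.
rewrite (_ : (fun y => _) = (fun y => Re (f y) * Im (k y) + Im (f y) * Re (k y))); last by apply/funext => y; exact: cImM.
have -> : 'D_v (fun y => Re (f y) * Im (k y) + Im (f y) * Re (k y)) x =
   'D_v (fun y => Re (f y) * Im (k y)) x + 'D_v (fun y => Im (f y) * Re (k y)) x by exact: (deriveD d3 d4).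
by rewrite e3 e4; ring.
Qed.

Lemma cderive_coord (i : 'I_d) x v : cderive (fun y : M => (y 0 i)%:C%C) x v = (v 0 i)%:C%C.
Proof.
apply: C_ext => /=; last exact: derive_cst.
by have [_ ->] := coord_derive i x v.
Qed.

Lemma cderive_dirD f x u v : smooth f -> cderive f x (u + v) = cderive f x u + cderive f x v.
Proof.
move=> hf.
have key (a : M -> R) : Ck 2 a -> 'D_(u + v) a x = 'D_u a x + 'D_v a x.
  move=> ca; have c1 := CkS ca; apply: deriveD_dir.
  - by move=> y; exact: (@Ck_der _ _ _ _ v c1 y).
  - by have := Ck_cont (Ck_D v ca); apply.
  - exact: (@Ck_der _ _ _ _ u c1 x).
  exact: (@Ck_der _ _ _ _ (u + v) c1 x).
by apply: C_ext; rewrite ?cReD ?cImD /=; apply: key; [exact: smooth_re | exact: smooth_im].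
Qed.

Lemma cderive_dirZ f x (c : R) v : smooth f -> cderive f x (c *: v) = c%:C%C * cderive f x v.
Proof.
move=> hf.
have key (a : M -> R) : Ck 1 a -> 'D_(c *: v) a x = c * 'D_v a x.
  by move=> ca; apply: deriveZ_dir; [exact: (@Ck_der _ _ _ _ v ca x) | exact: (@Ck_der _ _ _ _ (c *: v) ca x)].
apply: C_ext; rewrite ?cReM ?cImM /= mul0r ?subr0 ?addr0; apply: key; [exact: smooth_re | exact: smooth_im].
Qed.

Definition pd (i : 'I_d) f : M -> C := fun x => cderive f x (delta_mx 0 i).

Lemma cderive_dir f x v : smooth f -> cderive f x v = \sum_i (v 0 i)%:C%C * pd i f x.
Proof.
move=> hf; rewrite {1}[v]row_sum_delta.
have s (r : seq 'I_d) : cderive f x (\sum_(i <- r) v 0 i *: delta_mx 0 i) = \sum_(i <- r) (v 0 i)%:C%C * pd i f x.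
  elim: r => [|i r IH]; last by rewrite !big_cons cderive_dirD // cderive_dirZ // IH.
  rewrite !big_nil; apply: C_ext => /=; exact: derive0.
exact: s.
Qed.

Lemma cderive_comm f x u v : smooth f ->
  cderive (fun y => cderive f y u) x v = cderive (fun y => cderive f y v) x u.
Proof.
move=> hf.
have key (a : M -> R) : Ck 3 a -> 'D_v (fun y => 'D_u a y) x = 'D_u (fun y => 'D_v a y) x.
  move=> ca; have c2 := CkS ca; have c1 := CkS c2; apply: schwarz.
  - by move=> y; exact: (@Ck_der _ _ _ _ u c1 y).
  - by move=> y; exact: (@Ck_der _ _ _ _ v c1 y).
  - by move=> y; exact: (@Ck_der _ _ _ _ v (Ck_D u c2) y).
  - by move=> y; exact: (@Ck_der _ _ _ _ u (Ck_D v c2) y).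
  - by have := Ck_cont (Ck_D v (Ck_D u ca)); apply.
  by have := Ck_cont (Ck_D u (Ck_D v ca)); apply.
by apply: C_ext => /=; apply: key; [exact: smooth_re | exact: smooth_im].
Qed.

Lemma pd_smooth i f : smooth f -> smooth (pd i f). Proof. exact: smooth_D. Qed.
Lemma pd_comm i j f : smooth f -> pd i (pd j f) =1 pd j (pd i f).
Proof. by move=> hf x; exact: cderive_comm. Qed.

End ComplexSmooth.

Section LinearFunctionals.
Context {F : fieldType} {V : vectType F}.
Definition linear_form (l : V -> F) := forall c x y, l (c *: x + y) = c * l x + l y.
Definition linear_map (T : V -> V) := forall c x y, T (c *: x + y) = c *: T x + T y.
Context {l : V -> F} (ll : linear_form l).
Lemma linear_form0 : l 0 = 0.
Proof. by have /eqP := ll (-1) 0 0; rewrite scaler0 addr0 mulN1r addNr => /eqP. Qed.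
Lemma linear_formE x : l x = \sum_i vco i x * l (vbasis {:V})`_i.
Proof.
rewrite {1}(coord_vbasis (memvf x)).
have s (r : seq 'I_(\dim {:V})) : l (\sum_(i <- r) coord (vbasis {:V}) i x *: (vbasis {:V})`_i) =
   \sum_(i <- r) vco i x * l (vbasis {:V})`_i.
  by elim: r => [|i r IH]; rewrite ?big_nil ?linear_form0 // !big_cons ll IH.
exact: s.
Qed.
End LinearFunctionals.

(** Real structure constants make [log_coord], which keeps real parts only, lossless along the
    vectors of [e]. *)
Class nilpotent_frame (R : realType) (g : lie_algebra R[i]) d (e : d.-tuple g) (nb : {vspace g}) : Prop :=
  NilpotentFrame {
  frame_basis : basis_of nb e;
  frame_br : forall x y, x \in nb -> y \in nb -> br x y \in nb;
  frame_br2 : forall x y z, x \in nb -> y \in nb -> z \in nb -> br (br x y) z = 0;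
  frame_real : forall i j k, complex.Im (coord e k (br (tnth e i) (tnth e j))) = 0 }.

(** * The operators R(X) on the nilpotent group *)

Section RightDerivatives.
Context {R : realType} {g : lie_algebra R[i]} {bil : bilinear_lie g}.
Context {d : nat} {e : d.-tuple g} {nb : {vspace g}} {fr : nilpotent_frame e nb}.
Lemma he : basis_of nb e. Proof. by case: fr. Qed.
Lemma nb_br (x y : g) : x \in nb -> y \in nb -> br x y \in nb. Proof. by case: fr => _ H _ _; exact: H. Qed.
Lemma nb_br2 (x y z : g) : x \in nb -> y \in nb -> z \in nb -> br (br x y) z = 0.
Proof. by case: fr => _ _ H _; exact: H. Qed.
Lemma e_real i j k : complex.Im (coord e k (br (tnth e i) (tnth e j))) = 0.
Proof. by case: fr => _ _ _; exact. Qed.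
Local Notation M := 'rV[R]_d.
Local Notation C := R[i].
Implicit Types (x X Y : g) (y z : M) (f : M -> C) (k : 'I_d) (phi psi : M -> g).
Local Notation lv := (log_vec e).
Local Notation rd := (right_der e).

Lemma coordD k x x' : coord e k (x + x') = coord e k x + coord e k x'.
Proof. exact: linearD. Qed.
Lemma coordZ k (c : C) x : coord e k (c *: x) = c * coord e k x.
Proof. exact: linearZ. Qed.
Lemma e_nb i : tnth e i \in nb.
Proof. by apply: (basis_mem he); exact: mem_tnth. Qed.
Lemma coord_e i j : coord e j (tnth e i) = (i == j)%:R.
Proof. by rewrite (tnth_nth 0) coord_free ?(basis_free he). Qed.
Lemma nb_coord x : x \in nb -> x = \sum_i coord e i x *: tnth e i.
Proof. by move=> /(coord_basis he) {1}->; apply: eq_bigr => i _; rewrite (tnth_nth 0). Qed.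
Lemma lv_nb z : lv z \in nb.
Proof. by apply: memv_suml => i _; apply: memvZ; exact: e_nb. Qed.
Lemma coord_lv k z : coord e k (lv z) = (z 0 k)%:C%C.
Proof.
rewrite linear_sum (bigD1 k) //= linearZ /= coord_e eqxx big1 ?addr0 ?scaler1 ?mulr1 // => i ik.
by rewrite linearZ /= coord_e (negPf ik) mulr0.
Qed.

(** The velocity at [t = 0] of the logarithm of [exp (lv z) exp (t X)]; two-step nilpotency leaves
    no higher terms. *)
Definition wv X z : g := X + 2^-1 *: br (lv z) X.

(** [bch] is affine in its second argument, so the derivative is taken along a straight line. *)
Lemma right_der0E X f z : right_der0 e X f z = cderive f z (log_coord e (wv X z)).
Proof.
have E t : log_coord e (bch (lv z) (t%:C%C *: X)) = t *: log_coord e (wv X z) + z.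
  apply/rowP => i; rewrite !mxE.
  rewrite (_ : bch _ _ = lv z + t%:C%C *: wv X z); last first.
    by rewrite /bch /wv brZr scalerDr !scalerA (mulrC 2^-1) addrA.
  by rewrite coordD coordZ coord_lv cReD cReM /= mul0r subr0 addrC.
have E' (a : M -> R) : derive1 (fun t : R => a (log_coord e (bch (lv z) (t%:C%C *: X)))) 0 =
    'D_(log_coord e (wv X z)) a z.
  rewrite derive1E /derive; set f1 := (X in lim (X @ _) = _); set f2 := (X in _ = lim (X @ _)).
  suff -> : f1 = f2 by [].
  by apply/funext => t; rewrite /f1 /f2 /= !E addr0 scale0r add0r; congr (_ *: (a (_ *: _ + _) - _)); rewrite scaler1.
by apply: C_ext; [exact: (E' (fun y => complex.Re (f y))) | exact: (E' (fun y => complex.Im (f y)))].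
Qed.

Lemma wv_real i k z : ((log_coord e (wv (tnth e i) z)) 0 k)%:C%C = coord e k (wv (tnth e i) z).
Proof.
apply: C_ext; rewrite mxE //=.
rewrite coordD coordZ coord_e cImD cImM.
have -> : complex.Im (coord e k (br (lv z) (tnth e i))) = 0.
  rewrite br_suml linear_sum /=.
  have s (r : seq 'I_d) : complex.Im (\sum_(j <- r) coord e k (br ((z 0 j)%:C%C *: tnth e j) (tnth e i))) = 0.
    elim: r => [|j r IH]; first by rewrite big_nil.
    by rewrite big_cons cImD IH brZl coordZ cImM e_real mulr0 add0r mul0r addr0.
  exact: s.
have -> : (2^-1 : C) = ((2 : R)^-1)%:C%C by rewrite fmorphV rmorph_nat.
by case: (i == k) => /=; ring.
Qed.

Lemma wv_lin c X Y z : wv (c *: X + Y) z = c *: wv X z + wv Y z.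
Proof.
rewrite /wv brDr brZr !scalerDr !scalerA (mulrC 2^-1).
by rewrite addrACA.
Qed.
Lemma wv_nb X z : X \in nb -> wv X z \in nb.
Proof. by move=> hX; apply: memvD => //; apply: memvZ; apply: nb_br => //; exact: lv_nb. Qed.

Lemma rd_linl c X Y f z : rd (c *: X + Y) f z = c * rd X f z + rd Y f z.
Proof.
rewrite /right_der mulr_sumr -big_split /=; apply: eq_bigr => i _.
by rewrite linearD linearZ /= mulrDl mulrA.
Qed.

(** On the vectors of [e] the coefficients are real by [wv_real]; complex [X] follow because [wv] is
    linear in [X]. *)
Lemma rdE X f z : X \in nb -> smooth f -> rd X f z = \sum_k coord e k (wv X z) * pd k f z.
Proof.
move=> hX hf; rewrite /right_der.
under eq_bigr => i _ do rewrite right_der0E cderive_dir // mulr_sumr.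
rewrite exchange_big /=; apply: eq_bigr => k _.
under eq_bigr => i _ do rewrite wv_real mulrA.
rewrite -mulr_suml; congr (_ * _).
rewrite {2}(nb_coord hX).
have s (r : seq 'I_d) : \sum_(i <- r) coord e i X * coord e k (wv (tnth e i) z) =
    coord e k (wv (\sum_(i <- r) coord e i X *: tnth e i) z).
  elim: r => [|i r IH]; first by rewrite !big_nil /wv br0r scaler0 addr0 linear0.
  by rewrite !big_cons IH wv_lin (coordD k (_ *: _)) coordZ.
exact: s.
Qed.

Lemma rdD X f f' z : X \in nb -> smooth f -> smooth f' -> rd X (fun y => f y + f' y) z = rd X f z + rd X f' z.
Proof.
move=> hX hf hf'; rewrite !rdE //; last exact: smoothD.
by rewrite -big_split /=; apply: eq_bigr => i _; rewrite /pd cderiveD // mulrDr.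
Qed.
Lemma rd_cst X (c : C) z : X \in nb -> rd X (fun=> c) z = 0.
Proof.
move=> hX; rewrite rdE //; last exact: smooth_cst.
by rewrite big1 // => i _; rewrite /pd cderive_cst mulr0.
Qed.
Lemma rdM X f f' z : X \in nb -> smooth f -> smooth f' ->
  rd X (fun y => f y * f' y) z = rd X f z * f' z + f z * rd X f' z.
Proof.
move=> hX hf hf'; rewrite !rdE //; last exact: smoothM.
rewrite mulr_suml mulr_sumr -big_split /=; apply: eq_bigr => i _.
by rewrite /pd cderiveM //; ring.
Qed.
Lemma rdZ X (c : C) f z : X \in nb -> smooth f -> rd X (fun y => c * f y) z = c * rd X f z.
Proof. by move=> hX hf; rewrite rdM ?rd_cst ?mul0r ?add0r //; exact: smooth_cst. Qed.
Lemma rdB X f f' z : X \in nb -> smooth f -> smooth f' -> rd X (fun y => f y - f' y) z = rd X f z - rd X f' z.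
Proof.
move=> hX hf hf'.
rewrite (_ : (fun y => _) = (fun y => f y + (-1) * f' y)); last by apply/funext => y; rewrite mulN1r.
by rewrite rdD ?rdZ ?mulN1r //; exact: smoothZ.
Qed.
Lemma rd_sum X I (r : seq I) (F : I -> M -> C) z : X \in nb -> (forall i, smooth (F i)) ->
  rd X (fun y => \sum_(i <- r) F i y) z = \sum_(i <- r) rd X (F i) z.
Proof.
move=> hX hF; elim: r => [|i r IH].
  rewrite (_ : (fun y => _) = (fun=> 0)); last by apply/funext => y; rewrite big_nil.
  by rewrite rd_cst // big_nil.
rewrite (_ : (fun y => _) = (fun y => F i y + \sum_(j <- r) F j y)); last by apply/funext => y; rewrite big_cons.
by rewrite rdD ?IH ?big_cons //; exact: smooth_sum.
Qed.

Definition gsmooth phi := forall i, smooth (fun z => vco i (phi z)).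
(** Derivatives of [g]-valued maps, coordinate by coordinate, so that linear maps and brackets of
    such maps can be differentiated directly. *)
Definition isder X phi psi := gsmooth phi /\ forall i z, rd X (fun y => vco i (phi y)) z = vco i (psi z).

Lemma form_smooth (l : g -> C) phi : linear_form l -> gsmooth phi -> smooth (fun z => l (phi z)).
Proof.
move=> ll hp; rewrite (_ : (fun z => _) = (fun z => \sum_i vco i (phi z) * l (vbasis {:g})`_i)).
  by apply: smooth_sum => i _; apply: smoothM; [exact: hp | exact: smooth_cst].
by apply/funext => z; exact: linear_formE.
Qed.
Lemma form_der (l : g -> C) X phi psi z : X \in nb -> linear_form l -> isder X phi psi ->
  rd X (fun y => l (phi y)) z = l (psi z).
Proof.
move=> hX ll [hp hd]; rewrite (_ : (fun y => l (phi y)) = (fun z => \sum_i vco i (phi z) * l (vbasis {:g})`_i)).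
  rewrite rd_sum //; last by move=> i; apply: smoothM; [exact: hp | exact: smooth_cst].
  rewrite (linear_formE ll); apply: eq_bigr => i _.
  by rewrite rdM ?rd_cst ?mulr0 ?addr0 ?hd //; exact: smooth_cst.
by apply/funext => y; exact: linear_formE.
Qed.

Lemma coord_form i : linear_form (fun x : g => coord e i x).
Proof. by move=> c x y; rewrite linearP. Qed.

Lemma gsmooth_lin (T : g -> g) phi : linear_map T ->
  gsmooth phi -> gsmooth (fun z => T (phi z)).
Proof. by move=> lT hp i; apply: (form_smooth (l := fun x => vco i (T x))) => // c x y; rewrite lT vcoD vcoZ. Qed.
Lemma isder_lin (T : g -> g) X phi psi : X \in nb -> linear_map T ->
  isder X phi psi -> isder X (fun z => T (phi z)) (fun z => T (psi z)).
Proof.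
move=> hX lT hp; split; first by apply: gsmooth_lin => //; case: hp.
by move=> i z; apply: (form_der (l := fun x => vco i (T x)) z hX _ hp) => c x y; rewrite lT vcoD vcoZ.
Qed.
Lemma isder_cst X (Y : g) : X \in nb -> isder X (fun=> Y) (fun=> 0).
Proof. by move=> hX; split=> [i|i z]; [exact: smooth_cst | rewrite rd_cst // vco0]. Qed.
Lemma isderD X phi psi phi' psi' : X \in nb -> isder X phi psi -> isder X phi' psi' ->
  isder X (fun z => phi z + phi' z) (fun z => psi z + psi' z).
Proof.
move=> hX [h1 h2] [h3 h4]; split=> i.
  rewrite (_ : (fun z => _) = (fun z => vco i (phi z) + vco i (phi' z))); first exact: smoothD.
  by apply/funext => z; rewrite vcoD.
move=> z; rewrite vcoD -h2 -h4 -rdD //.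
by congr (rd X _ z); apply/funext => y; rewrite vcoD.
Qed.
Lemma isderZ X (c : C) phi psi : X \in nb -> isder X phi psi ->
  isder X (fun z => c *: phi z) (fun z => c *: psi z).
Proof. by move=> hX; apply: (isder_lin (T := fun x => c *: x)) => // a x y; rewrite scalerDr !scalerA mulrC. Qed.
Lemma isder_br X phi psi phi' psi' : X \in nb -> isder X phi psi -> isder X phi' psi' ->
  isder X (fun z => br (phi z) (phi' z)) (fun z => br (psi z) (phi' z) + br (phi z) (psi' z)).
Proof.
move=> hX [h1 h2] [h3 h4].
have E i (x y : g) : vco i (br x y) = \sum_j \sum_k vco j x * (vco k y * vco i (br (vbasis {:g})`_j (vbasis {:g})`_k)).
  rewrite (linear_formE (l := fun x => vco i (br x y))); last by move=> c ? ?; rewrite lie_br_linl vcoD vcoZ.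
  apply: eq_bigr => j _; rewrite (linear_formE (l := fun y : g => vco i (br _ y))); last by move=> c ? ?; rewrite brR vcoD vcoZ.
  by rewrite mulr_sumr.
have EF i : (fun z => vco i (br (phi z) (phi' z))) = (fun z => \sum_j \sum_k vco j (phi z) * (vco k (phi' z) * vco i (br (vbasis {:g})`_j (vbasis {:g})`_k))).
  by apply/funext => z; exact: E.
have s1 i j (k : 'I_(\dim {:g})) : smooth (fun z => vco k (phi' z) * vco i (br (vbasis {:g})`_j (vbasis {:g})`_k)).
  by apply: smoothM; [exact: h3 | exact: smooth_cst].
have s2 i j (k : 'I_(\dim {:g})) : smooth (fun z => vco j (phi z) * (vco k (phi' z) * vco i (br (vbasis {:g})`_j (vbasis {:g})`_k))).
  by apply: smoothM; [exact: h1 | exact: s1].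
have s3 i j : smooth (fun z => \sum_k vco j (phi z) * (vco k (phi' z) * vco i (br (vbasis {:g})`_j (vbasis {:g})`_k))).
  by apply: smooth_sum => k _.
split=> i; first by rewrite EF; apply: smooth_sum => j _.
move=> z; rewrite EF rd_sum // vcoD !E -big_split /=; apply: eq_bigr => j _.
rewrite rd_sum // -big_split /=; apply: eq_bigr => k _.
rewrite rdM // rdM //; last exact: smooth_cst.
by rewrite h2 h4 rd_cst // mulr0 addr0.
Qed.

Lemma gsmooth_lv : gsmooth lv.
Proof.
move=> i; rewrite (_ : (fun z => _) = (fun z => \sum_k (z 0 k)%:C%C * vco i (tnth e k))).
  by apply: smooth_sum => k _; apply: smoothM; [exact: smooth_coord | exact: smooth_cst].
by apply/funext => z; rewrite /vco /log_vec linear_sum; apply: eq_bigr => k _; rewrite linearZ.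
Qed.
Lemma rd_coord X k z : X \in nb -> rd X (fun y => (y 0 k)%:C%C) z = coord e k (wv X z).
Proof.
move=> hX; rewrite rdE //; last exact: smooth_coord.
rewrite (bigD1 k) //= /pd cderive_coord mxE !eqxx /= mulr1 big1 ?addr0 // => i ik.
by rewrite /pd cderive_coord mxE eqxx /= eq_sym (negPf ik) /= mulr0.
Qed.
Lemma isder_lv X : X \in nb -> isder X lv (wv X).
Proof.
move=> hX; split; first exact: gsmooth_lv.
move=> i z; rewrite (_ : (fun z => _) = (fun z => \sum_k (z 0 k)%:C%C * vco i (tnth e k))).
  rewrite rd_sum //; last by move=> k; apply: smoothM; [exact: smooth_coord | exact: smooth_cst].
  rewrite (nb_coord (wv_nb z hX)) /vco linear_sum; apply: eq_bigr => k _ /=.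
  rewrite rdM ?rd_cst ?mulr0 ?addr0 ?rd_coord ?linearZ //; [exact: smooth_coord | exact: smooth_cst].
by apply/funext => y; rewrite /vco /log_vec linear_sum; apply: eq_bigr => k _; rewrite linearZ.
Qed.

Lemma gsmooth_wv X : X \in nb -> gsmooth (wv X).
Proof.
move=> hX; have [h _] : isder X (wv X) (fun z => 0 + 2^-1 *: (br (wv X z) X + br (lv z) 0)).
  apply: isderD (isder_cst _ _) _ => //; apply: isderZ => //.
  by apply: isder_br => //; [exact: isder_lv | exact: isder_cst].
exact: h.
Qed.

Lemma isder_wv X Y : X \in nb -> Y \in nb -> isder X (wv Y) (fun z => 2^-1 *: br X Y).
Proof.
move=> hX hY.
have [h1 h2] : isder X (wv Y) (fun z => 0 + 2^-1 *: (br (wv X z) Y + br (lv z) 0)).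
  apply: isderD (isder_cst _ _) _ => //; apply: isderZ => //.
  by apply: isder_br => //; [exact: isder_lv | exact: isder_cst].
split=> // i z; rewrite h2 br0r addr0 add0r /wv brDl brZl nb_br2 ?scaler0 ?addr0 //.
exact: lv_nb.
Qed.

Lemma coef_smooth X k : X \in nb -> smooth (fun z => coord e k (wv X z)).
Proof. by move=> hX; apply: (form_smooth (l := fun x => coord e k x)); [exact: coord_form | exact: gsmooth_wv]. Qed.

Lemma rd_smooth X f : X \in nb -> smooth f -> smooth (rd X f).
Proof.
move=> hX hf; rewrite (_ : rd X f = fun z => \sum_k coord e k (wv X z) * pd k f z).
  by apply: smooth_sum => k _; apply: smoothM; [exact: coef_smooth | exact: pd_smooth].
by apply/funext => z; exact: rdE.
Qed.

Lemma rd_rd X Y f z : X \in nb -> Y \in nb -> smooth f ->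
  rd X (rd Y f) z = 2^-1 * \sum_k coord e k (br X Y) * pd k f z
    + \sum_k \sum_l coord e k (wv Y z) * coord e l (wv X z) * pd l (pd k f) z.
Proof.
move=> hX hY hf.
rewrite (_ : rd Y f = fun z => \sum_k coord e k (wv Y z) * pd k f z); last by apply/funext => y; exact: rdE.
rewrite rd_sum //; last by move=> k; apply: smoothM; [exact: coef_smooth | exact: pd_smooth].
rewrite mulr_sumr -big_split /=; apply: eq_bigr => k _.
rewrite rdM //; [|exact: coef_smooth|exact: pd_smooth]; congr (_ + _).
  rewrite (form_der (l := fun x => coord e k x) z hX (coord_form k) (isder_wv hX hY)) linearZ /=.
  by rewrite mulrA.
rewrite rdE // ?mulr_sumr; last exact: pd_smooth.
by apply: eq_bigr => l _; rewrite mulrA.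
Qed.

(** The second order parts cancel by symmetry of partial derivatives, and the first order parts are
    halves of [[X, Y]] and [[Y, X]]; moreover [wv] fixes [[X, Y]], which is central. *)
Lemma rd_comm X Y f z : X \in nb -> Y \in nb -> smooth f ->
  rd X (rd Y f) z - rd Y (rd X f) z = rd (br X Y) f z.
Proof.
move=> hX hY hf; rewrite (rd_rd z hX hY hf) (rd_rd z hY hX hf).
set P := (X in _ + X - _); set Q := (X in _ - (_ + X)).
have PQ : P = Q.
  rewrite /P exchange_big; apply: eq_bigr => j _; apply: eq_bigr => i _ /=.
  by rewrite (pd_comm j i hf z) (mulrC (coord e i (wv Y z))).
rewrite PQ opprD addrACA subrr addr0 -mulrBr rdE //; last exact: nb_br.
have -> : wv (br X Y) z = br X Y.
  rewrite /wv (br_anti (lv z)) (nb_br2 hX hY (lv_nb z)).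
  by rewrite oppr0 scaler0 addr0.
rewrite -sumrB mulr_sumr; apply: eq_bigr => k _.
by rewrite (br_anti Y) linearN /=; field.
Qed.

(* The coefficients of [W z] are frozen at [z] in the last term. *)
Lemma rd_leib X W W' f z : X \in nb -> isder X W W' -> smooth f ->
  rd X (fun y => rd (W y) f y) z = rd (W' z) f z + rd X (rd (W z) f) z.
Proof.
move=> hX hW hf.
have sc i : smooth (fun y => coord e i (W y)).
  by apply: (form_smooth (l := fun x => coord e i x)); [exact: coord_form | case: hW].
have se i : smooth (rd (tnth e i) f) by apply: rd_smooth => //; exact: e_nb.
have E x y : rd x f y = \sum_i coord e i x * rd (tnth e i) f y.
  rewrite {1}/right_der; apply: eq_bigr => i _; congr (_ * _).
  rewrite /right_der (bigD1 i) //= coord_e eqxx mul1r big1 ?addr0 // => j ji.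
  by rewrite coord_e eq_sym (negPf ji) mul0r.
rewrite (_ : (fun y => _) = (fun y => \sum_i coord e i (W y) * rd (tnth e i) f y)); last by apply/funext => y; exact: E.
rewrite (_ : rd (W z) f = (fun y => \sum_i coord e i (W z) * rd (tnth e i) f y)); last by apply/funext => y; exact: E.
rewrite !rd_sum //; [|by move=> i; apply: smoothZ | by move=> i; apply: smoothM].
rewrite (E (W' z)) -big_split /=; apply: eq_bigr => i _.
by rewrite rdM // rdZ // (form_der (l := fun x => coord e i x) z hX (coord_form i) hW).
Qed.

Lemma rdW_smooth W f : gsmooth W -> smooth f -> smooth (fun z => rd (W z) f z).
Proof.
move=> hW hf.
have E x y : rd x f y = \sum_i coord e i x * rd (tnth e i) f y.
  rewrite {1}/right_der; apply: eq_bigr => i _; congr (_ * _).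
  rewrite /right_der (bigD1 i) //= coord_e eqxx mul1r big1 ?addr0 // => j ji.
  by rewrite coord_e eq_sym (negPf ji) mul0r.
rewrite (_ : (fun y => _) = (fun y => \sum_i coord e i (W y) * rd (tnth e i) f y)); last by apply/funext => y; exact: E.
apply: smooth_sum => i _; apply: smoothM.
  by apply: (form_smooth (l := fun x => coord e i x)); [exact: coord_form | exact: hW].
by apply: rd_smooth => //; exact: e_nb.
Qed.

Lemma rd_diff_op X : X \in nb -> diff_op (rd X).
Proof.
move=> hX; apply: (@diff_op_ext _ _ (fun f z => \sum_k coord e k (wv X z) * pd k f z)) => [f hf z|].
  by rewrite rdE.
have s (r : seq 'I_d) : diff_op (fun f z => \sum_(k <- r) coord e k (wv X z) * pd k f z).
  elim: r => [|k r IH].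
    apply: (@diff_op_ext _ _ (fun f z => 0 * f z)); last by apply: diff_op_mul; exact: smooth_cst.
    by move=> f hf z; rewrite mul0r big_nil.
  apply: (@diff_op_ext _ _ (fun f z => coord e k (wv X z) * pd k f z + \sum_(k <- r) coord e k (wv X z) * pd k f z)).
    by move=> f hf z; rewrite big_cons.
  apply: diff_op_add IH.
  apply: (@diff_op_comp _ _ (fun f z => coord e k (wv X z) * f z) (pd k)).
    by apply: diff_op_mul; exact: coef_smooth.
  exact: diff_op_der.
exact: s.
Qed.

End RightDerivatives.

(** * Commutators of the representation with R(X) *)

Section Conformal.
Context {R : realType} {rp : real_part R[i] R}.
Context {g : lie_algebra R[i]} {h : {vspace g}}.
Context {bil : bilinear_lie g} {hc : is_cartan h} {nd : nondeg_killing g}.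
Context {b : {vspace g}} {n : nat} {al : 'I_n -> hdual h} {ss : simple_system b al}.
Context {q : 'I_n} {ts : two_step b al q}.
Context {d : nat} {e : d.-tuple g}.
Local Notation C := R[i].
Local Notation M := 'rV[R]_d.
Local Notation Gr := (graded (rp := rp) (al := al) (q := q)).
Local Notation levi := (levi al q).
Local Notation gr := (gr al q).
Local Notation nb := (nilrad_opp al q).
Local Notation pb := (parab b al q).
Local Notation bS := (bS (al := al) (q := q)).
Local Notation TV := (tensv levi (gr (- 2%:Z))).
Local Notation lv := (log_vec e).
Local Notation rd := (right_der e).
Implicit Types (x X : g) (y z : M) (f : M -> C).

Lemma nb_dec x : x \in nb -> exists u v : g, [/\ Gr (-1) u, Gr (-2) v & x = u + v].
Proof. by move/(nilrad_oppP (rp := rp)). Qed.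
Lemma Gr1_nb x : Gr (-1) x -> x \in nb.
Proof. by move=> h1; apply/(nilrad_oppP (rp := rp)); exists x, 0; rewrite addr0; split=> //; exact: Gr0. Qed.
Lemma Gr2_nb x : Gr (-2) x -> x \in nb.
Proof. by move=> h1; apply/(nilrad_oppP (rp := rp)); exists 0, x; rewrite add0r; split=> //; exact: Gr0. Qed.

Lemma nb_brGr x x' : x \in nb -> x' \in nb -> Gr (-2) (br x x').
Proof.
move=> /nb_dec [u [v [gu gv ->]]] /nb_dec [u' [v' [gu' gv' ->]]].
have e1 : br u v' = 0 by apply: (Gr_small _ (Gr_br gu gv')).
have e2 : br v u' = 0 by apply: (Gr_small _ (Gr_br gv gu')).
have e3 : br v v' = 0 by apply: (Gr_small _ (Gr_br gv gv')).
by rewrite brDl !brDr e1 e2 e3 !addr0; exact: (Gr_br gu gu').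
Qed.
Lemma nb_brcl x x' : x \in nb -> x' \in nb -> br x x' \in nb.
Proof. by move=> h1 h2; apply: Gr2_nb; exact: nb_brGr. Qed.
Lemma nb_br0 x x' : Gr (-2) x -> x' \in nb -> br x x' = 0.
Proof.
move=> gx /nb_dec [u' [v' [gu' gv' ->]]].
have e2 : br x u' = 0 by apply: (Gr_small _ (Gr_br gx gu')).
have e3 : br x v' = 0 by apply: (Gr_small _ (Gr_br gx gv')).
by rewrite brDr e2 e3 addr0.
Qed.

(* [low k x]: the components of [x] of degree larger than [k] vanish. *)
Definition low (k : int) x := forall (j : int) (y' : g), j + k < 0 -> Gr j y' -> killing x y' = 0.
Lemma low_br k u x : u \in nb -> low k x -> low (k - 1) (br u x).
Proof.
move=> /nb_dec [u1 [u2 [g1 g2 ->]]] hx j y' jk gy.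
rewrite killing_invN brDl killingDr (hx _ _ _ (Gr_br g1 gy)) ?(hx _ _ _ (Gr_br g2 gy)) ?addr0 ?oppr0 //; lia.
Qed.
Lemma low_br2 k u x : Gr (-2) u -> low k x -> low (k - 2) (br u x).
Proof.
move=> gu hx j y' jk gy; rewrite killing_invN (hx _ _ _ (Gr_br gu gy)) ?oppr0 //; lia.
Qed.
Lemma low2 x : low 2 x.
Proof. by move=> j y' jk gy; rewrite (Gr_small (_ : j < -2) gy) ?killing0r //; lia. Qed.
Lemma killing_all0 x : (forall (j : int) (y' : g), -2 <= j <= 2 -> Gr j y' -> killing x y' = 0) -> x = 0.
Proof.
move=> H; apply: nd => y'; have [c [gc ->]] := Gr_dec (rp := rp) (ts := ts) y'.
by rewrite !killingDr !(H _ _ _ (gc _)) ?addr0.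
Qed.
Lemma low_eq0 x : low (-3) x -> x = 0.
Proof. by move=> H; apply: killing_all0 => j y' jk; apply: H; lia. Qed.

Lemma nb_frame : basis_of nb e ->
  (forall i j k, complex.Im (coord e k (br (tnth e i) (tnth e j))) = 0) -> nilpotent_frame e nb.
Proof.
move=> he e_real; split=> // [x y'|x y' z']; first exact: nb_brcl.
by move=> h1 h2; apply: nb_br0; exact: nb_brGr.
Qed.

Context {fr : nilpotent_frame e nb}.
Hypothesis dim5 : (5 <= \dim {:g})%N.
Variable (Y : g).
Local Notation mk k := (fun z => iter k (br (lv z)) Y).
Local Notation phi := (fun z => Ad_inv e z Y).

Lemma low_mk k z : low (2 - k%:Z) (iter k (br (lv z)) Y).
Proof.
elim: k => [|k IH] /=; first by rewrite subr0; exact: low2.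
have -> : 2 - k.+1%:Z = 2 - k%:Z - 1 by lia.
by apply: low_br => //; exact: lv_nb.
Qed.

Lemma mk_big k z : (5 <= k)%N -> iter k (br (lv z)) Y = 0.
Proof.
move=> k5; have -> : k = (5 + (k - 5))%N by lia.
have z5 : iter 5 (br (lv z)) Y = 0.
  by apply: low_eq0; have := low_mk (k := 5) z; have -> : 2 - 5%:Z = -3 by [].
rewrite addnC iterD z5; elim: (k - 5)%N => //= m ->; exact: br0r.
Qed.

(** [ad (lv z)] lowers degrees by at least one, so five terms survive; [dim5] ensures that the
    truncation in [Ad_inv] has cut none of them. *)
Lemma phiE z : phi z = mk 0%N z - mk 1%N z + 2^-1 *: mk 2 z - 6^-1 *: mk 3 z + 24^-1 *: mk 4 z.
Proof.
have E k : iter k (br (- lv z)) Y = (-1) ^+ k *: iter k (br (lv z)) Y.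
  elim: k => [|k IH]; first by rewrite expr0 scale1r.
  by rewrite !iterS IH brZr brNl scalerN -scaleNr exprS mulN1r.
have -> : phi z = \sum_(0 <= k < \dim {:g}) ((k`!%:R)^-1 * (-1) ^+ k) *: iter k (br (lv z)) Y.
  by rewrite big_mkord; apply: eq_bigr => k _; rewrite E scalerA.
have tail : \sum_(5 <= k < \dim {:g}) ((k`!%:R)^-1 * (-1) ^+ k) *: iter k (br (lv z)) Y = 0.
  by rewrite big_nat_cond big1 // => k /andP [/andP [k5 _] _]; rewrite mk_big ?scaler0.
rewrite (big_cat_nat (n := 5)) //= tail addr0.
rewrite !big_nat_recr //= big_geq // add0r.
by apply: vco_ext => i; rewrite !vcoE !factS fact0 !exprS expr0; field.
Qed.

Lemma isder_ext X (p p' : M -> g) : isder (e := e) X p p' -> forall p'' : M -> g, p' =1 p'' -> isder (e := e) X p p''.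
Proof. by move=> [h1 h2] p'' E; split=> // i z; rewrite h2 E. Qed.

(** [c z = [lv z, X]] is central in the nilradical, so the derivative of the power
    [m_k = ad (lv z)^k Y] is [k [X, m_(k-1)] + (k choose 2) [c, m_(k-2)] + (k / 2) [c, m_(k-1)]].
    With the exponential coefficients the first family sums to [[phi, X]] and the two families in
    [c] cancel, up to terms that vanish for reasons of degree. *)
Lemma isder_phi X : X \in nb -> isder (e := e) X phi (fun z => br (phi z) X).
Proof.
move=> hX.
pose c z := br (lv z) X.
have cm z (v : g) : br (lv z) (br X v) = br X (br (lv z) v) + br (c z) v by rewrite jac addrC.
have cc z (v : g) : br (lv z) (br (c z) v) = br (c z) (br (lv z) v).
  have c0 : br (lv z) (c z) = 0.
    by rewrite br_anti nb_br0 ?oppr0 //; [apply: nb_brGr => // |]; exact: lv_nb.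
  by rewrite jac c0 br0l add0r.
have wE z (v : g) : br (wv (e := e) X z) v = br X v + 2^-1 *: br (c z) v by rewrite /wv brDl brZl.
have step k p : isder (e := e) X (mk k) p ->
    isder (e := e) X (mk k.+1) (fun z => br (wv (e := e) X z) (mk k z) + br (lv z) (p z)).
  by move=> hp; apply: isder_br hp => //; exact: isder_lv.
have D0 : isder (e := e) X (mk 0%N) (fun=> 0) by exact: isder_cst.
have D1 : isder (e := e) X (mk 1%N) (fun z => br X (mk 0%N z) + 2^-1 *: br (c z) (mk 0%N z)).
  by apply: (isder_ext (step 0%N _ D0)) => z; rewrite wE br0r addr0.
have D2 : isder (e := e) X (mk 2) (fun z => 2 *: br X (mk 1%N z) + br (c z) (mk 0%N z) + br (c z) (mk 1%N z)).
  apply: (isder_ext (step 1%N _ D1)) => z; rewrite wE brDr brZr cm cc /=.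
  by apply: vco_ext => i; rewrite !vcoE; field.
have D3 : isder (e := e) X (mk 3) (fun z => 3 *: br X (mk 2 z) + 3 *: br (c z) (mk 1%N z) + (3 / 2) *: br (c z) (mk 2 z)).
  apply: (isder_ext (step 2 _ D2)) => z; rewrite wE !brDr brZr cm !cc /=.
  by apply: vco_ext => i; rewrite !vcoE; field.
have D4 : isder (e := e) X (mk 4) (fun z => 4 *: br X (mk 3 z) + 6 *: br (c z) (mk 2 z) + 2 *: br (c z) (mk 3 z)).
  apply: (isder_ext (step 3 _ D3)) => z; rewrite wE !brDr !brZr cm !cc /=.
  by apply: vco_ext => i; rewrite !vcoE; field.
(* These boundary terms of the truncated series have degree at most -3. *)
have z1 z : br X (mk 4 z) = 0.
  apply: low_eq0; have -> : -3 = 2 - 4%:Z - 1 by [].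
  by apply: low_br => //; exact: low_mk.
have z2 z : br (c z) (mk 3 z) = 0.
  apply: low_eq0; have -> : -3 = 2 - 3%:Z - 2 by [].
  by apply: low_br2; [apply: nb_brGr => //; exact: lv_nb | exact: low_mk].
rewrite (_ : phi = fun z => mk 0%N z + (-1) *: mk 1%N z + 2^-1 *: mk 2 z + (- 6^-1) *: mk 3 z + 24^-1 *: mk 4 z).
  apply: (isder_ext (isderD hX (isderD hX (isderD hX (isderD hX D0 (isderZ (-1) hX D1))
     (isderZ 2^-1 hX D2)) (isderZ (- 6^-1) hX D3)) (isderZ 24^-1 hX D4))) => z.
  rewrite z2 phiE (br_anti (_ + _) X) !brDr !brNr !brZr z1 /=.
  by apply: vco_ext => i; rewrite !vcoE; field.
by apply/funext => z; rewrite phiE scaleN1r scaleNr.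
Qed.

Lemma gsmooth_phi : gsmooth phi.
Proof. by have [] := isder_phi (mem0v nb). Qed.

Local Notation p := (daddv_pi nb pb).
Local Notation p0 := (daddv_pi levi (nb + nilrad b al q)%VS).
Local Notation L := (killing (hvec (lam (al := al) q))).

Lemma nb_low x : x \in nb -> low (-1) x.
Proof.
move=> /nb_dec [u [v [gu gv ->]]] j y' jk gy.
by rewrite killingDl (Gr_killing gu gy) ?(Gr_killing gv gy) ?addr0 //; apply/eqP; lia.
Qed.
Lemma nb_pb : (nb :&: pb = 0)%VS.
Proof.
apply/eqP; rewrite -subv0; apply/subvP => x; rewrite memv_cap memv0 => /andP [xn xp].
apply/eqP; apply: killing_all0 => j y' jk gy.
have [j0 | j0] := leP j 0; first by apply: (nb_low xn (j := j)) => //; lia.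
have /(parabP (rp := rp)) [u [v [w [gu gv gw ->]]]] := xp.
by rewrite !killingDl (Gr_killing gu gy) ?(Gr_killing gv gy) ?(Gr_killing gw gy) ?addr0 //; apply/eqP; lia.
Qed.
Lemma levi_cap : (levi :&: (nb + nilrad b al q) = 0)%VS.
Proof.
apply/eqP; rewrite -subv0; apply/subvP => x; rewrite memv_cap memv0 => /andP [].
move=> /(leviP (rp := rp)) gx /memv_addP [x1 /nb_dec [u [v [gu gv ->]]] [x2 /(nilradP (rp := rp)) [u' [v' [gu' gv' ->]]] ex]].
apply/eqP; apply: killing_all0 => j y' jk gy.
have [j0 | j0] := eqVneq j 0; last by apply: (Gr_killing gx gy); rewrite add0r.
rewrite ex !killingDl (Gr_killing gu gy) ?(Gr_killing gv gy) ?(Gr_killing gu' gy) ?(Gr_killing gv' gy) ?addr0 //; apply/eqP; lia.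
Qed.

Lemma pE (c : int -> g) x : (forall k, Gr k (c k)) ->
  x = c (-2) + c (-1) + c 0 + c 1 + c 2 ->
  [/\ p x = c (-2) + c (-1), daddv_pi pb nb x = c 0 + c 1 + c 2 & p0 x = c 0].
Proof.
move=> gc ->.
have h1 : c (-2) + c (-1) \in nb by apply: memvD; [exact: Gr2_nb | exact: Gr1_nb].
have h2 : c 0 + c 1 + c 2 \in pb by apply/(parabP (rp := rp)); exists (c 0), (c 1), (c 2).
have h3 : c 0 \in levi by apply/(leviP (rp := rp)).
have h4 : c (-2) + c (-1) + (c 1 + c 2) \in (nb + nilrad b al q)%VS.
  by apply: memv_add => //; apply/(nilradP (rp := rp)); exists (c 1), (c 2).
split.
- rewrite (_ : _ + _ + _ + _ + _ = c (-2) + c (-1) + (c 0 + c 1 + c 2)); last by rewrite !addrA.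
  by apply: daddv_pi_l => //; exact: nb_pb.
- rewrite (_ : _ + _ + _ + _ + _ = (c 0 + c 1 + c 2) + (c (-2) + c (-1))); last by vring.
  by apply: daddv_pi_l => //; rewrite capvC; exact: nb_pb.
rewrite (_ : _ + _ + _ + _ + _ = c 0 + (c (-2) + c (-1) + (c 1 + c 2))); last by vring.
by apply: daddv_pi_l => //; exact: levi_cap.
Qed.

Lemma L_Gr k x : Gr k x -> k != 0 -> L x = 0.
Proof. by move=> gx k0; apply: (Gr_killing (h_Gr0 (hvec_h _)) gx); rewrite add0r. Qed.

Lemma p_nb x : p x \in nb. Proof. exact: memv_pi. Qed.
Lemma p0_levi x : p0 x \in levi. Proof. exact: memv_pi. Qed.

Lemma pi_actE s f z : pi_act e b al q s Y f z = s * L (phi z) * f z - rd (p (phi z)) f z.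
Proof.
rewrite /pi_act fund_charE; congr (_ * _ * _ - _).
move: (Ad_inv e z Y) => x.
have [c [gc ex]] := Gr_dec (rp := rp) (ts := ts) x.
have [_ e2 _] := pE gc ex.
transitivity (L (c 0 + c 1 + c 2)); first exact: (congr1 L e2).
transitivity (L (c (-2) + c (-1) + c 0 + c 1 + c 2)); last exact: (congr1 L (esym ex)).
rewrite !(killingDr _ _ (hvec _)).
have -> : L (c (-2)) = 0 by exact: (L_Gr (gc (-2))).
have -> : L (c (-1)) = 0 by exact: (L_Gr (gc (-1))).
by rewrite !add0r.
Qed.

(* [W X x] is the bracket of [X] with the degree 0 component of [x], in a form linear in [x]. *)
Definition W X x := p (br x X) - br (p x) X.
Lemma W_lin X : linear_map (W X).
Proof.
move=> c x x'; rewrite /W lie_br_linl !linearP /= lie_br_linl.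
by rewrite scalerBr opprD addrACA.
Qed.
Lemma WE X x : Gr (-1) X -> W X x = br (p0 x) X.
Proof.
move=> gX; have [c [gc ex]] := Gr_dec (rp := rp) (ts := ts) x.
have [e1 _ e3] := pE gc ex.
have X3 : br (c (-2)) X = 0 by apply: (Gr_small _ (Gr_br (gc (-2)) gX)).
pose c' (k : int) : g := if k == -2 then br (c (-1)) X else if k == -1 then br (c 0) X
  else if k == 0 then br (c 1) X else if k == 1 then br (c 2) X else 0.
have gc' k : Gr k (c' k).
  rewrite /c'; do 4 (case: eqP => [->|_]; first exact: (Gr_br (gc _) gX)).
  exact: Gr0.
have ex' : br x X = c' (-2) + c' (-1) + c' 0 + c' 1 + c' 2.
  by rewrite ex !(brDl _ _ X) X3 add0r /c' /= addr0.
have [e1' _ _] := pE gc' ex'.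
transitivity (c' (-2) + c' (-1) - br (c (-2) + c (-1)) X).
  exact: (eqB e1' (congr1 (fun v => br v X) e1)).
transitivity (br (c 0) X); last exact: (congr1 (fun v => br v X) (esym e3)).
by rewrite (brDl _ _ X) X3 add0r /c' /= addrC addKr.
Qed.

Lemma L_form : linear_form L. Proof. by move=> c x x'; rewrite killing_linr. Qed.
Lemma p_lin : linear_map p. Proof. by move=> c x x'; rewrite linearP. Qed.
Lemma L_phi_smooth : smooth (fun z => L (phi z)).
Proof. exact: form_smooth L_form gsmooth_phi. Qed.

Lemma pi_smooth s f : smooth f -> smooth (pi_act e b al q s Y f).
Proof.
move=> hf; rewrite (_ : pi_act e b al q s Y f = (fun z => s * L (phi z) * f z - rd (p (phi z)) f z)).
  apply: smoothB.
    by apply: smoothM => //; apply: smoothZ; exact: L_phi_smooth.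
  by apply: rdW_smooth => //; apply: gsmooth_lin p_lin gsmooth_phi.
by apply/funext => z; exact: pi_actE.
Qed.

Lemma pi_lin s (c : C) f (f' : M -> C) z : smooth f -> smooth f' ->
  pi_act e b al q s Y (fun y => c * f y + f' y) z = c * pi_act e b al q s Y f z + pi_act e b al q s Y f' z.
Proof.
move=> hf hf'; rewrite !pi_actE rdD ?rdZ //; [ring|exact: p_nb|exact: p_nb|exact: smoothZ].
Qed.

(** The vector field of [pi_act] contributes twice: through the commutator of [R(X)] with its frozen
    coefficients, and through the derivative of those coefficients. The two add up to
    [W X (phi z)]. *)
Lemma pi_rd s X f z : Gr (-1) X -> smooth f ->
  pi_act e b al q s Y (rd X f) z =
  rd X (pi_act e b al q s Y f) z - s * L (br (phi z) X) * f z + rd (W X (phi z)) f z.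
Proof.
move=> gX hf; have hX := Gr1_nb gX.
have hp := isder_phi hX.
rewrite (_ : pi_act e b al q s Y f = (fun z => s * L (phi z) * f z - rd (p (phi z)) f z)); last first.
  by apply/funext => y; exact: pi_actE.
have s1 : smooth (fun z => s * L (phi z)) by apply: smoothZ; exact: L_phi_smooth.
have s2 : smooth (fun z => rd (p (phi z)) f z).
  by apply: rdW_smooth => //; apply: gsmooth_lin p_lin gsmooth_phi.
rewrite pi_actE rdB //; last exact: smoothM.
rewrite rdM // rdZ //; last exact: L_phi_smooth.
rewrite (form_der z hX L_form hp) (rd_leib z hX (isder_lin hX p_lin hp) hf).
have -> : W X (phi z) = 1 *: p (br (phi z) X) + br X (p (phi z)).
  by rewrite /W scale1r (br_anti X).
rewrite rd_linl mul1r.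
have <- : rd X (rd (p (phi z)) f) z - rd (p (phi z)) (rd X f) z = rd (br X (p (phi z))) f z.
  by rewrite rd_comm //; exact: p_nb.
have ar (a1 a2 a3 a4 a5 : C) : a1 - a2 = a3 + a1 - (a4 + a5) - a3 + (a4 + (a5 - a2)) by ring.
exact: ar.
Qed.

Lemma pi_rd2 s X X' f z : Gr (-1) X -> Gr (-1) X' -> smooth f ->
  pi_act e b al q s Y (rd X (rd X' f)) z - rd X (rd X' (pi_act e b al q s Y f)) z =
  - s * L (br (phi z) X) * rd X' f z - s * L (br (phi z) X') * rd X f z
  - s * L (br (br (phi z) X) X') * f z + rd (W X' (br (phi z) X)) f z
  + (rd (W X (phi z)) (rd X' f) z + rd X (rd (W X' (phi z)) f) z).
Proof.
move=> gX gX' hf; have hX := Gr1_nb gX; have hX' := Gr1_nb gX'.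
have hp := isder_phi hX.
have sX' : smooth (rd X' f) by exact: rd_smooth.
rewrite (pi_rd s z gX sX').
rewrite (_ : pi_act e b al q s Y (rd X' f) = (fun y => rd X' (pi_act e b al q s Y f) y
   - s * L (br (phi y) X') * f y + rd (W X' (phi y)) f y)); last first.
  by apply/funext => y; exact: pi_rd.
have Lb_form : linear_form (fun x => L (br x X')).
  by move=> c x x'; rewrite lie_br_linl killing_linr.
have s0 : smooth (fun y => L (br (phi y) X')) by exact: form_smooth Lb_form gsmooth_phi.
have s1 : smooth (fun y => s * L (br (phi y) X')) by exact: smoothZ.
have s2 : smooth (fun y => s * L (br (phi y) X') * f y) by exact: smoothM.
have s3 : smooth (fun z => rd (W X' (phi z)) f z).
  by apply: rdW_smooth => //; apply: gsmooth_lin (W_lin X') gsmooth_phi.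
have s4 : smooth (rd X' (pi_act e b al q s Y f)) by apply: rd_smooth => //; exact: pi_smooth.
have s5 : smooth (fun y => rd X' (pi_act e b al q s Y f) y - s * L (br (phi y) X') * f y) by exact: smoothB.
rewrite (rdD z hX s5 s3) (rdB z hX s4 s2) (rdM z hX s1 hf) (rdZ s z hX s0).
rewrite (form_der z hX Lb_form hp) (rd_leib z hX (isder_lin hX (W_lin X') hp) hf).
have arith (A a1 a2 w1 w2 a3 w3 : C) :
  A - (a1 + a2) + (w1 + w2) - a3 + w3 - A = - a3 - a2 - a1 + w1 + (w3 + w2) by ring.
by rewrite !mulNr; exact: arith.
Qed.

End Conformal.

(** * Commutators of the representation with the second order operators *)

Section OmegaSystems.
Context {R : realType} {rp : real_part R[i] R}.
Context {g : lie_algebra R[i]} {h : {vspace g}}.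
Context {bil : bilinear_lie g} {hc : is_cartan h} {nd : nondeg_killing g}.
Context {b : {vspace g}} {n : nat} {al : 'I_n -> hdual h} {ss : simple_system b al}.
Context {q : 'I_n} {ts : two_step b al q}.
Local Notation C := R[i].
Local Notation Gr := (graded (rp := rp) (al := al) (q := q)).
Local Notation levi := (levi al q).
Local Notation gr := (gr al q).
Local Notation nb := (nilrad_opp al q).
Local Notation pb := (parab b al q).
Local Notation bS := (bS (al := al) (q := q)).
Local Notation TV := (tensv levi (gr (- 2%:Z))).
Context {d : nat} {e : d.-tuple g} {fr : nilpotent_frame e nb}.
Local Notation M := 'rV[R]_d.
Local Notation lv := (log_vec e).
Local Notation rd := (right_der e).
Local Notation p0 := (daddv_pi levi (nb + nilrad b al q)%VS).
Local Notation L := (killing (hvec (lam (al := al) q))).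
Local Notation W := (W (b := b) (al := al) (q := q)).
Local Notation OM := (Omega2 e al q).
Local Notation rf := (root_form (rp := rp)).
Local Notation E := (fun i : 'I_(\dim (gr 1)) => (vbasis (gr 1))`_i).
Local Notation F := (fun i : 'I_(\dim (gr 1)) => kdual (gr (- 1)) i).
Implicit Types (x X : g) (y z : M) (f : M -> C) (S : tensor g).

Hypothesis dim5 : (5 <= \dim {:g})%N.

Lemma gF i : Gr (-1) (F i). Proof. exact: kdual_mem. Qed.
Lemma F_nb i : F i \in nb. Proof. by apply: Gr1_nb; exact: gF. Qed.
Lemma coef_sym S (i j : 'I_(\dim (gr 1))) : ttau2_coef S i j = ttau2_coef S j i.
Proof. by rewrite !coefE bS_sym. Qed.

(** The symmetrization is absorbed by the symmetric coefficients. *)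
Lemma OmegaE S f z : OM S f z = \sum_i \sum_j ttau2_coef S i j * rd (F i) (rd (F j) f) z.
Proof.
rewrite /Omega2.
have H (G : 'I_(\dim (gr 1)) -> 'I_(\dim (gr 1)) -> C) :
  \sum_i \sum_j ttau2_coef S i j * (2^-1 * (G i j + G j i)) = \sum_i \sum_j ttau2_coef S i j * G i j.
  have H' : \sum_i \sum_j ttau2_coef S i j * G j i = \sum_i \sum_j ttau2_coef S i j * G i j.
    by rewrite exchange_big; apply: eq_bigr => i _; apply: eq_bigr => j _; rewrite coef_sym.
  transitivity (2^-1 * (\sum_i \sum_j ttau2_coef S i j * G i j + \sum_i \sum_j ttau2_coef S i j * G j i)).
    rewrite -big_split mulr_sumr; apply: eq_bigr => i _ /=.
    rewrite -big_split mulr_sumr; apply: eq_bigr => j _ /=.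
    by rewrite -mulrDr mulrCA.
  by rewrite H'; field.
exact: (H (fun i j => rd (F i) (rd (F j) f) z)).
Qed.

Lemma OmegaE_fun S f : OM S f = fun z => \sum_i \sum_j ttau2_coef S i j * rd (F i) (rd (F j) f) z.
Proof. by apply/funext => z; exact: OmegaE. Qed.

Lemma rdF_smooth i f : smooth f -> smooth (rd (F i) f).
Proof. by apply: rd_smooth; exact: F_nb. Qed.
Lemma Omega_smooth S f : smooth f -> smooth (OM S f).
Proof.
move=> hf; rewrite OmegaE_fun; apply: smooth_sum => i _; apply: smooth_sum => j _.
by apply: smoothZ; apply: rdF_smooth; exact: rdF_smooth.
Qed.
Lemma Omega_lin (c : C) S S' f z : OM (c *: S + S') f z = c * OM S f z + OM S' f z.
Proof.
rewrite !OmegaE mulr_sumr -big_split; apply: eq_bigr => i _ /=.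
rewrite mulr_sumr -big_split; apply: eq_bigr => j _ /=.
rewrite !coefE bSD bSZ.
have ar (a1 a2 a3 a4 : C) : (a1 * a2 + a3) * a4 = a1 * (a2 * a4) + a3 * a4 by ring.
exact: ar.
Qed.
Lemma Omega_sum I (r : seq I) (c : I -> C) (T : I -> tensor g) f z :
  OM (\sum_(i <- r) c i *: T i) f z = \sum_(i <- r) c i * OM (T i) f z.
Proof.
elim: r => [|i r IH]; last by rewrite !big_cons Omega_lin IH.
by rewrite !big_nil OmegaE big1 // => i _; rewrite big1 // => j _; rewrite coefE bS0 mul0r.
Qed.

Lemma rd_suml I (r : seq I) (c : I -> C) (T : I -> g) f z :
  rd (\sum_(i <- r) c i *: T i) f z = \sum_(i <- r) c i * rd (T i) f z.
Proof.
elim: r => [|i r IH]; last by rewrite !big_cons rd_linl IH.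
by rewrite !big_nil /right_der big1 // => i _; rewrite linear0 mul0r.
Qed.

(** Expanding [[Z, F i]] in the basis [F] moves the action of [Z] onto the coefficients, where
    [bS_eq] recognizes it as the action on [S]. *)
Lemma Omega_act Z S f z : Z \in levi -> S \in TV -> smooth f ->
  \sum_i \sum_j ttau2_coef S i j *
     (rd (br Z (F i)) (rd (F j) f) z + rd (F i) (rd (br Z (F j)) f) z) = OM (tens_act Z S) f z.
Proof.
move=> Zl ST hf; have k0 : 1 != 0 :> int by []. have kk : 1 + -1 = 0 :> int by [].
have gZ : Gr 0 Z by apply/(leviP (rp := rp)).
pose a (i k : 'I_(\dim (gr 1))) := killing (br Z (F i)) (E k).
have ZF i : br Z (F i) = \sum_k a i k *: F k.
  by apply: (kdual_dec (rp := rp) k0 kk); exact: (Gr_br0 gZ (gF i)).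
have ZE k : br Z (E k) = \sum_i (- a i k) *: E i.
  rewrite [LHS](kdual_dec2 (rp := rp) k0 kk (Gr_br0 gZ (gr_basis k k0))).
  by apply: eq_bigr => i _; congr (_ *: _); rewrite /a (killing_invN Z (F i)) opprK killingC.
pose rr (i j : 'I_(\dim (gr 1))) := rd (F i) (rd (F j) f) z.
transitivity (\sum_i \sum_j \sum_k ttau2_coef S i j * a i k * rr k j
            + \sum_i \sum_j \sum_k ttau2_coef S i j * a j k * rr i k).
  rewrite -big_split; apply: eq_bigr => i _ /=; rewrite -big_split; apply: eq_bigr => j _ /=.
  rewrite mulrDr; congr (_ + _).
    by rewrite ZF rd_suml mulr_sumr; apply: eq_bigr => k _; rewrite mulrA.
  rewrite ZF; set Q := rd (\sum_k _) f.
  have -> : Q = (fun y => \sum_k a j k * rd (F k) f y) by apply/funext => y; exact: rd_suml.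
  rewrite (rd_sum _ z (F_nb i)); last by move=> k; apply: smoothZ; exact: rdF_smooth.
  rewrite mulr_sumr; apply: eq_bigr => k _.
  by rewrite (rdZ (a j k) z (F_nb i) (rdF_smooth k hf)) mulrA.
rewrite OmegaE.
transitivity (\sum_k \sum_j ((\sum_i ttau2_coef S i j * a i k) + \sum_i ttau2_coef S k i * a i j) * rr k j); last first.
  apply: eq_bigr => k _; apply: eq_bigr => j _; congr (_ * _).
  have c1 : bS S (br Z (E k)) (E j) = - \sum_i ttau2_coef S i j * a i k.
    by rewrite ZE bS_suml -sumrN; apply: eq_bigr => i _; rewrite bS_Zl mulNr coefE mulrC.
  have c2 : bS S (E k) (br Z (E j)) = - \sum_i ttau2_coef S k i * a i j.
    by rewrite ZE bS_sumr -sumrN; apply: eq_bigr => i _; rewrite bS_Zr mulNr coefE mulrC.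
  rewrite coefE; have -> := bS_eq (rp := rp) (E k) (E j) Zl ST.
  by rewrite c1 c2 !opprK.
transitivity (\sum_k \sum_j (\sum_i ttau2_coef S i j * a i k) * rr k j
   + \sum_k \sum_j (\sum_i ttau2_coef S k i * a i j) * rr k j); last first.
  by rewrite -big_split; apply: eq_bigr => k _; rewrite -big_split; apply: eq_bigr => j _; rewrite mulrDl.
congr (_ + _).
  under eq_bigr => i _ do rewrite exchange_big /=.
  rewrite exchange_big /=; apply: eq_bigr => k _.
  by rewrite exchange_big /=; apply: eq_bigr => j _; rewrite mulr_suml.
apply: eq_bigr => i _; rewrite exchange_big /=; apply: eq_bigr => k _.
by rewrite mulr_suml.
Qed.

(** The vector dual to [lam q] acts on g(-1) by a scalar, so by invariance the left side is a
    multiple of [killing X' (br x X)], which is skew in [X] and [X']. This is what removes the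
    multiplication operator from the commutator. *)
Lemma L_anti x X X' : Gr (-1) X -> Gr (-1) X' -> L (br (br x X) X') = - L (br (br x X') X).
Proof.
move=> gX gX'.
have hl (u : g) : Gr (-1) u -> br (hvec (lam (al := al) q)) u = - re_inj (rf (al q) (al q) / 2) *: u.
  rewrite /graded /Hq brZl mulrN1z scaleN1r => eu; rewrite scaleNr -scalerN -eu scalerA -rmorphM.
  have pq : rf (al q) (al q) != 0 by rewrite gt_eqF //; apply: rf_gt0; exact: (al_root (ss := ss)).
  rewrite (_ : rf (al q) (al q) / 2 * _ = 1) ?rmorph1 ?scale1r //.
  by field.
have K (u v : g) : Gr (-1) u -> Gr (-1) v -> L (br (br x u) v) = re_inj (rf (al q) (al q) / 2) * killing v (br x u).
  move=> gu gv; rewrite (br_anti _ v) killingNr -killing_inv (hl _ gv) killingZl.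
  by rewrite mulNr opprK.
by rewrite !K // killingC killing_invN mulrN.
Qed.

Variable (Y : g).
Local Notation phi := (fun z => Ad_inv e z Y).

Lemma pi_sum s I (r : seq I) (c : I -> C) (G : I -> M -> C) z : (forall i, smooth (G i)) ->
  pi_act e b al q s Y (fun y => \sum_(i <- r) c i * G i y) z =
  \sum_(i <- r) c i * pi_act e b al q s Y (G i) z.
Proof.
move=> hG; elim: r => [|i r IH].
  rewrite big_nil (_ : (fun y => _) = (fun=> 0)); last by apply/funext => y; rewrite big_nil.
  by rewrite pi_actE // rd_cst ?mulr0 ?subr0 //; exact: p_nb.
rewrite big_cons (_ : (fun y => _) = (fun y => c i * G i y + \sum_(j <- r) c j * G j y)); last first.
  by apply/funext => y; rewrite big_cons.
rewrite pi_lin // ?IH //.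
by apply: smooth_sum => j _; exact: smoothZ.
Qed.

Variables (Vd : {vspace tensor g}) (s : C).
Hypothesis VdTV : (Vd <= TV)%VS.
Hypothesis key : forall S X, S \in Vd -> Gr 1 X ->
  \sum_i \sum_j ttau2_coef S i j *: br (br X (F i)) (F j) =
  2 * s *: (\sum_i \sum_j ttau2_coef S i j *: (L (br X (F i)) *: F j)).

(** For reasons of degree both sides see only the degree 1 component of [phi z], and [key] is
    applied to that component. *)
Lemma key_rd S f z : S \in Vd ->
  \sum_i \sum_j ttau2_coef S i j * rd (W (F j) (br (phi z) (F i))) f z =
  2 * s * \sum_i \sum_j ttau2_coef S i j * (L (br (phi z) (F i)) * rd (F j) f z).
Proof.
move=> SV; cbv beta; move: (Ad_inv e z Y) => x.
have [c [gc ex]] := Gr_dec (rp := rp) (ts := ts) x.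
have Lx i : L (br x (F i)) = L (br (c 1) (F i)).
  rewrite ex !(brDl _ _ (F i)) !(killingDr _ _ (hvec _)).
  have z0 (k : int) : k - 1 != 0 -> L (br (c k) (F i)) = 0 by move=> k1; exact: (L_Gr (Gr_br (gc k) (gF i)) k1).
  by rewrite (z0 (-2) isT) (z0 (-1) isT) (z0 0 isT) (z0 2 isT) !add0r addr0.
have Wx i j : W (F j) (br x (F i)) = br (br (c 1) (F i)) (F j).
  rewrite (WE (rp := rp) dim5 _ (gF j)).
  have X3 : br (c (-2)) (F i) = 0 by apply: (Gr_small _ (Gr_br (gc (-2)) (gF i))).
  pose c' (k : int) : g := if k == -2 then br (c (-1)) (F i) else if k == -1 then br (c 0) (F i)
    else if k == 0 then br (c 1) (F i) else if k == 1 then br (c 2) (F i) else 0.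
  have gc' k : Gr k (c' k).
    rewrite /c'; do 4 (case: eqP => [->|_]; first exact: (Gr_br (gc _) (gF i))).
    exact: Gr0.
  have ex' : br x (F i) = c' (-2) + c' (-1) + c' 0 + c' 1 + c' 2.
    by rewrite ex !(brDl _ _ (F i)) X3 add0r /c' /= addr0.
  have [_ _ e3] := pE dim5 gc' ex'.
  exact: (congr1 (fun v => br v (F j)) e3).
have K : rd (\sum_i \sum_j ttau2_coef S i j *: br (br (c 1) (F i)) (F j)) f z =
   rd (2 * s *: (\sum_i \sum_j ttau2_coef S i j *: (L (br (c 1) (F i)) *: F j))) f z by rewrite key.
have rs (G : 'I_(\dim (gr 1)) -> 'I_(\dim (gr 1)) -> g) : rd (\sum_i \sum_j ttau2_coef S i j *: G i j) f z =
    \sum_i \sum_j ttau2_coef S i j * rd (G i j) f z.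
  have rs1 := rd_suml (index_enum 'I_(\dim (gr 1))) (fun=> 1) (fun i => \sum_j ttau2_coef S i j *: G i j) f z.
  transitivity (rd (\sum_i 1 *: \sum_j ttau2_coef S i j *: G i j) f z).
    by congr (rd _ f z); apply: eq_bigr => i _; rewrite scale1r.
  by rewrite rs1; apply: eq_bigr => i _; rewrite mul1r rd_suml.
have rZ (t : C) x' : rd (t *: x') f z = t * rd x' f z.
  have := rd_suml [:: tt] (fun=> t) (fun=> x') f z; by rewrite !big_seq1.
rewrite rZ !rs in K.
transitivity (\sum_i \sum_j ttau2_coef S i j * rd (br (br (c 1) (F i)) (F j)) f z).
  by apply: eq_bigr => i _; apply: eq_bigr => j _; rewrite Wx.
rewrite K; congr (_ * _); apply: eq_bigr => i _; apply: eq_bigr => j _.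
by rewrite rZ Lx.
Qed.

(** [pi_rd2] is summed against the symmetric coefficients: the two first order terms with [s]
    coincide and cancel against [key_rd], the zeroth order term vanishes by [L_anti], and the second
    order part is the action of the degree 0 component of [phi z] on [S]. *)
Lemma Omega_comm S f z : S \in Vd -> smooth f ->
  pi_act e b al q s Y (OM S f) z - OM S (pi_act e b al q s Y f) z = OM (tens_act (p0 (phi z)) S) f z.
Proof.
move=> SV hf; have ST : S \in TV by move/subvP: VdTV; apply.
have -> : pi_act e b al q s Y (OM S f) z =
    \sum_i \sum_j ttau2_coef S i j * pi_act e b al q s Y (rd (F i) (rd (F j) f)) z.
  have srr i j : smooth (rd (F i) (rd (F j) f)) by apply: rdF_smooth; exact: rdF_smooth.
  rewrite OmegaE_fun.
  rewrite (_ : (fun y => _) = fun y => \sum_i 1 * \sum_j ttau2_coef S i j * rd (F i) (rd (F j) f) y); last first.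
    by apply/funext => y; apply: eq_bigr => i _; rewrite mul1r.
  rewrite pi_sum; last by move=> i; apply: smooth_sum => j _; apply: smoothZ.
  by apply: eq_bigr => i _; rewrite mul1r pi_sum.
rewrite [in X in _ - X]OmegaE -sumrB.
pose Lx i := L (br (phi z) (F i)); pose r i := rd (F i) f z.
pose G i j := pi_act e b al q s Y (rd (F i) (rd (F j) f)) z - rd (F i) (rd (F j) (pi_act e b al q s Y f)) z.
transitivity (\sum_i \sum_j ttau2_coef S i j * G i j).
  by apply: eq_bigr => i _; rewrite -sumrB; apply: eq_bigr => j _; rewrite -mulrBr.
have GE i j : G i j = - s * (Lx i * r j) - s * (Lx j * r i) - s * f z * L (br (br (phi z) (F i)) (F j))
    + rd (W (F j) (br (phi z) (F i))) f z
    + (rd (br (p0 (phi z)) (F i)) (rd (F j) f) z + rd (F i) (rd (br (p0 (phi z)) (F j)) f) z).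
  rewrite /G (pi_rd2 dim5 Y s z (gF i) (gF j) hf) -!(WE (rp := rp) dim5 _ (gF _)) /Lx /r.
  congr (_ - _ - _ + _ + _); [by rewrite mulrA | by rewrite mulrA | by rewrite mulrAC].
pose A := \sum_i \sum_j ttau2_coef S i j * (Lx i * r j).
have A2 : \sum_i \sum_j ttau2_coef S i j * (Lx j * r i) = A.
  by rewrite exchange_big; apply: eq_bigr => i _; apply: eq_bigr => j _; rewrite coef_sym.
pose B := \sum_i \sum_j ttau2_coef S i j * L (br (br (phi z) (F i)) (F j)).
have B0 : B = 0.
  have : B = - B.
    rewrite {1}/B exchange_big -sumrN; apply: eq_bigr => i _; rewrite -sumrN; apply: eq_bigr => j _ /=.
    by rewrite coef_sym (L_anti _ (gF j) (gF i)) mulrN.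
  move=> BB; have : 2 * B = 0 by rewrite mulr_natl mulr2n {1}BB addNr.
  by move=> /eqP; rewrite mulf_eq0 pnatr_eq0 /= => /eqP.
have K := key_rd f z SV; rewrite -/Lx in K.
have T4 := Omega_act z (p0_levi _) ST hf (Z := p0 (phi z)).
rewrite -T4.
transitivity (- s * A - s * A - s * f z * B
   + \sum_i \sum_j ttau2_coef S i j * rd (W (F j) (br (phi z) (F i))) f z
   + \sum_i \sum_j ttau2_coef S i j * (rd (br (p0 (phi z)) (F i)) (rd (F j) f) z + rd (F i) (rd (br (p0 (phi z)) (F j)) f) z)).
  rewrite -{2}A2 /A /B !mulr_sumr -!sumrB -!big_split; apply: eq_bigr => i _ /=.
  rewrite !mulr_sumr -!sumrB -!big_split; apply: eq_bigr => j _ /=.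
  rewrite GE !mulrDr !mulrN; congr (_ - _ - _ + _ + _); by rewrite mulrCA.
rewrite K B0 mulr0 subr0 -/A; ring.
Qed.

End OmegaSystems.

(** * Conformal invariance of equivalent lists *)

Section Invariance.
Context {R : realType} {rp : real_part R[i] R}.
Context {g : lie_algebra R[i]} {h : {vspace g}}.
Context {bil : bilinear_lie g} {hc : is_cartan h} {nd : nondeg_killing g}.
Context {b : {vspace g}} {n : nat} {al : 'I_n -> hdual h} {ss : simple_system b al}.
Context {q : 'I_n} {ts : two_step b al q}.
Local Notation C := R[i].
Local Notation Gr := (graded (rp := rp) (al := al) (q := q)).
Local Notation levi := (levi al q).
Local Notation gr := (gr al q).
Local Notation nb := (nilrad_opp al q).
Local Notation pb := (parab b al q).
Local Notation bS := (bS (al := al) (q := q)).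
Local Notation TV := (tensv levi (gr (- 2%:Z))).
Context {d : nat} {e : d.-tuple g} {fr : nilpotent_frame e nb}.
Local Notation M := 'rV[R]_d.
Local Notation lv := (log_vec e).
Local Notation rd := (right_der e).
Local Notation p0 := (daddv_pi levi (nb + nilrad b al q)%VS).
Local Notation L := (killing (hvec (lam (al := al) q))).
Local Notation W := (W (b := b) (al := al) (q := q)).
Local Notation OM := (Omega2 e al q).
Local Notation E := (fun i : 'I_(\dim (gr 1)) => (vbasis (gr 1))`_i).
Local Notation F := (fun i : 'I_(\dim (gr 1)) => kdual (gr (- 1)) i).
Implicit Types (X : g) (x y z : M) (f : M -> C) (S : tensor g).

Lemma diff_op_scale (a : M -> C) (T : operator R d) : smooth a -> diff_op T -> diff_op (fun f z => a z * T f z).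
Proof. by move=> ha hT; apply: (diff_op_comp (D1 := fun f z => a z * f z)) => //; exact: diff_op_mul. Qed.
Lemma diff_op_sum I (r : seq I) (T : I -> operator R d) : (forall i, diff_op (T i)) ->
  diff_op (fun f z => \sum_(i <- r) T i f z).
Proof.
move=> hT; elim: r => [|i r IH].
  apply: (@diff_op_ext _ _ (fun f z => 0 * f z)); last by apply: diff_op_mul; exact: smooth_cst.
  by move=> f hf z; rewrite mul0r big_nil.
apply: (@diff_op_ext _ _ (fun f z => T i f z + \sum_(j <- r) T j f z)); last exact: diff_op_add.
by move=> f hf z; rewrite big_cons.
Qed.
Lemma Omega_diff_op S : diff_op (OM S).
Proof.
apply: (@diff_op_ext _ _ (fun f z => \sum_i \sum_j ttau2_coef S i j * rd (F i) (rd (F j) f) z)) => [f hf z|].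
  by rewrite OmegaE.
apply: diff_op_sum => i; apply: diff_op_sum => j; apply: diff_op_scale; first exact: smooth_cst.
by apply: (diff_op_comp (D1 := rd (F i)) (D2 := rd (F j))); apply: rd_diff_op; exact: F_nb.
Qed.

(** The test function is a product of two affine functions vanishing at [x0], so at that point the
    two derivatives must fall on different factors. *)
Lemma Omega_test (E0 E1 : g) (x0 : M) : Gr 1 E0 -> Gr 1 E1 ->
  exists2 f, smooth f & forall S, OM S f x0 = 2 * bS S E0 E1.
Proof.
move=> g0 g1.
pose u (A : g) (y : M) : C := killing A (lv y) - killing A (lv x0).
have uf (A : g) : linear_form (killing A) by move=> c X X'; rewrite killing_linr.
have su (A : g) : smooth (u A).
  apply: smoothB; last exact: smooth_cst.
  by apply: form_smooth (uf A) _; exact: gsmooth_lv.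
have ru (A X : g) y : Gr 1 A -> Gr (-1) X -> rd X (u A) y = killing A X.
  move=> gA gX; have hX : X \in nb by exact: Gr1_nb gX.
  rewrite /u rdB //; [|by apply: form_smooth (uf A) _; exact: gsmooth_lv|exact: smooth_cst].
  rewrite rd_cst // subr0 (form_der y hX (uf A) (isder_lv hX)) /wv killingDr killingZr.
  have -> : killing A (br (lv y) X) = 0.
    by apply: (Gr_killing gA (nb_brGr (lv_nb y) hX)).
  by rewrite mulr0 addr0.
have u0 A : u A x0 = 0 by rewrite /u subrr.
exists (fun y => u E0 y * u E1 y); first exact: smoothM.
move=> S; rewrite OmegaE.
have R2 i j : rd (F i) (rd (F j) (fun y => u E0 y * u E1 y)) x0 =
   killing E0 (F j) * killing E1 (F i) + killing E0 (F i) * killing E1 (F j).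
  rewrite (_ : rd (F j) _ = fun y => killing E0 (F j) * u E1 y + killing E1 (F j) * u E0 y); last first.
    apply/funext => y; rewrite (rdM y (F_nb j) (su E0) (su E1)) !ru //; try exact: gF.
    by rewrite (mulrC (u E0 y)).
  rewrite (rdD x0 (F_nb i)); [|exact: smoothZ|exact: smoothZ].
  rewrite (rdZ _ _ (F_nb i) (su E1)) (rdZ _ _ (F_nb i) (su E0)) !ru //; try exact: gF.
  by rewrite (mulrC (killing E1 (F j))).
have k0 : 1 != 0 :> int by []. have kk : 1 + -1 = 0 :> int by [].
have B : bS S E0 E1 = \sum_i \sum_j ttau2_coef S i j * (killing E0 (F i) * killing E1 (F j)).
  rewrite {1}(kdual_dec2 (rp := rp) k0 kk g0) bS_suml; apply: eq_bigr => i _.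
  rewrite bS_Zl {1}(kdual_dec2 (rp := rp) k0 kk g1) bS_sumr mulr_sumr; apply: eq_bigr => j _.
  by rewrite bS_Zr coefE mulrA mulrC.
have B' : bS S E0 E1 = \sum_i \sum_j ttau2_coef S i j * (killing E0 (F j) * killing E1 (F i)).
  by rewrite B exchange_big; apply: eq_bigr => i _; apply: eq_bigr => j _; rewrite coef_sym.
rewrite mulr_natl mulr2n {1}B' B -big_split; apply: eq_bigr => i _ /=.
by rewrite -big_split; apply: eq_bigr => j _ /=; rewrite R2 mulrDr.
Qed.

Hypothesis dim5 : (5 <= \dim {:g})%N.
Variables (Vd : {vspace tensor g}) (s : C).
Hypothesis VdTV : (Vd <= TV)%VS.
Hypothesis Vdst : levi_stable al q (@tens_act _ g) Vd.
Hypothesis inj : forall S, S \in Vd ->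
  (forall X X' : g, Gr 1 X -> Gr 1 X' -> bS S X X' = 0) -> S = 0.
Hypothesis key : forall S X, S \in Vd -> Gr 1 X ->
  \sum_i \sum_j ttau2_coef S i j *: br (br X (F i)) (F j) =
  2 * s *: (\sum_i \sum_j ttau2_coef S i j *: (L (br X (F i)) *: F j)).
Variables (m : nat) (D : 'I_m -> operator R d).
Variables (Yt : m.-tuple (tensor g)) (Yb : basis_of Vd Yt).
Variables (A : M -> 'M[C]_m).
Hypothesis A_smooth : forall i j, smooth (fun x => A x i j).
Hypothesis A_unit : forall x, A x \in unitmx.
Hypothesis DE : forall i f x, smooth f -> D i f x = \sum_j A x j i * OM (tnth Yt j) f x.

Lemma Yt_Vd i : tnth Yt i \in Vd.
Proof. by apply: (basis_mem Yb); exact: mem_tnth. Qed.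

Lemma D_diff_op i : diff_op (D i).
Proof.
apply: (@diff_op_ext _ _ (fun f x => \sum_j A x j i * OM (tnth Yt j) f x)) => [f hf x|]; first by rewrite DE.
by apply: diff_op_sum => j; apply: diff_op_scale; [exact: A_smooth | exact: Omega_diff_op].
Qed.

(** Through the invertible matrix [A x], a relation among the [D i] at [x] becomes a tensor of [Vd]
    whose operator vanishes at [x]; by [Omega_test] its form is zero, so [inj] applies. *)
Lemma D_indep x : indep_at D x.
Proof.
move=> c hc'.
pose v := \col_i c i.
pose w j := (A x *m v) j 0.
have Sin : \sum_j w j *: tnth Yt j \in Vd by apply: memv_suml => j _; apply: memvZ; exact: Yt_Vd.
have O0 f : smooth f -> OM (\sum_j w j *: tnth Yt j) f x = 0.
  move=> hf; rewrite Omega_sum; transitivity (\sum_i c i * D i f x); last exact: hc'.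
  under [RHS]eq_bigr => i _ do rewrite DE // mulr_sumr.
  rewrite exchange_big /=; apply: eq_bigr => j _.
  rewrite /w mxE mulr_suml; apply: eq_bigr => i _.
  by rewrite /v mxE mulrCA mulrA.
have S0 : \sum_j w j *: tnth Yt j = 0.
  apply: inj => // X X' gX gX'.
  have [f hf /(_ (\sum_j w j *: tnth Yt j))] := Omega_test x gX gX'.
  by rewrite O0 // => /esym /eqP; rewrite mulf_eq0 pnatr_eq0 /= => /eqP.
have w0 j : w j = 0.
  have /freeP fY : free Yt by exact: basis_free Yb.
  apply: (fY w) j; rewrite -[RHS]S0; apply: eq_bigr => j _.
  by rewrite (tnth_nth 0).
have v0 : v = 0.
  rewrite -(mulKmx (A_unit x) v) (_ : A x *m v = 0) ?mulmx0 //.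
  by apply/matrixP => j k; rewrite ord1 [RHS]mxE; exact: w0.
by move=> i; have := congr1 (fun u : 'cV[C]_m => u i 0) v0; rewrite !mxE.
Qed.

Lemma det_smooth k (B : M -> 'M[C]_k) : (forall i j, smooth (fun x => B x i j)) -> smooth (fun x => \det (B x)).
Proof.
move=> hB; apply: smooth_sum => p _; apply: smoothM; first exact: smooth_cst.
by apply: smooth_prod => i.
Qed.

(** Cofactor formula for the inverse: determinants are polynomials in the entries and the
    determinant of [A x] does not vanish. *)
Lemma inv_smooth i j : smooth (fun x => invmx (A x) i j).
Proof.
rewrite (_ : (fun x => _) = fun x => (\det (A x))^-1 * ((-1) ^+ (j + i) * \det (row' j (col' i (A x))))); last first.
  by apply/funext => x; rewrite /invmx A_unit !mxE.
apply: smoothM; first apply: smoothV.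
- by move=> x; have := A_unit x; rewrite unitmxE unitfE.
- exact: det_smooth.
apply: smoothM; first exact: smooth_cst.
apply: det_smooth => k l.
rewrite (_ : (fun x => _) = fun x => A x (lift j k) (lift i l)) //.
by apply/funext => x; rewrite !mxE.
Qed.

Lemma D_inv i f x : smooth f -> OM (tnth Yt i) f x = \sum_l invmx (A x) l i * D l f x.
Proof.
move=> hf.
under eq_bigr => l _ do rewrite DE // mulr_sumr.
rewrite exchange_big /= (bigD1 i) //= [X in _ + X]big1 => [|k ki].
  rewrite addr0; under eq_bigr => l _ do rewrite mulrA.
  rewrite -mulr_suml (_ : \sum_l _ = 1) ?mul1r //.
  have := congr1 (fun B : 'M[C]_m => B i i) (mulmxV (A_unit x)); rewrite !mxE eqxx => E1; rewrite -[RHS]E1.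
  by apply: eq_bigr => l _; rewrite mulrC.
under eq_bigr => l _ do rewrite mulrA.
rewrite -mulr_suml (_ : \sum_l _ = 0) ?mul0r //.
have := congr1 (fun B : 'M[C]_m => B k i) (mulmxV (A_unit x)); rewrite !mxE (negPf ki) => E1; rewrite -[RHS]E1.
by apply: eq_bigr => l _; rewrite mulrC.
Qed.

Lemma conformal_list : conformally_invariant e b al q s D.
Proof.
split; [exact: D_diff_op | exact: D_indep | move=> Y].
pose phi z := Ad_inv e z Y.
have sphi : gsmooth phi by apply: (gsmooth_phi (rp := rp)).
pose Cm k j z := coord Yt k (tens_act (p0 (phi z)) (tnth Yt j)).
have sC k j : smooth (Cm k j).
  apply: (form_smooth (l := fun X => coord Yt k (tens_act (p0 X) (tnth Yt j))) _ sphi) => c X X'.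
  by rewrite linearP /= act_linl linearP.
(* Product rule: the action on the tensors [Yt] weighted by [A], minus the derivative of the entries
   of [A] along the vector field of [pi_act]. The inverse matrix then converts the result back to
   the list [D]. *)
pose G k i z := \sum_j A z j i * Cm k j z - rd (daddv_pi nb pb (phi z)) (fun y => A y k i) z.
have sG k i : smooth (G k i).
  apply: smoothB; first by apply: smooth_sum => j _; apply: smoothM.
  by apply: rdW_smooth => //; apply: gsmooth_lin (p_lin (b := b)) sphi.
exists (fun l i z => \sum_k invmx (A z) l k * G k i z); split.
  by move=> l i; apply: smooth_sum => k _; apply: smoothM => //; exact: inv_smooth.
move=> i f x hf.
pose O j := OM (tnth Yt j).
have sO j : smooth (O j f) by exact: (Omega_smooth (rp := rp)).
have sAO j : smooth (fun y => A y j i * O j f y) by exact: smoothM.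
have Oc j : pi_act e b al q s Y (O j f) x = O j (pi_act e b al q s Y f) x + \sum_k Cm k j x * O k f x.
  have OC := Omega_comm dim5 Y VdTV key x (Yt_Vd j) hf.
  rewrite -[LHS](subrK (O j (pi_act e b al q s Y f) x)) [LHS]addrC; congr (_ + _); rewrite OC.
  have St : tens_act (p0 (phi x)) (tnth Yt j) \in Vd by apply: Vdst; [exact: p0_levi | exact: Yt_Vd].
  have eS : tens_act (p0 (phi x)) (tnth Yt j) = \sum_k Cm k j x *: tnth Yt k.
    rewrite {1}(coord_basis Yb St); apply: eq_bigr => k _; congr (_ *: _).
    exact: esym (tnth_nth 0 Yt k).
  by rewrite eS; exact: Omega_sum.
have -> : D i f = fun y => \sum_j A y j i * O j f y by apply/funext => y; exact: DE.
have sp : smooth (pi_act e b al q s Y f) by apply: (pi_smooth (rp := rp)).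
rewrite DE // (pi_actE (rp := rp) dim5) (rd_sum _ x (p_nb _)) // mulr_sumr.
transitivity (\sum_j \sum_k (A x j i * Cm k j x) * O k f x -
   \sum_j rd (daddv_pi nb pb (phi x)) (fun y => A y j i) x * O j f x).
  rewrite -!sumrB; apply: eq_bigr => j _.
  rewrite (rdM x (p_nb _) (A_smooth j i) (sO j)).
  have hO := Oc j; rewrite (pi_actE (rp := rp) dim5) in hO.
  have -> : \sum_k A x j i * Cm k j x * O k f x = A x j i * \sum_k Cm k j x * O k f x.
    by rewrite [RHS]mulr_sumr; apply: eq_bigr => k _; rewrite mulrA.
  have ar (s' a o r1 r2 X Z : C) : s' * o - r2 = X + Z -> s' * (a * o) - (r1 * o + a * r2) - a * X = a * Z - r1 * o.
    by move=> e0; rewrite -[Z](addKr X) -e0; ring.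
  exact: ar hO.
rewrite exchange_big -sumrB /=.
transitivity (\sum_k G k i x * O k f x).
  by apply: eq_bigr => k _; rewrite /G [RHS]mulrBl; congr (_ - _); rewrite [RHS]mulr_suml.
transitivity (\sum_k \sum_l G k i x * (invmx (A x) l k * D l f x)).
  by apply: eq_bigr => k _; rewrite -mulr_sumr -D_inv.
rewrite exchange_big; apply: eq_bigr => l _ /=; rewrite mulr_suml; apply: eq_bigr => k _.
by rewrite mulrCA mulrA.
Qed.

End Invariance.

(** Splitting the coordinates of [x] into real and imaginary parts gives a second decomposition
    besides [x + i 0]; uniqueness in the real form makes the imaginary part zero. *)
Lemma real_coords (R : realType) (g : lie_algebra R[i]) (g0 : set g) (U : {vspace g}) d
    (e : d.-tuple g) x : basis_of U e -> (forall i, g0 (tnth e i)) -> has_real_form g0 U ->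
  x \in U -> g0 x -> forall k, complex.Im (coord e k x) = 0.
Proof.
move=> he eg0 [_ U00 Ulin Uuniq] xU gx k.
have eU i : (g0 `&` [set y | y \in U]) (tnth e i).
  by split; [exact: eg0 | apply: (basis_mem he); exact: mem_tnth].
have Usum (c : 'I_d -> R) : (g0 `&` [set y | y \in U]) (\sum_i (c i)%:C%C *: tnth e i).
  have s (r : seq 'I_d) : (g0 `&` [set y | y \in U]) (\sum_(i <- r) (c i)%:C%C *: tnth e i).
    by elim: r => [|i r IH]; rewrite ?big_nil // big_cons; exact: Ulin.
  exact: s.
have [[a b] [_ hu]] := Uuniq x xU.
have [a1 b1] : (a, b) = (x, 0) by apply: hu; split=> //=; rewrite scaler0 addr0.
have [a2 b2] : (a, b) = (\sum_i (complex.Re (coord e i x))%:C%C *: tnth e i,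
                       \sum_i (complex.Im (coord e i x))%:C%C *: tnth e i).
  apply: hu; split=> /=; [exact: Usum | exact: Usum |].
  rewrite {1}(coord_basis he xU) scaler_sumr -big_split; apply: eq_bigr => i _ /=.
  rewrite scalerA -scalerDl (tnth_nth 0); congr (_ *: _).
  by apply: C_ext; rewrite ?cReD ?cImD ?cReM ?cImM /=; ring.
have := congr1 (coord e k) b2; rewrite b1 linear0 linear_sum (bigD1 k) //= linearZ /=.
have ce i j : coord e j (tnth e i) = (i == j)%:R by rewrite (tnth_nth 0) coord_free ?(basis_free he).
rewrite ce eqxx big1 => [|i ik]; last by rewrite linearZ /= ce (negPf ik) mulr0.
by rewrite mulr1 addr0 => /(congr1 (@complex.Re R)) /= <-.
Qed.

Definition complex_real_part (R : realType) : real_part R[i] R.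
Proof.
apply: (@RealPart _ _ (@complex.Re R) (real_complex R)).
- by move=> k [a b] /=; rewrite mul0r subr0.
- by move=> [a b]; rewrite lecE /= => /andP [/eqP -> _].
by move=> [a b]; rewrite ltcE /= => /andP [].
Defined.

Section Conformal.
Context {R : realType} {rp : real_part R[i] R}.
Context {g : lie_algebra R[i]} {h : {vspace g}}.
Context {bil : bilinear_lie g} {hc : is_cartan h} {nd : nondeg_killing g}.
Context {b : {vspace g}} {n : nat} {al : 'I_n -> hdual h} {ss : simple_system b al}.
Context {q : 'I_n} {ts : two_step b al q}.
Context {d : nat} {e : d.-tuple g} {fr : nilpotent_frame e (nilrad_opp al q)}.

Lemma conformal_of_data (V Vd : {vspace tensor g}) (m : nat) (D : 'I_m -> operator R d) (s : R[i]) :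
  dual_constituent al q V Vd -> Omega2_system e al q Vd D ->
  conformal_data (rp := rp) (al := al) (q := q) Vd s -> conformally_invariant e b al q s D.
Proof.
move=> [VdTV Vdst _ _] [Yt Yb [A [As Au DE]]] [dim5 inj key].
exact: (conformal_list (rp := rp) dim5 VdTV Vdst inj key Yb As Au DE).
Qed.
End Conformal.

Theorem corollary7p23 (R : realType) (g : lie_algebra R[i])
    (h b : {vspace g}) (T : dynkin_type) (n : nat) (al : 'I_n -> hdual h)
    (q : 'I_n) (g_simple : simple_lie g) (h_cartan : cartan_subalgebra h)
    (b_borel : borel_subalgebra b) (hb : (h <= b)%VS)
    (hal : bourbaki_simple_roots b T al)
    (hqh : quasi_heisenberg b al q) (htype : listed_type T n q.+1)
    (mu gamma : hdual h)
    (hmu : highest_weight b al q (@lie_br _ g) (gr al q 1) mu)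
    (hgamma : highest_weight b al q (@lie_br _ g) (gr al q 2) gamma)
    (eps : hdual h) (V Vd : {vspace tensor g})
    (hV : special_constituent b al q mu gamma eps V)
    (hVd : dual_constituent al q V Vd)
    (g0 : set g) (hg0 : lie_real_form g0)
    (hq0 : has_real_form g0 (parab b al q))
    (hn0 : has_real_form g0 (nilrad_opp al q))
    (d : nat) (e : d.-tuple g) (he : basis_of (nilrad_opp al q) e)
    (heg0 : forall i, g0 (tnth e i))
    (m : nat) (D : 'I_m -> operator R d)
    (hD : Omega2_system e al q Vd D) :
  (type_1a mu eps ->
     conformally_invariant e b al q
       (#|` fset_set (roots_in_compl (mu + eps) (gr al q 1))|%:R / 2 - 1) D) /\
  (type_2 mu eps -> conformally_invariant e b al q (- 1) D).
Proof.
have bil : bilinear_lie g by exact: br_linr g_simple.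
have hc : is_cartan h by exact: h_cartan.
have [al_inj al_range al_int] := hal.
have nd : nondeg_killing g.
  (* If [al q] had zero length, its Cartan integer with itself would be 0, since dividing by zero
     gives 0, whereas the Bourbaki matrix has 2 on the diagonal. *)
  apply: (killing_nondeg g_simple); exists (hvec (al q)), (hvec (al q)).
  apply/eqP => E; have := al_int q q.
  rewrite /cartan_int hformE E invr0 mulr0 /bourbaki_entry eqxx => /eqP.
  by rewrite eq_sym intr_eq0.
have ss : simple_system b al by split.
have ts : two_step b al q by case: hqh.
pose rp := complex_real_part R.
have fr : nilpotent_frame e (nilrad_opp al q).
  apply: (nb_frame (rp := rp)) => // i j k.
  apply: (real_coords he heg0 hn0); last by apply: (hg0.2); exact: heg0.
  by apply: (nb_brcl (rp := rp)); apply: (basis_mem he); exact: mem_tnth.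
have [_ Virr Vhw _ eps1] := hV.
split=> ht; apply: (conformal_of_data (rp := rp) hVd hD).
  exact: (conformal_1a (rp := rp) hmu Virr Vhw eps1 hVd ht).
exact: (conformal_2 (rp := rp) hmu Virr Vhw eps1 hVd ht).
Qed.
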